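(* Let $P$ be a probability measure on $\mathbb{R}$ with bounded support, zero mean and unit variance. Then for all $0\le\lambda<\lambda_c$, as $N\to\infty$, $$D_{\mathsf{KL}}(\mathbb P_\lambda,\mathbb P_0)=\frac14\big(-\log(1-\lambda)-\lambda\big)+\mathcal O\Big(\frac1{\sqrt N}\Big).$$
   Context: Model. For $\lambda\ge 0$ and $N\ge1$, let $x^*_1,\dots,x^*_N$ be i.i.d. from $P$, let $W_{ij}$ ($1\le i<j\le N$) be i.i.d. $\mathcal N(0,1)$ independent of the $x_i^*$, and $Y_{ij}=\sqrt{\lambda/N}\,x_i^*x_j^*+W_{ij}$ for $1\le i<j\le N$. $\mathbb{P}_\lambda$ is the law of $\boldsymbol Y=(Y_{ij})_{i<j}$, and $D_{\mathsf{KL}}(\mathbb P_\lambda,\mathbb P_0)=\mathbb E_{\mathbb P_\lambda}\log\frac{d\mathbb P_\lambda}{d\mathbb P_0}(\boldsymbol Y)$. Threshold. For $r\ge0$, $\psi(r)=\mathbb E_{x^*,z}\log\int \exp(\sqrt r zx+rxx^*-\frac r2x^2)\,dP(x)$ with $x^*\sim P$, $z\sim\mathcal N(0,1)$ independent. $F(\lambda,q)=\psi(\lambda q)-\frac{\lambda q^2}{4}$, $\phi_{\mathsf{RS}}(\lambda)=\sup_{q\ge0}F(\lambda,q)$. $\mathcal D$ is the set of $\lambda>0$ at which $\phi_{\mathsf{RS}}$ is differentiable; for $\lambda\in\mathcal D$, $F(\lambda,\cdot)$ has a unique maximizer on $[0,\infty)$ (known result), denoted $q^*(\lambda)$, which is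 non-decreasing in $\lambda\in\mathcal D$. $\lambda_c=\sup\{\lambda>0:\lambda\in\mathcal D,\ q^*(\lambda)=0\}$; for such $P$ one has $\lambda_c\le1$. Constants in $\mathcal O(\cdot)$ may depend on $\lambda$ and $P$ but not on $N$. *)

(* Defs.v *)
From HB Require Import structures.
From mathcomp Require Import all_boot all_order all_algebra.
From mathcomp Require Import all_classical all_reals all_analysis.

Set Implicit Arguments.
Unset Strict Implicit.
Unset Printing Implicit Defensive.

Import Order.TTheory GRing.Theory Num.Theory.
Import numFieldNormedType.Exports.

Local Open Scope classical_set_scope.
Local Open Scope ring_scope.

Section iid.
Context d (T : measurableType d) (R : realType) (P : probability T R).

Definition cons_pair n (p : T * n.-tuple T) : n.+1.-tuple T :=
  [tuple of p.1 :: p.2].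

Lemma measurable_cons_pair n : measurable_fun setT (@cons_pair n).
Proof. exact: measurable_cons. Qed.

HB.instance Definition _ n := isMeasurableFun.Build _ _ _ _
  (@cons_pair n) (@measurable_cons_pair n).

(* The n-fold product P (x) ... (x) P, i.e. the law of n i.i.d. samples of P;
   see [iidE]. *)
Fixpoint iid n : probability (n.-tuple T) R :=
  if n is m.+1 then distribution (P \x iid m)%E (@cons_pair m)
  else \d_ [tuple].

Lemma iidE n (A : 'I_n -> set T) : (forall i, measurable (A i)) ->
  iid n [set x | forall i, A i (tnth x i)] = (\prod_(i < n) P (A i))%E.
Proof.
elim: n A => [|n IHn] A mA /=.
  by rewrite big_ord0 diracE mem_set//= => -[].
rewrite big_ord_recl -IHn//.
have mB : measurable [set x : n.-tuple T | forall i, A (lift ord0 i) (tnth x i)].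
  rewrite (_ : mkset _ =
    \bigcap_(i in [set: 'I_n]) ((@tnth _ T ^~ i) @^-1` A (lift ord0 i))).
    apply: fin_bigcap_measurable => // i _.
    by rewrite -[X in measurable X]setTI; exact: measurable_tnth.
  by apply/seteqP; split => x /= h i; [move=> _; exact: h|exact: (h i)].
rewrite -product_measure1E// /distribution /pushforward; congr (_ _).
apply/seteqP; split => -[a x] /=.
- move=> h; split; first exact: (h ord0).
  by move=> i; have := h (lift ord0 i); rewrite tnthS.
- move=> [ha hx] i; case: (unliftP ord0 i) => [j|] ->; last exact: ha.
  by rewrite tnthS; exact: hx.
Qed.

End iid.

Section spiked_wigner.
Context (R : realType) (P : probability R R).

Definition upper_pairs N : {set 'I_N * 'I_N} :=
  [set p : 'I_N * 'I_N | (p.1 < p.2)%N]%SET.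

(* The Borel structure of [measurableTypeR R], on which [normal_prob] lives, is
   that of [R] under another display; the identity transports [normal_prob]. *)
Definition borel_id : measurableTypeR R -> R := idfun.

Lemma measurable_borel_id : measurable_fun setT borel_id.
Proof. exact: (@measurable_id _ (measurableTypeR R)). Qed.

HB.instance Definition _ := isMeasurableFun.Build _ _ _ _
  borel_id measurable_borel_id.

Definition std_normal : probability R R :=
  distribution (normal_prob 0 1) borel_id.

(* [p.1] is the spike (x_i) and [p.2] the noise (W_ij); families indexed by the
   pairs i < j are tuples, the k-th entry belonging to the pair [enum_val k]. *)
Definition observation (l : R) N
    (p : N.-tuple R * #|upper_pairs N|.-tuple R) : #|upper_pairs N|.-tuple R :=
  [tuple Num.sqrt (l / N%:R)
           * tnth p.1 (enum_val k).1 * tnth p.1 (enum_val k).2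
         + tnth p.2 k | k < #|upper_pairs N|].

Lemma measurable_observation l N : measurable_fun setT (@observation l N).
Proof.
apply/measurable_fun_tnthP => k.
rewrite (_ : _ \o _ = fun p => Num.sqrt (l / N%:R)
    * tnth p.1 (enum_val k).1 * tnth p.1 (enum_val k).2 + tnth p.2 k).
  apply: measurable_realfun.measurable_funD.
    apply: measurable_realfun.measurable_funM; first apply: measurable_realfun.measurable_funM => //.
    - exact: (measurableT_comp (measurable_tnth _) measurable_fst).
    - exact: (measurableT_comp (measurable_tnth _) measurable_fst).
  exact: (measurableT_comp (measurable_tnth _) measurable_snd).
by apply/funext => p /=; rewrite tnth_mktuple.
Qed.

HB.instance Definition _ l N := isMeasurableFun.Build _ _ _ _
  (@observation l N) (@measurable_observation l N).

Definition spiked_law (l : R) N : probability (#|upper_pairs N|.-tuple R) R :=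
  distribution (iid P N \x iid std_normal #|upper_pairs N|)%E
    (@observation l N).

(* E_{x,z} log \int exp(sqrt r z y + r y x - r y^2 / 2) dP(y), with the pair
   [p] = (x, z) distributed as P (x) N(0, 1). *)
Definition psi (r : R) : R :=
  \int[(P \x std_normal)%E]_p
    ln (\int[P]_y expR (Num.sqrt r * p.2 * y + r * y * p.1 - r / 2 * y ^+ 2)).

Definition RS_potential (l q : R) : R := psi (l * q) - l * q ^+ 2 / 4.

(* For l > 0 and P of bounded support the potential is bounded above in q >= 0,
   psi growing at most linearly, so that [sup] is the genuine supremum. *)
Definition phi_RS (l : R) : R :=
  sup [set RS_potential l q | q in [set q | 0 <= q]].

Definition RS_maximizers (l : R) : set R :=
  [set q | 0 <= q /\ forall q', 0 <= q' -> RS_potential l q' <= RS_potential l q].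

(* The maximizer is known to exist and to be unique when [phi_RS] is
   differentiable at [l]; the default value -1 is not a legitimate overlap, so
   that [q_star l = 0] entails that 0 is a maximizer. *)
Definition q_star (l : R) : R := xget (-1) (RS_maximizers l).

Definition lambda_c : \bar R :=
  ereal_sup [set l%:E | l in
    [set l : R | [/\ 0 < l, derivable phi_RS l 1 & q_star l = 0]]].

End spiked_wigner.

(* If nu is not dominated by mu the derivative is constantly -oo, and so is the
   integral. *)
Definition KL d (T : measurableType d) (R : realType)
    (nu mu : probability T R) : \bar R :=
  (\int[nu]_y lne (Radon_Nikodym (charge_of_finite_measure nu) mu y))%E.

(* Main.v *)
(* Fix s = l / N and add the sites one at a time.  Given the pairs observed
   among the first n sites, the pairs joining them to a new site form a Gaussian
   channel of small signal whose prior is P times the posterior of the first n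
   spikes.  Expanding this channel to second order yields
     D_(n+1) - D_n = s^2 / 4 * E<Q^2>_n + O(s^3 E<|Q|^3>_n)
   for the relative entropy D_n and the overlap Q of two posterior samples, and
     E<Q^2>_(n+1) = (n + 1) (1 + s E<Q^2>_n) + lower order terms,
   so that s E<Q^2>_n is close to s n / (1 - s n) and D_N, a Riemann sum, to
   (- ln (1 - l) - l) / 4.  The recursion is closed by a bound on E<Q^4>, which
   requires the overlap not to exceed e N, except with probability O(1 / N^2).

   This is where l < lambda_c is used.  There is l0 > l at which 0 maximizes the
   potential, i.e. psi r <= r^2 / (4 l0) for all r >= 0.  The posterior mass of
   the overlaps near r / s is controlled by a moment of order 0 < th < 1 of the
   corresponding part of the likelihood ratio.  As x^th is concave, such moments
   are compared by means of the covariances only (Kahane); on this window the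
   covariance of the model is that of n scalar channels of parameter r, up to a
   constant, whose moments factor over the sites.  For small th a site
   contributes th * psi r, and the window has exponentially small mass. *)
From HB Require Import structures.
Require Import Defs.
From mathcomp Require Import all_boot all_order all_algebra.
From mathcomp Require Import all_classical all_reals all_analysis.
From mathcomp Require Import measurable_realfun ring lra.
Import Order.TTheory GRing.Theory Num.Theory.
Import numFieldNormedType.Exports.
Set Implicit Arguments.
Unset Strict Implicit.
Unset Printing Implicit Defensive.
Local Open Scope classical_set_scope.
Local Open Scope ring_scope.

(** * Functions of exponential growth *)

(** At such l the second moment of the likelihood ratio may diverge, because of rare large overlaps;
    hence there is no expansion of the whole model at once. One added site is a channel whose kernel
    is s times an overlap, and large overlaps only have to be rare under the posterior, which is
    weaker than any second moment bound. Three facts make this work. Powers of the overlap are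
    positive definite kernels, so E<Q^5> >= 0 and only large positive overlaps must be excluded. The
    exponent th < 1 gives Kahane's inequality its direction (more covariance, smaller moment), and
    small th brings in psi: psi r is the relative entropy E L ln L of the scalar channel, which is
    the derivative at th = 0 of E L^(1 + th), the additional factor L coming from the planted spike.
    Finally the exponent of the window at r is proportional to -(1 - l / l0) r^2 / 4, up to errors
    due to th and to the width of the window; the strict inequality l < l0 leaves room for both. The
    same bound on psi, taken near r = 0, forces l0 <= 1, whence l < 1. *)

Lemma integrable_EFin_le d (T : measurableType d) (R : realType)
    (mu : {measure set T -> \bar R}) (f h : T -> R) :
  measurable_fun setT f -> mu.-integrable setT (EFin \o h) ->
  (forall x, `|f x| <= h x) -> mu.-integrable setT (EFin \o f).
Proof.
move=> mf ih fh; apply: (le_integrable measurableT _ _ ih).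
  exact/measurable_EFinP.
by move=> x _ /=; rewrite lee_fin (le_trans (fh x))// ler_norm.
Qed.

Section dominated.
Context d (T : measurableType d) (R : realType).
Implicit Types (G f g : T -> R) (mu : probability T R).

(* [G] plays the role of a norm having all exponential moments; [dm G] is then an
   algebra of integrable functions, stable under partial integration. *)
Definition dm G f := measurable_fun setT f /\
  exists C, 0 <= C /\ forall x, `|f x| <= expR (C * (1 + `|G x|)).

(** The growth of exponents and of log-likelihoods, which [dm_exp] carries to [dm]. *)
Definition lin G f := measurable_fun setT f /\
  exists C, 0 <= C /\ forall x, `|f x| <= C * (1 + `|G x|).

Definition gauge mu G := [/\ measurable_fun setT G, forall x, 0 <= G x
  & forall C, mu.-integrable setT (EFin \o (fun x => expR (C * G x)))].

Section closure.
Variable G : T -> R.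
Let G0 x : 0 <= `|G x|. Proof. exact: normr_ge0. Qed.

Lemma le_gauge (C D x : R) (y : T) : C <= D -> C * (1 + `|G y|) <= D * (1 + `|G y|).
Proof. by move=> CD; rewrite ler_wpM2r// addr_ge0. Qed.

Lemma lin_cst (c : R) : lin G (fun=> c).
Proof.
split; first exact: measurable_cst.
by exists `|c|; split=> // x; rewrite ler_peMr// lerDl.
Qed.

Lemma linD f g : lin G f -> lin G g -> lin G (fun x => f x + g x).
Proof.
move=> [mf [C [C0 fC]]] [mg [D [D0 gD]]]; split; first exact: measurable_funD.
exists (C + D); split; first exact: addr_ge0.
by move=> x; rewrite (le_trans (ler_normD _ _))// mulrDl lerD.
Qed.

Lemma linN f : lin G f -> lin G (fun x => - f x).
Proof.
move=> [mf [C [C0 fC]]]; split; first exact: measurableT_comp.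
by exists C; split => // x; rewrite normrN.
Qed.

Lemma linB f g : lin G f -> lin G g -> lin G (fun x => f x - g x).
Proof. by move=> lf lg; apply: linD => //; exact: linN. Qed.

Lemma linM f g (B : R) : lin G f -> measurable_fun setT g ->
  (forall x, `|g x| <= B) -> lin G (fun x => f x * g x).
Proof.
move=> [mf [C [C0 fC]]] mg gB; split; first exact: measurable_funM.
have B0 : 0 <= B by apply: le_trans (gB point).
exists (C * B); split; first exact: mulr_ge0.
by move=> x; rewrite normrM mulrAC ler_pM.
Qed.

Lemma linZ f (c : R) : lin G f -> lin G (fun x => c * f x).
Proof.
move=> lf; rewrite (_ : (fun _ => _) = fun x => f x * c).
  by apply: (@linM _ (fun=> c) `|c|) => //.
by apply/funext => x; rewrite mulrC.
Qed.

Lemma lin_bounded f (B : R) : measurable_fun setT f -> (forall x, `|f x| <= B) ->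
  lin G f.
Proof.
move=> mf fB; have B0 : 0 <= B by apply: le_trans (fB point).
split=> //; exists B; split=> // x.
by rewrite (le_trans (fB x))// ler_peMr// lerDl.
Qed.

Lemma lin_sum (I : Type) (s : seq I) (p : pred I) (f : I -> T -> R) :
  (forall i, lin G (f i)) -> lin G (fun x => \sum_(i <- s | p i) f i x).
Proof.
move=> lf; elim: s => [|i s IH].
  by under eq_fun do rewrite big_nil; exact: lin_cst.
under eq_fun do rewrite big_cons; case: (p i) => //.
exact: linD.
Qed.

Lemma dm_lin f : lin G f -> dm G f.
Proof.
move=> [mf [C [C0 fC]]]; split=> //; exists C; split=> // x.
rewrite (le_trans (fC x))// (le_trans _ (expR_ge1Dx _))// lerDr//.
Qed.

Lemma dm_exp f : lin G f -> dm G (fun x => expR (f x)).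
Proof.
move=> [mf [C [C0 fC]]]; split; first exact: measurableT_comp.
exists C; split=> // x; rewrite ger0_norm ?expR_ge0// ler_expR.
by rewrite (le_trans _ (fC x))// ler_norm.
Qed.

Lemma dm_cst (c : R) : dm G (fun=> c).
Proof. exact/dm_lin/lin_cst. Qed.

Lemma dm_bounded f (B : R) : measurable_fun setT f -> (forall x, `|f x| <= B) ->
  dm G f.
Proof. by move=> mf fB; exact/dm_lin/(lin_bounded mf fB). Qed.

Lemma dmM f g : dm G f -> dm G g -> dm G (fun x => f x * g x).
Proof.
move=> [mf [C [C0 fC]]] [mg [D [D0 gD]]]; split; first exact: measurable_funM.
exists (C + D); split; first exact: addr_ge0.
by move=> x; rewrite normrM mulrDl expRD ler_pM.
Qed.

Lemma dm_le f g : measurable_fun setT f -> dm G g ->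
  (forall x, `|f x| <= `|g x|) -> dm G f.
Proof.
move=> mf [mg [D [D0 gD]]] fg; split=> //; exists D; split => // x.
exact: le_trans (gD x).
Qed.

Lemma dmD f g : dm G f -> dm G g -> dm G (fun x => f x + g x).
Proof.
move=> [mf [C [C0 fC]]] [mg [D [D0 gD]]]; split; first exact: measurable_funD.
(* The extra 1 absorbs the factor 2 of a sum of two exponentials, as 2 <= 1 + (1 + |G x|) <= exp (1
   + |G x|). *)
exists (C + D + 1); split; first by rewrite !addr_ge0.
move=> x; apply: (@le_trans _ _ (expR (C + D * 0 + (C + D) * `|G x| + D) *+ 2)).
  have h (E : R) : 0 <= E -> E <= C + D ->
      expR (E * (1 + `|G x|)) <= expR (C + D * 0 + (C + D) * `|G x| + D).
    move=> E0 EC; rewrite ler_expR mulr0 addr0.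
    by have := le_gauge 0 x EC; lra.
  rewrite (le_trans (ler_normD _ _))// mulr2n lerD//.
    by rewrite (le_trans (fC x))// h// lerDl.
  by rewrite (le_trans (gD x))// h// lerDr.
rewrite -mulr_natl; have -> : (C + D + 1) * (1 + `|G x|) =
  1 + `|G x| + (C + D * 0 + (C + D) * `|G x| + D) by ring.
rewrite (expRD (1 + `|G x|)) ler_wpM2r ?expR_ge0//.
have := expR_ge1Dx (1 + `|G x|); have := G0 x; lra.
Qed.

Lemma dmN f : dm G f -> dm G (fun x => - f x).
Proof.
move=> [mf [C [C0 fC]]]; split; first exact: measurableT_comp.
by exists C; split => // x; rewrite normrN.
Qed.

Lemma dmB f g : dm G f -> dm G g -> dm G (fun x => f x - g x).
Proof. by move=> lf lg; apply: dmD => //; exact: dmN. Qed.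

Lemma dmZ f (c : R) : dm G f -> dm G (fun x => c * f x).
Proof. by move=> lf; apply: dmM => //; exact: dm_cst. Qed.

Lemma dmX f n : dm G f -> dm G (fun x => f x ^+ n).
Proof.
move=> df; elim: n => [|n IH]; first exact: dm_cst.
by under eq_fun do rewrite exprS; exact: dmM.
Qed.

Lemma dm_sum (I : Type) (s : seq I) (p : pred I) (f : I -> T -> R) :
  (forall i, dm G (f i)) -> dm G (fun x => \sum_(i <- s | p i) f i x).
Proof.
move=> lf; elim: s => [|i s IH].
  by under eq_fun do rewrite big_nil; exact: dm_cst.
under eq_fun do rewrite big_cons; case: (p i) => //.
exact: dmD.
Qed.

Lemma dm_prod (I : Type) (s : seq I) (p : pred I) (f : I -> T -> R) :
  (forall i, dm G (f i)) -> dm G (fun x => \prod_(i <- s | p i) f i x).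
Proof.
move=> lf; elim: s => [|i s IH].
  by under eq_fun do rewrite big_nil; exact: dm_cst.
under eq_fun do rewrite big_cons; case: (p i) => //.
exact: dmM.
Qed.

Lemma dm_norm f : dm G f -> dm G (fun x => `|f x|).
Proof.
move=> [mf [C [C0 fC]]]; split; first exact: measurableT_comp.
by exists C; split => // x; rewrite normr_id.
Qed.

End closure.

Section expectation.
Variables (mu : probability T R) (G : T -> R).
Hypothesis gG : gauge mu G.

Lemma gauge_ge0 x : 0 <= G x. Proof. by case: gG. Qed.

Lemma dm_integrable f : dm G f -> mu.-integrable setT (EFin \o f).
Proof.
case: gG => mG G0 iG [mf [C [C0 fC]]].
have iC : mu.-integrable setT (EFin \o (fun x => expR C * expR (C * G x))).
  rewrite (_ : _ \o _ = fun x => (expR C)%:E * (EFin \o (fun x => expR (C * G x))) x)%E//.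
  exact: integrableZl.
apply: (integrable_EFin_le mf iC) => x.
by rewrite (le_trans (fC x))// ger0_norm// mulrDr mulr1 expRD.
Qed.

Lemma intD f g : dm G f -> dm G g ->
  \int[mu]_x (f x + g x) = \int[mu]_x f x + \int[mu]_x g x.
Proof. by move=> df dg; rewrite RintegralD//; exact: dm_integrable. Qed.

Lemma intB f g : dm G f -> dm G g ->
  \int[mu]_x (f x - g x) = \int[mu]_x f x - \int[mu]_x g x.
Proof. by move=> df dg; rewrite RintegralB//; exact: dm_integrable. Qed.

Lemma intZ f (c : R) : dm G f -> \int[mu]_x (c * f x) = c * \int[mu]_x f x.
Proof. by move=> df; rewrite RintegralZl//; exact: dm_integrable. Qed.

Lemma intZr f (c : R) : dm G f -> \int[mu]_x (f x * c) = \int[mu]_x f x * c.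
Proof. by move=> df; rewrite RintegralZr//; exact: dm_integrable. Qed.

Lemma int_le f g : dm G f -> dm G g -> (forall x, f x <= g x) ->
  \int[mu]_x f x <= \int[mu]_x g x.
Proof. by move=> df dg fg; apply: le_Rintegral => //; exact: dm_integrable. Qed.

Lemma int_norm f : dm G f -> `|\int[mu]_x f x| <= \int[mu]_x `|f x|.
Proof. by move=> df; apply: le_normr_Rintegral => //; exact: dm_integrable. Qed.

Lemma int_norm_le f g : dm G f -> dm G g -> (forall x, `|f x| <= g x) ->
  `|\int[mu]_x f x| <= \int[mu]_x g x.
Proof.
move=> df dg fg; rewrite (le_trans (int_norm df))// int_le//.
exact: dm_norm.
Qed.

Lemma int_sum (I : Type) (s : seq I) (p : pred I) (f : I -> T -> R) :
  (forall i, dm G (f i)) ->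
  \int[mu]_x (\sum_(i <- s | p i) f i x) = \sum_(i <- s | p i) \int[mu]_x f i x.
Proof.
move=> df; elim: s => [|i s IH].
  by under eq_Rintegral do rewrite big_nil; rewrite big_nil Rintegral_cst// mul0r.
rewrite big_cons; under eq_Rintegral do rewrite big_cons.
by case: (p i) => //; rewrite intD ?IH//; exact: dm_sum.
Qed.

End expectation.

Lemma int_cst mu (c : R) : \int[mu]_x c = c.
Proof.
by rewrite Rintegral_cst// [X in fine X](@probability_setT _ _ _ mu)/= mulr1.
Qed.

Lemma int_ge0 mu f : (forall x, 0 <= f x) -> 0 <= \int[mu]_x f x.
Proof. by move=> f0; apply: Rintegral_ge0 => x _. Qed.

(** For the zero gauge, [dm] means measurable and bounded. This is the gauge of spikes and replicas,
    whereas the noise has the l1 norm. *)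
Lemma gauge0 mu : gauge mu (fun=> 0).
Proof.
split=> //; move=> C; under eq_fun do rewrite mulr0 expR0.
exact: finite_measure_integrable_cst.
Qed.

Lemma int_EFin mu f : mu.-integrable setT (EFin \o f) ->
  (\int[mu]_x f x)%:E = (\int[mu]_x (f x)%:E)%E.
Proof. by move=> fi; rewrite /Rintegral fineK//; exact: integrable_fin_num. Qed.

Lemma eq_int mu f g : (forall x, f x = g x) -> \int[mu]_x f x = \int[mu]_x g x.
Proof. by move=> fg; apply: eq_Rintegral => x _. Qed.

End dominated.

Section composition.
Context d d' (T : measurableType d) (T' : measurableType d') (R : realType).
Variables (G : T -> R) (G' : T' -> R) (phi : T -> T').
Hypotheses (mphi : measurable_fun setT phi).

Lemma lin_comp f : (forall x, `|G' (phi x)| <= `|G x|) ->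
  lin G' f -> lin G (f \o phi).
Proof.
move=> hG [mf [C [C0 fC]]]; split; first exact: measurableT_comp.
exists C; split=> // x; rewrite (le_trans (fC _))//.
by rewrite ler_wpM2l// lerD2l.
Qed.

Lemma dm_comp (B : R) f : (forall x, `|G' (phi x)| <= B * (1 + `|G x|)) ->
  dm G' f -> dm G (f \o phi).
Proof.
move=> hG [mf [C [C0 fC]]]; split; first exact: measurableT_comp.
exists (C * (1 + `|B|)); split=> [|x]; first by rewrite mulr_ge0// addr_ge0.
rewrite (le_trans (fC _))// ler_expR -mulrA ler_wpM2l//.
have := hG x; have := ler_norm B; have := normr_ge0 (G x); nra.
Qed.

End composition.

Section product.
Context d1 d2 (T1 : measurableType d1) (T2 : measurableType d2) (R : realType).
Variables (mu1 : probability T1 R) (mu2 : probability T2 R).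
Variables (G1 : T1 -> R) (G2 : T2 -> R).
Hypotheses (g1 : gauge mu1 G1) (g2 : gauge mu2 G2).

Definition prodG (p : T1 * T2) := G1 p.1 + G2 p.2.

Let G10 := gauge_ge0 g1.
Let G20 := gauge_ge0 g2.

Lemma gauge_prod : gauge (mu1 \x mu2)%E prodG.
Proof.
case: (g1) => mG1 _ i1; case: (g2) => mG2 _ i2.
have mG : measurable_fun setT prodG.
  by apply: measurable_funD; exact: measurableT_comp.
split=> //; first by move=> x; rewrite addr_ge0.
move=> C; apply/integrable12ltyP.
  by apply/measurable_EFinP; apply: measurableT_comp => //; exact: measurable_funM.
have K2 : (\int[mu2]_y (expR (C * G2 y))%:E = (\int[mu2]_y expR (C * G2 y))%:E)%E.
  by rewrite int_EFin.
have K1 : (\int[mu1]_y (expR (C * G1 y))%:E = (\int[mu1]_y expR (C * G1 y))%:E)%E.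
  by rewrite int_EFin.
under eq_integral.
  move=> x _.
  under eq_integral do rewrite /= ger0_norm ?expR_ge0// mulrDr expRD EFinM /=.
  rewrite ge0_integralZl ?lee_fin ?expR_ge0//; last first.
    by have /integrableP[] := i2 C.
  rewrite K2; over.
rewrite /= ge0_integralZr ?lee_fin ?int_ge0//; last first.
  by have /integrableP[] := i1 C.
by rewrite K1 -EFinM ltry.
Qed.

Lemma dm_sec1 f x : dm prodG f -> dm G2 (fun y => f (x, y)).
Proof.
move=> [mf [C [C0 fC]]]; split; first exact: measurableT_comp.
exists (C * (1 + `|G1 x|)); split; first by rewrite mulr_ge0// addr_ge0.
move=> y; rewrite (le_trans (fC _))// ler_expR -mulrA ler_wpM2l// /prodG/=.
rewrite !ger0_norm ?addr_ge0//; have := G10 x; have := G20 y; nra.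
Qed.

Lemma dm_sec2 f y : dm prodG f -> dm G1 (fun x => f (x, y)).
Proof.
move=> [mf [C [C0 fC]]]; split; first exact: measurableT_comp.
exists (C * (1 + `|G2 y|)); split; first by rewrite mulr_ge0// addr_ge0.
move=> x; rewrite (le_trans (fC _))// ler_expR -mulrA ler_wpM2l// /prodG/=.
rewrite !ger0_norm ?addr_ge0//; have := G10 x; have := G20 y; nra.
Qed.

Lemma dm_fst f : dm G1 f -> dm prodG (fun p => f p.1).
Proof.
move=> [mf [C [C0 fC]]]; split; first exact: measurableT_comp.
exists C; split => // p; rewrite (le_trans (fC _))// ler_expR ler_wpM2l//.
by rewrite lerD2l /prodG !ger0_norm ?addr_ge0// lerDl.
Qed.

Lemma lin_fst f : lin G1 f -> lin prodG (fun p => f p.1).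
Proof.
move=> [mf [C [C0 fC]]]; split; first exact: measurableT_comp.
exists C; split => // p; rewrite (le_trans (fC _))// ler_wpM2l//.
by rewrite lerD2l /prodG !ger0_norm ?addr_ge0// lerDl.
Qed.

Section fubini.
Variable f : T1 * T2 -> R.
Hypothesis df : dm prodG f.

Let fi : (mu1 \x mu2)%E.-integrable setT (EFin \o f).
Proof. exact: (dm_integrable gauge_prod df). Qed.

Let F1 x : (\int[mu2]_y (f (x, y))%:E = (\int[mu2]_y f (x, y))%:E)%E.
Proof. by rewrite int_EFin//; exact: (dm_integrable g2 (dm_sec1 x df)). Qed.

Let F2 y : (\int[mu1]_x (f (x, y))%:E = (\int[mu1]_x f (x, y))%:E)%E.
Proof. by rewrite int_EFin//; exact: (dm_integrable g1 (dm_sec2 y df)). Qed.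

Lemma fubini1 : \int[(mu1 \x mu2)%E]_p f p = \int[mu1]_x \int[mu2]_y f (x, y).
Proof.
rewrite /Rintegral -integral12_prod_meas1//; congr fine.
by apply: eq_integral => x _; rewrite /fubini_F/= F1.
Qed.

Lemma fubini2 : \int[(mu1 \x mu2)%E]_p f p = \int[mu2]_y \int[mu1]_x f (x, y).
Proof.
rewrite /Rintegral -integral21_prod_meas1//; congr fine.
by apply: eq_integral => x _; rewrite /fubini_G/= F2.
Qed.

Lemma dm_int2 : dm G1 (fun x => \int[mu2]_y f (x, y)).
Proof.
case: (g2) => _ _ i2; split.
  have := measurable_fubini_F fi; rewrite /fubini_F.
  under eq_fun do rewrite /= F1.
  by move/measurable_EFinP.
case: df => mf [C [C0 fC]].
set K := \int[mu2]_y expR (C * G2 y).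
have K0 : 0 <= K by apply: int_ge0 => y; exact: expR_ge0.
(* The partial integral is at most exp (C (1 + G1 x)) K, and K <= exp (K (1 + G1 x)). *)
exists (C + K); split; first exact: addr_ge0.
move=> x.
apply: (@le_trans _ _ (\int[mu2]_y (expR (C * (1 + G1 x)) * expR (C * G2 y)))).
  apply: (int_norm_le g2 (dm_sec1 x df)).
    apply: dmZ => //; apply: dm_exp; apply: linZ => //.
    case: (g2) => mG2 _ _; split=> //; exists 1; split => // y.
    by rewrite mul1r lerDr.
  move=> y; rewrite (le_trans (fC _))// -expRD ler_expR /prodG/= -mulrDr.
  by rewrite ger0_norm ?addr_ge0// ler_wpM2l// addrA.
rewrite RintegralZl// [`|G1 x|]ger0_norm// mulrDl expRD ler_wpM2l ?expR_ge0//.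
apply: le_trans (expR_ge1Dx _).
by rewrite mulrDr mulr1 -/K; have := mulr_ge0 K0 (G10 x); lra.
Qed.

Lemma dm_int1 : dm G2 (fun y => \int[mu1]_x f (x, y)).
Proof.
case: (g1) => _ _ i1; split.
  have := measurable_fubini_G fi; rewrite /fubini_G.
  under eq_fun do rewrite /= F2.
  by move/measurable_EFinP.
case: df => mf [C [C0 fC]].
set K := \int[mu1]_y expR (C * G1 y).
have K0 : 0 <= K by apply: int_ge0 => y; exact: expR_ge0.
exists (C + K); split; first exact: addr_ge0.
move=> x.
apply: (@le_trans _ _ (\int[mu1]_y (expR (C * (1 + G2 x)) * expR (C * G1 y)))).
  apply: (int_norm_le g1 (dm_sec2 x df)).
    apply: dmZ => //; apply: dm_exp; apply: linZ => //.
    case: (g1) => mG1 _ _; split=> //; exists 1; split => // y.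
    by rewrite mul1r lerDr.
  move=> y; rewrite (le_trans (fC _))// -expRD ler_expR /prodG/= -mulrDr.
  by rewrite ger0_norm ?addr_ge0// ler_wpM2l//; lra.
rewrite RintegralZl// [`|G2 x|]ger0_norm// mulrDl expRD ler_wpM2l ?expR_ge0//.
apply: le_trans (expR_ge1Dx _).
by rewrite mulrDr mulr1 -/K; have := mulr_ge0 K0 (G20 x); lra.
Qed.

Lemma fubini_swap : \int[mu1]_x \int[mu2]_y f (x, y) =
  \int[mu2]_y \int[mu1]_x f (x, y).
Proof. by rewrite -fubini1 fubini2. Qed.

End fubini.
End product.

(** * Product measures *)

Section iid_push.
Context d (T : measurableType d) (R : realType) (P : probability T R).

(** Rectangles form a pi-system generating the product sigma-algebra. Inserting, merging and
    selecting coordinates of an i.i.d. sample are therefore justified on rectangles alone, through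
    [int_iid_push]. *)
Lemma iid_unique n (Q : probability (n.-tuple T) R) :
  (forall A : 'I_n -> set T, (forall i, measurable (A i)) ->
    Q [set x | forall i, A i (tnth x i)] = (\prod_(i < n) P (A i))%E) ->
  forall B, measurable B -> Q B = iid P n B.
Proof.
move=> QE B mB.
pose C := [set B : set (n.-tuple T) | exists A : 'I_n -> set T,
  (forall i, measurable (A i)) /\ B = [set x | forall i, A i (tnth x i)]].
apply: (@measure_unique _ _ _ C (fun=> setT)) => //.
- apply/seteqP; split.
  + apply: smallest_sub; first exact: smallest_sigma_algebra.
    rewrite -bigcup_seq; apply: bigcup_sub => i _ _ [A mA <-].
    apply: sub_sigma_algebra; exists (fun j => if j == i then A else setT).
    split; first by move=> j; case: ifP.
    rewrite setTI; apply/seteqP; split => x /=.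
      by move=> Ax j; case: ifP => // /eqP ->.
    by move/(_ i); rewrite eqxx.
  + apply: smallest_sub; first exact: sigma_algebra_measurable.
    move=> _ [A [mA ->]].
    rewrite (_ : mkset _ =
      \bigcap_(i in [set: 'I_n]) ((@tnth _ T ^~ i) @^-1` A i)).
      apply: fin_bigcap_measurable => // i _.
      by rewrite -[X in measurable X]setTI; exact: measurable_tnth.
    by apply/seteqP; split => x /= h i; [move=> _; exact: h|exact: (h i)].
- move=> _ _ [A [mA ->]] [A' [mA' ->]]; exists (fun i => A i `&` A' i).
  split; first by move=> i; exact: measurableI.
  apply/seteqP; split => x /=; first by move=> [h h'] i; split.
  by move=> h; split=> i; have [] := h i.
- move=> _; exists (fun=> setT); split => //.
  by apply/seteqP; split => x.
- by rewrite bigcup_const.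
- by move=> _ [A [mA ->]]; exact: (etrans (QE A mA) (esym (iidE P mA))).
- by move=> _; rewrite (le_lt_trans (probability_le1 _ _))// ltry.
Qed.

Lemma int_iid_push d' (S : measurableType d') (Q : probability S R) n
    (phi : S -> n.-tuple T) (F : n.-tuple T -> R) :
  measurable_fun setT phi ->
  (forall A : 'I_n -> set T, (forall i, measurable (A i)) ->
    Q [set s | forall i, A i (tnth (phi s) i)] = (\prod_(i < n) P (A i))%E) ->
  measurable_fun setT F -> Q.-integrable setT (EFin \o (F \o phi)) ->
  \int[Q]_s F (phi s) = \int[iid P n]_t F t.
Proof.
move=> mphi Qphi mF iF.
pose phi' : {mfun S >-> n.-tuple T} := HB.pack phi
  (isMeasurableFun.Build _ _ _ _ phi mphi).
rewrite /Rintegral; congr fine.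
transitivity (\int[distribution Q phi']_t (F t)%:E)%E.
  by rewrite integral_distribution//; exact/measurable_EFinP.
apply: eq_measure_integral => A mA _.
exact: (@iid_unique _ (distribution Q phi')).
Qed.

Section gauge_iid.
Variable G : T -> R.
Hypothesis gG : gauge P G.

Definition iidG n (t : n.-tuple T) := \sum_(i < n) G (tnth t i).

Lemma iidG_cons n z (t : n.-tuple T) : iidG [tuple of z :: t] = G z + iidG t.
Proof.
rewrite /iidG big_ord_recl; congr (_ + _).
by apply: eq_bigr => i _; rewrite tnthS.
Qed.

Lemma measurable_iidG n : measurable_fun setT (@iidG n).
Proof.
apply: measurable_sum => i; apply: measurableT_comp; first by case: gG.
exact: measurable_tnth.
Qed.

Lemma gauge_iid n : gauge (iid P n) (@iidG n).
Proof.
case: (gG) => mG G0 _; elim: n => [|n IH].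
  split; [exact: measurable_iidG|by move=> x; rewrite sumr_ge0|].
  move=> C; rewrite (_ : _ \o _ = cst (1 : R)%:E).
    exact: finite_measure_integrable_cst.
  by apply/funext => t /=; rewrite /iidG big_ord0 mulr0 expR0.
split; [exact: measurable_iidG|by move=> x; rewrite sumr_ge0|].
move=> C; rewrite /=.
have mE : measurable_fun setT (fun t : n.+1.-tuple T => expR (C * iidG t)).
  by apply: measurableT_comp => //; apply: measurable_funM => //;
    exact: measurable_iidG.
have [_ _ /(_ C) iC] := gauge_prod gG IH.
apply/integrableP; split; first exact/measurable_EFinP.
rewrite ge0_integral_distribution//; last first.
  by do 2 apply: measurableT_comp => //.
move/integrableP : iC => [_]; apply: le_lt_trans; rewrite le_eqVlt; apply/predU1l.
by apply: eq_integral => -[z t] _ /=; rewrite iidG_cons.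
Qed.

Lemma dm_cons n F : dm (@iidG n.+1) F ->
  dm (prodG G (@iidG n)) (fun p => F [tuple of p.1 :: p.2]).
Proof.
move=> dF; apply: (dm_comp (phi := @cons_pair _ T n) (B := 1) _ _ dF).
- exact: measurable_cons_pair.
- by move=> -[z t]; rewrite /cons_pair iidG_cons /prodG/= mul1r lerDr.
Qed.

Lemma int_iidS n F : dm (@iidG n.+1) F ->
  \int[iid P n.+1]_t F t = \int[P]_z \int[iid P n]_t F [tuple of z :: t].
Proof.
move=> dF.
rewrite -(fubini1 gG (gauge_iid n) (dm_cons dF)).
rewrite /Rintegral; congr fine; rewrite /= integral_distribution//.
- by apply/measurable_EFinP; case: dF.
- apply: (dm_integrable (gauge_prod gG (gauge_iid n)) (dm_cons dF)).
Qed.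

Lemma dm_iid_sec n F z : dm (@iidG n.+1) F ->
  dm (@iidG n) (fun t => F [tuple of z :: t]).
Proof. by move=> dF; exact: (dm_sec1 gG (gauge_iid n) z (dm_cons dF)). Qed.

Lemma dm_iid_int n F : dm (@iidG n.+1) F ->
  dm G (fun z => \int[iid P n]_t F [tuple of z :: t]).
Proof. by move=> dF; exact: (dm_int2 gG (gauge_iid n) (dm_cons dF)). Qed.

Lemma dm_tnth n f (i : 'I_n) : dm G f -> dm (@iidG n) (fun t => f (tnth t i)).
Proof.
case: (gG) => mG G0 _ df; apply: (dm_comp (phi := fun t => tnth t i) (B := 1) _ _ df).
- exact: measurable_tnth.
- move=> t; rewrite mul1r !ger0_norm ?sumr_ge0// /iidG (bigD1 i)//=.
  have : 0 <= \sum_(j < n | j != i) G (tnth t j) by rewrite sumr_ge0.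
  by move=> h; lra.
Qed.

Lemma lin_tnth n f (i : 'I_n) : lin G f -> lin (@iidG n) (fun t => f (tnth t i)).
Proof.
case: (gG) => mG G0 _ df; apply: (lin_comp (phi := fun t => tnth t i) _ _ df).
- exact: measurable_tnth.
- move=> t; rewrite !ger0_norm ?sumr_ge0// /iidG (bigD1 i)//= lerDl.
  by rewrite sumr_ge0.
Qed.

Lemma int_iid_prod n (f : 'I_n -> T -> R) : (forall i, dm G (f i)) ->
  \int[iid P n]_t \prod_(i < n) f i (tnth t i) = \prod_(i < n) \int[P]_z f i z.
Proof.
have G0 := gauge_ge0 gG.
elim: n f => [|n IH] f df.
  by rewrite big_ord0; under eq_int do rewrite big_ord0; rewrite int_cst.
rewrite int_iidS; last first.
  apply: dm_prod => i; exact: dm_tnth.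
rewrite big_ord_recl -IH// mulrC -(intZ gG)//.
apply: eq_int => z; rewrite mulrC -(intZ (gauge_iid n)).
  apply: eq_int => t; rewrite big_ord_recl; congr (_ * _).
  by apply: eq_bigr => i _; rewrite tnthS.
apply: dm_prod => i; exact: dm_tnth.
Qed.

End gauge_iid.

(** Puts the new coordinate at an arbitrary position i, so that any site can be regarded as the one
    added last. *)
Definition insertt n (i : 'I_n.+1) (p : T * n.-tuple T) : n.+1.-tuple T :=
  [tuple if unlift i j is Some k then tnth p.2 k else p.1 | j < n.+1].

Lemma measurable_insertt n (i : 'I_n.+1) : measurable_fun setT (insertt i).
Proof.
apply/measurable_fun_tnthP => j.
rewrite (_ : _ \o _ = fun p : T * n.-tuple T =>
  if unlift i j is Some k then tnth p.2 k else p.1); last first.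
  by apply/funext => p /=; rewrite tnth_mktuple.
case: unliftP => [k _|_]; last exact: measurable_fst.
exact: (measurableT_comp (measurable_tnth _)).
Qed.

Lemma tnth_insertt n (i : 'I_n.+1) p : tnth (insertt i p) i = p.1.
Proof. by rewrite tnth_mktuple unlift_none. Qed.

Lemma tnth_insertt_lift n (i : 'I_n.+1) k p :
  tnth (insertt i p) (lift i k) = tnth p.2 k.
Proof. by rewrite tnth_mktuple liftK. Qed.

Lemma int_iid_insert n (i : 'I_n.+1) (F : n.+1.-tuple T -> R) :
  measurable_fun setT F ->
  (P \x iid P n)%E.-integrable setT (EFin \o (F \o insertt i)) ->
  \int[(P \x iid P n)%E]_p F (insertt i p) = \int[iid P n.+1]_t F t.
Proof.
move=> mF iF; apply: int_iid_push => //; first exact: measurable_insertt.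
move=> A mA; rewrite (bigD1_ord i)//= -iidE//.
have mB : measurable [set x : n.-tuple T | forall k, A (lift i k) (tnth x k)].
  rewrite (_ : mkset _ =
    \bigcap_(k in [set: 'I_n]) ((@tnth _ T ^~ k) @^-1` A (lift i k))).
    apply: fin_bigcap_measurable => // k _.
    by rewrite -[X in measurable X]setTI; exact: measurable_tnth.
  by apply/seteqP; split => x /= h k; [move=> _; exact: h|exact: (h k)].
rewrite -product_measure1E//; congr (_ _).
apply/seteqP; split => -[z x] /=.
- move=> h; split; first by have := h i; rewrite tnth_insertt.
  by move=> k; have := h (lift i k); rewrite tnth_insertt_lift.
- move=> [hz hx] j; case: (unliftP i j) => [k|] ->.
    by rewrite tnth_insertt_lift; exact: hx.
  by rewrite tnth_insertt.
Qed.

Section merge.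
Variables (m m1 m2 : nat) (chi : 'I_m -> 'I_m1 + 'I_m2)
  (b : 'I_m1 + 'I_m2 -> 'I_m).
Hypotheses (chiK : cancel chi b) (bK : cancel b chi).

(** [chi] sorts the indices into two groups. It will separate the noise of the pairs avoiding a site
    from that of the pairs containing it. *)
Definition merget (p : m1.-tuple T * m2.-tuple T) : m.-tuple T :=
  [tuple match chi k with inl i => tnth p.1 i | inr j => tnth p.2 j end | k < m].

Lemma measurable_merget : measurable_fun setT merget.
Proof.
apply/measurable_fun_tnthP => k.
rewrite (_ : _ \o _ = fun p : m1.-tuple T * m2.-tuple T =>
  match chi k with inl i => tnth p.1 i | inr j => tnth p.2 j end); last first.
  by apply/funext => p /=; rewrite tnth_mktuple.
by case: (chi k) => j; exact: (measurableT_comp (measurable_tnth _)).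
Qed.

Lemma tnth_merget_l p i : tnth (merget p) (b (inl i)) = tnth p.1 i.
Proof. by rewrite tnth_mktuple bK. Qed.

Lemma tnth_merget_r p j : tnth (merget p) (b (inr j)) = tnth p.2 j.
Proof. by rewrite tnth_mktuple bK. Qed.

Lemma int_iid_merge (F : m.-tuple T -> R) :
  measurable_fun setT F ->
  (iid P m1 \x iid P m2)%E.-integrable setT (EFin \o (F \o merget)) ->
  \int[(iid P m1 \x iid P m2)%E]_p F (merget p) = \int[iid P m]_t F t.
Proof.
move=> mF iF; apply: int_iid_push => //; first exact: measurable_merget.
move=> A mA.
have -> : (\prod_(k < m) P (A k) = (\prod_(i < m1) P (A (b (inl i)))) *
    \prod_(j < m2) P (A (b (inr j))))%E.
  rewrite (reindex b); last by exists chi => x _; [exact: bK|exact: chiK].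
  by rewrite big_sumType.
have mB n (A' : 'I_n -> set T) : (forall i, measurable (A' i)) ->
    measurable [set x : n.-tuple T | forall k, A' k (tnth x k)].
  move=> mA'; rewrite (_ : mkset _ =
    \bigcap_(k in [set: 'I_n]) ((@tnth _ T ^~ k) @^-1` A' k)).
    apply: fin_bigcap_measurable => // k _.
    by rewrite -[X in measurable X]setTI; exact: measurable_tnth.
  by apply/seteqP; split => x /= h k; [move=> _; exact: h|exact: (h k)].
rewrite -!iidE// -product_measure1E//; last 2 first.
- exact: (mB _ (fun i => A (b (inl i)))).
- exact: (mB _ (fun i => A (b (inr i)))).
congr (_ _); apply/seteqP; split => -[x y] /=.
- move=> h; split => k; first by have := h (b (inl k)); rewrite tnth_merget_l.
  by have := h (b (inr k)); rewrite tnth_merget_r.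
- move=> [hx hy] k; rewrite -(chiK k); case: (chi k) => j.
    by rewrite tnth_merget_l; exact: hx.
  by rewrite tnth_merget_r; exact: hy.
Qed.

End merge.

Section marginal.
Variables (k n : nat) (sg : 'I_k -> 'I_n).
Hypothesis sg_inj : injective sg.

Definition subtuple (t : n.-tuple T) : k.-tuple T := [tuple tnth t (sg i) | i < k].

Lemma measurable_subt : measurable_fun setT subtuple.
Proof.
apply/measurable_fun_tnthP => j.
rewrite (_ : _ \o _ = fun t : n.-tuple T => tnth t (sg j)); last first.
  by apply/funext => p /=; rewrite tnth_mktuple.
exact: measurable_tnth.
Qed.

Lemma int_iid_sub (F : k.-tuple T -> R) :
  measurable_fun setT F -> (iid P n).-integrable setT (EFin \o (F \o subtuple)) ->
  \int[iid P n]_t F (subtuple t) = \int[iid P k]_t F t.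
Proof.
move=> mF iF; apply: int_iid_push => //; first exact: measurable_subt.
move=> A mA.
(* Coordinates outside the image of [sg] are left free; their factor is [P setT], i.e. 1. *)
pose B (j : 'I_n) := if [pick i | sg i == j] is Some i then A i else setT.
have BE i : B (sg i) = A i.
  by rewrite /B; case: pickP => [i' /eqP/sg_inj ->//|/(_ i)]; rewrite eqxx.
have mB j : measurable (B j) by rewrite /B; case: pickP.
have -> : [set t | forall i, A i (tnth (subtuple t) i)] =
    [set t : n.-tuple T | forall j, B j (tnth t j)].
  apply/seteqP; split => t /= h j.
    rewrite /B; case: pickP => // i /eqP <-.
    by have := h i; rewrite tnth_mktuple.
  by rewrite tnth_mktuple; have := h (sg j); rewrite BE.
rewrite iidE//.
rewrite (bigID (fun j => j \in codom sg))/= [X in (_ * X)%E]big1 ?mule1; last first.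
  move=> j jn; rewrite /B; case: pickP => [i /eqP ij|_].
    by rewrite -ij codom_f in jn.
  exact: probability_setT.
rewrite (reindex_omap sg (fun j => [pick i | sg i == j])); last first.
  move=> j /codomP[i ->]; case: pickP => [i' /eqP <-//|/(_ i)].
  by rewrite eqxx.
apply: eq_big => [i|i _]; last by rewrite BE.
rewrite codom_f/=; case: pickP => [i' /eqP/sg_inj ->|/(_ i)]; rewrite eqxx//.
Qed.

End marginal.

End iid_push.

(** * Measures given by a density *)

Section density.
Context d (T : measurableType d) (R : realType).
Variables (mu nu : {measure set T -> \bar R}) (f : T -> R).
Hypotheses (mf : measurable_fun setT f) (f0 : forall x, 0 <= f x).
Hypothesis nuE : forall A, measurable A -> (nu A = \int[mu]_(x in A) (f x)%:E)%E.

Import HBNNSimple.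

Lemma ge0_integral_density (h : T -> \bar R) :
  measurable_fun setT h -> (forall x, (0 <= h x)%E) ->
  (\int[nu]_x h x = \int[mu]_x (h x * (f x)%:E))%E.
Proof.
move=> mh h0; pose h_ := nnsfun_approx measurableT mh.
have mfE : measurable_fun setT (EFin \o f) by exact/measurable_EFinP.
have f0E x : (0 <= (f x)%:E)%E by rewrite lee_fin.
have -> : (\int[nu]_x h x = lim (\int[nu]_x (EFin \o h_ n) x @[n --> \oo]))%E.
  rewrite -monotone_convergence//=.
  - by apply: eq_integral => ? _; apply/esym/cvg_lim => //=;
      exact: cvg_nnsfun_approx.
  - by move=> n; exact/measurable_EFinP/measurable_funTS.
  - by move=> n ? _; rewrite lee_fin.
  - by move=> ? _ ? ? mn; rewrite lee_fin; exact/lefP/nd_nnsfun_approx.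
have -> : (\int[mu]_x (h x * (f x)%:E) =
    lim (\int[mu]_x ((EFin \o h_ n) x * (f x)%:E) @[n --> \oo]))%E.
  rewrite -monotone_convergence//=.
  - apply: eq_integral => x _; apply/esym/cvg_lim => //=.
    by apply: cvgeZr => //; exact: cvg_nnsfun_approx.
  - by move=> n; apply: emeasurable_funM => //; exact/measurable_EFinP/measurable_funTS.
  - by move=> n ? _; rewrite mule_ge0 ?lee_fin.
  - move=> ? _ ? ? mn; rewrite lee_wpmul2r ?lee_fin//.
    exact/lefP/nd_nnsfun_approx.
suff suf n : (\int[mu]_x ((EFin \o h_ n) x * (f x)%:E) =
    \int[nu]_x (EFin \o h_ n) x)%E 
  by rewrite (_ : (fun n => \int[mu]_x _)%E = (fun n => \int[nu]_x (EFin \o h_ n) x)%E)//;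
    apply/funext => n; exact: suf.
transitivity (\int[nu]_x
   (\sum_(y \in range (h_ n)) (y * \1_(h_ n @^-1` [set y]) x)%:E))%E; last first.
  by apply: eq_integral => t tE; rewrite /= fimfunE -fsumEFin.
have indich m r : measurable_fun setT (fun x => (r * \1_(h_ m @^-1` [set r]) x)%:E).
  by apply: (measurable_comp measurableT) => //; exact: measurable_funM.
rewrite ge0_integral_fsum//; last by move=> m y Ey; exact: nnfun_muleindic_ge0.
transitivity (\int[mu]_x (\sum_(y \in range (h_ n))
    (y * \1_(h_ n @^-1` [set y]) x)%:E * (f x)%:E))%E.
  under [RHS]eq_integral => x xE.
    rewrite -ge0_mule_fsuml => [|y]; last exact: nnfun_muleindic_ge0.
    rewrite fsumEFin // -(fimfunE _ x); over.
  by [].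
rewrite ge0_integral_fsum//; last 2 first.
  - by move=> y; exact: emeasurable_funM.
  - move=> m y Ey; rewrite mule_ge0// EFinM; exact: nnfun_muleindic_ge0.
apply: eq_fsbigr => r rhn.
under [RHS]eq_integral do rewrite EFinM.
rewrite integralZl_indic_nnsfun => //.
under eq_integral do rewrite EFinM -muleA.
have mB : measurable (h_ n @^-1` [set r]) by exact: measurable_sfunP.
have r0 : 0 <= r by move: rhn; rewrite inE => -[x _ <-].
rewrite ge0_integralZl//; last 2 first.
- by apply: emeasurable_funM => //; exact/measurable_EFinP/measurable_indic.
- by move=> x _; rewrite mule_ge0 ?lee_fin.
congr (_ * _)%E; rewrite integral_indic// setIT nuE//.
rewrite [RHS]integral_mkcond; apply: eq_integral => x _.
by rewrite patchE indicE; case: ifP; rewrite ?mul1e ?mul0e.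
Qed.

Lemma int_density (h : T -> R) : measurable_fun setT h ->
  \int[nu]_x h x = \int[mu]_x (h x * f x).
Proof.
move=> mh; rewrite /Rintegral; congr fine; rewrite [LHS]integralE [RHS]integralE.
have mhE : measurable_fun setT (EFin \o h) by exact/measurable_EFinP.
rewrite !ge0_integral_density//; last 2 first.
- exact: measurable_funeneg.
- exact: measurable_funepos.
congr (_ - _)%E; apply: eq_integral => x _.
- rewrite !funeposE -!EFin_max -EFinM maxr_pMl ?mul0r//.
- by rewrite !funenegE -!EFinN -!EFin_max -EFinM maxr_pMl ?mul0r ?mulNr.
Qed.

End density.

Section dens_prob.
Context d (T : measurableType d) (R : realType) (mu : probability T R).
Variables (f : T -> R).
Hypotheses (mf : measurable_fun setT f) (f0 : forall x, 0 <= f x).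
Hypothesis f1 : (\int[mu]_x (f x)%:E = 1)%E.

(** The proofs are arguments so that the measure and probability instances can be attached to the
    term itself. *)
Definition density_measure (_ : measurable_fun setT f) (_ : forall x, 0 <= f x)
    (_ : (\int[mu]_x (f x)%:E = 1)%E) : set T -> \bar R :=
  fun A => (\int[mu]_(x in A) (f x)%:E)%E.

Let nu := density_measure mf f0 f1.

Let nu0 : nu set0 = 0%E. Proof. by rewrite /nu/density_measure integral_set0. Qed.

Let nu_ge0 A : (0 <= nu A)%E.
Proof. by rewrite /nu/density_measure integral_ge0//= => x _; rewrite lee_fin. Qed.

Let nu_sigma_additive : semi_sigma_additive nu.
Proof.
move=> /= A mA tA mUA; rewrite /nu/density_measure/=.
rewrite ge0_integral_bigcup//=; last first.
- by move=> x _; rewrite lee_fin.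
- by apply: measurable_funTS; exact/measurable_EFinP.
apply: is_cvg_ereal_nneg_natsum_cond => n _ _.
by apply: integral_ge0 => /= x ?; rewrite lee_fin.
Qed.

HB.instance Definition _ := isMeasure.Build _ _ _ nu nu0 nu_ge0 nu_sigma_additive.

Let nu_setT : nu setT = 1%E. Proof. by []. Qed.

HB.instance Definition _ := @Measure_isProbability.Build _ _ R nu nu_setT.

End dens_prob.

Lemma ex_density d (T : measurableType d) (R : realType) (mu : probability T R)
    (f : T -> R) : measurable_fun setT f -> (forall x, 0 <= f x) ->
  mu.-integrable setT (EFin \o f) -> \int[mu]_x f x = 1 ->
  exists nu : probability T R, forall h, measurable_fun setT h ->
    \int[nu]_x h x = \int[mu]_x (h x * f x).
Proof.
move=> mf f0 fi f1.
have f1E : (\int[mu]_x (f x)%:E = 1)%E by rewrite -int_EFin// f1.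
exists (density_measure mf f0 f1E) => h mh.
exact: (int_density mf f0 _ mh).
Qed.

Section law.
Context d d' (S : measurableType d') (T : measurableType d) (R : realType).
Variables (Q : probability S R) (P : {measure set T -> \bar R}) (phi : S -> T).
Hypotheses (mphi : measurable_fun setT phi)
  (QP : forall A, measurable A -> Q (phi @^-1` A) = P A).

Lemma int_law (F : T -> R) : measurable_fun setT F ->
  Q.-integrable setT (EFin \o (F \o phi)) ->
  \int[Q]_s F (phi s) = \int[P]_x F x.
Proof.
move=> mF iF.
pose phi' : {mfun S >-> T} := HB.pack phi (isMeasurableFun.Build _ _ _ _ phi mphi).
rewrite /Rintegral; congr fine.
transitivity (\int[distribution Q phi']_t (F t)%:E)%E.
  by rewrite integral_distribution//; exact/measurable_EFinP.
apply: eq_measure_integral => A mA _; exact: QP.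
Qed.

End law.

(** * Gaussian measures *)

Section gaussian1.
Variable R : realType.
Local Notation leb := (@lebesgue_measure R).
Local Notation RT := (measurableTypeR R).
Local Notation phi := (@normal_pdf R 0 1).
Local Notation gam := (std_normal R).

(** Uniqueness of Lebesgue measure: a times its image under x -> a x + b gives every interval its
    length. *)
Lemma integral_affine (a b : R) (h : RT -> \bar R) : 0 < a ->
  measurable_fun setT h -> (forall x, (0 <= h x)%E) ->
  (\int[leb]_x h x = a%:E * \int[leb]_x h (a * x + b)%R)%E.
Proof.
move=> a0 mh h0.
have mphi : measurable_fun setT (fun x : RT => (a * x + b : RT)).
  apply: measurable_funD => //; exact: measurable_funM.
pose a' : {nonneg R} := NngNum (ltW a0).
transitivity (\int[mscale a' leb]_x h (a * x + b)%R)%E; last first.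
  rewrite ge0_integral_mscale//; exact: (measurableT_comp mh mphi).
rewrite -(@ge0_integral_pushforward _ _ _ _ _ _ mphi (mscale a' leb) setT)//=.
apply: eq_measure_integral => A mA _.
apply: lebesgue_measure_unique => // _ [[u v]] _ <-.
transitivity (a%:E * leb `]((u - b) / a)%R, ((v - b) / a)%R]%classic)%E; last first.
  rewrite /pushforward /mscale/=; congr (_ * leb _)%E.
  apply/seteqP; split => x /=; rewrite !in_itv/=;
  by rewrite ltr_pdivrMr// ler_pdivlMr// ltrBlDr lerBrDr mulrC.
rewrite !lebesgue_measure_itv/= !lte_fin ltr_pM2r ?invr_gt0// ltrD2r.
case: ifP => _; last by rewrite mule0.
by rewrite -EFinB -EFinM; congr _%:E; field; rewrite gt_eqF.
Qed.

Lemma integral_gam (h : R -> \bar R) : measurable_fun setT h ->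
  (forall x, (0 <= h x)%E) ->
  (\int[gam]_x h x = \int[leb]_x (h x * (phi x)%:E))%E.
Proof.
move=> mh h0; rewrite ge0_integral_distribution//.
rewrite (@ge0_integral_density _ RT R leb (normal_prob 0 1) phi)//.
- exact: measurable_normal_pdf.
- exact: normal_pdf_ge0.
Qed.

Lemma phiE x : phi x = (Num.sqrt (pi *+ 2))^-1 * expR (- x ^+ 2 / 2).
Proof.
by rewrite normal_pdfE ?oner_neq0// /normal_peak /normal_fun expr1n mul1r subr0.
Qed.

Lemma phi_shift (t x : R) : phi (x - t) = phi x * expR (t * x - t ^+ 2 / 2).
Proof.
rewrite !phiE -mulrA -expRD; by congr (_ * expR _); field.
Qed.

Lemma integral_phi : (\int[leb]_x (phi x)%:E = 1)%E.
Proof. exact: integral_normal_pdf. Qed.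

Let mexp (t c : R) : measurable_fun setT (fun x : R => expR (t * x - c)).
Proof.
by apply: measurableT_comp => //; apply: measurable_funB => //.
Qed.

(** Cameron-Martin in dimension one: after a translation of the Lebesgue integral, the density at x
    - t is the density at x times the exponential. *)
Lemma gam_shift (h : R -> \bar R) (t : R) : measurable_fun setT h ->
  (forall x, (0 <= h x)%E) ->
  (\int[gam]_x h (x + t)%R = \int[gam]_x (h x * (expR (t * x - t ^+ 2 / 2))%:E))%E.
Proof.
move=> mh h0.
have mht : measurable_fun setT (fun x : R => h (x + t)).
  by apply: (measurableT_comp mh); exact: measurable_funD.
have mh' : measurable_fun setT (h : RT -> \bar R).
  exact: (measurableT_comp mh (@measurable_borel_id R)).
have mphi : measurable_fun setT (phi : RT -> R) by exact: measurable_normal_pdf.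
have me' : measurable_fun setT (fun x : RT => (expR (t * x - t ^+ 2 / 2))%:E).
  apply/measurable_EFinP.
  exact: (measurableT_comp (mexp t (t ^+ 2 / 2)) (@measurable_borel_id R)).
rewrite integral_gam// [in RHS]integral_gam//; last 2 first.
- by apply: emeasurable_funM => //; exact/measurable_EFinP/mexp.
- by move=> x; rewrite mule_ge0 ?lee_fin ?expR_ge0.
rewrite [RHS](@integral_affine 1 t)//; last 2 first.
- apply: emeasurable_funM => //; last exact/measurable_EFinP.
  exact: emeasurable_funM.
- by move=> x; rewrite !mule_ge0 ?lee_fin ?expR_ge0// normal_pdf_ge0.
rewrite mul1e; apply: eq_integral => x _; rewrite mul1r -muleA; congr (_ * _)%E.
rewrite -EFinM; congr _%:E.
by rewrite mulrC -phi_shift addrK.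
Qed.

Lemma gauge_gam : gauge gam (fun x => `|x|).
Proof.
split=> // C; apply/integrableP; split.
  apply/measurable_EFinP; apply: measurableT_comp => //.
  by apply: measurable_funM => //; exact: measurableT_comp.
have mexp' (t : R) : measurable_fun setT (fun x : R => (expR (t * x))%:E).
  by apply/measurable_EFinP; have := mexp t 0; under eq_fun do rewrite subr0.
(* Applied to a constant, the shift formula evaluates the Laplace transform of the Gaussian. *)
have mgf t : (\int[gam]_x (expR (t * x))%:E < +oo)%E.
  have := @gam_shift (fun=> (expR (t ^+ 2 / 2))%:E) t (measurable_cst _) ltac:(by move=> x;
    rewrite lee_fin expR_ge0).
  under eq_integral do rewrite /=.
  rewrite integral_cst// => /esym h.
  rewrite (eq_integral (fun x => (expR (t ^+ 2 / 2))%:E * (expR (t * x - t ^+ 2 / 2))%:E)%E).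
    by rewrite h [X in (_ * X)%E](@probability_setT _ _ _ gam) mule1 ltry.
  by move=> x _; rewrite -EFinM -expRD; congr (expR _)%:E; ring.
apply: (@le_lt_trans _ _ (\int[gam]_x ((expR (C * x))%:E + (expR (- C * x))%:E))%E).
  apply: ge0_le_integral => //=.
  - apply/measurable_EFinP; do 2 apply: measurableT_comp => //.
    by apply: measurable_funM => //; exact: measurableT_comp.
  - by apply: emeasurable_funD.
  - move=> x _; rewrite ger0_norm ?expR_ge0// -EFinD lee_fin.
    have [x0|x0] := leP 0 x; first by rewrite ger0_norm// lerDl expR_ge0.
    by rewrite ltr0_norm// mulrN mulNr lerDr expR_ge0.
rewrite ge0_integralD//.
by rewrite lte_add_pinfty.
Qed.

(** The stability of the Gaussian law. It is what allows a signal multiplied by sqrt 2 to be read as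
    two independent observations. *)
Lemma gam_rot (A : set R) : measurable A ->
  (gam \x gam)%E ((fun p => (p.1 + p.2) / Num.sqrt 2) @^-1` A) = gam A.
Proof.
move=> mA; set r2 := Num.sqrt 2 : R.
have r20 : 0 < r2 by rewrite sqrtr_gt0.
have r22 : r2 ^+ 2 = 2 by rewrite sqr_sqrtr.
pose h x : \bar R := (\1_A x)%:E.
have mh : measurable_fun setT h by apply/measurable_EFinP; exact: measurable_indic.
have h0 x : (0 <= h x)%E by rewrite lee_fin.
have mrot : measurable_fun setT (fun p : R * R => (p.1 + p.2) / r2).
  by apply: measurable_funM => //; apply: measurable_funD.
have mhrot : measurable_fun setT (fun p : R * R => h ((p.1 + p.2) / r2)).
  exact: measurableT_comp.
have mphi : measurable_fun setT (phi : RT -> R) by exact: measurable_normal_pdf.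
have p0 x : (0 <= (phi x)%:E)%E by rewrite lee_fin normal_pdf_ge0.
have mid : measurable_fun setT (@borel_id R) by exact: measurable_borel_id.
have mh' : measurable_fun setT (h \o @borel_id R) by exact: measurableT_comp.
pose k (v w : R) := phi (r2 * w - v).
have mk : measurable_fun setT (fun p : RT * RT => (k p.1 p.2)%:E).
  apply/measurable_EFinP; apply: measurableT_comp => //.
  by apply: measurable_funB => //; apply: measurable_funM.
have k0 v w : (0 <= (k v w)%:E)%E by rewrite lee_fin normal_pdf_ge0.
have mk1 v : measurable_fun setT (fun w : RT => (k v w)%:E).
  exact: (measurableT_comp mk (pair1_measurable v)).
have mk2 w : measurable_fun setT (fun v : RT => (k v w)%:E).
  exact: (measurableT_comp mk (pair2_measurable w)).
have mD : measurable ((fun p : R * R => (p.1 + p.2) / r2) @^-1` A).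
  by rewrite -[X in measurable X]setTI; exact: mrot.
transitivity (\int[gam]_x h x)%E;
  last by rewrite (integral_indic gam measurableT mA) setIT.
transitivity (\int[gam \x gam]_p h ((p.1 + p.2) / r2)%R)%E.
  by rewrite (integral_indic (gam \x gam)%E measurableT mD) setIT.
rewrite fubini_tonelli2//.
pose H (v : R) := (r2%:E * \int[leb]_w (h w * (k v w)%:E))%E.
have mhk : measurable_fun setT (fun p : RT * RT => (h p.2 * (k p.1 p.2)%:E)%E).
  by apply: emeasurable_funM => //; exact: (measurableT_comp mh' measurable_snd).
have mH : measurable_fun setT (H : RT -> \bar R).
  apply: emeasurable_funM => //.
  apply: (measurable_fun_fubini_tonelli_F _ mhk).
  by move=> p; rewrite mule_ge0.
have H0 v : (0 <= H v)%E.
  apply: mule_ge0; first by rewrite lee_fin ltW.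
  apply: integral_ge0 => w _.
  by rewrite mule_ge0.
transitivity (\int[gam]_v H v)%E.
  apply: eq_integral => v _; rewrite /fubini_G/= integral_gam//; last first.
    exact: (measurableT_comp mhrot (pair2_measurable v)).
  rewrite (@integral_affine r2 (- v))//; last 2 first.
  - apply: emeasurable_funM; last exact/measurable_EFinP.
    exact: (measurableT_comp (measurableT_comp mhrot (pair2_measurable v)) mid).
  - by move=> x; rewrite mule_ge0.
  congr (_ * _)%E; apply: eq_integral => w _.
  by rewrite /k subrK mulrAC divff ?mul1r// gt_eqF.
rewrite integral_gam//.
have mF : measurable_fun setT (fun p : RT * RT =>
    (h p.2 * (r2 * k p.1 p.2 * phi p.1)%:E)%E).
  apply: emeasurable_funM => //; first exact: (measurableT_comp mh' measurable_snd).
  apply/measurable_EFinP; apply: measurable_funM; last exact: measurableT_comp.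
  by apply: measurable_funM => //; exact/measurable_EFinP.
have F0 v w : (0 <= h w * (r2 * k v w * phi v)%:E)%E.
  by rewrite mule_ge0// lee_fin !mulr_ge0 ?normal_pdf_ge0// ltW.
transitivity (\int[leb]_v \int[leb]_w (h w * (r2 * k v w * phi v)%:E))%E.
  apply: eq_integral => v _; rewrite /H muleAC.
  transitivity (\int[leb]_w ((r2 * phi v)%:E * (h w * (k v w)%:E)))%E.
    rewrite ge0_integralZl ?EFinM//.
    - exact: emeasurable_funM.
    - by move=> w _; rewrite mule_ge0.
    by rewrite mule_ge0// lee_fin ltW.
  apply: eq_integral => w _; rewrite muleCA; congr (_ * _)%E.
  by rewrite -!EFinM; congr _%:E; ring.
rewrite (fubini_tonelli (fun p : RT * RT => h p.2 * (r2 * k p.1 p.2 * phi p.1)%:E)%E)//.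
transitivity (\int[leb]_w (h w * (phi w)%:E))%E.
  apply: eq_integral => w _.
  (* Rotation invariance enters as (sqrt 2 w - v)^2 + v^2 = w^2 + (sqrt 2 v - w)^2: the density of w
     comes out, and v is left with a translated and rescaled Gaussian of total mass 1. *)
  transitivity (\int[leb]_v ((h w * (phi w)%:E) * (r2%:E * (phi (r2 * v + - w))%:E)))%E.
    apply: eq_integral => v _; rewrite -[RHS]muleA; congr (_ * _)%E.
    rewrite -!EFinM; congr _%:E; rewrite /k !phiE.
    transitivity (r2 * (Num.sqrt (pi *+ 2))^-1 ^+ 2 *
        expR (- (r2 * w - v) ^+ 2 / 2 + - v ^+ 2 / 2)).
      by rewrite expRD; ring.
    transitivity (r2 * (Num.sqrt (pi *+ 2))^-1 ^+ 2 *
        expR (- w ^+ 2 / 2 + - (r2 * v - w) ^+ 2 / 2)); last by rewrite expRD; ring.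
    congr (_ * expR _); rewrite -!mulrDl; congr (_ / 2).
    transitivity (- (r2 ^+ 2) * w ^+ 2 + 2 * r2 * w * v - 2 * v ^+ 2); first by ring.
    by transitivity (- (r2 ^+ 2) * v ^+ 2 + 2 * r2 * w * v - 2 * w ^+ 2);
      [rewrite r22; ring|ring].
  have mp : measurable_fun setT (fun v : RT => (phi (r2 * v + - w))%:E).
    apply/measurable_EFinP; apply: (measurableT_comp mphi).
    by apply: measurable_funD => //; exact: measurable_funM.
  rewrite ge0_integralZl//=; last 3 first.
  - by apply: emeasurable_funM.
  - by move=> v _; rewrite mule_ge0// lee_fin ltW.
  - by rewrite mule_ge0.
  rewrite ge0_integralZl//=; last by rewrite lee_fin ltW.
  rewrite -(@integral_affine r2 (- w) (fun v => (phi v)%:E))//.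
    by rewrite integral_phi mule1.
  exact/measurable_EFinP.
by rewrite -integral_gam.
Qed.

End gaussian1.

Section gaussian_tuple.
Variable R : realType.
Local Notation gam := (std_normal R).

Definition absg (x : R) : R := `|x|.

Definition l1norm m : m.-tuple R -> R := iidG absg (n := m).

Lemma gauge_l1norm m : gauge (iid gam m) (@l1norm m).
Proof. exact: (gauge_iid (@gauge_gam R)). Qed.

Lemma l1norm_ge0 m (g : m.-tuple R) : 0 <= l1norm g.
Proof. by rewrite /l1norm /iidG sumr_ge0// => i _; rewrite /absg. Qed.

Lemma lin_absg : lin absg id.
Proof.
split=> //; exists 1; split=> // x; by rewrite mul1r /absg normr_id lerDr.
Qed.

Lemma int_gam_shift (F : R -> R) (t : R) : dm absg F ->
  \int[gam]_x F (x + t) = \int[gam]_x (F x * expR (t * x - t ^+ 2 / 2)).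
Proof.
move=> dF; have [mF _] := dF.
have mexp : measurable_fun setT (fun x : R => expR (t * x - t ^+ 2 / 2)).
  by apply: measurableT_comp => //; apply: measurable_funB.
have mt : measurable_fun setT (fun x : R => x + t) by exact: measurable_funD.
have e1 : (\int[gam]_x (expR (t * x - t ^+ 2 / 2))%:E = 1)%E.
  have := @gam_shift R (fun=> 1%E) t (@measurable_cst _ _ _ _ _ _) (fun _ => lee01).
  rewrite integral_cst// [X in (_ * X)%E](@probability_setT _ _ _ gam) mule1.
  by under eq_integral do rewrite mul1e.
have e0 : forall x : R, 0 <= expR (t * x - t ^+ 2 / 2) by move=> x; exact: expR_ge0.
rewrite -(@int_density _ R R gam (density_measure mexp e0 e1) _ mexp e0)//.
apply: (int_law mt) => //.
  move=> A mA.
  have mtA : measurable ((fun x => x + t) @^-1` A).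
    by rewrite -[X in measurable X]setTI; exact: mt.
  rewrite -[LHS]/(gam _) -(setIT (_ @^-1` A)) -(integral_indic gam measurableT mtA).
  rewrite (gam_shift (h := fun x => (\1_A x)%:E)) => [|//|x]; last 2 first.
  - exact/measurable_EFinP/measurable_indic.
  - by rewrite lee_fin.
  rewrite /= /density_measure [RHS]integral_mkcond; apply: eq_integral => x _.
  by rewrite patchE indicE; case: ifP; rewrite ?mul1e ?mul0e.
apply: (dm_integrable (@gauge_gam R)).
apply: (dm_comp (B := 1 + `|t|) mt _ dF).
move=> x; rewrite /absg !normr_id; have := ler_normD x t; have := normr_ge0 x.
have := normr_ge0 t; nra.
Qed.

Lemma int_gam_rot (F : R -> R) : dm absg F ->
  \int[(gam \x gam)%E]_p F ((p.1 + p.2) / Num.sqrt 2) = \int[gam]_x F x.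
Proof.
move=> dF; have [mF _] := dF.
have mt : measurable_fun setT (fun p : R * R => (p.1 + p.2) / Num.sqrt 2).
  by apply: measurable_funM => //; apply: measurable_funD.
apply: (int_law mt) => //; first by move=> A mA; exact: gam_rot.
have gp := gauge_prod (@gauge_gam R) (@gauge_gam R).
apply: (dm_integrable gp).
apply: (dm_comp (B := `|(Num.sqrt 2)^-1|) mt _ dF).
move=> x; rewrite /absg /prodG normr_id (@ger0_norm _ (_ + _)) ?addr_ge0// normrM mulrC ler_wpM2l//.
by rewrite (le_trans (ler_normD _ _))// lerDr.
Qed.

Definition shiftt m (a : 'I_m -> R) (g : m.-tuple R) : m.-tuple R :=
  [tuple tnth g k + a k | k < m].

Lemma measurable_shiftt m (a : 'I_m -> R) : measurable_fun setT (shiftt a).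
Proof.
apply/measurable_fun_tnthP => k.
rewrite (_ : _ \o _ = fun g : m.-tuple R => tnth g k + a k); last first.
  by apply/funext => g /=; rewrite tnth_mktuple.
by apply: measurable_funD => //; exact: measurable_tnth.
Qed.

(* Exponent of the Cameron-Martin density of [shiftt a]. *)
Definition gexp m (a : 'I_m -> R) (g : m.-tuple R) : R :=
  \sum_(k < m) (tnth g k * a k - a k ^+ 2 / 2).

Lemma lin_gexp m (a : 'I_m -> R) : lin (@l1norm m) (gexp a).
Proof.
apply: lin_sum => k.
apply: linB; last exact: lin_cst.
rewrite (_ : (fun _ => _) = fun g : m.-tuple R => a k * tnth g k); last first.
  by apply/funext => g; rewrite mulrC.
apply: linZ.
exact: (lin_tnth (@gauge_gam R) k lin_absg).
Qed.

Lemma gexp_cons m (a : 'I_m.+1 -> R) z (t : m.-tuple R) :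
  gexp a [tuple of z :: t] =
  (a ord0 * z - a ord0 ^+ 2 / 2) + gexp (a \o lift ord0) t.
Proof.
rewrite /gexp big_ord_recl; congr (_ + _); first by rewrite mulrC.
by apply: eq_bigr => k _; rewrite tnthS.
Qed.

Lemma dm_shiftt m (a : 'I_m -> R) F : dm (@l1norm m) F ->
  dm (@l1norm m) (fun g => F (shiftt a g)).
Proof.
move=> dF; apply: (dm_comp (B := 1 + \sum_k `|a k|) (measurable_shiftt a) _ dF).
move=> g; rewrite !ger0_norm ?l1norm_ge0//; apply: (@le_trans _ _ (l1norm g + \sum_k `|a k|)).
  rewrite /l1norm /iidG -big_split/=; apply: ler_sum => k _.
  by rewrite tnth_mktuple ler_normD.
have : 0 <= \sum_k `|a k| by rewrite sumr_ge0.
have := l1norm_ge0 g; nra.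
Qed.

Lemma int_shift m (a : 'I_m -> R) F : dm (@l1norm m) F ->
  \int[iid gam m]_g F (shiftt a g) = \int[iid gam m]_g (F g * expR (gexp a g)).
Proof.
have gg := @gauge_gam R.
have dexp n (b : 'I_n -> R) : dm (@l1norm n) (fun g => expR (gexp b g)).
  by apply: dm_exp; exact: lin_gexp.
elim: m a F => [|m IH] a F dF.
  apply: eq_int => g; rewrite /gexp big_ord0 expR0 mulr1; congr F.
  by rewrite tuple0 [RHS]tuple0.
rewrite (int_iidS gg (dm_shiftt a dF)).
rewrite (int_iidS gg (dmM dF (dexp _ a))).
pose Phi z := \int[iid gam m]_t (F [tuple of z :: t] * expR (gexp (a \o lift ord0) t)).
(* Reading the tail through [behead] exhibits [Phi] as a partial integral of a function of the whole
   tuple, so that [dm_iid_int] bounds its growth. *)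
have dK : dm (@l1norm m.+1) (fun g => F g * expR (gexp (a \o lift ord0) [tuple of behead g])).
  apply: dmM => //.
  apply: (dm_comp (phi := fun g : m.+1.-tuple R => [tuple of behead g]) (B := 1) _ _
      (dexp _ (a \o lift ord0))).
  - exact: measurable_behead.
  - move=> g; rewrite mul1r !ger0_norm ?l1norm_ge0//.
    rewrite [X in _ <= _ + l1norm X]tuple_eta /l1norm iidG_cons.
    by rewrite /absg; have := normr_ge0 (thead g); lra.
have dPhi : dm absg Phi.
  suff -> : Phi = (fun z => \int[iid gam m]_t (F [tuple of z :: t] *
      expR (gexp (a \o lift ord0) [tuple of behead [tuple of z :: t]]))).
    exact: (dm_iid_int gg dK).
  apply/funext => z; apply: eq_int => t; congr (_ * expR (gexp _ _)).
  exact/val_inj.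
transitivity (\int[gam]_z Phi (z + a ord0)).
  apply: eq_int => z; rewrite /Phi -IH; last exact: (dm_iid_sec gg _ dF).
  apply: eq_int => t; congr F; apply: eq_from_tnth => k; rewrite tnth_mktuple.
  by case: (unliftP ord0 k) => [j|] ->; rewrite ?tnthS// tnth_mktuple.
rewrite int_gam_shift//; apply: eq_int => z.
rewrite -(intZr (@gauge_l1norm m)).
  apply: eq_int => t; rewrite gexp_cons -mulrA -expRD; congr (_ * expR _).
  by rewrite addrC.
apply: dmM; last exact: dexp.
exact: (dm_iid_sec gg _ dF).
Qed.

Definition rott m (p : m.-tuple R * m.-tuple R) : m.-tuple R :=
  [tuple (tnth p.1 k + tnth p.2 k) / Num.sqrt 2 | k < m].

Lemma measurable_rott m : measurable_fun setT (@rott m).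
Proof.
apply/measurable_fun_tnthP => k.
rewrite (_ : _ \o _ = fun p : m.-tuple R * m.-tuple R =>
   (tnth p.1 k + tnth p.2 k) / Num.sqrt 2); last first.
  by apply/funext => g /=; rewrite tnth_mktuple.
apply: measurable_funM => //; apply: measurable_funD.
  exact: (measurableT_comp (measurable_tnth _) measurable_fst).
exact: (measurableT_comp (measurable_tnth _) measurable_snd).
Qed.

Lemma l1norm_rott m p : l1norm (@rott m p) <= prodG (@l1norm m) (@l1norm m) p.
Proof.
rewrite /l1norm /iidG /prodG -big_split/=; apply: ler_sum => k _.
rewrite tnth_mktuple /absg normrM (le_trans _ (ler_normD _ _))//.
rewrite ler_piMr// ger0_norm ?invr_ge0// invf_le1 ?sqrtr_gt0//.
rewrite -[leLHS]sqrtr1 ler_sqrt//; lra.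
Qed.

Lemma dm_rott m F : dm (@l1norm m) F -> dm (prodG (@l1norm m) (@l1norm m)) (fun p => F (rott p)).
Proof.
move=> dF; apply: (dm_comp (B := 1) (@measurable_rott m) _ dF).
move=> p; rewrite !ger0_norm ?l1norm_ge0 ?addr_ge0 ?l1norm_ge0// (le_trans (l1norm_rott _))//
  mul1r lerDr//.
Qed.

Lemma int_rot m F : dm (@l1norm m) F ->
  \int[(iid gam m)]_g \int[(iid gam m)]_g' F (rott (g, g')) = \int[iid gam m]_g F g.
Proof.
have gg := @gauge_gam R.
elim: m F => [|m IH] F dF.
  apply: eq_int => g; rewrite -[RHS](@int_cst _ _ _ (iid gam 0)).
  by apply: eq_int => g'; congr F; rewrite tuple0 [RHS]tuple0.
have gm := @gauge_l1norm m.
have gm1 := @gauge_l1norm m.+1.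
have dR := dm_rott dF.
rewrite (int_iidS gg); last exact: (dm_int2 gm1 gm1 dR).
(* The nesting ((t, z'), t') lets Fubini move the second head z' in front of the first tail t, after
   which the induction hypothesis applies to the two tails. *)
pose K (z : R) (q : (m.-tuple R * R) * m.-tuple R) :=
  F (rott ([tuple of z :: q.1.1], [tuple of q.1.2 :: q.2])).
have rcons z z' (t t' : m.-tuple R) : rott ([tuple of z :: t], [tuple of z' :: t'])
    = [tuple of (z + z') / Num.sqrt 2 :: rott (t, t')].
  apply: eq_from_tnth => k; rewrite tnth_mktuple.
  by case: (unliftP ord0 k) => [j|] ->; rewrite ?tnthS// tnth_mktuple.
have dK z : dm (prodG (prodG (@l1norm m) absg) (@l1norm m)) (K z).
  apply: (dm_comp (B := 1 + `|z|) (phi := fun q : (m.-tuple R * R) * m.-tuple R =>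
    rott ([tuple of z :: q.1.1], [tuple of q.1.2 :: q.2])) _ _ dF).
  - apply: (measurableT_comp (@measurable_rott m.+1)).
    apply: measurable_fun_pair.
      apply: measurable_cons => //.
      exact: (measurableT_comp measurable_fst measurable_fst).
    apply: measurable_cons => //.
    exact: (measurableT_comp measurable_snd measurable_fst).
  - move=> q; rewrite [`|l1norm _|]ger0_norm ?l1norm_ge0//.
    rewrite [`|prodG _ _ _|]ger0_norm ?addr_ge0 ?l1norm_ge0 /absg//.
    rewrite (le_trans (l1norm_rott _))// /prodG/= /l1norm !iidG_cons.
    have := l1norm_ge0 q.1.1; have := l1norm_ge0 q.2; rewrite /l1norm /absg.
    have := normr_ge0 z; have := normr_ge0 q.1.2.
    move: (iidG _ q.2) (iidG _ q.1.1) `|z| `|q.1.2| => A B C E; nra.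
transitivity (\int[gam]_z \int[gam]_z' \int[iid gam m]_t
    F [tuple of (z + z') / Num.sqrt 2 :: t]).
  apply: eq_int => z.
  transitivity (\int[iid gam m]_t \int[gam]_z' \int[iid gam m]_t' K z ((t, z'), t')).
    apply: eq_int => t; rewrite (int_iidS gg)//.
    exact: (dm_sec1 gm1 gm1 _ dR).
  rewrite (fubini_swap gm gg (f := fun p => \int[iid gam m]_t' K z (p, t'))); last first.
    exact: (dm_int2 (gauge_prod gm gg) gm (dK z)).
  apply: eq_int => z'.
  rewrite -(IH (fun t => F [tuple of (z + z') / Num.sqrt 2 :: t])); last first.
    exact: (dm_iid_sec gg _ dF).
  by apply: eq_int => t; apply: eq_int => t'; rewrite /K/= rcons.
pose Phi z := \int[iid gam m]_t F [tuple of z :: t].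
have dPhi : dm absg Phi by exact: (dm_iid_int gg dF).
rewrite (int_iidS gg dF) -(int_gam_rot dPhi).
rewrite (fubini1 gg gg)//.
have mt : measurable_fun setT (fun p : R * R => (p.1 + p.2) / Num.sqrt 2).
  by apply: measurable_funM => //; apply: measurable_funD.
apply: (dm_comp (B := `|(Num.sqrt 2)^-1|) mt _ dPhi).
move=> x; rewrite /absg /prodG normr_id (@ger0_norm _ (_ + _)) ?addr_ge0// normrM mulrC ler_wpM2l//.
by rewrite (le_trans (ler_normD _ _))// lerDr.
Qed.

End gaussian_tuple.

(** * Taylor estimates *)

Section real_estimates.
Variable R : realType.
Implicit Types (u x y L D th : R).

(** A mean value theorem for either order of x0 and x. The conclusion records that c lies on the
    same side of x0 as x and not farther, which settles the sign and the size of Taylor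
    remainders. *)
Lemma mvt_between (f f' : R -> R) (x0 x : R) (I : interval R) :
  (forall y, y \in I -> is_derive y 1 f (f' y)) -> x0 \in I -> x \in I ->
  exists2 c, [/\ c \in I, `|c - x0| <= `|x - x0| & 0 <= (c - x0) * (x - x0)] &
    f x - f x0 = f' c * (x - x0).
Proof.
move=> df x0I xI.
have sub (a b : R) : a \in I -> b \in I -> {subset `[a, b] <= I}.
  by move=> aI bI y; rewrite in_itv/= => ayb; exact: (@interval_is_interval _ I a b aI bI y).
have cont (a b : R) : a \in I -> b \in I -> {within `[a, b], continuous f}.
  move=> aI bI; apply: derivable_within_continuous => y /(sub _ _ aI bI) yI.
  by have [] := df y yI.
have [xx0|xx0|->] := ltgtP x x0.
- have [c cI E] : exists2 c, c \in `]x, x0[%R & f x0 - f x = f' c * (x0 - x).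
    have dfl y : y \in `]x, x0[%R -> is_derive y 1 f (f' y).
      by move=> /subset_itv_oo_cc yI; apply: df; exact: (sub x x0).
    exact: (MVT xx0 dfl (cont x x0 xI x0I)).
  have cI' := sub x x0 xI x0I c (subset_itv_oo_cc cI).
  move: cI; rewrite in_itv/= => /andP[xc cx0].
  exists c; last by rewrite -[LHS]opprB E -mulrN opprB.
  by rewrite !ltr0_norm ?subr_lt0//; split => //; [lra|nra].
- have [c cI E] : exists2 c, c \in `]x0, x[%R & f x - f x0 = f' c * (x - x0).
    have dfl y : y \in `]x0, x[%R -> is_derive y 1 f (f' y).
      by move=> /subset_itv_oo_cc yI; apply: df; exact: (sub x0 x).
    exact: (MVT xx0 dfl (cont x0 x x0I xI)).
  have cI' := sub x0 x x0I xI c (subset_itv_oo_cc cI).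
  move: cI; rewrite in_itv/= => /andP[xc cx0].
  exists c => //.
  by rewrite !gtr0_norm ?subr_gt0//; split => //; [lra|nra].
- by exists x0; rewrite !subrr ?mulr0.
Qed.

Lemma expR_taylor1 u : `|expR u - 1| <= `|u| * expR `|u|.
Proof.
have [u0|u0] := leP 0 u.
  rewrite !ger0_norm ?subr_ge0 ?expR_ge1//; last first.
    by rewrite -[leLHS]expR0 ler_expR.
  have := expR_ge1Dx (- u); have := expR_gt0 u.
  have : expR u * expR (- u) = 1 by rewrite -expRD subrr expR0.
  nra.
rewrite ltr0_norm ?subr_lt0 ?expR_lt1// (ltr0_norm u0).
have := expR_ge1Dx u; have := @expR_ge1Dx R (- u); nra.
Qed.

Lemma expR_taylor2 u : `|expR u - 1 - u| <= u ^+ 2 * expR `|u|.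
Proof.
have h := expR_ge1Dx u; rewrite ger0_norm; last by lra.
have [u0|u0] := leP 0 u.
  have := expR_taylor1 u; rewrite (ger0_norm u0) ger0_norm; last by lra.
  have := expR_ge1Dx (- u); have := expR_gt0 u.
  have : expR u * expR (- u) = 1 by rewrite -expRD subrr expR0.
  nra.
have := expR_gt0 u; have := @expR_ge1Dx R (- u); rewrite (ltr0_norm u0).
have : expR u * expR (- u) = 1 by rewrite -expRD subrr expR0.
move: (expR u) (expR (- u)) => a b ab b1 a0.
suff : a - 1 - u <= u ^+ 2 by nra.
nra.
Qed.

Lemma expR_taylor3 u : `|expR u - 1 - u - u ^+ 2 / 2| <= `|u| ^+ 3 * expR `|u|.
Proof.
pose f x : R := expR x - 1 - x - x ^+ 2 / 2.
pose f' x : R := expR x - 1 - x.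
have df (y : R) : y \in `]-oo, +oo[ -> is_derive y 1 f (f' y).
  move=> _; rewrite /f /f'; apply: is_derive_eq.
  by rewrite /GRing.scale/=; field.
have [c [cI c1 posterior_err]] := mvt_between df (isT : 0 \in `]-oo, +oo[) (isT : u \in `]-oo,
  +oo[).
rewrite !subr0 in c1 posterior_err *.
have -> : f 0 = 0 by rewrite /f expR0 expr0n/=; lra.
rewrite subr0 => E.
have -> : expR u - 1 - u - u ^+ 2 / 2 = f' c * u by rewrite -E.
rewrite normrM exprSr mulrAC ler_wpM2r//.
apply: (le_trans (expR_taylor2 c)).
rewrite -[c ^+ 2]real_normK ?num_real// ler_pM ?expR_ge0 ?exprn_ge0//.
  by rewrite ler_pXn2r ?nnegrE.
by rewrite ler_expR.
Qed.

(** The difference has derivative (x - 1)^3 / x, of the sign of x - 1, and vanishes at 1. *)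
Lemma ln_taylor3_le L : 0 < L ->
  ln L <= (L - 1) - (L - 1) ^+ 2 / 2 + (L - 1) ^+ 3 / 3.
Proof.
move=> L0.
pose f x : R := (x - 1) - (x - 1) ^+ 2 / 2 + (x - 1) ^+ 3 / 3 - ln x.
pose f' x : R := (x - 1) ^+ 3 / x.
have df (y : R) : y \in `]0, +oo[ -> is_derive y 1 f (f' y).
  rewrite in_itv/= andbT => y0; rewrite /f /f'.
  have := is_derive1_ln y0 => dln.
  apply: is_derive_eq; rewrite /GRing.scale/=; field; lra.
have I1 : (1 : R) \in `]0, +oo[ by rewrite in_itv/= ltr01.
have IL : L \in `]0, +oo[ by rewrite in_itv/= L0.
have [c [cI c1 posterior_err]] := mvt_between df I1 IL.
have -> : f 1 = 0 by rewrite /f ln1 subrr !expr0n/=; lra.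
rewrite subr0 => E.
have c0 : 0 < c by move: cI; rewrite in_itv/= andbT.
suff : 0 <= f L by rewrite /f; lra.
rewrite E /f' mulrAC divr_ge0 ?(ltW c0)//.
have -> : (c - 1) ^+ 3 * (L - 1) = (c - 1) ^+ 2 * ((c - 1) * (L - 1)) by ring.
by rewrite mulr_ge0 ?sqr_ge0.
Qed.

(** With [lnM_ge], polynomial bounds valid for every L > 0: they enclose E L ln L by moments of L up
    to order 4, without any truncation of L. *)
Lemma lnM_le L : 0 < L -> L * ln L <=
  (L - 1) + (L - 1) ^+ 2 / 2 - (L - 1) ^+ 3 / 6 + (L - 1) ^+ 4 / 3.
Proof.
move=> L0; have := ler_wpM2l (ltW L0) (ln_taylor3_le L0).
move=> /le_trans; apply; rewrite le_eqVlt; apply/orP; left; apply/eqP.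
by field.
Qed.

Lemma ln_taylor2_sign L : 0 < L ->
  0 <= (ln L - (L - 1) + (L - 1) ^+ 2 / 2) * (L - 1).
Proof.
move=> L0.
pose f x : R := ln x - (x - 1) + (x - 1) ^+ 2 / 2.
pose f' x : R := (x - 1) ^+ 2 / x.
have df (y : R) : y \in `]0, +oo[ -> is_derive y 1 f (f' y).
  rewrite in_itv/= andbT => y0; rewrite /f /f'.
  have := is_derive1_ln y0 => dln.
  apply: is_derive_eq; rewrite /GRing.scale/=; field; lra.
have I1 : (1 : R) \in `]0, +oo[ by rewrite in_itv/= ltr01.
have IL : L \in `]0, +oo[ by rewrite in_itv/= L0.
have [c [cI c1 posterior_err]] := mvt_between df I1 IL.
have -> : f 1 = 0 by rewrite /f ln1 subrr !expr0n/=; lra.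
rewrite subr0 => E.
have c0 : 0 < c by move: cI; rewrite in_itv/= andbT.
rewrite -/(f L) E /f' -mulrA -expr2 mulrAC divr_ge0 ?(ltW c0)//.
by rewrite mulr_ge0 ?sqr_ge0.
Qed.

(** The derivative of the difference is the function of [ln_taylor2_sign], which has the sign of x -
    1. *)
Lemma lnM_ge L : 0 < L ->
  (L - 1) + (L - 1) ^+ 2 / 2 - (L - 1) ^+ 3 / 6 <= L * ln L.
Proof.
move=> L0.
pose f x : R := x * ln x - (x - 1) - (x - 1) ^+ 2 / 2 + (x - 1) ^+ 3 / 6.
pose f' x : R := ln x - (x - 1) + (x - 1) ^+ 2 / 2.
have df (y : R) : y \in `]0, +oo[ -> is_derive y 1 f (f' y).
  rewrite in_itv/= andbT => y0; rewrite /f /f'.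
  have := is_derive1_ln y0 => dln.
  apply: is_derive_eq; rewrite /GRing.scale/=; field; lra.
have I1 : (1 : R) \in `]0, +oo[ by rewrite in_itv/= ltr01.
have IL : L \in `]0, +oo[ by rewrite in_itv/= L0.
have [c [cI c1 posterior_err]] := mvt_between df I1 IL.
have -> : f 1 = 0 by rewrite /f ln1 mulr0 subrr !expr0n/=; lra.
rewrite subr0 => E.
have c0 : 0 < c by move: cI; rewrite in_itv/= andbT.
suff : 0 <= f L by rewrite /f; lra.
rewrite E; have := ln_taylor2_sign c0; rewrite -/(f' c) => fc.
have [c1'|c1'|c1'] := ltgtP c 1.
- have : f' c <= 0 by nra.
  have : L - 1 <= 0 by nra.
  nra.
- have : 0 <= f' c by nra.
  have : 0 <= L - 1 by nra.
  nra.
- by rewrite c1' /f' ln1 subrr expr0n/= mul0r subr0 addr0 mul0r.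
Qed.

Lemma ln1B_bound y : 0 <= y -> y <= 2^-1 ->
  0 <= - ln (1 - y) - y <= 2 * y ^+ 2.
Proof.
move=> y0 y1; have L0 : 0 < 1 - y by lra.
have := le_ln1Dx (x := - y); have -> : 1 + - y = 1 - y by [].
move=> h1; have {}h1 := h1 ltac:(lra).
have h2 := @le_ln1Dx R (y / (1 - y)).
have E : ln (1 + y / (1 - y)) = - ln (1 - y).
  rewrite -lnV ?posrE//; congr ln; field; lra.
have {}h2 : - ln (1 - y) <= y / (1 - y).
  by rewrite -E; apply: h2; rewrite (@lt_le_trans _ _ 0)// divr_ge0// ltW.
apply/andP; split; first by lra.
have : y / (1 - y) <= y + 2 * y ^+ 2.
  by rewrite ler_pdivrMr//; nra.
lra.
Qed.

(** Uniform in L >= 0. Away from 1 the cubic term dominates everything; for L in [1/2, 2] put L =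
    exp x, with |x| <= 1 and |x| <= 2 |L - 1|. *)
Lemma powR_taylor th : 0 < th -> th < 1 -> exists2 C : R, 0 < C & forall L, 0 <= L ->
  `|L `^ th - 1 - th * (L - 1) + th * (1 - th) / 2 * (L - 1) ^+ 2|
    <= C * `|L - 1| ^+ 3.
Proof.
move=> th0 th1; set e1 := expR 1 : R.
have e11 : 1 <= e1 by rewrite /e1 -[leLHS]expR0 ler_expR.
(* The Taylor errors give 2 e1 + e1 (1 + e1) times |x|^3 <= 8 |L - 1|^3. The summand 24 serves the
   outer ranges: below 1/2 the left side is at most 3 while |L - 1|^3 >= 1/8. *)
exists (8 * (2 * e1 + e1 * (1 + e1)) + 24); first by nra.
move=> L L0.
have kap : 0 <= th * (1 - th) / 2 <= 1 by apply/andP; split; nra.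
have [Ls|Ls] := ltP L (2^-1).
  have p0 : 0 <= L `^ th <= 1.
    rewrite powR_ge0/=; have -> : 1 = 1 `^ th :> R by rewrite powR1.
    by apply: ge0_ler_powR; rewrite ?nnegrE//; lra.
  have D1 : `|L - 1| ^+ 3 >= 1/8.
    have : 1/2 <= `|L - 1| by rewrite ltr0_norm; lra.
    by move=> h; have := exprn_ge0 2 (normr_ge0 (L - 1)); nra.
  apply: (@le_trans _ _ 3); last by nra.
  rewrite ler_norml; apply/andP; split; nra.
have L0' : 0 < L by lra.
have pE : L `^ th = expR (th * ln L) by rewrite /powR gt_eqF.
have [Lb|Lb] := ltP 2 L.
  have p0 : 1 <= L `^ th <= L.
    rewrite pE -[X in X <= _ <= _]expR0 -[X in _ <= _ <= X](@lnK _ L) ?posrE//.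
    rewrite !ler_expR; have : 0 <= ln L by rewrite ln_ge0//; lra.
    by move=> h; apply/andP; split; nra.
  rewrite (@ger0_norm _ (L - 1)); last by lra.
  apply: (@le_trans _ _ (24 * (L - 1) ^+ 3)); last first.
    by rewrite ler_wpM2r ?exprn_ge0; nra.
  have : 1 <= L - 1 by lra.
  set D := L - 1; move=> D1; have LE : L = D + 1 by rewrite /D; ring.
  have D3 : D ^+ 2 <= D ^+ 3 by nra.
  have D2 : D <= D ^+ 2 by nra.
  rewrite ler_norml; apply/andP; split; nra.
set x := ln L; set D := L - 1.
have LE : L = expR x by rewrite /x lnK.
have x1 : `|x| <= 2 * `|D|.
  have hx : x <= D.
    have := @le_ln1Dx R D; rewrite /D addrCA subrr addr0; apply; lra.
  have hx' : - x <= 2 * `|D|.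
    rewrite /x -lnV ?posrE//.
    have := @le_ln1Dx R (L^-1 - 1); rewrite addrCA subrr addr0.
    have Li : L^-1 <= 2 by rewrite -[leRHS]invrK lef_pV2 ?posrE ?invr_gt0; lra.
    have Li0 : 0 < L^-1 by rewrite invr_gt0.
    move=> h; apply: (le_trans (h _)); first by lra.
    have -> : L^-1 - 1 = - D * L^-1 by rewrite /D; field; lra.
    have := ler_norm (- D); rewrite normrN => h2; have := normr_ge0 D; nra.
  rewrite ler_norml lerNl hx'/= (le_trans hx)//.
  have := ler_norm D; have := normr_ge0 D; lra.
have x2 : `|x| <= 1.
  have hx : x <= 1.
    have := @le_ln1Dx R D; rewrite /D addrCA subrr addr0 /x => h.
    apply: (le_trans (h _)); lra.
  rewrite ler_norml hx andbT lerNl /x -lnV ?posrE//.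
  have Li : L^-1 <= 2 by rewrite -[leRHS]invrK lef_pV2 ?posrE ?invr_gt0; lra.
  have Li0 : 0 < L^-1 by rewrite invr_gt0.
  have := @le_ln1Dx R (L^-1 - 1); rewrite addrCA subrr addr0 => h.
  apply: (le_trans (h _)); lra.
have ex y : `|y| <= 1 -> expR `|y| <= e1 by move=> ?; rewrite ler_expR.
have thx : `|th * x| <= `|x|.
  by rewrite normrM gtr0_norm// ler_piMl// ltW.
have t3 : `|expR (th * x) - 1 - th * x - (th * x) ^+ 2 / 2| <= e1 * `|x| ^+ 3.
  apply: (le_trans (expR_taylor3 _)); rewrite mulrC ler_pM ?expR_ge0 ?exprn_ge0//.
    by apply: ex; exact: le_trans x2.
  by rewrite ler_pXn2r ?nnegrE.
have s3 : `|expR x - 1 - x - x ^+ 2 / 2| <= e1 * `|x| ^+ 3.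
  apply: (le_trans (expR_taylor3 _)); rewrite mulrC ler_pM ?expR_ge0 ?exprn_ge0//.
  exact: ex.
have s2 : `|expR x - 1 - x| <= e1 * `|x| ^+ 2.
  apply: (le_trans (expR_taylor2 _)); rewrite mulrC -[x ^+ 2]real_normK ?num_real//.
  by rewrite ler_wpM2r ?exprn_ge0// ex.
have s1 : `|expR x - 1| <= e1 * `|x|.
  apply: (le_trans (expR_taylor1 _)); rewrite mulrC ler_wpM2r// ex//.
have DE : D = expR x - 1 by rewrite /D LE.
have sq : `|D ^+ 2 - x ^+ 2| <= e1 * (1 + e1) * `|x| ^+ 3.
  have -> : D ^+ 2 - x ^+ 2 = (expR x - 1 - x) * (D + x) by rewrite DE; ring.
  rewrite normrM.
  have : `|D + x| <= (1 + e1) * `|x|.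
    by rewrite (le_trans (ler_normD _ _))// DE mulrDl mul1r addrC lerD2l.
  move=> h; have := ler_pM (normr_ge0 _) (normr_ge0 _) s2 h.
  by move/le_trans; apply; rewrite le_eqVlt; apply/orP; left; apply/eqP; ring.
have bound : `|L `^ th - 1 - th * D + th * (1 - th) / 2 * D ^+ 2| <=
    (2 * e1 + e1 * (1 + e1)) * `|x| ^+ 3.
  have -> : L `^ th - 1 - th * D + th * (1 - th) / 2 * D ^+ 2 =
    (expR (th * x) - 1 - th * x - (th * x) ^+ 2 / 2) +
    (- th * (expR x - 1 - x - x ^+ 2 / 2) +
     th * (1 - th) / 2 * (D ^+ 2 - x ^+ 2)).
    by rewrite pE -/x DE; field.
  have h1 : `|- th * (expR x - 1 - x - x ^+ 2 / 2)| <= e1 * `|x| ^+ 3.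
    by rewrite normrM normrN (gtr0_norm th0) (le_trans _ s3)// ler_piMl// ltW.
  have h2 : `|th * (1 - th) / 2 * (D ^+ 2 - x ^+ 2)| <= e1 * (1 + e1) * `|x| ^+ 3.
    case/andP: kap => k0 k1; rewrite normrM (ger0_norm k0) (le_trans _ sq)//.
    by rewrite ler_piMl.
  apply: (le_trans (ler_normD _ _)); apply: (le_trans (lerD t3 (ler_normD _ _))).
  move: h1 h2; set y := `|x| ^+ 3; lra.
apply: (le_trans bound); rewrite -/D.
have : `|x| ^+ 3 <= (2 * `|D|) ^+ 3 by rewrite ler_pXn2r ?nnegrE ?mulr_ge0.
rewrite exprMn => h.
have -> : (8 * (2 * e1 + e1 * (1 + e1)) + 24) * `|D| ^+ 3 =
  (2 * e1 + e1 * (1 + e1)) * (2 ^+ 3 * `|D| ^+ 3) + 24 * `|D| ^+ 3 by ring.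
rewrite -[leLHS]addr0 lerD// ?mulr_ge0 ?exprn_ge0// ler_wpM2l//; nra.
Qed.

End real_estimates.

(** * Gaussian channels *)

Section bounded.
Context d (T : measurableType d) (R : realType).
Implicit Types (f g : T -> R).

Definition bd f := dm (fun=> 0) f.

Lemma bdP f : bd f -> exists2 B, 0 <= B & forall x, `|f x| <= B.
Proof.
move=> [mf [C [C0 fC]]]; exists (expR (C * (1 + 0))); first exact: expR_ge0.
by move=> x; rewrite (le_trans (fC x))// normr0.
Qed.

Lemma bdI f B : measurable_fun setT f -> (forall x, `|f x| <= B) -> bd f.
Proof. exact: dm_bounded. Qed.

Lemma bd_dm G f : bd f -> dm G f.
Proof. by move=> bf; have [B B0 fB] := bdP bf; apply: dm_bounded fB; case: bf. Qed.

Lemma bd_exp f : bd f -> bd (fun x => expR (f x)).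
Proof.
move=> bf; have [B B0 fB] := bdP bf; apply: (@bdI _ (expR B)).
  by apply: measurableT_comp => //; case: bf.
move=> x; rewrite ger0_norm ?expR_ge0// ler_expR.
by rewrite (le_trans (ler_norm _)).
Qed.

End bounded.

Lemma bd_comp d d' (T : measurableType d) (T' : measurableType d') (R : realType)
    (f' : T' -> R) (phi : T -> T') :
  measurable_fun setT phi -> bd f' -> bd (fun x => f' (phi x)).
Proof.
move=> mphi bf; have [B B0 fB] := bdP bf.
apply: (bdI (B := B)) => //; apply: measurableT_comp => //.
by case: bf.
Qed.

(** * Replicas: i.i.d. samples of a prior *)

Section replicas.
Context d (Z : measurableType d) (R : realType) (pi : probability Z R).

Lemma bd_iidS n (F : n.+1.-tuple Z -> R) : bd F ->
  \int[iid pi n.+1]_t F t = \int[pi]_z \int[iid pi n]_t F [tuple of z :: t].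
Proof. by move=> bF; apply: (int_iidS (gauge0 pi)); exact: bd_dm. Qed.

Lemma bd_cons n (F : n.+1.-tuple Z -> R) z : bd F ->
  bd (fun t : n.-tuple Z => F [tuple of z :: t]).
Proof.
move=> bF; apply: (bd_comp (phi := fun t : n.-tuple Z => [tuple of z :: t])) => //.
exact: measurable_cons.
Qed.

Lemma bd_tnth2 n (f : Z -> Z -> R) (i j : 'I_n) : bd (fun p => f p.1 p.2) ->
  bd (fun t => f (tnth t i) (tnth t j)).
Proof.
move=> bf; apply: (bd_comp (phi := fun t : n.-tuple Z => (tnth t i, tnth t j)) _ bf).
by apply: measurable_fun_pair; exact: measurable_tnth.
Qed.

Lemma bd_tnth n (f : Z -> R) (i : 'I_n) : bd f -> bd (fun t => f (tnth t i)).
Proof. by move=> bf; apply: (bd_comp _ bf); exact: measurable_tnth. Qed.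

Lemma int_iid2 (f : Z -> Z -> R) : bd (fun p => f p.1 p.2) ->
  \int[iid pi 2]_t f (tnth t ord0) (tnth t (lift ord0 ord0)) =
  \int[pi]_x \int[pi]_y f x y.
Proof.
move=> bf; have bF := bd_tnth2 (ord0 : 'I_2) (lift ord0 ord0) bf.
rewrite bd_iidS//; apply: eq_int => x.
rewrite bd_iidS; last exact: (bd_cons x bF).
apply: eq_int => y; rewrite -[RHS](@int_cst _ _ _ (iid pi 0)).
by apply: eq_int => t; rewrite !tnthS.
Qed.

Lemma int_pair_marg n (f : Z -> Z -> R) (i j : 'I_n) : i != j ->
  bd (fun p => f p.1 p.2) ->
  \int[iid pi n]_t f (tnth t i) (tnth t j) = \int[pi]_x \int[pi]_y f x y.
Proof.
move=> ij bf; rewrite -int_iid2//.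
pose sg (k : 'I_2) := if k == ord0 then i else j.
have sgI : injective sg.
  move=> k k'; rewrite /sg; case: k k' => [[|[|//]] ?] [[|[|//]] ?];
  rewrite -!val_eqE/= => E; apply/val_inj => //=; move: ij; by rewrite E eqxx.
have bF := bd_tnth2 (ord0 : 'I_2) (lift ord0 ord0) bf.
rewrite -(int_iid_sub (P := pi) sgI).
- by apply: eq_int => t; rewrite !tnth_mktuple.
- by case: bF.
- apply: (dm_integrable (gauge0 _)).
  by apply: (bd_comp _ bF); exact: measurable_subt.
Qed.

Lemma int_iid4 (F : 4.-tuple Z -> R) : bd F -> \int[iid pi 4]_t F t =
  \int[pi]_x \int[pi]_y \int[pi]_z \int[pi]_u F [tuple x; y; z; u].
Proof.
move=> bF; rewrite bd_iidS//; apply: eq_int => x.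
have bF1 := bd_cons x bF; rewrite bd_iidS//; apply: eq_int => y.
have bF2 := bd_cons y bF1; rewrite bd_iidS//; apply: eq_int => z.
have bF3 := bd_cons z bF2; rewrite bd_iidS//; apply: eq_int => u.
rewrite -[RHS](@int_cst _ _ _ (iid pi 0)); apply: eq_int => t; congr F.
by apply/val_inj => /=; rewrite (tuple0 t).
Qed.

Definition indep n (j : 'I_n) (F : n.-tuple Z -> R) :=
  forall t t', (forall i, i != j -> tnth t i = tnth t' i) -> F t = F t'.

(** Coordinate j occurs only in k, so it can be inserted last and integrated first. *)
Lemma int_center n (k : Z -> Z -> R) (i j : 'I_n.+1) (F : n.+1.-tuple Z -> R) :
  bd (fun p => k p.1 p.2) -> (forall x, \int[pi]_y k x y = 0) ->
  i != j -> bd F -> indep j F ->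
  \int[iid pi n.+1]_t (k (tnth t i) (tnth t j) * F t) = 0.
Proof.
move=> bk k0 ij bF iF.
have bH : bd (fun t => k (tnth t i) (tnth t j) * F t).
  by apply: dmM => //; exact: bd_tnth2.
have bHi := bd_comp (measurable_insertt j) bH.
have [j' ij'] : exists j', i = lift j j'.
  by case: (unliftP j i) => [j' ->|E]; [exists j'|rewrite E eqxx in ij].
have gp := gauge_prod (gauge0 pi) (gauge0 (iid pi n)).
rewrite -(int_iid_insert (i := j)); last 2 first.
- by case: bH.
- apply: (dm_integrable (gauge0 _)) => //.
rewrite (fubini2 (gauge0 pi) (gauge0 (iid pi n))); last exact: bd_dm.
rewrite -[RHS](@int_cst _ _ _ (iid pi n)); apply: eq_int => t.
transitivity (\int[pi]_z (k (tnth t j') z * F (insertt j (point, t)))).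
  apply: eq_int => z; rewrite ij' tnth_insertt_lift tnth_insertt; congr (_ * _).
  apply: iF => i'; case: (unliftP j i') => [i'' ->|->]; last by rewrite eqxx.
  by rewrite !tnth_insertt_lift.
rewrite (intZr (gauge0 pi)) ?k0 ?mul0r//.
exact: (bd_comp (pair1_measurable _) bk).
Qed.

End replicas.

Section channel.
Context d (Z : measurableType d) (R : realType) (pi : probability Z R).
Variables (m : nat) (a : 'I_m -> Z -> R) (A : R).
Hypotheses (ma : forall k, measurable_fun setT (a k))
  (aA : forall k z, `|a k z| <= A).

Local Notation gam := (iid (std_normal R) m).
Let gg : gauge gam (@l1norm R m) := gauge_l1norm R m.

(* The observation is a z + g with z distributed as pi and g standard Gaussian;
   [amp g z] is its likelihood ratio given z and [lik g] the unconditional one. *)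
Definition ker x y : R := \sum_(k < m) a k x * a k y.

Lemma kerC x y : ker x y = ker y x.
Proof. by apply: eq_bigr => k _; rewrite mulrC. Qed.

Lemma bd_a k : bd (a k). Proof. exact: bdI. Qed.

Lemma bd_ker : bd (fun p => ker p.1 p.2).
Proof.
apply: dm_sum => k; apply: dmM.
- exact: (bd_comp measurable_fst (bd_a k)).
- exact: (bd_comp measurable_snd (bd_a k)).
Qed.

Definition amp (g : m.-tuple R) (z : Z) : R := expR (gexp (a^~ z) g).

Lemma lin_gexpa : lin (prodG (@l1norm R m) (fun _ : Z => 0))
  (fun p => gexp (a^~ p.2) p.1).
Proof.
apply: lin_sum => k; apply: linB.
  apply: (linM (B := A)); last by move=> p; exact: aA.
    exact: (lin_fst gg (gauge0 pi) (lin_tnth (@gauge_gam R) k (lin_absg R))).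
  exact: measurableT_comp.
have m2 : measurable_fun setT
    (fun p : m.-tuple R * Z => a k p.2 ^+ 2 / 2).
  apply: measurable_funM => //; apply: measurable_funX.
  exact: measurableT_comp.
apply: (lin_bounded _ m2 (_ : forall x, _ <= A ^+ 2 / 2)).
move=> p; rewrite normrM normrX [`|2^-1|]ger0_norm// ler_wpM2r//.
by rewrite ler_pXn2r ?nnegrE// (le_trans _ (aA k p.2)).
Qed.

Lemma dm_amp : dm (prodG (@l1norm R m) (fun _ : Z => 0)) (fun p => amp p.1 p.2).
Proof. exact: dm_exp lin_gexpa. Qed.

Lemma dm_amp_comp d' (S : measurableType d') (phi : S -> Z) :
  measurable_fun setT phi ->
  dm (prodG (@l1norm R m) (fun _ : S => 0)) (fun p => amp p.1 (phi p.2)).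
Proof.
move=> mphi; apply: (dm_comp (B := 1) (phi := fun p => (p.1, phi p.2)) _ _ dm_amp).
  by apply: measurable_fun_pair => //; exact: measurableT_comp.
by move=> p; rewrite /prodG/= mul1r lerDr.
Qed.

Lemma bd_amp g : bd (amp g).
Proof. exact: (dm_sec1 gg (gauge0 pi) g dm_amp). Qed.

Definition lik g := \int[pi]_z amp g z.

Lemma dm_lik : dm (@l1norm R m) lik.
Proof. exact: (dm_int2 gg (gauge0 pi) dm_amp). Qed.

Lemma lik_gt0 g : 0 < lik g.
Proof.
have [_ [C [C0 aC]]] := lin_gexpa.
apply: (@lt_le_trans _ _ (expR (- (C * (1 + l1norm g))))); first exact: expR_gt0.
rewrite -[leLHS](int_cst pi); apply: (int_le (gauge0 pi)).
- exact: dm_cst.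
- exact: bd_amp.
- move=> z; rewrite ler_expR; have := aC (g, z); rewrite /prodG/= addr0.
  by rewrite (ger0_norm (l1norm_ge0 g)) ler_norml => /andP[].
Qed.

Lemma lin_lnlik : lin (@l1norm R m) (fun g => ln (lik g)).
Proof.
have [_ [C [C0 aC]]] := lin_gexpa.
have aC' g z : `|gexp (a^~ z) g| <= C * (1 + `|l1norm g|).
  by have := aC (g, z); rewrite /prodG/= addr0.
have ml : measurable_fun setT (fun g => ln (lik g)).
  by apply: measurableT_comp => //; case: dm_lik.
split=> //; exists C; split=> // g.
rewrite ler_norml -[X in X <= _ <= _]expRK -[X in _ <= _ <= X]expRK.
rewrite !ler_ln ?posrE ?lik_gt0 ?expR_gt0//; apply/andP; split.
- rewrite -[leLHS](int_cst pi); apply: (int_le (gauge0 pi)).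
  + exact: dm_cst.
  + exact: bd_amp.
  + by move=> z; rewrite ler_expR; have := aC' g z; rewrite ler_norml => /andP[].
- rewrite -[leRHS](int_cst pi); apply: (int_le (gauge0 pi)).
  + exact: bd_amp.
  + exact: dm_cst.
  + by move=> z; rewrite ler_expR; have := aC' g z; rewrite ler_norml => /andP[].
Qed.

Lemma dm_invlik : dm (@l1norm R m) (fun g => (lik g)^-1).
Proof.
rewrite (_ : (fun _ => _) = fun g => expR (- ln (lik g))).
  by apply: dm_exp; apply: linN; exact: lin_lnlik.
by apply/funext => g; rewrite expRN lnK// posrE lik_gt0.
Qed.

(** The kernel summed over the pairs of entries: the exponent of the joint moment of the
    amplitudes. *)
Fixpoint psum (zs : seq Z) : R :=
  if zs is z :: zs' then \sum_(y <- zs') ker z y + psum zs' else 0.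

(** Completing the square: the squares of the individual signals belong to the exponent of the
    summed signal, and the cross terms are left over as [psum]. *)
Lemma gexp_seq (zs : seq Z) g : \sum_(z <- zs) gexp (a^~ z) g =
  gexp (fun k => \sum_(z <- zs) a k z) g + psum zs.
Proof.
elim: zs => [|z zs IH].
  rewrite big_nil /gexp big1 ?addr0//= => k _.
  by rewrite big_nil mulr0 expr0n/= mul0r subr0.
rewrite big_cons IH /= addrA addrA; congr (_ + _).
rewrite /ker exchange_big/= /gexp -!big_split/=; apply: eq_bigr => k _.
by rewrite big_cons -mulr_sumr; field.
Qed.

Lemma int_expgexp (b : 'I_m -> R) : \int[gam]_g expR (gexp b g) = 1.
Proof.
have := int_shift b (dm_cst (@l1norm R m) 1); rewrite int_cst => ->.
by apply: eq_int => g; rewrite mul1r.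
Qed.

Lemma int_amps (zs : seq Z) :
  \int[gam]_g (\prod_(z <- zs) amp g z) = expR (psum zs).
Proof.
transitivity (\int[gam]_g (expR (psum zs) *
    expR (gexp (fun k => \sum_(z <- zs) a k z) g))).
  by apply: eq_int => g; rewrite -expR_sum gexp_seq expRD mulrC.
rewrite (intZ gg) ?int_expgexp ?mulr1//.
by apply: dm_exp; exact: lin_gexp.
Qed.

Section moments.
Variable w : Z -> Z -> R.
Hypothesis bw : bd (fun p => w p.1 p.2).

(** The numerator of the posterior average of w over two replicas; the denominator is the square of
    [lik]. *)
Definition pair_weight (g : m.-tuple R) := \int[pi]_x \int[pi]_y (w x y * (amp g x * amp g y)).

Lemma bd_wamp g : bd (fun p => w p.1 p.2 * (amp g p.1 * amp g p.2)).
Proof.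
apply: dmM => //; apply: dmM.
- exact: (bd_comp measurable_fst (bd_amp g)).
- exact: (bd_comp measurable_snd (bd_amp g)).
Qed.

Definition o0 : 'I_4 := @Ordinal 4 0 isT.
Definition o1 : 'I_4 := @Ordinal 4 1 isT.
Definition o2 : 'I_4 := @Ordinal 4 2 isT.
Definition o3 : 'I_4 := @Ordinal 4 3 isT.

Definition opt (b : bool) (x : R) := if b then x else 1.

(* Two weighted replicas, followed by zero, one or two free ones: the moments of
   order 0, 1 and 2 of [lik] against [pair_weight] are integrals over 4 replicas. *)
Definition wamps b2 b3 g (t : 4.-tuple Z) :=
  w (tnth t o0) (tnth t o1) * (amp g (tnth t o0) * amp g (tnth t o1)) *
  (opt b2 (amp g (tnth t o2)) * opt b3 (amp g (tnth t o3))).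

Lemma bd_wamps b2 b3 g : bd (wamps b2 b3 g).
Proof.
rewrite /bd /wamps; apply: dmM.
  exact: (bd_tnth2 (f := fun x y => w x y * (amp g x * amp g y)) o0 o1 (bd_wamp g)).
by apply: dmM; [case: b2|case: b3]; rewrite /opt; by [exact: dm_cst|
  exact: (bd_tnth _ (bd_amp g))].
Qed.

Lemma wavE b2 b3 g : \int[iid pi 4]_t wamps b2 b3 g t =
  pair_weight g * (opt b2 (lik g) * opt b3 (lik g)).
Proof.
rewrite int_iid4; last exact: bd_wamps.
have go b : \int[pi]_z opt b (amp g z) = opt b (lik g).
  by case: b => //=; rewrite int_cst.
have bo b : bd (fun z => opt b (amp g z)).
  by case: b; [exact: bd_amp|exact: dm_cst].
have b1 x : bd (fun y => w x y * (amp g x * amp g y)).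
  exact: (bd_comp (pair1_measurable x) (bd_wamp g)).
rewrite -(intZr (gauge0 pi)); last first.
  exact: (dm_int2 (gauge0 pi) (gauge0 pi) (bd_dm _ (bd_wamp g))).
apply: eq_int => x.
transitivity (\int[pi]_y (w x y * (amp g x * amp g y) *
    (opt b2 (lik g) * opt b3 (lik g)))); last by rewrite (intZr (gauge0 pi) _ (b1 x)).
apply: eq_int => y; set W := w x y * _.
transitivity (\int[pi]_z (W * (opt b2 (amp g z) * opt b3 (lik g)))); last first.
  rewrite (intZ (gauge0 pi)) ?(intZr (gauge0 pi) _ (bo b2)) ?go//.
  by apply: dmM; [exact: bo|exact: dm_cst].
apply: eq_int => z; rewrite -[in RHS](go b3) -(intZ (gauge0 pi) _ (bo b3)).
rewrite -(intZ (gauge0 pi))//.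
by apply: dmM; [exact: dm_cst|exact: bo].
Qed.

Definition opt_seq (b : bool) (z : Z) := if b then [:: z] else [::].

Lemma int_wav b2 b3 :
  \int[gam]_g (pair_weight g * (opt b2 (lik g) * opt b3 (lik g))) =
  \int[iid pi 4]_t (w (tnth t o0) (tnth t o1) *
    expR (psum ([:: tnth t o0; tnth t o1] ++ opt_seq b2 (tnth t o2) ++ opt_seq b3 (tnth t o3)))).
Proof.
have gi := gauge0 (iid pi 4).
have damp (i : 'I_4) : dm (prodG (@l1norm R m) (fun _ : 4.-tuple Z => 0))
    (fun p => amp p.1 (tnth p.2 i)).
  exact: (dm_amp_comp (phi := fun t => tnth t i) (measurable_tnth i)).
have dopt b i : dm (prodG (@l1norm R m) (fun _ : 4.-tuple Z => 0))
    (fun p => opt b (amp p.1 (tnth p.2 i))).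
  by case: b; [exact: damp|exact: dm_cst].
have dF : dm (prodG (@l1norm R m) (fun _ : 4.-tuple Z => 0))
    (fun p => wamps b2 b3 p.1 p.2).
  apply: dmM; last exact: dmM.
  apply: dmM; last exact: dmM.
  apply: bd_dm; exact: (bd_comp measurable_snd (bd_tnth2 o0 o1 bw)).
transitivity (\int[gam]_g \int[iid pi 4]_t wamps b2 b3 g t).
  by apply: eq_int => g; rewrite wavE.
rewrite (fubini_swap gg gi dF); apply: eq_int => t.
rewrite -int_amps -(intZ gg); last first.
  by apply: dm_prod => z; exact: (dm_sec2 gg (gauge0 pi) z dm_amp).
apply: eq_int => g; rewrite /wamps -mulrA; congr (_ * _).
rewrite !big_cons big_cat/= /opt /opt_seq; clear dF.
by case: b2; case: b3; rewrite ?big_seq1 ?big_nil; ring.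
Qed.

Lemma dm_wav : dm (@l1norm R m) pair_weight.
Proof.
have gi := gauge0 (iid pi 4).
have damp (i : 'I_4) : dm (prodG (@l1norm R m) (fun _ : 4.-tuple Z => 0))
    (fun p => amp p.1 (tnth p.2 i)).
  exact: (dm_amp_comp (phi := fun t => tnth t i) (measurable_tnth i)).
have dF : dm (prodG (@l1norm R m) (fun _ : 4.-tuple Z => 0))
    (fun p => wamps false false p.1 p.2).
  apply: dmM; last exact: (dm_cst _ (1 * 1)).
  apply: dmM; last exact: dmM.
  apply: bd_dm; exact: (bd_comp measurable_snd (bd_tnth2 o0 o1 bw)).
have := dm_int2 gg gi dF; congr (dm _ _); apply/funext => g.
by rewrite wavE /opt !mulr1.
Qed.

End moments.

End channel.

(** * Second-order expansion of a channel *)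

Section channel_expansion.
Context d (Z : measurableType d) (R : realType) (pi : probability Z R).
Variables (m : nat) (a : 'I_m -> Z -> R) (A B : R).
Hypotheses (ma : forall k, measurable_fun setT (a k))
  (aA : forall k z, `|a k z| <= A) (kB : forall x y, `|ker a x y| <= B).

Local Notation gam := (iid (std_normal R) m).
Local Notation L := (lik pi a).
Let gg : gauge gam (@l1norm R m) := gauge_l1norm R m.
Let gi := gauge0 (iid pi 4).
Let dL : dm (@l1norm R m) L := dm_lik pi ma aA.
Let bk : bd (fun p => ker a p.1 p.2) := bd_ker ma aA.

Definition ker_at (i j : 'I_4) (t : 4.-tuple Z) := ker a (tnth t i) (tnth t j).

Lemma bd_qq i j : bd (ker_at i j).
Proof. exact: (bd_tnth2 (f := ker a)). Qed.

(** The six pairs of four replicas. It is a common error term for [s2], [s3] and [s4], the kernel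
    sums over the pairs of the first two, three and four replicas. *)
Definition sabs p (t : 4.-tuple Z) := `|ker_at o0 o1 t| ^+ p + `|ker_at o0 o2 t| ^+ p +
  `|ker_at o1 o2 t| ^+ p + `|ker_at o0 o3 t| ^+ p + `|ker_at o1 o3 t| ^+ p + `|ker_at o2 o3 t| ^+ p.

Definition s2 := ker_at o0 o1.
Definition s3 t := ker_at o0 o1 t + ker_at o0 o2 t + ker_at o1 o2 t.
Definition s4 t := ker_at o0 o1 t + ker_at o0 o2 t + ker_at o1 o2 t + ker_at o0 o3 t +
  ker_at o1 o3 t
  + ker_at o2 o3 t.

Lemma bd_sabs p : bd (sabs p).
Proof. by do !apply: dmD; apply: dmX; apply: dm_norm; exact: bd_qq. Qed.

Lemma bd_s3 : bd s3. Proof. by do !apply: dmD; exact: bd_qq. Qed.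

Lemma bd_s4 : bd s4. Proof. by do !apply: dmD; exact: bd_qq. Qed.

(** Six terms need three levels of pairwise grouping, each costing a factor c; squares have c = 2
    and cubes c = 4. *)
Lemma sum6_gen (f : R -> R) (c : R) (x1 x2 x3 x4 x5 x6 : R) : 1 <= c ->
  (forall x, 0 <= x -> 0 <= f x) ->
  (forall x y, 0 <= x -> 0 <= y -> f (x + y) <= c * (f x + f y)) ->
  0 <= x1 -> 0 <= x2 -> 0 <= x3 -> 0 <= x4 -> 0 <= x5 -> 0 <= x6 ->
  f (x1 + x2 + x3 + x4 + x5 + x6) <=
  c ^+ 3 * (f x1 + f x2 + f x3 + f x4 + f x5 + f x6).
Proof.
move=> c1 f0 h h1 h2 h3 h4 h5 h6.
have c0 : 0 <= c by rewrite (le_trans _ c1).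
have -> : x1 + x2 + x3 + x4 + x5 + x6 = (x1 + x2) + (x3 + x4) + (x5 + x6).
  by rewrite !addrA.
apply: (le_trans (h _ _ _ _)); rewrite ?addr_ge0//.
have -> : c ^+ 3 = c * c ^+ 2 by rewrite exprS.
rewrite -mulrA ler_wpM2l//.
have -> : f x1 + f x2 + f x3 + f x4 + f x5 + f x6 =
  (f x1 + f x2 + (f x3 + f x4)) + (f x5 + f x6) by rewrite !addrA.
rewrite mulrDr lerD//.
  apply: (le_trans (h _ _ _ _)); rewrite ?addr_ge0//.
  by rewrite expr2 -mulrA ler_wpM2l// mulrDr lerD// h.
apply: (le_trans (h _ _ h5 h6)); rewrite ler_wpM2r ?addr_ge0 ?f0//.
by rewrite expr2 ler_peMr.
Qed.

Lemma sum6_sqr (x1 x2 x3 x4 x5 x6 : R) : 0 <= x1 -> 0 <= x2 -> 0 <= x3 ->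
  0 <= x4 -> 0 <= x5 -> 0 <= x6 -> (x1 + x2 + x3 + x4 + x5 + x6) ^+ 2 <=
  8 * (x1 ^+ 2 + x2 ^+ 2 + x3 ^+ 2 + x4 ^+ 2 + x5 ^+ 2 + x6 ^+ 2).
Proof.
have -> : 8 = 2 ^+ 3 :> R by ring.
apply: (sum6_gen (f := fun x => x ^+ 2)) => [|x _|x y _ _]; first by lra.
  exact: sqr_ge0.
by have := sqr_ge0 (x - y); lra.
Qed.

Lemma sum6_cube (x1 x2 x3 x4 x5 x6 : R) : 0 <= x1 -> 0 <= x2 -> 0 <= x3 ->
  0 <= x4 -> 0 <= x5 -> 0 <= x6 -> (x1 + x2 + x3 + x4 + x5 + x6) ^+ 3 <=
  64 * (x1 ^+ 3 + x2 ^+ 3 + x3 ^+ 3 + x4 ^+ 3 + x5 ^+ 3 + x6 ^+ 3).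
Proof.
have -> : 64 = 4 ^+ 3 :> R by ring.
apply: (sum6_gen (f := fun x => x ^+ 3)) => [|x|x y x0 y0]; first by lra.
  exact: exprn_ge0.
have : 0 <= 3 * (x + y) * (x - y) ^+ 2.
  by rewrite mulr_ge0 ?sqr_ge0// mulr_ge0// addr_ge0.
lra.
Qed.

Definition exp6 : R := expR (6 * B).

Lemma exp6_ge0 : 0 <= exp6. Proof. exact: expR_ge0. Qed.

Lemma sabs1_le t : sabs 1 t <= 6 * B.
Proof.
rewrite /sabs !expr1.
have := kB (tnth t o0) (tnth t o1); have := kB (tnth t o0) (tnth t o2).
have := kB (tnth t o1) (tnth t o2); have := kB (tnth t o0) (tnth t o3).
have := kB (tnth t o1) (tnth t o3); have := kB (tnth t o2) (tnth t o3).
rewrite /ker_at; lra.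
Qed.

Lemma sabs_taylor2 (s : R) t : `|s| <= sabs 1 t ->
  `|expR s - 1 - s| <= 8 * exp6 * sabs 2 t.
Proof.
move=> sS; rewrite (le_trans (expR_taylor2 s))// -[s ^+ 2]real_normK ?num_real//.
have h1 : expR `|s| <= exp6 by rewrite ler_expR (le_trans sS)// sabs1_le.
have h2 : `|s| ^+ 2 <= 8 * sabs 2 t.
  apply: le_trans (sum6_sqr _ _ _ _ _ _) => //.
  by rewrite ler_pXn2r ?nnegrE// ?(le_trans _ sS)//; move: sS; rewrite /sabs !expr1.
have -> : 8 * exp6 * sabs 2 t = 8 * sabs 2 t * exp6 by ring.
by rewrite ler_pM ?exprn_ge0 ?expR_ge0.
Qed.

Lemma sabs_taylor3 (s : R) t : `|s| <= sabs 1 t ->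
  `|expR s - 1 - s - s ^+ 2 / 2| <= 64 * exp6 * sabs 3 t.
Proof.
move=> sS; rewrite (le_trans (expR_taylor3 s))//.
have h1 : expR `|s| <= exp6 by rewrite ler_expR (le_trans sS)// sabs1_le.
have h2 : `|s| ^+ 3 <= 64 * sabs 3 t.
  apply: le_trans (sum6_cube _ _ _ _ _ _) => //.
  by rewrite ler_pXn2r ?nnegrE// ?(le_trans _ sS)//; move: sS; rewrite /sabs !expr1.
have -> : 64 * exp6 * sabs 3 t = 64 * sabs 3 t * exp6 by ring.
by rewrite ler_pM ?exprn_ge0 ?expR_ge0.
Qed.

Lemma s2_sabs t : `|s2 t| <= sabs 1 t.
Proof.
rewrite /sabs !expr1 /s2; do !(rewrite -[leLHS]addr0; apply: lerD => //).
Qed.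

Lemma s3_sabs t : `|s3 t| <= sabs 1 t.
Proof.
rewrite /sabs !expr1 /s3.
have := ler_normD (ker_at o0 o1 t + ker_at o0 o2 t) (ker_at o1 o2 t).
have := ler_normD (ker_at o0 o1 t) (ker_at o0 o2 t).
have := normr_ge0 (ker_at o0 o3 t); have := normr_ge0 (ker_at o1 o3 t).
have := normr_ge0 (ker_at o2 o3 t); lra.
Qed.

Lemma s4_sabs t : `|s4 t| <= sabs 1 t.
Proof.
rewrite /sabs !expr1 /s4; do !(apply: (le_trans (ler_normD _ _)); apply: lerD => //).
Qed.

Lemma int_wav00 w : bd (fun p => w p.1 p.2) -> \int[gam]_g pair_weight pi a w g =
  \int[iid pi 4]_t (w (tnth t o0) (tnth t o1) * expR (s2 t)).
Proof.
move=> bw; have := int_wav pi ma aA bw false false.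
under eq_int do rewrite /opt/= !mulr1.
move=> ->; apply: eq_int => t; congr (_ * expR _).
by rewrite /= !big_cons !big_nil !addr0.
Qed.

Lemma int_wav10 w : bd (fun p => w p.1 p.2) -> \int[gam]_g (pair_weight pi a w g * L g) =
  \int[iid pi 4]_t (w (tnth t o0) (tnth t o1) * expR (s3 t)).
Proof.
move=> bw; have := int_wav pi ma aA bw true false.
under eq_int do rewrite /opt/= !mulr1.
move=> ->; apply: eq_int => t; congr (_ * expR _).
by rewrite /= !big_cons !big_nil !addr0 /s3 /ker_at.
Qed.

Lemma int_wav11 w : bd (fun p => w p.1 p.2) ->
  \int[gam]_g (pair_weight pi a w g * L g ^+ 2) =
  \int[iid pi 4]_t (w (tnth t o0) (tnth t o1) * expR (s4 t)).
Proof.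
move=> bw; have := int_wav pi ma aA bw true true.
under eq_int do rewrite /opt/= -expr2.
move=> ->; apply: eq_int => t; congr (_ * expR _).
by rewrite /= !big_cons !big_nil !addr0 /s4 /ker_at; ring.
Qed.

Lemma wav1 g : pair_weight pi a (fun _ _ => 1) g = L g ^+ 2.
Proof.
have bA := bd_amp pi ma aA g.
rewrite /pair_weight expr2 {1}/lik -(intZr (gauge0 pi))//; apply: eq_int => x.
rewrite /lik -(intZ (gauge0 pi))//; apply: eq_int => y.
by rewrite mul1r.
Qed.

Lemma int_lik1 : \int[gam]_g L g = 1.
Proof.
rewrite /lik (fubini_swap gg (gauge0 pi) (f := fun p => amp a p.1 p.2)).
  rewrite -[RHS](int_cst pi); apply: eq_int => z.
  exact: (int_expgexp (a^~ z)).
exact: (dm_amp pi ma aA).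
Qed.

Let bd1 : bd (fun p : Z * Z => (fun _ _ => 1 : R) p.1 p.2).
Proof. exact: dm_cst. Qed.

Lemma int_lik2 : \int[gam]_g L g ^+ 2 = \int[iid pi 4]_t expR (s2 t).
Proof.
have := int_wav00 bd1; under eq_int do rewrite wav1.
by move=> ->; apply: eq_int => t; rewrite mul1r.
Qed.

Lemma int_lik3 : \int[gam]_g L g ^+ 3 = \int[iid pi 4]_t expR (s3 t).
Proof.
have := int_wav10 bd1; under eq_int do rewrite wav1 -exprSr.
by move=> ->; apply: eq_int => t; rewrite mul1r.
Qed.

Lemma int_lik4 : \int[gam]_g L g ^+ 4 = \int[iid pi 4]_t expR (s4 t).
Proof.
have := int_wav11 bd1; under eq_int do rewrite wav1 -exprD.
by move=> ->; apply: eq_int => t; rewrite mul1r.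
Qed.

Lemma int_expB (s : 4.-tuple Z -> R) (P : 4.-tuple Z -> R) (C : R) (p : nat) :
  bd s -> bd P ->
  (forall t, `|expR (s t) - P t| <= C * sabs p t) ->
  `|\int[iid pi 4]_t expR (s t) - \int[iid pi 4]_t P t| <=
    C * \int[iid pi 4]_t sabs p t.
Proof.
move=> bs bP h; rewrite -(intB gi)//; last exact: bd_exp.
rewrite -(intZ gi); last exact: bd_sabs.
apply: (int_norm_le gi) => //; last by apply: dmZ; exact: bd_sabs.
by apply: dmB => //; exact: bd_exp.
Qed.

Section centered.
Hypothesis a0 : forall k, \int[pi]_z a k z = 0.

Lemma int_ker0 x : \int[pi]_y ker a x y = 0.
Proof.
rewrite /ker (int_sum (gauge0 pi)).
  apply: big1 => k _; rewrite (intZ (gauge0 pi)) ?a0 ?mulr0//.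
  exact: (bd_a ma aA).
by move=> k; apply: dmM; [exact: dm_cst|exact: (bd_a ma aA)].
Qed.

(* Jensen, using that the signal is centered. *)
Lemma lik_ge g : expR (- (B / 2)) <= L g.
Proof.
have bl : bd (fun z => \sum_(k < m) tnth g k * a k z).
  apply: dm_sum => k; apply: dmM; [exact: dm_cst|exact: (bd_a ma aA)].
have E : \int[pi]_z (expR (- (B / 2)) * (1 + \sum_(k < m) tnth g k * a k z)) =
    expR (- (B / 2)).
  rewrite (intZ (gauge0 pi)); last by apply: dmD; [exact: dm_cst|].
  rewrite (intD (gauge0 pi))//; last exact: dm_cst.
  rewrite int_cst (int_sum (gauge0 pi)).
    rewrite big1 ?addr0 ?mulr1// => k _.
    by rewrite (intZ (gauge0 pi)) ?a0 ?mulr0//; exact: (bd_a ma aA).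
  by move=> k; apply: dmM; [exact: dm_cst|exact: (bd_a ma aA)].
rewrite -E; apply: (int_le (gauge0 pi)).
- by apply: dmM; [exact: dm_cst|apply: dmD; [exact: dm_cst|]].
- exact: (bd_amp pi ma aA).
- move=> z; apply: (@le_trans _ _ (expR (- (B / 2)) *
      expR (\sum_(k < m) tnth g k * a k z))).
    by rewrite ler_wpM2l ?expR_ge0// expR_ge1Dx.
  rewrite -expRD /amp ler_expR.
  have -> : gexp (a^~ z) g = \sum_(k < m) tnth g k * a k z - ker a z z / 2.
    rewrite /gexp /ker mulr_suml -sumrB; apply: eq_bigr => k _.
    by rewrite expr2.
  have := le_trans (ler_norm _) (kB z z); lra.
Qed.

Lemma qqC i j t : ker_at i j t = ker_at j i t.
Proof. exact: kerC. Qed.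

Lemma qq_center (i j : 'I_4) (F : 4.-tuple Z -> R) : i != j -> bd F ->
  indep j F -> \int[iid pi 4]_t (ker_at i j t * F t) = 0.
Proof. exact: (int_center (k := ker a) bk int_ker0). Qed.

Section weight.
Variable w : Z -> Z -> R.
Hypothesis bw : bd (fun p => w p.1 p.2).

Let bw' : bd (fun p => `|w p.1 p.2|). Proof. exact: dm_norm. Qed.

Definition w01 (t : 4.-tuple Z) := w (tnth t o0) (tnth t o1).

Lemma bd_w01 : bd w01. Proof. exact: (bd_tnth2 (f := w)). Qed.

Lemma indep_w01 (j : 'I_4) : j != o0 -> j != o1 -> indep j w01.
Proof. by move=> j0 j1 t t' h; rewrite /w01 !h// eq_sym. Qed.

Lemma wq_center i j : i != j -> j != o0 -> j != o1 ->
  \int[iid pi 4]_t (ker_at i j t * w01 t) = 0.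
Proof.
by move=> ij j0 j1; apply: qq_center => //; [exact: bd_w01|exact: indep_w01].
Qed.

Lemma wav_norm_le g : `|pair_weight pi a w g| <= pair_weight pi a (fun x y => `|w x y|) g.
Proof.
have b1 := bd_wamp pi ma aA bw g; have b2 := bd_wamp pi ma aA (w := fun x y => `|w x y|) bw' g.
rewrite /pair_weight.
rewrite -(fubini1 (gauge0 pi) (gauge0 pi) (bd_dm _ b1)).
rewrite -(fubini1 (gauge0 pi) (gauge0 pi) (bd_dm _ b2)).
apply: (int_norm_le (gauge0 _)) => //.
by move=> p; rewrite normrM (@ger0_norm _ (amp _ _ _ * _))// mulr_ge0// expR_ge0.
Qed.

Let bwE s : bd s -> bd (fun t => w01 t * expR (s t)).
Proof. by move=> bs; apply: dmM; [exact: bd_w01|exact: bd_exp]. Qed.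

(** The first-order part of exp s3 - exp s2 consists of kernels between a weighted replica and the
    free replica 2. The signal being centered, these integrate to zero against w and may be
    subtracted, leaving second-order errors. *)
Lemma wav_lik1_le : `|\int[gam]_g (pair_weight pi a w g * (L g - 1))| <=
  16 * exp6 * \int[iid pi 4]_t (`|w01 t| * sabs 2 t).
Proof.
have dV := dm_wav pi ma aA bw.
have bS : bd (fun t => `|w01 t| * sabs 2 t).
  by apply: dmM; [apply: dm_norm; exact: bd_w01|exact: bd_sabs].
have -> : \int[gam]_g (pair_weight pi a w g * (L g - 1)) =
    \int[iid pi 4]_t (w01 t * (expR (s3 t) - expR (s2 t))).
  under eq_int do rewrite mulrBr mulr1.
  rewrite (intB gg)//; last exact: dmM.
  rewrite int_wav10// int_wav00// -(intB gi); last 2 first.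
  - exact: (bwE bd_s3).
  - exact: (bwE (bd_qq o0 o1)).
  by apply: eq_int => t; rewrite /w01 mulrBr.
have b1 : bd (fun t => ker_at o0 o2 t * w01 t) by apply: dmM; [exact: bd_qq|exact: bd_w01].
have b2 : bd (fun t => ker_at o1 o2 t * w01 t) by apply: dmM; [exact: bd_qq|exact: bd_w01].
have z0 : \int[iid pi 4]_t (ker_at o0 o2 t * w01 t + ker_at o1 o2 t * w01 t) = 0.
  by rewrite (intD gi)// !wq_center// addr0.
have bM : bd (fun t => w01 t * (expR (s3 t) - expR (s2 t))).
  apply: dmM; first exact: bd_w01.
  by apply: dmB; apply: bd_exp; [exact: bd_s3|exact: bd_qq].
rewrite -[X in `|X|]subr0 -z0 -(intB gi)//; last exact: dmD.
rewrite -(intZ gi)//; apply: (int_norm_le gi).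
- by apply: dmB => //; exact: dmD.
- by apply: dmZ.
move=> t.
have -> : w01 t * (expR (s3 t) - expR (s2 t)) - (ker_at o0 o2 t * w01 t + ker_at o1 o2 t * w01 t)
   = w01 t * ((expR (s3 t) - 1 - s3 t) - (expR (s2 t) - 1 - s2 t)).
  by rewrite /s3 /s2; ring.
rewrite normrM mulrCA ler_wpM2l// (le_trans (ler_normB _ _))//.
have := sabs_taylor2 (s3_sabs t); have := sabs_taylor2 (s2_sabs t); lra.
Qed.

(** The same cancellation for exp s4 - 2 exp s3 + exp s2: constants cancel, and every first-order
    kernel that survives has a free endpoint. *)
Lemma wav_lik2_le : \int[gam]_g (pair_weight pi a (fun x y => `|w x y|) g * (L g - 1) ^+ 2) <=
  32 * exp6 * \int[iid pi 4]_t (`|w01 t| * sabs 2 t).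
Proof.
have dV := dm_wav pi ma aA (w := fun x y => `|w x y|) bw'.
have bN : bd (fun t => `|w01 t|) by apply: dm_norm; exact: bd_w01.
have bS : bd (fun t => `|w01 t| * sabs 2 t) by apply: dmM => //; exact: bd_sabs.
have bE s : bd s -> bd (fun t => `|w01 t| * expR (s t)).
  by move=> bs; apply: dmM => //; exact: bd_exp.
have -> : \int[gam]_g (pair_weight pi a (fun x y => `|w x y|) g * (L g - 1) ^+ 2) =
    \int[iid pi 4]_t (`|w01 t| * (expR (s4 t) - 2 * expR (s3 t) + expR (s2 t))).
  transitivity (\int[gam]_g (pair_weight pi a (fun x y => `|w x y|) g * L g ^+ 2
     - 2 * (pair_weight pi a (fun x y => `|w x y|) g * L g)
     + pair_weight pi a (fun x y => `|w x y|) g)).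
    by apply: eq_int => g; ring.
  have d2 : dm (@l1norm R m) (fun g => pair_weight pi a (fun x y => `|w x y|) g * L g ^+ 2).
    by apply: dmM => //; exact: dmX.
  have d1 : dm (@l1norm R m) (fun g => pair_weight pi a (fun x y => `|w x y|) g * L g).
    exact: dmM.
  rewrite (intD gg)//; last by apply: dmB => //; exact: dmZ.
  rewrite (intB gg)//; last exact: dmZ.
  rewrite (intZ gg)// int_wav11// int_wav10// int_wav00//.
  rewrite -(intZ gi); last exact: (bE _ bd_s3).
  rewrite -(intB gi); last 2 first.
  - exact: (bE _ bd_s4).
  - by apply: dmZ; exact: (bE _ bd_s3).
  rewrite -(intD gi); last 2 first.
  - by apply: dmB; [exact: (bE _ bd_s4)|apply: dmZ; exact: (bE _ bd_s3)].
  - exact: (bE _ (bd_qq o0 o1)).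
  by apply: eq_int => t; rewrite /w01; ring.
pose wn x y := `|w x y|.
have cz i j : i != j -> j != o0 -> j != o1 ->
    \int[iid pi 4]_t (ker_at i j t * `|w01 t|) = 0.
  move=> ij j0 j1; apply: qq_center => // t t' h.
  by rewrite (indep_w01 j0 j1 h).
have bq i j : bd (fun t => ker_at i j t * `|w01 t|) by apply: dmM => //; exact: bd_qq.
have z0 : \int[iid pi 4]_t (ker_at o0 o3 t * `|w01 t| + ker_at o1 o3 t * `|w01 t| +
   ker_at o2 o3 t * `|w01 t| - ker_at o0 o2 t * `|w01 t| - ker_at o1 o2 t * `|w01 t|) = 0.
  rewrite !(intB gi, intD gi); do ?[exact: bq|apply: dmB|apply: dmD].
  by rewrite !cz//; ring.
have bZ : bd (fun t => ker_at o0 o3 t * `|w01 t| + ker_at o1 o3 t * `|w01 t| +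
   ker_at o2 o3 t * `|w01 t| - ker_at o0 o2 t * `|w01 t| - ker_at o1 o2 t * `|w01 t|).
  by do ?[exact: bq|apply: dmB|apply: dmD].
have bM : bd (fun t => `|w01 t| * (expR (s4 t) - 2 * expR (s3 t) + expR (s2 t))).
  apply: dmM => //; apply: dmD; last by apply: bd_exp; exact: bd_qq.
  apply: dmB; first by apply: bd_exp; exact: bd_s4.
  by apply: dmZ; apply: bd_exp; exact: bd_s3.
rewrite -[leLHS]subr0 -z0 -(intB gi)//.
rewrite -(intZ gi)//; apply: (int_le gi).
- exact: dmB.
- exact: dmZ.
move=> t.
have -> : `|w01 t| * (expR (s4 t) - 2 * expR (s3 t) + expR (s2 t)) -
  (ker_at o0 o3 t * `|w01 t| + ker_at o1 o3 t * `|w01 t| +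
   ker_at o2 o3 t * `|w01 t| - ker_at o0 o2 t * `|w01 t| - ker_at o1 o2 t * `|w01 t|)
   = `|w01 t| * ((expR (s4 t) - 1 - s4 t) - 2 * (expR (s3 t) - 1 - s3 t) +
      (expR (s2 t) - 1 - s2 t)).
  by rewrite /s4 /s3 /s2; ring.
rewrite mulrCA ler_wpM2l//.
have := sabs_taylor2 (s4_sabs t); have := sabs_taylor2 (s3_sabs t).
have := sabs_taylor2 (s2_sabs t); rewrite !ler_norml.
by move=> /andP[? ?] /andP[? ?] /andP[? ?]; lra.
Qed.

(** The constant of [wav_lik1_le], plus that of [wav_lik2_le] times the upper bound exp (B / 2) on 1
    / L. *)
Definition posterior_err : R := 16 * exp6 + expR (B / 2) * (32 * exp6).

(** 1 / L = 1 - (L - 1) + (L - 1)^2 / L. The first term is an exact replica integral, the second is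
    small by centering, and in the last one L is bounded below by [lik_ge]. *)
Lemma posterior_expansion :
  `|\int[gam]_g (pair_weight pi a w g / L g) - \int[iid pi 4]_t (w01 t * expR (s2 t))| <=
  posterior_err * \int[iid pi 4]_t (`|w01 t| * sabs 2 t).
Proof.
have dV := dm_wav pi ma aA bw; have dVn := dm_wav pi ma aA (w := fun x y => `|w x y|) bw'.
have dI := dm_invlik pi ma aA.
have dL1 : dm (@l1norm R m) (fun g => L g - 1) by apply: dmB => //; exact: dm_cst.
have dr : dm (@l1norm R m) (fun g => pair_weight pi a w g * ((L g - 1) ^+ 2 / L g)).
  by apply: dmM => //; apply: dmM => //; exact: dmX.
have d1 : dm (@l1norm R m) (fun g => pair_weight pi a w g * (L g - 1)) by exact: dmM.
have dn : dm (@l1norm R m) (fun g => pair_weight pi a (fun x y => `|w x y|) g * (L g - 1) ^+ 2).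
  by apply: dmM => //; exact: dmX.
have dq : dm (@l1norm R m) (fun g => pair_weight pi a w g / L g) by exact: dmM.
rewrite -(int_wav00 bw) -(intB gg dq dV).
have -> : \int[gam]_g (pair_weight pi a w g / L g - pair_weight pi a w g) =
  \int[gam]_g (pair_weight pi a w g * ((L g - 1) ^+ 2 / L g) - pair_weight pi a w g * (L g - 1)).
  by apply: eq_int => g; have := lik_gt0 pi ma aA g => L0; field; rewrite gt_eqF.
rewrite (intB gg)// (le_trans (ler_normB _ _))// /posterior_err mulrDl addrC lerD//.
  exact: wav_lik1_le.
rewrite -mulrA; apply: (@le_trans _ _ (expR (B / 2) *
  \int[gam]_g (pair_weight pi a (fun x y => `|w x y|) g * (L g - 1) ^+ 2))); last first.
  by rewrite ler_wpM2l ?expR_ge0// wav_lik2_le.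
rewrite -(intZ gg)//; apply: (int_norm_le gg) => //; first exact: dmZ.
move=> g; rewrite normrM mulrCA ler_pM//; first exact: wav_norm_le.
have L0 := lik_gt0 pi ma aA g.
rewrite normrM ger0_norm ?sqr_ge0// mulrC ler_wpM2r ?sqr_ge0//.
rewrite gtr0_norm ?invr_gt0// -[leRHS]invrK -expRN lef_pV2 ?posrE ?expR_gt0//.
exact: lik_ge.
Qed.

End weight.

Definition qp (e : ('I_4 * 'I_4) * ('I_4 * 'I_4)) t :=
  ker_at e.1.1 e.1.2 t * ker_at e.2.1 e.2.2 t.

Lemma bd_qp e : bd (qp e).
Proof. by apply: dmM; exact: bd_qq. Qed.

Lemma int_qp0 i j i' j' : i != j -> j != i' -> j != j' ->
  \int[iid pi 4]_t qp ((i, j), (i', j')) t = 0.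
Proof.
move=> ij ji jj; apply: qq_center => //; first exact: bd_qq.
by move=> t t' h; rewrite /ker_at !h// eq_sym.
Qed.

Lemma int_qq0 i j : i != j -> \int[iid pi 4]_t ker_at i j t = 0.
Proof.
move=> ij; have := @qq_center i j (fun=> 1) ij (dm_cst _ _).
under eq_int do rewrite mulr1.
by apply.
Qed.

Definition qsq := \int[iid pi 4]_t ker_at o0 o1 t ^+ 2.

Lemma int_qsq i j : i != j -> \int[iid pi 4]_t qp ((i, j), (i, j)) t = qsq.
Proof.
move=> ij; rewrite /qsq /qp /=.
have bk2 : bd (fun p => ker a p.1 p.2 ^+ 2) by exact: dmX.
under eq_int do rewrite -expr2.
by rewrite (int_pair_marg (f := fun x y => ker a x y ^+ 2) pi ij)//
  (int_pair_marg (f := fun x y => ker a x y ^+ 2) pi)//.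
Qed.

Lemma int_P2 : \int[iid pi 4]_t (1 + s2 t + s2 t ^+ 2 / 2) = 1 + qsq / 2.
Proof.
have b := bd_qq o0 o1.
rewrite (intD gi); last 2 first.
- by apply: dmD => //; exact: dm_cst.
- by apply: dmM; [exact: dmX|exact: dm_cst].
rewrite (intD gi)//; last exact: dm_cst.
by rewrite int_cst int_qq0// addr0 (intZr gi)//; exact: dmX.
Qed.

Lemma int_P3 : \int[iid pi 4]_t (1 + s3 t + s3 t ^+ 2 / 2) = 1 + 3 * qsq / 2.
Proof.
have b := bd_s3.
rewrite (intD gi); last 2 first.
- by apply: dmD => //; exact: dm_cst.
- by apply: dmM; [exact: dmX|exact: dm_cst].
rewrite (intD gi)//; last exact: dm_cst.
rewrite int_cst; have -> : \int[iid pi 4]_t s3 t = 0.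
  rewrite /s3 !(intD gi); try exact: bd_qq; last by apply: dmD; exact: bd_qq.
  by rewrite !int_qq0// !addr0.
rewrite addr0 (intZr gi); last exact: dmX.
congr (_ + _ / _).
(* [l1] holds the squares and [l2] the products of distinct kernels, written so that the second
   endpoint of the first factor is absent from the second factor, as [int_qp0] requires. *)
pose l1 := [:: ((o0, o1), (o0, o1)); ((o0, o2), (o0, o2)); ((o1, o2), (o1, o2))].
pose l2 := [:: ((o0, o1), (o0, o2)); ((o1, o2), (o0, o1)); ((o2, o0), (o1, o2))].
transitivity (\int[iid pi 4]_t (\sum_(e <- l1) qp e t + 2 * \sum_(e <- l2) qp e t)).
  apply: eq_int => t; rewrite /l1 /l2 !big_cons !big_nil /qp /= (qqC o2 o0) /s3.
  ring.
have d1 : bd (fun t => \sum_(e <- l1) qp e t) by apply: dm_sum => e; exact: bd_qp.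
have d2 : bd (fun t => \sum_(e <- l2) qp e t) by apply: dm_sum => e; exact: bd_qp.
rewrite (intD gi)//; last exact: dmZ.
rewrite (intZ gi)// !(int_sum gi); try (by move=> e; exact: bd_qp).
by rewrite /l1 /l2 !big_cons !big_nil !int_qsq// !int_qp0//; ring.
Qed.

Lemma int_P4 : \int[iid pi 4]_t (1 + s4 t + s4 t ^+ 2 / 2) = 1 + 6 * qsq / 2.
Proof.
have b := bd_s4.
rewrite (intD gi); last 2 first.
- by apply: dmD => //; exact: dm_cst.
- by apply: dmM; [exact: dmX|exact: dm_cst].
rewrite (intD gi)//; last exact: dm_cst.
rewrite int_cst; have -> : \int[iid pi 4]_t s4 t = 0.
  rewrite /s4 !(intD gi); try exact: bd_qq; try (by do ?apply: dmD; exact: bd_qq).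
  by rewrite !int_qq0// !addr0.
rewrite addr0 (intZr gi); last exact: dmX.
congr (_ + _ / _).
pose l1 := [:: ((o0, o1), (o0, o1)); ((o0, o2), (o0, o2)); ((o1, o2), (o1, o2));
  ((o0, o3), (o0, o3)); ((o1, o3), (o1, o3)); ((o2, o3), (o2, o3))].
pose l2 := [:: ((o0, o1), (o0, o2)); ((o1, o2), (o0, o1)); ((o0, o1), (o0, o3));
  ((o1, o3), (o0, o1)); ((o0, o1), (o2, o3)); ((o2, o0), (o1, o2));
  ((o0, o2), (o0, o3)); ((o0, o2), (o1, o3)); ((o2, o3), (o0, o2));
  ((o1, o2), (o0, o3)); ((o1, o2), (o1, o3)); ((o2, o3), (o1, o2));
  ((o3, o0), (o1, o3)); ((o3, o0), (o2, o3)); ((o3, o1), (o2, o3))].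
transitivity (\int[iid pi 4]_t (\sum_(e <- l1) qp e t + 2 * \sum_(e <- l2) qp e t)).
  apply: eq_int => t; rewrite /l1 /l2 !big_cons !big_nil /qp /=.
  by rewrite (qqC o2 o0) (qqC o3 o0) (qqC o3 o1) /s4; ring.
have d1 : bd (fun t => \sum_(e <- l1) qp e t) by apply: dm_sum => e; exact: bd_qp.
have d2 : bd (fun t => \sum_(e <- l2) qp e t) by apply: dm_sum => e; exact: bd_qp.
rewrite (intD gi)//; last exact: dmZ.
rewrite (intZ gi)// !(int_sum gi); try (by move=> e; exact: bd_qp).
by rewrite /l1 /l2 !big_cons !big_nil !int_qsq// !int_qp0//; ring.
Qed.

Lemma dm_liklnlik : dm (@l1norm R m) (fun g => L g * ln (L g)).
Proof. by apply: dmM => //; apply: dm_lin; exact: lin_lnlik. Qed.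

(** Up to E, the moment of order k of L is 1 + C(k, 2) qsq / 2. Inserted in [lnM_ge] and [lnM_le],
    these moments give qsq / 4 on both sides. The upper bound costs (1/3 + 3/2 + 3) E <= 5 E, and
    320 = 5 * 64. *)
Lemma entropy_expansion :
  `|\int[gam]_g (L g * ln (L g)) - qsq / 4| <= 320 * exp6 * \int[iid pi 4]_t sabs 3 t.
Proof.
set E := 64 * exp6 * \int[iid pi 4]_t sabs 3 t.
have bP s : bd s -> bd (fun t => 1 + s t + s t ^+ 2 / 2).
  move=> bs; apply: dmD; first by apply: dmD => //; exact: dm_cst.
  by apply: dmM; [exact: dmX|exact: dm_cst].
have tay s : bd s -> (forall t, `|s t| <= sabs 1 t) ->
    `|\int[iid pi 4]_t expR (s t) - \int[iid pi 4]_t (1 + s t + s t ^+ 2 / 2)| <= E.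
  move=> bs sS; apply: int_expB => //; first exact: bP.
  move=> t; have := sabs_taylor3 (sS t); congr (`|_| <= _); ring.
have e2 := tay s2 (bd_qq o0 o1) s2_sabs.
have e3 := tay s3 bd_s3 s3_sabs.
have e4 := tay s4 bd_s4 s4_sabs.
rewrite -int_lik2 int_P2 in e2; rewrite -int_lik3 int_P3 in e3.
rewrite -int_lik4 int_P4 in e4.
have dX n : dm (@l1norm R m) (fun g => L g ^+ n) by exact: dmX.
have dc c : dm (@l1norm R m) (fun=> c) by exact: dm_cst.
pose m2 := \int[gam]_g L g ^+ 2; pose m3 := \int[gam]_g L g ^+ 3.
pose m4 := \int[gam]_g L g ^+ 4.
have low : \int[gam]_g (L g ^+ 3 * (- 6^-1) + L g ^+ 2 + L g * (- 2^-1) + (- 3^-1)) <=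
    \int[gam]_g (L g * ln (L g)).
  apply: (int_le gg).
  - by do !(apply: dmD => //); exact: dmM.
  - exact: dm_liklnlik.
  - move=> g; have := lnM_ge (lik_gt0 pi ma aA g); lra.
have up : \int[gam]_g (L g * ln (L g)) <=
  \int[gam]_g (L g ^+ 4 * 3^-1 + L g ^+ 3 * (- 3 / 2) + L g ^+ 2 * 3 +
    L g * (- 11 / 6) + 0).
  apply: (int_le gg).
  - exact: dm_liklnlik.
  - by do !(apply: dmD => //); exact: dmM.
  - move=> g; have := lnM_le (lik_gt0 pi ma aA g); lra.
have lowE : \int[gam]_g (L g ^+ 3 * (- 6^-1) + L g ^+ 2 + L g * (- 2^-1) + (- 3^-1)) =
    m3 * (- 6^-1) + m2 - 2^-1 - 3^-1.
  rewrite !(intD gg)//; do ?[by apply: dmM|apply: dmD => //].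
  by rewrite !(intZr gg)// int_lik1 int_cst mul1r.
have upE : \int[gam]_g (L g ^+ 4 * 3^-1 + L g ^+ 3 * (- 3 / 2) + L g ^+ 2 * 3 +
    L g * (- 11 / 6) + 0) = m4 * 3^-1 + m3 * (- 3 / 2) + m2 * 3 - 11 / 6.
  rewrite !(intD gg)//; do ?[by apply: dmM|apply: dmD => //].
  by rewrite !(intZr gg)// int_lik1 int_cst -/m2 -/m3 -/m4; field.
rewrite lowE in low; rewrite upE in up.
have -> : 320 * exp6 * \int[iid pi 4]_t sabs 3 t = 5 * E by rewrite /E; ring.
move: e2 e3 e4 low up; rewrite -/m2 -/m3 -/m4 !ler_norml.
move=> /andP[? ?] /andP[? ?] /andP[? ?] ? ?; apply/andP; split; lra.
Qed.

End centered.

End channel_expansion.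

(** * Comparison of fractional moments *)

Lemma dm_powR d (T : measurableType d) (R : realType) (G f : T -> R) (th : R) :
  0 <= th -> th <= 1 -> (forall x, 0 <= f x) -> dm G f ->
  dm G (fun x => f x `^ th).
Proof.
move=> th0 th1 f0 df; have [mf _] := df.
apply: (dm_le (g := fun x => 1 + f x)).
- exact: measurableT_comp (measurable_powR th) mf.
- by apply: dmD => //; exact: dm_cst.
- move=> x; rewrite !ger0_norm ?powR_ge0 ?addr_ge0//.
  have [fx1|fx1] := leP (f x) 1.
    rewrite (@le_trans _ _ 1)// ?lerDl//.
    have -> : 1 = 1 `^ th :> R by rewrite powR1.
    by apply: ge0_ler_powR; rewrite ?nnegrE.
  rewrite (@le_trans _ _ (f x))// ?lerDr//.
  by rewrite -[leRHS]powRr1 ?(ltW (lt_trans _ fx1))// ler_powR// ltW.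
Qed.

Lemma int_sqr_le d (T : measurableType d) (R : realType) (mu : probability T R)
    (f : T -> R) : bd f -> (\int[mu]_x f x) ^+ 2 <= \int[mu]_x (f x ^+ 2).
Proof.
move=> bf; set c := \int[mu]_x f x.
have b2 : bd (fun x => f x ^+ 2) by exact: dmX.
have bc : bd (fun _ : T => c) by exact: dm_cst.
have : 0 <= \int[mu]_x (f x ^+ 2 - 2 * c * f x + c ^+ 2).
  by apply: int_ge0 => x; have := sqr_ge0 (f x - c); congr (_ <= _); ring.
rewrite (intD (gauge0 mu)); last 2 first.
- by apply: dmB => //; exact: dmZ.
- exact: dm_cst.
rewrite (intB (gauge0 mu))//; last exact: dmZ.
rewrite (intZ (gauge0 mu))// int_cst -/c; lra.
Qed.

Definition scale_signal (R : realType) (Z : Type) m (h : R) (a : 'I_m -> Z -> R) :=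
  fun k z => h * a k z.

Section one_step.
Context d (Z : measurableType d) (R : realType) (pi : probability Z R).
Variables (m : nat) (a : 'I_m -> Z -> R) (A B : R).
Hypotheses (ma : forall k, measurable_fun setT (a k))
  (aA : forall k z, `|a k z| <= A) (kB : forall x y, `|ker a x y| <= B).
Variable h : R.
Hypotheses (h0 : 0 < h) (h1 : h <= 1).

Local Notation gam := (iid (std_normal R) m).
Local Notation L := (lik pi (scale_signal h a)).
Let gg : gauge gam (@l1norm R m) := gauge_l1norm R m.
Let gi := gauge0 (iid pi 4).

Lemma mscale_signal k : measurable_fun setT (scale_signal h a k).
Proof. exact: measurable_funM. Qed.

Lemma scA k z : `|scale_signal h a k z| <= A.
Proof.
rewrite normrM gtr0_norm//; apply: le_trans (aA k z).
by rewrite ler_piMl.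
Qed.

Lemma ker_sc x y : ker (scale_signal h a) x y = h ^+ 2 * ker a x y.
Proof. by rewrite /ker mulr_sumr; apply: eq_bigr => k _; rewrite /scale_signal; ring. Qed.

Lemma h2_le1 : h ^+ 2 <= 1.
Proof. by rewrite expr_le1// ltW. Qed.

Lemma ker_scB x y : `|ker (scale_signal h a) x y| <= B.
Proof.
rewrite ker_sc normrM ger0_norm ?sqr_ge0// (le_trans _ (kB x y))//.
by rewrite ler_piMl// h2_le1.
Qed.

Let B0 : 0 <= B. Proof. exact: le_trans (kB point point). Qed.

Let dL : dm (@l1norm R m) L := dm_lik pi mscale_signal scA.

Lemma dm_likB1 n : dm (@l1norm R m) (fun g => (L g - 1) ^+ n).
Proof. by apply: dmX; apply: dmB => //; exact: dm_cst. Qed.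

Lemma int_likB1 : \int[gam]_g (L g - 1) = 0.
Proof.
by rewrite (intB gg)// ?(int_lik1 pi mscale_signal scA) ?int_cst ?subrr//; exact: dm_cst.
Qed.

Lemma int_likB1_sqr : \int[gam]_g (L g - 1) ^+ 2 =
  \int[iid pi 4]_t expR (s2 (scale_signal h a) t) - 1.
Proof.
rewrite -(int_lik2 pi mscale_signal scA).
transitivity (\int[gam]_g (L g ^+ 2 - 2 * L g + 1)).
  by apply: eq_int => g; ring.
have d2 : dm (@l1norm R m) (fun g => L g ^+ 2) by exact: dmX.
rewrite (intD gg); last 2 first.
- by apply: dmB => //; exact: dmZ.
- exact: dm_cst.
rewrite (intB gg)//; last exact: dmZ.
by rewrite (intZ gg)// (int_lik1 pi mscale_signal scA) int_cst; ring.
Qed.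

Lemma int_likB1_sqr_le : \int[gam]_g (L g - 1) ^+ 2 <= h ^+ 2 * (B * expR B).
Proof.
rewrite int_likB1_sqr -[X in _ - X](int_cst (iid pi 4)) -(intB gi); last 2 first.
- by apply: bd_exp; exact: (bd_qq mscale_signal scA).
- exact: dm_cst.
rewrite -[leRHS](int_cst (iid pi 4)); apply: (int_le gi).
- apply: dmB; last exact: dm_cst.
  by apply: bd_exp; exact: (bd_qq mscale_signal scA).
- exact: dm_cst.
move=> t; rewrite (le_trans (ler_norm _))// (le_trans (expR_taylor1 _))//.
rewrite mulrA ler_pM ?expR_ge0//; last by rewrite ler_expR ker_scB.
rewrite /s2 /ker_at ker_sc normrM ger0_norm ?sqr_ge0// ler_wpM2l ?sqr_ge0//.
Qed.

Lemma psum_nseq n z : psum (scale_signal h a) (nseq n z) = 'C(n, 2)%:R * (h ^+ 2 * ker a z z).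
Proof.
elim: n => [|n IH]; first by rewrite bin0n mul0r.
rewrite /= IH (_ : \sum_(y <- nseq n z) _ = n%:R * (h ^+ 2 * ker a z z)).
  by rewrite -mulrDl -natrD binS bin1 addnC.
rewrite big_nseq; elim: (n) => [|k IH']; first by rewrite mul0r.
by rewrite iterS IH' ker_sc -[in RHS]natr1 mulrDl mul1r addrC.
Qed.

Lemma int_amp_pow n z : \int[gam]_g (amp (scale_signal h a) g z) ^+ n =
  expR ('C(n, 2)%:R * (h ^+ 2 * ker a z z)).
Proof.
rewrite -psum_nseq -(int_amps (scale_signal h a)); apply: eq_int => g.
by rewrite big_nseq; elim: n => [|n IH]; rewrite ?expr0// exprS IH iterS.
Qed.

(** The fourth moment is e^(6x) - 4 e^(3x) + 6 e^x - 3, where orders 0 and 1 in x cancel. The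
    quadratic remainders add up to 36 + 4 * 9 + 6 = 78. *)
Lemma int_ampB1_4 z : \int[gam]_g (amp (scale_signal h a) g z - 1) ^+ 4 <=
  h ^+ 4 * (78 * B ^+ 2 * expR (6 * B)).
Proof.
have damp : dm (@l1norm R m) (fun g => amp (scale_signal h a) g z).
  exact: (dm_sec2 gg (gauge0 pi) z (dm_amp pi mscale_signal scA)).
have dX n : dm (@l1norm R m) (fun g => amp (scale_signal h a) g z ^+ n) by exact: dmX.
set x := h ^+ 2 * ker a z z.
have -> : \int[gam]_g (amp (scale_signal h a) g z - 1) ^+ 4 =
    expR (6 * x) + expR (3 * x) * (- 4) + expR (1 * x) * 6 + (-3).
  transitivity (\int[gam]_g (amp (scale_signal h a) g z ^+ 4 + amp (scale_signal h a) g z ^+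
    3 * (-4)
    + amp (scale_signal h a) g z ^+ 2 * 6 + (amp (scale_signal h a) g z ^+ 1 * (-4) + 1))).
    by apply: eq_int => g; ring.
  rewrite !(intD gg)//; do ?[exact: dX|exact: dm_cst|by apply: dmM => //; exact: dm_cst
     |apply: dmD].
  rewrite !(intZr gg)// !int_amp_pow int_cst -/x.
  have -> : 'C(1, 2)%:R * x = 0 by rewrite mul0r.
  by rewrite expR0; ring.
have xB : `|x| <= h ^+ 2 * B.
  by rewrite normrM ger0_norm ?sqr_ge0// ler_wpM2l ?sqr_ge0.
have xB' : `|x| <= B by rewrite (le_trans xB)// ler_piMl// h2_le1.
have tay c : 0 <= c -> c <= 6 -> `|expR (c * x) - 1 - c * x| <=
    c ^+ 2 * (h ^+ 4 * B ^+ 2 * expR (6 * B)).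
  move=> c0 exp6; apply: (le_trans (expR_taylor2 _)).
  have e1 : expR `|c * x| <= expR (6 * B).
    by rewrite ler_expR normrM ger0_norm// ler_pM.
  have e2 : x ^+ 2 <= (h ^+ 2 * B) ^+ 2.
    rewrite -[x ^+ 2]real_normK ?num_real//.
    by rewrite ler_pXn2r ?nnegrE// (le_trans _ xB).
  have -> : c ^+ 2 * (h ^+ 4 * B ^+ 2 * expR (6 * B)) =
    c ^+ 2 * (h ^+ 2 * B) ^+ 2 * expR (6 * B) by ring.
  rewrite exprMn; apply: ler_pM e1; last exact: (ler_wpM2l (sqr_ge0 c) e2).
  - exact: (mulr_ge0 (sqr_ge0 _) (sqr_ge0 _)).
  - exact: expR_ge0.
have t6 := tay 6 ltac:(by []) (lexx _); have t3 := tay 3 ltac:(by []) ltac:(by rewrite ler_nat).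
have t1 := tay 1 ltac:(by []) ltac:(by rewrite ler1n).
move: t6 t3 t1; rewrite !ler_norml.
set E := h ^+ 4 * B ^+ 2 * expR (6 * B).
have -> : h ^+ 4 * (78 * B ^+ 2 * expR (6 * B)) = 78 * E by rewrite /E; ring.
by move=> /andP[? ?] /andP[? ?] /andP[? ?]; lra.
Qed.

Lemma int_likB1_4_le : \int[gam]_g (L g - 1) ^+ 4 <=
  h ^+ 4 * (78 * B ^+ 2 * expR (6 * B)).
Proof.
have bA g := bd_amp pi mscale_signal scA g.
have bA1 g : bd (fun z => amp (scale_signal h a) g z - 1).
  by apply: dmB; [exact: bA|exact: dm_cst].
have dF : dm (prodG (@l1norm R m) (fun _ : Z => 0)) (fun p => (amp (scale_signal h a) p.1 p.2 -
  1) ^+ 4).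
  by apply: dmX; apply: dmB; [exact: (dm_amp pi mscale_signal scA)|exact: dm_cst].
apply: (@le_trans _ _ (\int[gam]_g \int[pi]_z (amp (scale_signal h a) g z - 1) ^+ 4)).
  apply: (int_le gg); [exact: dm_likB1|exact: (dm_int2 gg (gauge0 pi) dF)|].
  move=> g; have -> : L g - 1 = \int[pi]_z (amp (scale_signal h a) g z - 1).
    rewrite (intB (gauge0 pi)) ?int_cst//; last exact: (dm_cst (fun=> 0) 1).
    exact: bA.
  have j1 := int_sqr_le pi (bA1 g).
  have j2 := int_sqr_le pi (dmX 2 (bA1 g)).
  have E y : y ^+ 4 = (y ^+ 2) ^+ 2 :> R by rewrite -exprM.
  rewrite E; apply: (@le_trans _ _ ((\int[pi]_z (amp (scale_signal h a) g z - 1) ^+ 2) ^+ 2)).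
    by rewrite ler_pXn2r ?nnegrE ?sqr_ge0//; apply: int_ge0 => z; exact: sqr_ge0.
  by apply: (le_trans j2); rewrite le_eqVlt; apply/orP; left; apply/eqP; apply: eq_int => z.
rewrite (fubini_swap gg (gauge0 pi) dF) -[leRHS](int_cst pi).
apply: (int_le (gauge0 pi)).
- exact: (dm_int1 gg (gauge0 pi) dF).
- exact: dm_cst.
- exact: int_ampB1_4.
Qed.

Definition step_const : R := (B * expR B + 78 * B ^+ 2 * expR (6 * B)).

(** Only even moments of L - 1 are at hand, so the cubic Taylor error is split as |x|^3 <= h x^2 +
    x^4 / h; the moments of order 2 and 4 being O(h^2) and O(h^4), the result is O(h^3). *)
Lemma int_lik_powR (th C : R) : 0 < th -> th < 1 ->
  (forall x, 0 <= x -> `|x `^ th - 1 - th * (x - 1) + th * (1 - th) / 2 * (x - 1) ^+ 2|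
    <= C * `|x - 1| ^+ 3) -> 0 <= C ->
  `|\int[gam]_g (L g `^ th) - 1 + th * (1 - th) / 2 * \int[gam]_g (L g - 1) ^+ 2|
     <= C * step_const * h ^+ 3.
Proof.
move=> th0 th1 tay C0.
have dp : dm (@l1norm R m) (fun g => L g `^ th).
  by apply: dm_powR => //; [exact: ltW|exact: ltW|move=> g;
    apply/ltW/(lik_gt0 pi mscale_signal scA)].
have dc c : dm (@l1norm R m) (fun=> c) by exact: dm_cst.
have d1 : dm (@l1norm R m) (fun g => th * (L g - 1)) by apply: dmZ; exact: dmB.
have d2 : dm (@l1norm R m) (fun g => th * (1 - th) / 2 * (L g - 1) ^+ 2).
  by apply: dmZ; exact: dm_likB1.
have -> : \int[gam]_g (L g `^ th) - 1 + th * (1 - th) / 2 * \int[gam]_g (L g - 1) ^+ 2 =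
    \int[gam]_g (L g `^ th - 1 - th * (L g - 1) + th * (1 - th) / 2 * (L g - 1) ^+ 2).
  rewrite (intD gg)//; last by apply: dmB => //; exact: dmB.
  rewrite (intB gg)//; last exact: dmB.
  rewrite (intB gg)// !(intZ gg); last 2 first.
  - exact: dm_likB1.
  - exact: dmB.
  by rewrite int_likB1 int_cst mulr0 subr0.
apply: (@le_trans _ _ (\int[gam]_g (C * (h * (L g - 1) ^+ 2 + h^-1 * (L g - 1) ^+ 4)))).
  apply: (int_norm_le gg).
  - by apply: dmD => //; apply: dmB => //; exact: dmB.
  - by apply: dmZ; apply: dmD; apply: dmZ; exact: dm_likB1.
  move=> g; apply: (le_trans (tay _ _)); first exact/ltW/(lik_gt0 pi mscale_signal scA).
  rewrite ler_wpM2l//; set x := L g - 1.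
  have -> : x ^+ 4 = (`|x| ^+ 2) ^+ 2 by rewrite real_normK ?num_real// -exprM.
  rewrite -[x ^+ 2]real_normK ?num_real//; set y := `|x|.
  have hi : 0 < h^-1 by rewrite invr_gt0.
  have : 0 <= h^-1 * y ^+ 2 * (h - y) ^+ 2.
    exact: (mulr_ge0 (mulr_ge0 (ltW hi) (sqr_ge0 _)) (sqr_ge0 _)).
  have -> : h^-1 * y ^+ 2 * (h - y) ^+ 2 = h * y ^+ 2 - 2 * y ^+ 3 + h^-1 * (y ^+ 2) ^+ 2.
    by field; rewrite gt_eqF.
  have : 0 <= y ^+ 3 by exact: (exprn_ge0 3 (normr_ge0 x)).
  lra.
rewrite (intZ gg); last by apply: dmD; apply: dmZ; exact: dm_likB1.
rewrite -mulrA ler_wpM2l// (intD gg); last 2 first.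
- by apply: dmZ; exact: dm_likB1.
- by apply: dmZ; exact: dm_likB1.
rewrite !(intZ gg); last 2 first.
- exact: dm_likB1.
- exact: dm_likB1.
have e1 : h * \int[gam]_g (L g - 1) ^+ 2 <= h ^+ 3 * (B * expR B).
  by rewrite exprS -mulrA; apply: (ler_wpM2l (ltW h0)); exact: int_likB1_sqr_le.
have e2 : h^-1 * \int[gam]_g (L g - 1) ^+ 4 <= h ^+ 3 * (78 * B ^+ 2 * expR (6 * B)).
  rewrite ler_pdivrMl// [leRHS](_ : _ = h ^+ 4 * (78 * B ^+ 2 * expR (6 * B)));
    [exact: int_likB1_4_le|ring].
rewrite /step_const; lra.
Qed.

End one_step.

(** * Doubling a signal, and Kahane's inequality *)

Section doubling.
Context d (Z : measurableType d) (R : realType) (pi : probability Z R) (th : R).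
Hypotheses (th0 : 0 < th) (th1 : th < 1).

(** The weight f is kept arbitrary because doubling absorbs the likelihood of one observation into
    it; comparisons are therefore proved for all f at once. *)
Definition frac_moment m (a : 'I_m -> Z -> R) (f : Z -> R) : R :=
  \int[iid (std_normal R) m]_g ((\int[pi]_z (amp a g z * f z)) `^ th).

Lemma pmom_ge0 m (a : 'I_m -> Z -> R) f : 0 <= frac_moment a f.
Proof. by apply: int_ge0 => g; exact: powR_ge0. Qed.

Lemma dm_pmom1 m (a : 'I_m -> Z -> R) A f :
  (forall k, measurable_fun setT (a k)) -> (forall k z, `|a k z| <= A) ->
  bd f -> (forall z, 0 <= f z) ->
  dm (@l1norm R m) (fun g => (\int[pi]_z (amp a g z * f z)) `^ th).
Proof.
move=> ma aA bf f0; apply: dm_powR; [exact: ltW|exact: ltW| |].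
  by move=> g; apply: int_ge0 => z; rewrite mulr_ge0// expR_ge0.
have dF : dm (prodG (@l1norm R m) (fun _ : Z => 0)) (fun q => amp a q.1 q.2 * f q.2).
  apply: dmM; first exact: (dm_amp pi ma aA).
  by apply: bd_dm; exact: (bd_comp measurable_snd bf).
exact: (dm_int2 (gauge_l1norm R m) (gauge0 pi) dF).
Qed.

Lemma dm_pmom2 m1 m2 (a : 'I_m1 -> Z -> R) (b : 'I_m2 -> Z -> R) A1 A2 f :
  (forall k, measurable_fun setT (a k)) -> (forall k z, `|a k z| <= A1) ->
  (forall k, measurable_fun setT (b k)) -> (forall k z, `|b k z| <= A2) ->
  bd f -> (forall z, 0 <= f z) ->
  dm (prodG (@l1norm R m1) (@l1norm R m2))
    (fun p => (\int[pi]_z (amp a p.1 z * (amp b p.2 z * f z))) `^ th).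
Proof.
move=> ma aA mb bA bf f0; apply: dm_powR; [exact: ltW|exact: ltW| |].
  by move=> g; apply: int_ge0 => z; rewrite !mulr_ge0// expR_ge0.
have da : dm (prodG (prodG (@l1norm R m1) (@l1norm R m2)) (fun _ : Z => 0))
    (fun q => amp a q.1.1 q.2).
  apply: (dm_comp (B := 1) (phi := fun q : (m1.-tuple R * m2.-tuple R) * Z =>
    (q.1.1, q.2)) _ _ (dm_amp pi ma aA)).
    apply: measurable_fun_pair => //; exact: (measurableT_comp measurable_fst measurable_fst).
  move=> [[g g'] z]; rewrite /prodG /= mul1r !addr0 !ger0_norm ?addr_ge0 ?l1norm_ge0//.
  by have := l1norm_ge0 g'; lra.
have db : dm (prodG (prodG (@l1norm R m1) (@l1norm R m2)) (fun _ : Z => 0))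
    (fun q => amp b q.1.2 q.2).
  apply: (dm_comp (B := 1) (phi := fun q : (m1.-tuple R * m2.-tuple R) * Z =>
    (q.1.2, q.2)) _ _ (dm_amp pi mb bA)).
    apply: measurable_fun_pair => //; exact: (measurableT_comp measurable_snd measurable_fst).
  move=> [[g g'] z]; rewrite /prodG /= mul1r !addr0 !ger0_norm ?addr_ge0 ?l1norm_ge0//.
  by have := l1norm_ge0 g; lra.
have dF : dm (prodG (prodG (@l1norm R m1) (@l1norm R m2)) (fun _ : Z => 0))
    (fun q => amp a q.1.1 q.2 * (amp b q.1.2 q.2 * f q.2)).
  apply: dmM => //; apply: dmM => //.
  by apply: bd_dm; exact: (bd_comp measurable_snd bf).
exact: (dm_int2 (gauge_prod (gauge_l1norm R m1) (gauge_l1norm R m2)) (gauge0 pi) dF).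
Qed.

Lemma amp_rott m (a : 'I_m -> Z -> R) g g' z :
  amp (scale_signal (Num.sqrt 2) a) (rott (g, g')) z = amp a g z * amp a g' z.
Proof.
rewrite /amp -expRD; congr expR; rewrite /gexp -big_split/=; apply: eq_bigr => k _.
have s2 : Num.sqrt 2 != 0 :> R by rewrite gt_eqF// sqrtr_gt0.
by rewrite tnth_mktuple /scale_signal /= exprMn sqr_sqrtr//; field.
Qed.

(* A signal multiplied by sqrt 2 is two independent observations of it. *)
Lemma pmom_double m (a : 'I_m -> Z -> R) A f :
  (forall k, measurable_fun setT (a k)) -> (forall k z, `|a k z| <= A) ->
  bd f -> (forall z, 0 <= f z) ->
  frac_moment (scale_signal (Num.sqrt 2) a) f =
  \int[iid (std_normal R) m]_g frac_moment a (fun z => amp a g z * f z).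
Proof.
move=> ma aA bf f0; rewrite -[LHS](int_rot (F := fun g => (\int[pi]_z (amp (scale_signal
  (Num.sqrt 2) a) g z * f z)) `^ th)); last first.
  apply: (dm_pmom1 (A := Num.sqrt 2 * A)) => //.
    by move=> k; exact: measurable_funM.
  by move=> k z; rewrite normrM ger0_norm ?sqrtr_ge0// ler_wpM2l// sqrtr_ge0.
apply: eq_int => g; apply: eq_int => g'; congr (_ `^ _); apply: eq_int => z.
by rewrite amp_rott; ring.
Qed.

Section domination.
Variables (m1 m2 : nat) (a : 'I_m1 -> Z -> R) (b : 'I_m2 -> Z -> R) (A1 A2 : R).
Hypotheses (ma : forall k, measurable_fun setT (a k)) (aA : forall k z, `|a k z| <= A1)
  (mb : forall k, measurable_fun setT (b k)) (bA : forall k z, `|b k z| <= A2).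

Lemma bd_ampf m (a' : 'I_m -> Z -> R) A g f : (forall k, measurable_fun setT (a' k)) ->
  (forall k z, `|a' k z| <= A) -> bd f -> bd (fun z => amp a' g z * f z).
Proof. by move=> ma' aA' bf; apply: dmM => //; exact: (bd_amp pi ma' aA'). Qed.

Lemma ampf_ge0 m (a' : 'I_m -> Z -> R) g f : (forall z, 0 <= f z) ->
  forall z, 0 <= amp a' g z * f z.
Proof. by move=> f0 z; rewrite mulr_ge0// expR_ge0. Qed.

(** Of the two observations of a, one is replaced by b with weight amp a g f; Fubini exchanges the
    roles, and the other one is replaced with weight amp b g f. Each replacement costs c. *)
Lemma pmom_dom_double c : 0 <= c ->
  (forall f, bd f -> (forall z, 0 <= f z) -> frac_moment a f <= c * frac_moment b f) ->
  forall f, bd f -> (forall z, 0 <= f z) ->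
  frac_moment (scale_signal (Num.sqrt 2) a) f <= c ^+
    2 * frac_moment (scale_signal (Num.sqrt 2) b) f.
Proof.
move=> c0 h f bf f0.
have g1 := gauge_l1norm R m1; have g2 := gauge_l1norm R m2.
rewrite (pmom_double ma aA bf f0) (pmom_double mb bA bf f0).
have daa : dm (@l1norm R m1) (fun g => frac_moment a (fun z => amp a g z * f z)) :=
  dm_int1 g1 g1 (dm_pmom2 ma aA ma aA bf f0).
have dbb : dm (@l1norm R m2) (fun g => frac_moment b (fun z => amp b g z * f z)) :=
  dm_int1 g2 g2 (dm_pmom2 mb bA mb bA bf f0).
have dba : dm (@l1norm R m1) (fun g => frac_moment b (fun z => amp a g z * f z)) :=
  dm_int1 g2 g1 (dm_pmom2 mb bA ma aA bf f0).
have dab : dm (@l1norm R m2) (fun g => frac_moment a (fun z => amp b g z * f z)) :=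
  dm_int1 g1 g2 (dm_pmom2 ma aA mb bA bf f0).
apply: (@le_trans _ _ (\int[iid (std_normal R) m1]_g
    (c * frac_moment b (fun z => amp a g z * f z)))).
  apply: (int_le g1 daa); first exact: dmZ.
  move=> g; exact: (h _ (bd_ampf g ma aA bf) (@ampf_ge0 _ a g _ f0)).
rewrite (intZ g1)// expr2 -mulrA; apply: ler_wpM2l => //.
have -> : \int[iid (std_normal R) m1]_g frac_moment b (fun z => amp a g z * f z) =
    \int[iid (std_normal R) m2]_g frac_moment a (fun z => amp b g z * f z).
  have /= <- := fubini_swap g2 g1 (dm_pmom2 mb bA ma aA bf f0).
  apply: eq_int => g; apply: eq_int => g'; apply: (congr1 (fun u => u `^ th)).
  apply: eq_int => z.
  by rewrite mulrCA.
rewrite -(intZ g2)//; apply: (int_le g2) => //; first exact: dmZ.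
move=> g; exact: (h _ (bd_ampf g mb bA bf) (@ampf_ge0 _ b g _ f0)).
Qed.

End domination.
End doubling.

Lemma ex_pow2_gt (R : realType) (M : R) (p0 : nat) :
  exists2 p, (p0 <= p)%N & M < 2 ^+ p.
Proof.
exists (p0 + Num.bound `|M|)%N; first exact: leq_addr.
rewrite (le_lt_trans (ler_norm M))// (lt_trans (archi_boundP (normr_ge0 M)))//.
rewrite -natrX ltr_nat (leq_trans (ltn_expl _ (ltnSn 1)))// leq_exp2l//.
exact: leq_addl.
Qed.

Section kahane.
Context d (Z : measurableType d) (R : realType) (pi : probability Z R) (th : R).
Hypotheses (th0 : 0 < th) (th1 : th < 1).

Lemma sc_id m (a : 'I_m -> Z -> R) : scale_signal 1 a = a.
Proof. by apply/funext => k; apply/funext => z; rewrite /scale_signal mul1r. Qed.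

Lemma sc_sc m (a : 'I_m -> Z -> R) x y : scale_signal x (scale_signal y a) = scale_signal (x * y) a.
Proof. by apply/funext => k; apply/funext => z; rewrite /scale_signal mulrA. Qed.

Lemma pmom_int0 m (a : 'I_m -> Z -> R) A f :
  (forall k, measurable_fun setT (a k)) -> (forall k z, `|a k z| <= A) ->
  bd f -> (forall z, 0 <= f z) -> \int[pi]_z f z = 0 -> frac_moment pi th a f = 0.
Proof.
move=> ma aA bf f0 f1; rewrite -[RHS](int_cst (iid (std_normal R) m)).
apply: eq_int => g; suff -> : \int[pi]_z (amp a g z * f z) = 0.
  by rewrite powR0// gt_eqF.
have ba := bd_amp pi ma aA g; have [M M0 aM] := bdP ba.
apply/le_anti/andP; split; last first.
  by apply: int_ge0 => z; rewrite mulr_ge0// expR_ge0.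
rewrite -(mulr0 M) -f1 -(intZ (gauge0 pi))//; apply: (int_le (gauge0 pi)).
- exact: dmM.
- exact: dmZ.
- by move=> z; rewrite ler_wpM2r// (le_trans (ler_norm _)).
Qed.

(** Homogeneity of degree th turns the weight f into a prior nu, for which the expansion around L =
    1 is available. *)
Lemma pmom_density m (a : 'I_m -> Z -> R) A f (nu : probability Z R) :
  (forall k, measurable_fun setT (a k)) -> (forall k z, `|a k z| <= A) ->
  bd f -> (forall z, 0 <= f z) -> 0 < \int[pi]_z f z ->
  (forall h, measurable_fun setT h ->
    \int[nu]_x h x = \int[pi]_x (h x * (f x / \int[pi]_z f z))) ->
  frac_moment pi th a f = (\int[pi]_z f z) `^ th *
    \int[iid (std_normal R) m]_g (lik nu a g `^ th).
Proof.
move=> ma aA bf f0 F0 nuE; set F := \int[pi]_z f z in F0 nuE *.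
rewrite -(intZ (gauge_l1norm R m)); last first.
  apply: dm_powR; [exact: ltW|exact: ltW| |exact: (dm_lik nu ma aA)].
  by move=> g; exact/ltW/(lik_gt0 nu ma aA).
apply: eq_int => g; rewrite -powRM//; [|exact: ltW|exact/ltW/(lik_gt0 nu ma aA)].
have ba := bd_amp pi ma aA g.
congr (_ `^ _); rewrite /lik nuE; last by case: ba.
rewrite -(intZ (gauge0 pi)); last first.
  by apply: dmM => //; apply: dmM => //; exact: dm_cst.
by apply: eq_int => z; field; rewrite gt_eqF.
Qed.

Section compare.
Variables (m1 m2 : nat) (a : 'I_m1 -> Z -> R) (b : 'I_m2 -> Z -> R) (A1 A2 B : R).
Hypotheses (ma : forall k, measurable_fun setT (a k)) (aA : forall k z, `|a k z| <= A1)
  (mb : forall k, measurable_fun setT (b k)) (bA : forall k z, `|b k z| <= A2).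
Hypotheses (aB : forall x y, `|ker a x y| <= B) (bB : forall x y, `|ker b x y| <= B).
Hypothesis kab : forall x y, ker b x y <= ker a x y.

(** The second-order coefficient is -th (1 - th) / 2 times the variance of L, and a larger kernel
    has a larger variance. *)
Lemma pmom_step : exists C h0, [/\ 0 <= C, 0 < h0 &
  forall h, 0 < h -> h <= h0 -> forall f, bd f -> (forall z, 0 <= f z) ->
    frac_moment pi th (scale_signal h a) f <= (1 + C * h ^+
      3) * frac_moment pi th (scale_signal h b) f].
Proof.
pose c := th * (1 - th) / 2.
have c0 : 0 <= c.
  by rewrite divr_ge0// mulr_ge0 ?subr_ge0//; exact: ltW.
have c1 : c <= 1 by rewrite /c; have := sqr_ge0 th; have := th0; have := th1; lra.
have [C C0 tay] := powR_taylor th0 th1.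
have B0 : 0 <= B := le_trans (normr_ge0 _) (aB point point).
have cs0 : 0 <= step_const B.
  by rewrite /step_const addr_ge0// ?mulr_ge0 ?expR_ge0 ?sqr_ge0.
pose M := B * expR B + C * step_const B.
have M0 : 0 <= M.
  by rewrite addr_ge0 ?mulr_ge0 ?expR_ge0// ltW.
(* The choice of h0 keeps the moment of b above 1/2, so that the additive error 2 E is at most 4 E
   times that moment. *)
exists (4 * (C * step_const B)), (2 * (M + 1))^-1; split.
- by rewrite !mulr_ge0// ltW.
- by rewrite invr_gt0; lra.
move=> h h0 hM f bf f0.
have hM' : h * M <= 2^-1.
  have M1 : 0 < 2 * (M + 1) by lra.
  have : h * (2 * (M + 1)) <= 1 by rewrite -ler_pdivlMr// mul1r.
  lra.
have h1 : h <= 1.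
  by rewrite (le_trans hM)// invf_le1; lra.
have mha k : measurable_fun setT (scale_signal h a k) by exact: measurable_funM.
have mhb k : measurable_fun setT (scale_signal h b k) by exact: measurable_funM.
have hA := scA aA h0 h1; have hB := scA bA h0 h1.
have [F0|F0] := eqVneq (\int[pi]_z f z) 0.
  by rewrite (pmom_int0 mha hA)// (pmom_int0 mhb hB)// mulr0.
have {}F0 : 0 < \int[pi]_z f z by rewrite lt_neqAle eq_sym F0 int_ge0.
have bff : bd (fun z => f z / \int[pi]_z f z) by apply: dmM => //; exact: dm_cst.
have [nu nuE] : exists nu : probability Z R, forall h, measurable_fun setT h ->
    \int[nu]_x h x = \int[pi]_x (h x * (f x / \int[pi]_z f z)).
  apply: ex_density.
  - by case: bff.
  - by move=> z; rewrite divr_ge0// ltW.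
  - exact: (dm_integrable (gauge0 pi)).
  - by rewrite (intZr (gauge0 pi))// mulfV// gt_eqF.
rewrite (pmom_density mha hA bf f0 F0 nuE) (pmom_density mhb hB bf f0 F0 nuE).
rewrite mulrCA; apply: ler_wpM2l; first exact: powR_ge0.
have := int_lik_powR nu ma aA aB h0 h1 th0 th1 tay (ltW C0).
have := int_lik_powR nu mb bA bB h0 h1 th0 th1 tay (ltW C0).
have Vb := int_likB1_sqr_le nu mb bA bB h0 h1.
have Vab : \int[iid (std_normal R) m2]_g (lik nu (scale_signal h b) g - 1) ^+ 2 <=
    \int[iid (std_normal R) m1]_g (lik nu (scale_signal h a) g - 1) ^+ 2.
  rewrite (int_likB1_sqr nu ma aA h0 h1) (int_likB1_sqr nu mb bA h0 h1).
  rewrite lerD2r; apply: (int_le (gauge0 _)).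
  - by apply: bd_exp; exact: (bd_qq mhb hB).
  - by apply: bd_exp; exact: (bd_qq mha hA).
  - move=> t; rewrite ler_expR /s2 /ker_at (ker_sc b) (ker_sc a).
    by rewrite ler_wpM2l// sqr_ge0.
have Vb0 : 0 <= \int[iid (std_normal R) m2]_g (lik nu (scale_signal h b) g - 1) ^+ 2.
  by apply: int_ge0 => g; exact: sqr_ge0.
move: Vab Vb Vb0.
set Vb := \int[_]_g (_ - 1) ^+ 2; set Va := \int[_]_g (_ - 1) ^+ 2.
set Qb := \int[_]_g (_ `^ _); set Qa := \int[_]_g (_ `^ _).
move=> Vab Vb1 Vb0; rewrite !ler_norml => /andP[b1 b2] /andP[a1 a2].
rewrite -/c in b1 b2 a1 a2; clearbody c.

have cV : c * Vb <= c * Va by exact: ler_wpM2l.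
have h2 : h ^+ 2 <= h by rewrite expr2 ler_piMl// ltW.
have h3 : h ^+ 3 <= h by rewrite exprS ler_piMr ?(ltW h0)// expr_le1// ltW.
have cVb : c * Vb <= h * (B * expR B).
  apply: (@le_trans _ _ Vb); first by rewrite ler_piMl.
  apply: (le_trans Vb1); apply: ler_wpM2r => //.
  by rewrite mulr_ge0// expR_ge0.
have Eh : C * step_const B * h ^+ 3 <= h * (C * step_const B).
  by rewrite mulrC; apply: ler_wpM2r => //; rewrite mulr_ge0// ltW.
set E := C * step_const B * h ^+ 3 in b1 b2 a1 a2 Eh *.
have E0 : 0 <= E by rewrite /E !mulr_ge0// ?exprn_ge0 ?ltW.
have -> : 4 * (C * step_const B) * h ^+ 3 = 4 * E by rewrite /E; ring.
move: hM'; rewrite /M => hM'.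
have Qb2 : 2^-1 <= Qb by lra.
nra.
Qed.

End compare.

Definition frac_moment_le m1 m2 (a : 'I_m1 -> Z -> R) (b : 'I_m2 -> Z -> R) c :=
  forall f, bd f -> (forall z, 0 <= f z) -> frac_moment pi th a f <= c * frac_moment pi th b f.

Section iterate.
Variables (m1 m2 : nat) (a : 'I_m1 -> Z -> R) (b : 'I_m2 -> Z -> R) (A1 A2 B : R).
Hypotheses (ma : forall k, measurable_fun setT (a k)) (aA : forall k z, `|a k z| <= A1)
  (mb : forall k, measurable_fun setT (b k)) (bA : forall k z, `|b k z| <= A2).

Let msc' m (a' : 'I_m -> Z -> R) x : (forall k, measurable_fun setT (a' k)) ->
  forall k, measurable_fun setT (scale_signal x a' k).
Proof. by move=> ma' k; exact: measurable_funM. Qed.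

Let bsc m (a' : 'I_m -> Z -> R) A x : (forall k z, `|a' k z| <= A) ->
  forall k z, `|scale_signal x a' k z| <= `|x| * A.
Proof. by move=> aA' k z; rewrite normrM ler_wpM2l. Qed.

Lemma pdom_double x c : 0 <= c -> frac_moment_le (scale_signal x a) (scale_signal x b) c ->
  frac_moment_le (scale_signal (2 * x) a) (scale_signal (2 * x) b) (c ^+ 4).
Proof.
move=> c0 h.
have h1 := pmom_dom_double th0 th1 (msc' x ma) (bsc x aA) (msc' x mb) (bsc x bA) c0 h.
have h2 := pmom_dom_double th0 th1 (msc' (Num.sqrt 2) (msc' x ma)) (bsc _ (bsc x aA))
  (msc' (Num.sqrt 2) (msc' x mb)) (bsc _ (bsc x bA)) (sqr_ge0 c) h1.
move=> f bf f0; have := h2 f bf f0.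
by rewrite !sc_sc -expr2 sqr_sqrtr// -exprM.
Qed.

Lemma pdom_iter p x c : 0 <= c -> frac_moment_le (scale_signal x a) (scale_signal x b) c ->
  frac_moment_le (scale_signal (2 ^+ p * x) a) (scale_signal (2 ^+ p * x) b) (c ^+ (4 ^ p)).
Proof.
elim: p x c => [|p IH] x c c0 h; first by rewrite expr0 mul1r expr1.
rewrite exprSr -mulrA expnS exprM; apply: IH; first exact: exprn_ge0.
exact: pdom_double.
Qed.

Hypotheses (aB : forall x y, `|ker a x y| <= B) (bB : forall x y, `|ker b x y| <= B).
Hypothesis kab : forall x y, ker b x y <= ker a x y.

(* Kahane's inequality without interpolation: for the signals scaled by 2^-p the
   Taylor expansion gives it up to a factor 1 + O(8^-p), and 2 p doublings raise
   this factor to the power 4^p, so that it tends to 1. *)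
Theorem kahane f : bd f -> (forall z, 0 <= f z) ->
  frac_moment pi th a f <= frac_moment pi th b f.
Proof.
move=> bf f0; have [C [h0 [C0 h00 step]]] := pmom_step ma aA mb bA aB bB kab.
rewrite leNgt; apply/negP => uv.
set u := frac_moment pi th a f in uv; set v := frac_moment pi th b f in uv.
have v0 : 0 <= v by exact: pmom_ge0.
have [p0 _ hp0] := ex_pow2_gt h0^-1 0.
(* The iterated bound u <= exp (C / 2^p) v yields u - v <= C e^C v / 2^p, which this p contradicts;
   p >= p0 makes 2^-p an admissible h. *)
have [p p0p hp] := ex_pow2_gt (C * expR C * v / (u - v)) p0.
have P0 : 0 < 2 ^+ p :> R by exact: exprn_gt0.
have x0 : 0 < (2 ^+ p)^-1 :> R by rewrite invr_gt0.
have xh : (2 ^+ p)^-1 <= h0.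
  rewrite invf_ple ?posrE// (le_trans (ltW hp0))//.
  by rewrite ler_eXn2l// ltr1n.
have c0 : 0 <= 1 + C * (2 ^+ p)^-1 ^+ 3.
  by rewrite addr_ge0// mulr_ge0// exprn_ge0// ltW.
have := pdom_iter p c0 (step _ x0 xh).
rewrite mulfV ?gt_eqF// !sc_id => /(_ f bf f0); rewrite -/u -/v => uc.
have uc' : u <= expR (C * (2 ^+ p)^-1) * v.
  apply: (le_trans uc); apply: ler_wpM2r => //.
  apply: (@le_trans _ _ (expR (C * (2 ^+ p)^-1 ^+ 3) ^+ (4 ^ p))).
    rewrite ler_pXn2r ?nnegrE ?expR_ge0// ?expn_gt0//.
    exact: expR_ge1Dx.
  rewrite -expRM_natl ler_expR natrX (_ : 4 = 2 ^+ 2)//; last by ring.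
  rewrite -exprM mulnC exprM.
  suff -> : (2 ^+ p) ^+ 2 * (C * (2 ^+ p)^-1 ^+ 3) = C * (2 ^+ p)^-1 by [].
  by move: (2 ^+ p) P0 => q q0; field; rewrite gt_eqF.
have y0 : 0 <= C * (2 ^+ p)^-1 by rewrite mulr_ge0// ltW.
have y1 : C * (2 ^+ p)^-1 <= C.
  by rewrite ler_piMr// invf_le1// exprn_ege1// ler1n.
have := expR_taylor1 (C * (2 ^+ p)^-1); rewrite (ger0_norm y0).
move=> /(le_trans (ler_norm _)) e1.
have e2 : C * (2 ^+ p)^-1 * expR (C * (2 ^+ p)^-1) <= C * (2 ^+ p)^-1 * expR C.
  by apply: ler_wpM2l => //; rewrite ler_expR.
have e3 : u - v <= C * (2 ^+ p)^-1 * expR C * v.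
  have : (expR (C * (2 ^+ p)^-1) - 1) * v <= C * (2 ^+ p)^-1 * expR C * v.
    by apply: ler_wpM2r => //; exact: le_trans e1 e2.
  lra.
move: hp; rewrite ltr_pdivrMr ?subr_gt0// => hp.
have := ler_wpM2l (ltW P0) e3.
have -> : 2 ^+ p * (C * (2 ^+ p)^-1 * expR C * v) = C * expR C * v.
  by move: (2 ^+ p) P0 => q q0; field; rewrite gt_eqF.
lra.
Qed.

End iterate.
End kahane.

(** * The cavity recursion *)

Section pair_split.
Variables (n : nat) (i : 'I_n.+1).

(** On the left the pairs avoiding site i, relabelled by [lift i]; on the right the pairs joining i
    to another site, put in increasing order. *)
Definition pair_site (t : 'I_#|upper_pairs n| + 'I_n) : 'I_n.+1 * 'I_n.+1 :=
  match t with
  | inl k => (lift i (enum_val k).1, lift i (enum_val k).2)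
  | inr j => if (i < lift i j)%N then (i, lift i j) else (lift i j, i)
  end.

Lemma ltn_lift (a b : 'I_n) : (lift i a < lift i b)%N = (a < b)%N.
Proof. by rewrite /= !ltnNge leq_bump2. Qed.

Lemma pair_site_upper t : pair_site t \in upper_pairs n.+1.
Proof.
case: t => [k|j].
  by rewrite inE ltn_lift; have := enum_valP k; rewrite inE.
rewrite inE /=; case: ifP => [//|/negbT]; rewrite -leqNgt leq_eqVlt => /orP[/eqP E|//].
by have := neq_bump i j; rewrite E eqxx.
Qed.

Lemma pair_site_inj : injective pair_site.
Proof.
have bI (a b : 'I_n) : bump i a = bump i b -> a = b.
  by move=> /(can_inj (bumpK i))/val_inj.
have bN (a : 'I_n) : bump i a <> i by move=> E; have := neq_bump i a; rewrite E eqxx.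
move=> [k|j] [k'|j'] E; have := congr1 (fun p => val p.1) E;
  have := congr1 (fun p => val p.2) E; rewrite /=.
- move=> /bI E2 /bI E1; congr inl; apply: enum_val_inj.
  by rewrite [LHS]surjective_pairing [RHS]surjective_pairing E1 E2.
- by case: ifP => _ /= => [_ /bN|/bN].
- by case: ifP => _ /= => [_ /esym/bN|/esym/bN].
- case: ifP => _; case: ifP => _ /=.
  + by move=> /bI ->.
  + by move=> /bN.
  + by move=> /esym/bN.
  + by move=> _ /bI ->.
Qed.

Lemma pair_site_surj p : p \in upper_pairs n.+1 -> exists t, pair_site t = p.
Proof.
case: p => a b; rewrite inE /=.
case: (unliftP i a) => [a' ->|->]; case: (unliftP i b) => [b' ->|->].
- rewrite ltn_lift => ab; have abU : (a', b') \in upper_pairs n by rewrite inE.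
  exists (inl (enum_rank_in abU (a', b'))).
  by rewrite /= enum_rankK_in.
- move=> h; exists (inr a') => /=.
  by rewrite ltnNge (ltnW h).
- by move=> h; exists (inr b'); rewrite /= h.
- by rewrite ltnn.
Qed.

Definition join_pair t : 'I_#|upper_pairs n.+1| :=
  enum_rank_in (pair_site_upper t) (pair_site t).

Lemma enum_val_join t : enum_val (join_pair t) = pair_site t.
Proof. by rewrite enum_rankK_in// pair_site_upper. Qed.

Lemma join_pair_surj k : exists t, join_pair t == k.
Proof.
have [t tE] := pair_site_surj (enum_valP k).
by exists t; apply/eqP/enum_val_inj; rewrite enum_val_join.
Qed.

Definition split_pair k := xchoose (join_pair_surj k).

Lemma split_pairK : cancel split_pair join_pair.
Proof. by move=> k; apply/eqP/(xchooseP (join_pair_surj k)). Qed.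

Lemma join_pairK : cancel join_pair split_pair.
Proof.
move=> t; apply: pair_site_inj; rewrite -enum_val_join split_pairK.
exact: enum_val_join.
Qed.

Definition mergep (R : realType) (p : #|upper_pairs n|.-tuple R * n.-tuple R) :=
  merget split_pair p.

End pair_split.

Section model.
Context d (T : measurableType d) (R : realType) (P : probability T R).
Variables (c : T -> R) (K : R).
Hypotheses (mc : measurable_fun setT c) (cK : forall x, `|c x| <= K).
Variable s : R.
Hypothesis s0 : 0 <= s.

Let K0 : 0 <= K. Proof. exact: le_trans (cK point). Qed.

(** The signal of the model, with s for l / N held fixed while n grows, and with a bounded function
    c, later [clamp], of the spike. *)
Definition signal n (k : 'I_#|upper_pairs n|) (x : n.-tuple T) : R :=
  Num.sqrt s * (c (tnth x (enum_val k).1) * c (tnth x (enum_val k).2)).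

Definition cavity_row n (j : 'I_n) (z : T * n.-tuple T) : R :=
  Num.sqrt s * (c z.1 * c (tnth z.2 j)).

Definition overlap n (x y : n.-tuple T) : R := \sum_(i < n) c (tnth x i) * c (tnth y i).

Lemma measurable_entry n (j : 'I_n) : measurable_fun setT (fun x : n.-tuple T => c (tnth x j)).
Proof. exact: (measurableT_comp mc (measurable_tnth j)). Qed.

Lemma measurable_signal n k : measurable_fun setT (@signal n k).
Proof. by apply: measurable_funM => //; apply: measurable_funM; exact: measurable_entry. Qed.

Lemma measurable_cavity_row n j : measurable_fun setT (@cavity_row n j).
Proof.
apply: measurable_funM => //; apply: measurable_funM.
- exact: (measurableT_comp mc measurable_fst).
- exact: (measurableT_comp (measurable_entry j) measurable_snd).
Qed.

Lemma cc_le x y : `|c x * c y| <= K ^+ 2.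
Proof. by rewrite normrM expr2 ler_pM. Qed.

Lemma signal_le n k x : `|@signal n k x| <= Num.sqrt s * K ^+ 2.
Proof. by rewrite normrM (ger0_norm (sqrtr_ge0 s)) ler_wpM2l ?sqrtr_ge0// cc_le. Qed.

Lemma cavity_row_le n j z : `|@cavity_row n j z| <= Num.sqrt s * K ^+ 2.
Proof. by rewrite normrM (ger0_norm (sqrtr_ge0 s)) ler_wpM2l ?sqrtr_ge0// cc_le. Qed.

Lemma overlap_le n (x y : n.-tuple T) : `|overlap x y| <= n%:R * K ^+ 2.
Proof.
rewrite (le_trans (ler_norm_sum _ _ _))// mulr_natl -[in leRHS](card_ord n).
rewrite -sumr_const; apply: ler_sum => j _; exact: cc_le.
Qed.

Lemma ker_row n (z z' : T * n.-tuple T) :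
  ker (@cavity_row n) z z' = s * (c z.1 * c z'.1) * overlap z.2 z'.2.
Proof.
rewrite /ker /overlap mulr_sumr; apply: eq_bigr => j _; rewrite /cavity_row.
by rewrite -[in RHS](sqr_sqrtr s0); ring.
Qed.

Lemma ker_row_le n (z z' : T * n.-tuple T) :
  `|ker (@cavity_row n) z z'| <= s * n%:R * K ^+ 4.
Proof.
rewrite ker_row normrM normrM (ger0_norm s0).
have -> : s * n%:R * K ^+ 4 = s * K ^+ 2 * (n%:R * K ^+ 2) by ring.
apply: ler_pM; rewrite ?mulr_ge0//; last exact: overlap_le.
by rewrite ler_wpM2l// cc_le.
Qed.

Section insertion.
Variables (n : nat) (i : 'I_n.+1).

Lemma ov_insert (z z' : T * n.-tuple T) :
  overlap (insertt i z) (insertt i z') = c z.1 * c z'.1 + overlap z.2 z'.2.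
Proof.
rewrite /overlap (bigD1_ord i)//= !tnth_insertt; congr (_ + _).
by apply: eq_bigr => j _; rewrite !tnth_insertt_lift.
Qed.

Lemma sig_insert_l k (z : T * n.-tuple T) :
  signal (join_pair i (inl k)) (insertt i z) = signal k z.2.
Proof. by rewrite /signal enum_val_join /= !tnth_insertt_lift. Qed.

Lemma sig_insert_r j (z : T * n.-tuple T) :
  signal (join_pair i (inr j)) (insertt i z) = cavity_row j z.
Proof.
rewrite /signal enum_val_join /cavity_row /=; case: ifP => _ /=.
- by rewrite tnth_insertt tnth_insertt_lift.
- by rewrite tnth_insertt tnth_insertt_lift [in LHS](mulrC (c _)).
Qed.

Lemma amp_merge g (z : T * n.-tuple T) :
  amp (@signal n.+1) (mergep i g) (insertt i z) = amp (@signal n) g.1 z.2 * amp (@cavity_row n)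
    g.2 z.
Proof.
rewrite /amp -expRD; congr expR; rewrite /gexp.
rewrite (reindex (join_pair i))/=; last first.
  by exists (split_pair i) => t _; [exact: join_pairK|exact: split_pairK].
rewrite big_sumType /=; congr (_ + _); apply: eq_bigr => k _.
- by rewrite sig_insert_l (tnth_merget_l (@join_pairK _ i)).
- by rewrite sig_insert_r (tnth_merget_r (@join_pairK _ i)).
Qed.

End insertion.

End model.

(** * Posterior averages over two replicas *)

Section averages.
Context d (Z : measurableType d) (R : realType) (pi : probability Z R).
Variables (m : nat) (a : 'I_m -> Z -> R) (A : R).
Hypotheses (ma : forall k, measurable_fun setT (a k)) (aA : forall k z, `|a k z| <= A).
Implicit Types w : Z -> Z -> R.

Local Notation gam := (iid (std_normal R) m).
Let gg : gauge gam (@l1norm R m) := gauge_l1norm R m.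
Let g2 := gauge0 (pi \x pi)%E.

(** The observations have density L with respect to the noise and the posterior average is
    [pair_weight] / L^2; hence a single L in the denominator. The planted spike needs no separate
    treatment, being one more replica. *)
Definition av w := \int[gam]_g (pair_weight pi a w g / lik pi a g).

Lemma wav_prod w g : bd (fun p => w p.1 p.2) ->
  pair_weight pi a w g = \int[(pi \x pi)%E]_p (w p.1 p.2 * (amp a g p.1 * amp a g p.2)).
Proof.
move=> bw; have b := bd_wamp pi ma aA bw g.
by rewrite (fubini1 (gauge0 pi) (gauge0 pi) (bd_dm _ b)).
Qed.

Lemma wav_le w1 w2 g : bd (fun p => w1 p.1 p.2) -> bd (fun p => w2 p.1 p.2) ->
  (forall x y, w1 x y <= w2 x y) -> pair_weight pi a w1 g <= pair_weight pi a w2 g.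
Proof.
move=> b1 b2 h; rewrite !wav_prod//; apply: (int_le g2).
- exact: (bd_wamp pi ma aA b1).
- exact: (bd_wamp pi ma aA b2).
- by move=> p; rewrite ler_wpM2r// mulr_ge0// expR_ge0.
Qed.

Lemma wav_sum (I : Type) (r : seq I) (al : I -> R) (w : I -> Z -> Z -> R) g :
  (forall i, bd (fun p => w i p.1 p.2)) ->
  pair_weight pi a (fun x y => \sum_(i <- r) al i * w i x y) g =
  \sum_(i <- r) al i * pair_weight pi a (w i) g.
Proof.
move=> bw.
have bs : bd (fun p : Z * Z => \sum_(i <- r) al i * w i p.1 p.2).
  by apply: dm_sum => i; apply: dmZ; exact: bw.
rewrite (@wav_prod (fun x y => \sum_(i <- r) al i * w i x y) g bs).
transitivity (\int[(pi \x pi)%E]_p (\sum_(i <- r)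
    al i * (w i p.1 p.2 * (amp a g p.1 * amp a g p.2)))).
  by apply: eq_int => p; rewrite mulr_suml; apply: eq_bigr => i _; ring.
have b i := bd_wamp pi ma aA (bw i) g.
rewrite (int_sum g2); last by move=> i; apply: dmZ; exact: b.
by apply: eq_bigr => i _; rewrite (intZ g2); [rewrite wav_prod|exact: b].
Qed.

Lemma wav_mul (f f' : Z -> R) g : bd f -> bd f' ->
  pair_weight pi a (fun x y => f x * f' y) g =
  (\int[pi]_x (f x * amp a g x)) * (\int[pi]_x (f' x * amp a g x)).
Proof.
move=> bf bf'; have ba := bd_amp pi ma aA g.
rewrite -(intZr (gauge0 pi)); last exact: dmM.
apply: eq_int => x; rewrite -(intZ (gauge0 pi)); last exact: dmM.
by apply: eq_int => y; ring.
Qed.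

Lemma wav_cst (k : R) g : pair_weight pi a (fun _ _ => k) g = k * lik pi a g ^+ 2.
Proof.
have := @wav_mul (fun=> k) (fun=> 1) g (dm_cst _ _) (dm_cst _ _).
transitivity (pair_weight pi a (fun _ _ => k * 1) g); first by rewrite mulr1.
rewrite H; rewrite (intZ (gauge0 pi)); last exact: (bd_amp pi ma aA).
rewrite expr2 mulrA; congr (_ * _).
by apply: eq_int => x; rewrite mul1r.
Qed.

Lemma dm_wavlik w : bd (fun p => w p.1 p.2) ->
  dm (@l1norm R m) (fun g => pair_weight pi a w g / lik pi a g).
Proof. by move=> bw; apply: dmM; [exact: dm_wav bw|exact: (dm_invlik pi ma aA)]. Qed.

Lemma av_le w1 w2 : bd (fun p => w1 p.1 p.2) -> bd (fun p => w2 p.1 p.2) ->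
  (forall x y, w1 x y <= w2 x y) -> av w1 <= av w2.
Proof.
move=> b1 b2 h; apply: (int_le gg); [exact: dm_wavlik|exact: dm_wavlik|].
move=> g; rewrite ler_pM2r ?invr_gt0 ?(lik_gt0 pi ma aA)//.
exact: wav_le.
Qed.

Lemma av_sum (I : Type) (r : seq I) (al : I -> R) (w : I -> Z -> Z -> R) :
  (forall i, bd (fun p => w i p.1 p.2)) ->
  av (fun x y => \sum_(i <- r) al i * w i x y) = \sum_(i <- r) al i * av (w i).
Proof.
move=> bw.
transitivity (\int[gam]_g (\sum_(i <- r) al i * (pair_weight pi a (w i) g / lik pi a g))).
  apply: eq_int => g; rewrite wav_sum// mulr_suml.
  by apply: eq_bigr => i _; rewrite mulrA.
rewrite (int_sum gg); last by move=> i; apply: dmZ; exact: dm_wavlik.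
by apply: eq_bigr => i _; rewrite (intZ gg)//; exact: dm_wavlik.
Qed.

Lemma av_cst (k : R) : av (fun _ _ => k) = k.
Proof.
transitivity (\int[gam]_g (k * lik pi a g)).
  apply: eq_int => g; rewrite wav_cst; field.
  by rewrite gt_eqF// (lik_gt0 pi ma aA).
by rewrite (intZ gg) ?(int_lik1 pi ma aA) ?mulr1//; exact: (dm_lik pi ma aA).
Qed.

Lemma eq_av w1 w2 : (forall x y, w1 x y = w2 x y) -> av w1 = av w2.
Proof. by move=> h; congr av; apply/funext => x; apply/funext => y. Qed.

End averages.

Section product_integrals.
Context d1 d2 (T1 : measurableType d1) (T2 : measurableType d2) (R : realType).
Variables (mu1 : probability T1 R) (mu2 : probability T2 R).

Lemma int_prod_mul (f1 : T1 -> R) (f2 : T2 -> R) : bd f1 -> bd f2 ->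
  \int[(mu1 \x mu2)%E]_p (f1 p.1 * f2 p.2) = (\int[mu1]_x f1 x) * (\int[mu2]_x f2 x).
Proof.
move=> b1 b2.
have b : bd (fun p : T1 * T2 => f1 p.1 * f2 p.2).
  by apply: dmM; [exact: (bd_comp measurable_fst b1)|exact: (bd_comp measurable_snd b2)].
rewrite (fubini1 (gauge0 mu1) (gauge0 mu2) (bd_dm _ b)) -(intZr (gauge0 mu1))//.
by apply: eq_int => x; rewrite -(intZ (gauge0 mu2)).
Qed.

End product_integrals.

Section cavity.
Context d (T : measurableType d) (R : realType) (P : probability T R).
Variables (c : T -> R) (K : R).
Hypotheses (mc : measurable_fun setT c) (cK : forall x, `|c x| <= K).
Hypotheses (cint0 : \int[P]_x c x = 0) (cint1 : \int[P]_x c x ^+ 2 = 1).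
Variable s : R.
Hypothesis s0 : 0 <= s.

Local Notation gam m := (iid (std_normal R) m).
Local Notation sg := (signal c s).
Local Notation rw := (cavity_row c s).

Let ms n k := @measurable_signal _ T R c mc s n k.
Let sK n k x := @signal_le _ T R c K cK s n k x.
Let mr n j := @measurable_cavity_row _ T R c mc s n j.
Let rK n j z := @cavity_row_le _ T R c K cK s n j z.

Variable n : nat.
Local Notation mu := (iid P n).
Local Notation L := (lik mu (@sg n)).
Local Notation Pmu := (P \x mu)%E.

Let dL : dm (@l1norm R #|upper_pairs n|) L := dm_lik mu (@ms n) (@sK n).
Let L0 g : 0 < L g := lik_gt0 mu (@ms n) (@sK n) g.
Let gP := gauge0 Pmu.

(** The prior of the channel of the added site: a fresh coordinate of law P together with,
    independently, n spikes drawn from the posterior given g. *)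
Definition posterior (g : #|upper_pairs n|.-tuple R)
    (nu : probability (T * n.-tuple T)%type R) :=
  forall h, measurable_fun setT h ->
    \int[nu]_z h z = \int[Pmu]_z (h z * (amp (@sg n) g z.2 / L g)).

Let bdens g : bd (fun z : T * n.-tuple T => amp (@sg n) g z.2 / L g).
Proof.
apply: dmM; last exact: dm_cst.
exact: (bd_comp measurable_snd (bd_amp mu (@ms n) (@sK n) g)).
Qed.

Lemma ex_posterior g : exists nu, posterior g nu.
Proof.
apply: ex_density.
- by case: (bdens g).
- by move=> z; rewrite divr_ge0 ?expR_ge0// ltW.
- exact: (dm_integrable gP (bdens g)).
- have ba := bd_amp mu (@ms n) (@sK n) g.
  have b1 : bd (fun _ : T => 1 : R) by exact: dm_cst.
  have b2 : bd (fun x => amp (@sg n) g x / L g).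
    by apply: dmM; [exact: ba|exact: dm_cst].
  transitivity ((\int[P]_x 1) * \int[mu]_x (amp (@sg n) g x / L g)); last first.
    by rewrite int_cst mul1r (intZr (gauge0 mu)) ?mulfV// -/(lik _ _ _) gt_eqF.
  rewrite -(int_prod_mul P mu b1 b2).
  by apply: eq_int => z /=; rewrite mul1r.
Qed.

Section at_posterior.
Variables (g : #|upper_pairs n|.-tuple R) (nu : probability (T * n.-tuple T)%type R).
Hypothesis nuE : posterior g nu.

Lemma int_posterior h : bd h ->
  \int[Pmu]_z (h z * amp (@sg n) g z.2) = L g * \int[nu]_z h z.
Proof.
move=> bh; rewrite nuE; last by case: bh.
rewrite -(intZ gP); last by apply: dmM; [exact: bh|exact: bdens].
by apply: eq_int => z; field; rewrite gt_eqF.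
Qed.

Definition gibbs (F : n.-tuple T -> n.-tuple T -> R) := pair_weight mu (@sg n) F g / L g ^+ 2.

Definition signal_moment k := \int[P]_x c x ^+ k.

Lemma bd_c : bd c. Proof. exact: bdI mc cK. Qed.

(** The fresh coordinate is independent of the other spikes, and the two replicas of it are
    independent of each other, hence the squared moment. *)
Lemma posterior_mom k F : bd (fun p => F p.1 p.2) ->
  \int[nu]_z \int[nu]_z' ((c z.1 * c z'.1) ^+ k * F z.2 z'.2) = signal_moment k ^+ 2 * gibbs F.
Proof.
move=> bF.
have bck : bd (fun x => c x ^+ k) by apply: dmX; exact: bd_c.
have ba := bd_amp mu (@ms n) (@sK n) g.
have bFx x : bd (F x) by exact: (bd_comp (pair1_measurable x) bF).
have bal : bd (fun y => amp (@sg n) g y / L g).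
  by apply: dmM; [exact: ba|exact: dm_cst].
have bFa x : bd (fun y => F x y * (amp (@sg n) g y / L g)).
  by apply: dmM; [exact: bFx|exact: bal].
have bFF : bd (fun p : n.-tuple T * n.-tuple T => F p.1 p.2 * (amp (@sg n) g p.2 / L g)).
  by apply: dmM; [exact: bF|exact: (bd_comp measurable_snd bal)].
have bG : bd (fun x => \int[mu]_y (F x y * (amp (@sg n) g y / L g))).
  exact: (dm_int2 (gauge0 mu) (gauge0 mu) (bd_dm _ bFF)).
have tilted_lik z : \int[nu]_z' ((c z.1 * c z'.1) ^+ k * F z.2 z'.2) =
    c z.1 ^+ k * (signal_moment k * \int[mu]_y (F z.2 y * (amp (@sg n) g y / L g))).
  rewrite -(int_prod_mul P mu bck (bFa z.2)) -(intZ gP); last first.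
    by apply: dmM; [exact: (bd_comp measurable_fst bck)|
      exact: (bd_comp measurable_snd (bFa z.2))].
  rewrite nuE.
    by apply: eq_int => z'; rewrite exprMn; ring.
  apply: measurable_funM.
    apply: measurable_funX; apply: measurable_funM => //.
    exact: (measurableT_comp mc measurable_fst).
  by case: (bFx z.2) => mF _; exact: (measurableT_comp mF measurable_snd).
transitivity (\int[nu]_z (c z.1 ^+ k * (signal_moment k *
   \int[mu]_y (F z.2 y * (amp (@sg n) g y / L g))))); first exact: eq_int.
have bG' : bd (fun x => signal_moment k * \int[mu]_y (F x y * (amp (@sg n) g y / L g))).
  exact: dmZ.
rewrite nuE; last first.
  case: bck bG' => mck _ [mG' _]; apply: measurable_funM.
  - exact: (measurableT_comp mck measurable_fst).
  - exact: (measurableT_comp mG' measurable_snd).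
have bH : bd (fun x => signal_moment k * \int[mu]_y (F x y * (amp (@sg n) g y / L g)) *
    (amp (@sg n) g x / L g)) by apply: dmM; [exact: bG'|exact: bal].
transitivity (signal_moment k * \int[mu]_x (signal_moment k * \int[mu]_y (F x y * (amp (@sg n) g
  y / L g)) *
    (amp (@sg n) g x / L g))).
  rewrite -(int_prod_mul P mu bck bH); apply: eq_int => z /=; ring.
rewrite expr2 -mulrA; congr (_ * _); rewrite /gibbs.
transitivity (\int[mu]_x (signal_moment k / L g ^+ 2 *
   \int[mu]_y (F x y * (amp (@sg n) g x * amp (@sg n) g y)))).
  apply: eq_int => x; have bx : bd (fun y => F x y * amp (@sg n) g y).
    by apply: dmM; [exact: bFx|exact: ba].
  transitivity (signal_moment k / L g ^+ 2 * (amp (@sg n) g x *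
      \int[mu]_y (F x y * amp (@sg n) g y))).
    transitivity (signal_moment k * (\int[mu]_y (F x y * amp (@sg n) g y) / L g) *
      (amp (@sg n) g x / L g)); last by field; rewrite gt_eqF.
    congr (_ * _ * _); rewrite -(intZr (gauge0 mu))//.
    by apply: eq_int => y; rewrite mulrA.
  congr (_ * _); rewrite -(intZ (gauge0 mu))//.
  by apply: eq_int => y; ring.
rewrite (intZ (gauge0 mu)) /pair_weight; first by ring.
exact: (dm_int2 (gauge0 mu) (gauge0 mu) (bd_dm _ (bd_wamp mu (@ms n) (@sK n) bF g))).
Qed.

End at_posterior.
End cavity.

Section cavity_identity.
Context d (T : measurableType d) (R : realType) (P : probability T R).
Variables (c : T -> R) (K : R).
Hypotheses (mc : measurable_fun setT c) (cK : forall x, `|c x| <= K).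
Variable s : R.
Variables (n : nat) (i : 'I_n.+1).

Local Notation gam m := (iid (std_normal R) m).
Local Notation sg := (signal c s).
Local Notation rw := (cavity_row c s).
Local Notation mu := (iid P n).
Local Notation mu' := (iid P n.+1).
Local Notation L := (lik mu (@sg n)).
Local Notation Pmu := (P \x mu)%E.

Let ms k j := @measurable_signal _ T R c mc s k j.
Let sK k j x := @signal_le _ T R c K cK s k j x.
Let mr j := @measurable_cavity_row _ T R c mc s n j.
Let rK j z := @cavity_row_le _ T R c K cK s n j z.

Lemma int_insert F : bd F ->
  \int[mu']_x F x = \int[Pmu]_z F (insertt i z).
Proof.
move=> bF; rewrite -(int_iid_insert (i := i))//; first by case: bF.
apply: (dm_integrable (gauge0 _)).
exact: (bd_comp (measurable_insertt i) bF).
Qed.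

Lemma dm_merge F : dm (@l1norm R #|upper_pairs n.+1|) F ->
  dm (prodG (@l1norm R #|upper_pairs n|) (@l1norm R n)) (fun g => F (mergep i g)).
Proof.
move=> dF; apply: (dm_comp (B := 1) (phi := mergep (R := R) i) _ _ dF).
  exact: measurable_merget.
move=> g; rewrite mul1r /prodG.
suff -> : l1norm (mergep i g) = l1norm g.1 + l1norm g.2 by rewrite lerDr.
rewrite /l1norm /iidG (reindex (join_pair i))/=; last first.
  by exists (split_pair i) => t _; [exact: join_pairK|exact: split_pairK].
rewrite big_sumType /=; congr (_ + _); apply: eq_bigr => k _.
- by rewrite (tnth_merget_l (@join_pairK _ i)).
- by rewrite (tnth_merget_r (@join_pairK _ i)).
Qed.

Lemma int_merge F : dm (@l1norm R #|upper_pairs n.+1|) F ->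
  \int[gam #|upper_pairs n.+1|]_g F g =
  \int[gam #|upper_pairs n|]_g \int[gam n]_g' F (mergep i (g, g')).
Proof.
move=> dF; rewrite -(int_iid_merge (@split_pairK n i) (@join_pairK n i)).
- exact: (fubini1 (gauge_l1norm R _) (gauge_l1norm R _) (dm_merge dF)).
- by case: dF.
- apply: (dm_integrable (gauge_prod (gauge_l1norm R _) (gauge_l1norm R _))).
  exact: (dm_merge dF).
Qed.

(** Bayes: the new row is observed under the posterior given the former observations, so the
    likelihood ratios multiply. *)
Lemma lik_merge g nu : posterior P c s g.1 nu ->
  lik mu' (@sg n.+1) (mergep i g) = L g.1 * lik nu (@rw n) g.2.
Proof.
move=> nuE; rewrite /lik (int_insert (bd_amp mu' (ms (k := n.+1)) (sK (k := n.+1)) _)).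
rewrite -/(lik nu _ _) -(int_posterior mc cK nuE (bd_amp nu mr rK g.2)).
by apply: eq_int => z; rewrite amp_merge mulrC.
Qed.

Lemma bd_insert2 (W : n.+1.-tuple T -> n.+1.-tuple T -> R) :
  bd (fun p => W p.1 p.2) ->
  bd (fun p : (T * n.-tuple T) * (T * n.-tuple T) => W (insertt i p.1) (insertt i p.2)).
Proof.
move=> bW; apply: (bd_comp (phi := fun p : (T * n.-tuple T) * (T * n.-tuple T) =>
  (insertt i p.1, insertt i p.2)) _ bW).
apply: measurable_fun_pair.
- exact: (measurableT_comp (measurable_insertt i) measurable_fst).
- exact: (measurableT_comp (measurable_insertt i) measurable_snd).
Qed.

Lemma wav_merge W g nu : posterior P c s g.1 nu -> bd (fun p => W p.1 p.2) ->
  pair_weight mu' (@sg n.+1) W (mergep i g) =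
  L g.1 ^+ 2 * pair_weight nu (@rw n) (fun z z' => W (insertt i z) (insertt i z')) g.2.
Proof.
move=> nuE bW; have bW' := bd_insert2 bW.
have b := bd_wamp mu' (ms (k := n.+1)) (sK (k := n.+1)) bW (mergep i g).
have b' := bd_wamp nu mr rK (w := fun z z' => W (insertt i z) (insertt i z')) bW' g.2.
have bi := dm_int2 (gauge0 mu') (gauge0 mu') (bd_dm _ b).
have bi' := dm_int2 (gauge0 nu) (gauge0 nu) (bd_dm _ b').
rewrite /pair_weight (int_insert bi).
transitivity (\int[Pmu]_z ((L g.1 * \int[nu]_z' (W (insertt i z) (insertt i z') *
    (amp (@rw n) g.2 z * amp (@rw n) g.2 z'))) * amp (@sg n) g.1 z.2)).
  apply: eq_int => z.
  have bz : bd (fun z' : T * n.-tuple T => W (insertt i z) (insertt i z') *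
      (amp (@rw n) g.2 z * amp (@rw n) g.2 z')).
    exact: (bd_comp (pair1_measurable z) b').
  have bzz : bd (fun z' : T * n.-tuple T => amp (@sg n) g.1 z.2 *
     (W (insertt i z) (insertt i z') * (amp (@rw n) g.2 z * amp (@rw n) g.2 z'))).
    exact: dmZ.
  rewrite (int_insert (bd_comp (pair1_measurable (insertt i z)) b)).
  transitivity (\int[Pmu]_z' ((amp (@sg n) g.1 z.2 *
     (W (insertt i z) (insertt i z') * (amp (@rw n) g.2 z * amp (@rw n) g.2 z'))) *
     amp (@sg n) g.1 z'.2)).
    by apply: eq_int => z' /=; rewrite !amp_merge; ring.
  rewrite (int_posterior mc cK nuE bzz) (intZ (gauge0 nu))//; ring.
have biZ : bd (fun z => L g.1 * \int[nu]_z' (W (insertt i z) (insertt i z') *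
    (amp (@rw n) g.2 z * amp (@rw n) g.2 z'))) by exact: dmZ.
by rewrite (int_posterior mc cK nuE biZ) (intZ (gauge0 nu))// expr2 mulrA.
Qed.

(** The posterior nu is taken for each g separately, and only M g and E g are integrated; thus nu
    need not be chosen measurably in g. *)
Lemma av_site (W : n.+1.-tuple T -> n.+1.-tuple T -> R) M E :
  bd (fun p => W p.1 p.2) ->
  dm (@l1norm R _) (fun g => L g * M g) -> dm (@l1norm R _) (fun g => L g * E g) ->
  (forall g nu, posterior P c s g nu ->
    `|av nu (@rw n) (fun z z' => W (insertt i z) (insertt i z')) - M g| <= E g) ->
  `|av mu' (@sg n.+1) W - \int[gam _]_g (L g * M g)| <= \int[gam _]_g (L g * E g).
Proof.
move=> bW dM dE h.
have dWL := dm_wavlik mu' (ms (k := n.+1)) (sK (k := n.+1)) bW.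
have gg := gauge_l1norm R #|upper_pairs n|; have g1 := gauge_l1norm R n.
have dI := dm_int2 gg g1 (dm_merge dWL).
rewrite /av (int_merge dWL) -(intB gg)//; apply: (int_norm_le gg) => //.
  exact: dmB.
move=> g; have [nu nuE] := ex_posterior P mc cK s g.
have L0 := lik_gt0 mu (ms (k := n)) (sK (k := n)) g.
have -> : \int[gam n]_g' (pair_weight mu' (@sg n.+1) W (mergep i (g, g')) /
    lik mu' (@sg n.+1) (mergep i (g, g'))) =
    L g * av nu (@rw n) (fun z z' => W (insertt i z) (insertt i z')).
  have bW' := bd_insert2 bW.
  rewrite -(intZ g1); last exact: (dm_wavlik nu mr rK (w :=
    fun z z' => W (insertt i z) (insertt i z')) bW').
  apply: eq_int => g'; rewrite (@wav_merge W (g, g') nu nuE bW).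
  rewrite (@lik_merge (g, g') nu nuE)/=.
  have l0 := lik_gt0 nu mr rK g'.
  by field; rewrite !gt_eqF.
by rewrite -mulrBr normrM (gtr0_norm L0) ler_pM2l// h.
Qed.

(** The chain rule of relative entropy: L l ln (L l) = l (L ln L) + L (l ln l), where the likelihood
    ratio l of the row has mean 1. *)
Lemma entropy_site H : dm (@l1norm R _) (fun g => L g * H g) ->
  forall E, dm (@l1norm R _) (fun g => L g * E g) ->
  (forall g nu, posterior P c s g nu ->
    `|\int[gam n]_g' (lik nu (@rw n) g' * ln (lik nu (@rw n) g')) - H g| <= E g) ->
  `|\int[gam _]_g (lik mu' (@sg n.+1) g * ln (lik mu' (@sg n.+1) g)) -
    \int[gam _]_g (L g * ln (L g)) - \int[gam _]_g (L g * H g)| <=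
  \int[gam _]_g (L g * E g).
Proof.
move=> dH E dE h.
have dl := dm_liklnlik mu' (ms (k := n.+1)) (sK (k := n.+1)).
have dl0 := dm_liklnlik mu (ms (k := n)) (sK (k := n)).
have gg := gauge_l1norm R #|upper_pairs n|; have g1 := gauge_l1norm R n.
have dI := dm_int2 gg g1 (dm_merge dl).
rewrite (int_merge dl) -!(intB gg)//; last exact: dmB.
apply: (int_norm_le gg) => //; first by apply: dmB => //; exact: dmB.
move=> g; have [nu nuE] := ex_posterior P mc cK s g.
have L0 := lik_gt0 mu (ms (k := n)) (sK (k := n)) g.
have dln := dm_liklnlik nu mr rK.
have dlk := dm_lik nu mr rK.
have -> : \int[gam n]_g' (lik mu' (@sg n.+1) (mergep i (g, g')) *
    ln (lik mu' (@sg n.+1) (mergep i (g, g')))) = L g * ln (L g) +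
    L g * \int[gam n]_g' (lik nu (@rw n) g' * ln (lik nu (@rw n) g')).
  transitivity (\int[gam n]_g' (L g * ln (L g) * lik nu (@rw n) g' +
     L g * (lik nu (@rw n) g' * ln (lik nu (@rw n) g')))).
    apply: eq_int => g'; rewrite (@lik_merge (g, g') nu nuE)/=.
    have l0 := lik_gt0 nu mr rK g'.
    by rewrite lnM ?posrE//; ring.
  rewrite (intD g1); [|exact: dmZ|exact: dmZ].
  by rewrite !(intZ g1)// (int_lik1 nu mr rK) mulr1.
rewrite [X in `|X| <= _](_ : _ = L g *
  (\int[gam n]_g' (lik nu (@rw n) g' * ln (lik nu (@rw n) g')) - H g)); last by ring.
rewrite normrM (gtr0_norm L0) ler_pM2l//.
exact: h.
Qed.

End cavity_identity.

(** * Expansion of the channel of an added site *)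

Section cavity_expansion.
Context d (T : measurableType d) (R : realType) (P : probability T R).
Variables (c : T -> R) (K : R).
Hypotheses (mc : measurable_fun setT c) (cK : forall x, `|c x| <= K).
Hypotheses (cint0 : \int[P]_x c x = 0) (cint1 : \int[P]_x c x ^+ 2 = 1).
Variables (s l : R).
Hypotheses (s0 : 0 <= s).

Local Notation gam m := (iid (std_normal R) m).
Local Notation sg := (signal c s).
Local Notation rw := (cavity_row c s).

Let ms k j := @measurable_signal _ T R c mc s k j.
Let sK k j x := @signal_le _ T R c K cK s k j x.
Let mr k j := @measurable_cavity_row _ T R c mc s k j.
Let rK k j z := @cavity_row_le _ T R c K cK s k j z.
Let K0 : 0 <= K. Proof. exact: le_trans (cK point). Qed.

Definition overlap_moment n p := av (iid P n) (@sg n) (fun x y => overlap c x y ^+ p).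
Definition abs_moment n p := av (iid P n) (@sg n) (fun x y => `|overlap c x y| ^+ p).
Definition model_entropy n := \int[gam #|upper_pairs n|]_g
  (lik (iid P n) (@sg n) g * ln (lik (iid P n) (@sg n) g)).

Lemma bd_ov n : bd (fun p : n.-tuple T * n.-tuple T => overlap c p.1 p.2).
Proof.
apply: dm_sum => j; apply: dmM.
- exact: (bd_comp measurable_fst (bd_comp (measurable_tnth j) (bd_c mc cK))).
- exact: (bd_comp measurable_snd (bd_comp (measurable_tnth j) (bd_c mc cK))).
Qed.

Lemma bd_ovX n p : bd (fun q : n.-tuple T * n.-tuple T => overlap c q.1 q.2 ^+ p).
Proof. by apply: dmX; exact: bd_ov. Qed.

Lemma bd_ovaX n p : bd (fun q : n.-tuple T * n.-tuple T => `|overlap c q.1 q.2| ^+ p).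
Proof. by apply: dmX; apply: dm_norm; exact: bd_ov. Qed.

Variable n : nat.
Hypothesis sn : s * n%:R <= l.

Local Notation mu := (iid P n).
Local Notation L := (lik mu (@sg n)).
Local Notation B := (l * K ^+ 4).
Local Notation Sp p := (fun x y : n.-tuple T => overlap c x y ^+ p).
Local Notation Sa p := (fun x y : n.-tuple T => `|overlap c x y| ^+ p).

Let kB z z' : `|ker (@rw n) z z'| <= B.
Proof.
rewrite (le_trans (ker_row_le cK s0 _ _))// ler_wpM2r// exprn_even_ge0//.
Qed.

Section at_posterior.
Variables (g : #|upper_pairs n|.-tuple R) (nu : probability (T * n.-tuple T)%type R).
Hypothesis nuE : posterior P c s g nu.
Local Notation gibbs := (gibbs P c s g).

Let gi := gauge0 (iid nu 4).

(** The zero mean of P centers the row whatever the posterior of the other spikes, which is what the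
    channel expansions require. *)
Lemma row0 k : \int[nu]_z rw k z = 0.
Proof.
have bc := bd_c mc cK.
have ba := bd_amp mu (@ms n) (@sK n) g.
rewrite nuE; last exact: mr.
have bs : bd (fun x => c (tnth x k) * (amp (@sg n) g x / L g)).
  apply: dmM; first exact: (bd_comp (measurable_tnth k) bc).
  by apply: dmM; [exact: ba|exact: dm_cst].
transitivity (\int[P]_x (Num.sqrt s * c x) *
   \int[mu]_x (c (tnth x k) * (amp (@sg n) g x / L g))).
  rewrite -(int_prod_mul P mu (dmZ (Num.sqrt s) bc) bs).
  by apply: eq_int => z; rewrite /cavity_row; ring.
by rewrite (intZ (gauge0 P))// cint0 mulr0 mul0r.
Qed.

Lemma br_ge0 F : (forall x y, 0 <= F x y) -> 0 <= gibbs F.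
Proof.
move=> F0; rewrite divr_ge0 ?sqr_ge0//; apply: int_ge0 => x; apply: int_ge0 => y.
by rewrite mulr_ge0// mulr_ge0// expR_ge0.
Qed.

Lemma bd_lift2 (F : n.-tuple T -> n.-tuple T -> R) : bd (fun p => F p.1 p.2) ->
  bd (fun p : (T * n.-tuple T) * (T * n.-tuple T) => F p.1.2 p.2.2).
Proof.
move=> bF; apply: (bd_comp (phi := fun p : (T * n.-tuple T) * (T * n.-tuple T) =>
  (p.1.2, p.2.2)) _ bF).
by apply: measurable_fun_pair;
  [exact: (measurableT_comp measurable_snd measurable_fst)|
   exact: (measurableT_comp measurable_snd measurable_snd)].
Qed.

Lemma bd_cc : bd (fun p : (T * n.-tuple T) * (T * n.-tuple T) => c p.1.1 * c p.2.1).
Proof.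
have bc := bd_c mc cK; apply: dmM.
- apply: (bd_comp _ bc); exact: (measurableT_comp measurable_fst measurable_fst).
- apply: (bd_comp _ bc); exact: (measurableT_comp measurable_fst measurable_snd).
Qed.

Lemma int_mom4 (i j : 'I_4) k (F : n.-tuple T -> n.-tuple T -> R) : i !=
  j -> bd (fun p => F p.1 p.2) ->
  \int[iid nu 4]_t ((c (tnth t i).1 * c (tnth t j).1) ^+ k *
     F (tnth t i).2 (tnth t j).2) = signal_moment P c k ^+ 2 * gibbs F.
Proof.
move=> ij bF; rewrite -(posterior_mom mc cK nuE k bF).
apply: (int_pair_marg (f := fun z z' : T * n.-tuple T =>
  (c z.1 * c z'.1) ^+ k * F z.2 z'.2) nu ij).
by apply: dmM; [apply: dmX; exact: bd_cc|exact: bd_lift2].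
Qed.

Lemma int_br4 (i j : 'I_4) (F : n.-tuple T -> n.-tuple T -> R) : i !=
  j -> bd (fun p => F p.1 p.2) ->
  \int[iid nu 4]_t F (tnth t i).2 (tnth t j).2 = gibbs F.
Proof.
move=> ij bF; have := int_mom4 0 ij bF.
rewrite /signal_moment; under eq_int do rewrite expr0 mul1r.
by move=> ->; rewrite int_cst expr1n mul1r.
Qed.

Lemma bd_br4 (i j : 'I_4) (F : n.-tuple T -> n.-tuple T -> R) : bd (fun p : n.-tuple T * n.-tuple
  T => F p.1 p.2) ->
  bd (fun t : 4.-tuple (T * n.-tuple T) => F (tnth t i).2 (tnth t j).2).
Proof.
move=> bF; exact: (bd_tnth2 (f := fun z z' : T * n.-tuple T => F z.2 z'.2) i j (bd_lift2 bF)).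
Qed.

Lemma qq_le p i j t : `|ker_at (@rw n) i j t| ^+ p <=
  s ^+ p * K ^+ (2 * p) * `|overlap c (tnth t i).2 (tnth t j).2| ^+ p.
Proof.
rewrite /ker_at (ker_row _ s0) exprM -!exprMn; apply: lerXn2r; rewrite ?nnegrE//.
  by rewrite !mulr_ge0// exprn_even_ge0.
rewrite (normrM (_ * _) (overlap _ _ _)) (normrM s) (ger0_norm s0) ler_wpM2r// ler_wpM2l//.
exact: cc_le.
Qed.

Lemma dist_comb (x y z u v e X S : R) : `|x - y| <= v * u -> u <= 12 * X * S ->
  0 <= v -> `|y - z| <= e * X * S -> `|x - z| <= (12 * v + e) * X * S.
Proof.
move=> h1 h2 v0 h3; have := ler_wpM2l v0 h2; have := ler_distD y x z; lra.
Qed.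

Lemma powM2_le p (a b : R) : 0 <= a -> 0 <= b ->
  a ^+ p * b ^+ 2 <= a ^+ (p + 2) + b ^+ (p + 2).
Proof.
move=> a0 b0; have [ab|/ltW ba] := leP a b.
  rewrite (@le_trans _ _ (b ^+ (p + 2)))// ?lerDr ?exprn_ge0//.
  rewrite exprD ler_wpM2r ?exprn_ge0//.
  exact: lerXn2r.
rewrite (@le_trans _ _ (a ^+ (p + 2)))// ?lerDl ?exprn_ge0//.
rewrite exprD ler_wpM2l ?exprn_ge0//.
exact: lerXn2r.
Qed.

Definition pairs4 := [:: (o0, o1); (o0, o2); (o1, o2); (o0, o3); (o1, o3); (o2, o3)].
Lemma l6P e : e \in pairs4 -> e.1 != e.2.
Proof. by rewrite !inE => /or4P[/eqP->|/eqP->|/eqP->|/or3P[/eqP->|/eqP->|/eqP->]]. Qed.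

Lemma sabs_sum p t :
  sabs (@rw n) p t = \sum_(e <- pairs4) `|ker_at (@rw n) e.1 e.2 t| ^+ p.
Proof. by rewrite /pairs4 !big_cons big_nil /sabs /= addr0 !addrA. Qed.

Section weight.
Variables (w : T * n.-tuple T -> T * n.-tuple T -> R) (p : nat) (M : R).
Hypotheses (bw : bd (fun q => w q.1 q.2)) (M0 : 0 <= M).
Hypothesis wM : forall z z', `|w z z'| <= M * (`|overlap c z.2 z'.2| ^+ p + 1).

(** Each of the six pairs contributes at most 2 <|Q|^(p+2)> + <Q^2>, whence the factor 12. *)
Lemma row_sabs2 : \int[iid nu 4]_t (`|w01 w t| * sabs (@rw n) 2 t) <=
  12 * (M * (s ^+ 2 * K ^+ 4)) * (gibbs (Sa (p + 2)) + gibbs (Sa 2)).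
Proof.
pose D (e : 'I_4 * 'I_4) (t : 4.-tuple (T * n.-tuple T)) :=
  `|overlap c (tnth t o0).2 (tnth t o1).2| ^+ (p + 2) +
  `|overlap c (tnth t e.1).2 (tnth t e.2).2| ^+ (p + 2) +
  `|overlap c (tnth t e.1).2 (tnth t e.2).2| ^+ 2.
have bS k (i j : 'I_4) : bd (fun t : 4.-tuple (T * n.-tuple T) =>
    `|overlap c (tnth t i).2 (tnth t j).2| ^+ k).
  exact: (bd_br4 i j (F := Sa k) (bd_ovaX n k)).
have bD e : bd (D e) by apply: dmD; [apply: dmD|]; exact: bS.
have mrn := @mr n; have rKn := @rK n.
apply: (@le_trans _ _ (\int[iid nu 4]_t
    (M * (s ^+ 2 * K ^+ 4) * \sum_(e <- pairs4) D e t))).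
  apply: (int_le gi).
  - apply: dmM; first by apply: dm_norm; exact: (bd_w01 bw).
    exact: (bd_sabs mrn rKn).
  - by apply: dmZ; apply: dm_sum => e; exact: bD.
  move=> t; have wt := wM (tnth t o0) (tnth t o1).
  rewrite -/(w01 w t) in wt.
  have q i j := qq_le 2 i j t.
  rewrite sabs_sum mulr_sumr mulr_sumr; apply: ler_sum => e _.
  apply: (@le_trans _ _ (M * (`|overlap c (tnth t o0).2 (tnth t o1).2| ^+ p + 1) *
    (s ^+ 2 * K ^+ 4 * `|overlap c (tnth t e.1).2 (tnth t e.2).2| ^+ 2))).
    by apply: ler_pM.
  rewrite [leLHS](_ : _ = M * (s ^+ 2 * K ^+ 4) *
    (`|overlap c (tnth t o0).2 (tnth t o1).2| ^+ p * `|overlap c (tnth t e.1).2 (tnth t e.2).2|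
      ^+ 2 +
     `|overlap c (tnth t e.1).2 (tnth t e.2).2| ^+ 2)); last by ring.
  apply: ler_wpM2l.
    by rewrite mulr_ge0// mulr_ge0 ?exprn_even_ge0.
  by rewrite lerD2r; apply: powM2_le.
rewrite (intZ gi); last by apply: dm_sum => e; exact: bD.
rewrite (int_sum gi); last exact: bD.
have E x y : 12 * x * y = x * (12 * y) :> R by ring.
rewrite E; apply: ler_wpM2l.
  by rewrite mulr_ge0// mulr_ge0 ?exprn_even_ge0.
have b2 := br_ge0 (F := Sa 2) (fun x y => exprn_ge0 2 (normr_ge0 _)).
rewrite (_ : \sum_(e <- pairs4) _ = \sum_(e <- pairs4) (2 * gibbs (Sa (p + 2)) + gibbs (Sa 2))).
  move: b2; move: (gibbs (Sa (p + 2))) (gibbs (Sa 2)) => x y y0.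
  by rewrite /pairs4 !big_cons big_nil; lra.
apply: eq_big_seq => e /l6P eP.
rewrite (intD gi); [|by apply: dmD; exact: bS|exact: bS].
rewrite (intD gi); [|exact: bS|exact: bS].
rewrite (int_br4 (F := Sa (p + 2)) (i := o0) (j := o1))//; last exact: bd_ovaX.
rewrite (int_br4 (F := Sa (p + 2)) eP); last exact: bd_ovaX.
rewrite (int_br4 (F := Sa 2) eP); last exact: bd_ovaX.
by move: (gibbs (Sa (p + 2))) (gibbs (Sa 2)) => x y; ring.
Qed.

Lemma row_linear :
  `|\int[iid nu 4]_t (w01 w t * expR (s2 (@rw n) t)) -
    \int[iid nu 4]_t (w01 w t * (1 + s2 (@rw n) t))| <=
  expR B * (M * (s ^+ 2 * K ^+ 4)) * (gibbs (Sa (p + 2)) + gibbs (Sa 2)).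
Proof.
have mrn := @mr n; have rKn := @rK n.
have bq : bd (s2 (@rw n)) := bd_qq mrn rKn o0 o1.
have bw0 : bd (w01 w) := bd_w01 bw.
have b1 : bd (fun t => w01 w t * expR (s2 (@rw n) t)).
  by apply: dmM; [exact: bw0|exact: bd_exp].
have b2 : bd (fun t => w01 w t * (1 + s2 (@rw n) t)).
  by apply: dmM; [exact: bw0|apply: dmD; [exact: dm_cst|exact: bq]].
have bS k : bd (fun t : 4.-tuple (T * n.-tuple T) =>
    `|overlap c (tnth t o0).2 (tnth t o1).2| ^+ k).
  exact: (bd_br4 o0 o1 (F := Sa k) (bd_ovaX n k)).
have -> : gibbs (Sa (p + 2)) + gibbs (Sa 2) = \int[iid nu 4]_t
    (`|overlap c (tnth t o0).2 (tnth t o1).2| ^+ (p + 2) +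
     `|overlap c (tnth t o0).2 (tnth t o1).2| ^+ 2).
  rewrite (intD gi); [|exact: bS|exact: bS].
  rewrite (int_br4 (F := Sa (p + 2)) (i := o0) (j := o1))//; last exact: bd_ovaX.
  by rewrite (int_br4 (F := Sa 2) (i := o0) (j := o1))//; exact: bd_ovaX.
rewrite -(intB gi)// -(intZ gi); last by apply: dmD; exact: bS.
apply: (int_norm_le gi); first exact: dmB.
  by apply: dmZ; apply: dmD; exact: bS.
move=> t; rewrite -mulrBr normrM.
have e1 : `|expR (s2 (@rw n) t) - (1 + s2 (@rw n) t)| <=
    s ^+ 2 * K ^+ 4 * `|overlap c (tnth t o0).2 (tnth t o1).2| ^+ 2 * expR B.
  rewrite opprD addrA (le_trans (expR_taylor2 _))// -real_normK ?num_real//.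
  apply: ler_pM; rewrite ?exprn_ge0 ?expR_ge0//; first exact: (qq_le 2).
  by rewrite ler_expR; exact: kB.
apply: (le_trans (ler_pM _ _ (wM _ _) e1)) => //.
rewrite [leLHS](_ : _ = expR B * (M * (s ^+ 2 * K ^+ 4)) *
    (`|overlap c (tnth t o0).2 (tnth t o1).2| ^+ (p + 2) +
     `|overlap c (tnth t o0).2 (tnth t o1).2| ^+ 2)); last by rewrite exprD; ring.
by [].
Qed.

(** Up to order s^2, averaging w after the row is observed amounts to integrating w (1 + ker) under
    the prior of the row. *)
Lemma row_av : `|av nu (@rw n) w - \int[iid nu 4]_t (w01 w t * (1 + s2 (@rw n) t))| <=
  (12 * posterior_err B + expR B) * (M * (s ^+ 2 * K ^+ 4)) * (gibbs (Sa (p + 2)) + gibbs (Sa 2)).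
Proof.
have h3 := posterior_expansion (pi := nu) (@mr n) (@rK n) kB row0 bw.
have c20 : 0 <= posterior_err B.
  by rewrite /posterior_err addr_ge0// !mulr_ge0 ?expR_ge0.
exact: (dist_comb h3 row_sabs2 c20 row_linear).
Qed.

(* [r] lists the terms (a, (p, q)) of a polynomial \sum a v^p S^q. *)
Lemma int_poly (r : seq (R * (nat * nat))) :
  (forall z z', w z z' * (1 + ker (@rw n) z z') =
    \sum_(e <- r) e.1 * ((c z.1 * c z'.1) ^+ e.2.1 * overlap c z.2 z'.2 ^+ e.2.2)) ->
  \int[iid nu 4]_t (w01 w t * (1 + s2 (@rw n) t)) =
  \sum_(e <- r) e.1 * (signal_moment P c e.2.1 ^+ 2 * gibbs (Sp e.2.2)).
Proof.
move=> h.
have b (e : R * (nat * nat)) : bd (fun t : 4.-tuple (T * n.-tuple T) =>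
   (c (tnth t o0).1 * c (tnth t o1).1) ^+ e.2.1 *
   overlap c (tnth t o0).2 (tnth t o1).2 ^+ e.2.2).
  apply: dmM.
    apply: dmX.
    exact: (bd_tnth2 (f := fun z z' : T * n.-tuple T => c z.1 * c z'.1) o0 o1 bd_cc).
  exact: (bd_br4 o0 o1 (F := Sp e.2.2) (bd_ovX n _)).
transitivity (\int[iid nu 4]_t \sum_(e <- r) e.1 *
   ((c (tnth t o0).1 * c (tnth t o1).1) ^+ e.2.1 *
   overlap c (tnth t o0).2 (tnth t o1).2 ^+ e.2.2)).
  by apply: eq_int => t; rewrite -h.
rewrite (int_sum gi); last by move=> e; apply: dmZ; exact: b.
apply: eq_bigr => e _; rewrite (intZ gi); last exact: b.
congr (_ * _).
exact: (int_mom4 (i := o0) (j := o1) e.2.1 isT (bd_ovX n e.2.2)).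
Qed.

End weight.

(** The unit variance makes [qsq] equal to s^2 <Q^2>; 1920 is 320 for each of the six pairs in
    [sabs]. *)
Lemma row_entropy :
  `|\int[gam n]_g' (lik nu (@rw n) g' * ln (lik nu (@rw n) g')) -
    s ^+ 2 / 4 * gibbs (Sa 2)| <=
  1920 * exp6 B * (s ^+ 3 * K ^+ 6) * gibbs (Sa 3).
Proof.
have mrn := @mr n; have rKn := @rK n.
have := entropy_expansion (pi := nu) (@mr n) (@rK n) kB row0.
have -> : qsq nu (@rw n) / 4 = s ^+ 2 / 4 * gibbs (Sa 2).
  rewrite mulrAC; congr (_ / _); rewrite /qsq.
  transitivity (\int[iid nu 4]_t (s ^+ 2 * ((c (tnth t o0).1 * c (tnth t o1).1) ^+ 2 *
     `|overlap c (tnth t o0).2 (tnth t o1).2| ^+ 2))).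
    apply: eq_int => t; rewrite /ker_at (ker_row _ s0) real_normK ?num_real//.
    by ring.
  rewrite (intZ gi); last first.
    apply: dmM; last exact: (bd_br4 o0 o1 (F := Sa 2) (bd_ovaX n 2)).
    apply: dmX.
    exact: (bd_tnth2 (f := fun z z' : T * n.-tuple T => c z.1 * c z'.1) o0 o1 bd_cc).
  rewrite (int_mom4 (i := o0) (j := o1) 2 (F := Sa 2) isT (bd_ovaX n 2)).
  by rewrite /signal_moment cint1 expr1n mul1r.
move=> /le_trans; apply.
have c60 : 0 <= exp6 B by exact: expR_ge0.
rewrite (_ : 1920 * exp6 B * (s ^+ 3 * K ^+ 6) * gibbs (Sa 3) =
   320 * exp6 B * (6 * (s ^+ 3 * K ^+ 6) * gibbs (Sa 3))); last by ring.
apply: (ler_wpM2l (mulr_ge0 (ler0n R 320) c60)).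
have bS (i j : 'I_4) : bd (fun t : 4.-tuple (T * n.-tuple T) =>
    s ^+ 3 * K ^+ 6 * `|overlap c (tnth t i).2 (tnth t j).2| ^+ 3).
  by apply: dmZ; exact: (bd_br4 i j (F := Sa 3) (bd_ovaX n 3)).
have bq i j : bd (fun t => `|ker_at (@rw n) i j t| ^+ 3).
  by apply: dmX; apply: dm_norm; exact: (bd_qq mrn rKn).
have q i j : i != j -> \int[iid nu 4]_t `|ker_at (@rw n) i j t| ^+ 3 <=
    s ^+ 3 * K ^+ 6 * gibbs (Sa 3).
  move=> ij; rewrite -(int_br4 (F := Sa 3) ij); last exact: bd_ovaX.
  rewrite -(intZ gi); last exact: (bd_br4 i j (F := Sa 3) (bd_ovaX n 3)).
  by apply: (int_le gi); [exact: bq|exact: bS|move=> t; exact: (qq_le 3)].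
under eq_int do rewrite sabs_sum.
rewrite (int_sum gi); last by move=> e; exact: bq.
apply: (@le_trans _ _ (\sum_(e <- pairs4) s ^+ 3 * K ^+ 6 * gibbs (Sa 3))).
  by rewrite !big_seq; apply: ler_sum => e /l6P; exact: q.
by rewrite /pairs4 !big_cons big_nil; lra.
Qed.

End at_posterior.

End cavity_expansion.

Section cavity_recursion.
Context d (T : measurableType d) (R : realType) (P : probability T R).
Variables (c : T -> R) (K : R).
Hypotheses (mc : measurable_fun setT c) (cK : forall x, `|c x| <= K).
Hypotheses (cint0 : \int[P]_x c x = 0) (cint1 : \int[P]_x c x ^+ 2 = 1).
Variables (s l : R).
Hypotheses (s0 : 0 <= s).

Local Notation gam m := (iid (std_normal R) m).
Local Notation sg := (signal c s).
Local Notation rw := (cavity_row c s).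
Local Notation overlap_moment := (overlap_moment P c s).
Local Notation abs_moment := (abs_moment P c s).

Let ms k j := @measurable_signal _ T R c mc s k j.
Let sK k j x := @signal_le _ T R c K cK s k j x.
Let K0 : 0 <= K. Proof. exact: le_trans (cK point). Qed.

Variable n : nat.
Hypothesis sn : s * n%:R <= l.

Local Notation mu := (iid P n).
Local Notation L := (lik mu (@sg n)).
Local Notation B := (l * K ^+ 4).
Local Notation Sp p := (fun x y : n.-tuple T => overlap c x y ^+ p).
Local Notation Sa p := (fun x y : n.-tuple T => `|overlap c x y| ^+ p).
Let gg := gauge_l1norm R #|upper_pairs n|.

Lemma Lbr F g : L g * gibbs P c s g F = pair_weight mu (@sg n) F g / L g.
Proof.
have L0 := lik_gt0 mu (@ms n) (@sK n) g.
by rewrite /gibbs; move: (pair_weight _ _ _ _) (lik _ _ _) L0 => x y y0; field; rewrite gt_eqF.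
Qed.

Lemma dm_Lbr F : bd (fun p => F p.1 p.2) ->
  dm (@l1norm R #|upper_pairs n|) (fun g => L g * gibbs P c s g F).
Proof.
move=> bF; have := dm_wavlik mu (@ms n) (@sK n) bF.
by congr (dm _ _); apply/funext => g; rewrite Lbr.
Qed.

Lemma int_Lbr F : \int[gam _]_g (L g * gibbs P c s g F) = av mu (@sg n) F.
Proof. by apply: eq_int => g; exact: Lbr. Qed.

(** v is the contribution of site i to the overlap, S the overlap of the other sites, and 1 + s v S
    the linearized effect of the row. *)
Lemma overlap_site q (r : seq (R * (nat * nat))) M (i : 'I_n.+1) : 0 <= M ->
  (forall v S, v * (v + S) ^+ q * (1 + s * v * S) =
    \sum_(e <- r) e.1 * (v ^+ e.2.1 * S ^+ e.2.2)) ->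
  (forall v S, `|v| <= K ^+ 2 -> `|v * (v + S) ^+ q| <= M * (`|S| ^+ q + 1)) ->
  `|av (iid P n.+1) (@sg n.+1)
      (fun x y => c (tnth x i) * c (tnth y i) * overlap c x y ^+ q)
    - \sum_(e <- r) e.1 * (signal_moment P c e.2.1 ^+ 2 * overlap_moment n e.2.2)| <=
  (12 * posterior_err B + expR B) * (M * (s ^+ 2 * K ^+ 4)) * (abs_moment n (q + 2) +
    abs_moment n 2).
Proof.
move=> M0 hr hM.
set D := (12 * posterior_err B + expR B) * (M * (s ^+ 2 * K ^+ 4)).
pose Mg g := \sum_(e <- r) e.1 * (signal_moment P c e.2.1 ^+ 2 * gibbs P c s g (Sp e.2.2)).
pose Eg g := D * (gibbs P c s g (Sa (q + 2)) + gibbs P c s g (Sa 2)).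
have dSp k := dm_Lbr (F := Sp k) (bd_ovX mc cK n k).
have dSa k := dm_Lbr (F := Sa k) (bd_ovaX mc cK n k).
have LM g : L g * Mg g = \sum_(e <- r) e.1 * signal_moment P c e.2.1 ^+ 2 *
    (L g * gibbs P c s g (Sp e.2.2)).
  rewrite mulr_sumr; apply: eq_bigr => e _.
  by move: (gibbs _ _ _ _ _) (lik _ _ _) => x y; ring.
have LE g : L g * Eg g = D * (L g * gibbs P c s g (Sa (q + 2)) + L g * gibbs P c s g (Sa 2)).
  by rewrite /Eg mulrCA mulrDr.
have iM : \int[gam _]_g (L g * Mg g) =
    \sum_(e <- r) e.1 * (signal_moment P c e.2.1 ^+ 2 * overlap_moment n e.2.2).
  transitivity (\int[gam #|upper_pairs n|]_g \sum_(e <- r) e.1 * signal_moment P c e.2.1 ^+ 2 *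
    (L g * gibbs P c s g (Sp e.2.2))); first by apply: eq_int => g; exact: LM.
  rewrite (int_sum gg); last by move=> e; apply: dmZ; exact: dSp.
  apply: eq_bigr => e _; rewrite (intZ gg); last exact: dSp.
  by rewrite int_Lbr; exact/esym/mulrA.
have iE : \int[gam _]_g (L g * Eg g) = D * (abs_moment n (q + 2) + abs_moment n 2).
  transitivity (\int[gam #|upper_pairs n|]_g
    (D * (L g * gibbs P c s g (Sa (q + 2)) + L g * gibbs P c s g (Sa 2)))).
    by apply: eq_int => g; exact: LE.
  rewrite (intZ gg); last by apply: dmD; exact: dSa.
  rewrite (intD gg); [|exact: dSa|exact: dSa].
  by congr (_ * (_ + _)); exact: int_Lbr.
rewrite -iM -iE.
have bcn : bd (fun x : n.+1.-tuple T => c (tnth x i)).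
  exact: (bd_comp (measurable_tnth i) (bd_c mc cK)).
apply: (av_site (i := i) mc cK).
- apply: dmM; last exact: (bd_ovX mc cK n.+1 q).
  by apply: dmM; [exact: (bd_comp measurable_fst bcn)|exact: (bd_comp measurable_snd bcn)].
- have := dm_sum r predT (fun e => dmZ (e.1 * signal_moment P c e.2.1 ^+ 2) (dSp e.2.2)).
  by congr (dm _ _); apply/funext => g; rewrite LM.
- have := dmZ D (dmD (dSa (q + 2)%N) (dSa 2)).
  by congr (dm _ _); apply/funext => g; rewrite LE.
move=> g nu nuE.
pose w (z z' : T * n.-tuple T) := c z.1 * c z'.1 * (c z.1 * c z'.1 + overlap c z.2 z'.2) ^+ q.
have wE : av nu (@rw n) (fun z z' => c (tnth (insertt i z) i) *
    c (tnth (insertt i z') i) * overlap c (insertt i z) (insertt i z') ^+ q) =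
    av nu (@rw n) w.
  by apply: eq_av => z z'; rewrite !tnth_insertt ov_insert.
rewrite wE.
have bw : bd (fun p => w p.1 p.2).
  have bcc := bd_cc mc cK n; apply: dmM; first exact: bcc.
  apply: dmX; apply: dmD; first exact: bcc.
  exact: (bd_lift2 (bd_ov mc cK n)).
have wM z z' : `|w z z'| <= M * (`|overlap c z.2 z'.2| ^+ q + 1).
  by apply: hM; exact: cc_le.
have wr z z' : w z z' * (1 + ker (@rw n) z z') =
    \sum_(e <- r) e.1 * ((c z.1 * c z'.1) ^+ e.2.1 * overlap c z.2 z'.2 ^+ e.2.2).
  by rewrite (ker_row _ s0); exact: hr.
rewrite /Mg -(int_poly mc cK nuE wr).
exact: (row_av mc cK cint0 s0 sn nuE bw M0 wM).
Qed.

(** One factor of Q^(q+1) is written as a sum over the sites, and in each term that site is taken as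
    the one added last. *)
Lemma overlap_step q (r : seq (R * (nat * nat))) M : 0 <= M ->
  (forall v S, v * (v + S) ^+ q * (1 + s * v * S) =
    \sum_(e <- r) e.1 * (v ^+ e.2.1 * S ^+ e.2.2)) ->
  (forall v S, `|v| <= K ^+ 2 -> `|v * (v + S) ^+ q| <= M * (`|S| ^+ q + 1)) ->
  `|overlap_moment n.+1 q.+1 - n.+1%:R * \sum_(e <- r) e.1 * (signal_moment P c e.2.1 ^+
    2 * overlap_moment n e.2.2)| <=
  n.+1%:R * ((12 * posterior_err B + expR B) * (M * (s ^+ 2 * K ^+ 4)) * (abs_moment n (q + 2) +
    abs_moment n 2)).
Proof.
move=> M0 hr hM; have h i := overlap_site i M0 hr hM.
set Y := \sum_(e <- r) _ in h *; set E := _ * (_ + _) in h *.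
have -> : overlap_moment n.+1 q.+1 = \sum_(i < n.+1) 1 * av (iid P n.+1) (@sg n.+1)
      (fun x y => c (tnth x i) * c (tnth y i) * overlap c x y ^+ q).
  have bcn (i : 'I_n.+1) : bd (fun x : n.+1.-tuple T => c (tnth x i)).
    exact: (bd_comp (measurable_tnth i) (bd_c mc cK)).
  have bW (i : 'I_n.+1) : bd (fun p : n.+1.-tuple T * n.+1.-tuple T =>
      c (tnth p.1 i) * c (tnth p.2 i) * overlap c p.1 p.2 ^+ q).
    apply: dmM; last exact: (bd_ovX mc cK n.+1 q).
    by apply: dmM; [exact: (bd_comp measurable_fst (bcn i))|
      exact: (bd_comp measurable_snd (bcn i))].
  rewrite -(av_sum (iid P n.+1) (@ms n.+1) (@sK n.+1) (index_enum 'I_n.+1) (fun=> 1)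
    (w := fun i x y => c (tnth x i) * c (tnth y i) * overlap c x y ^+ q) bW).
  apply: eq_av => x y; rewrite exprS {1}/overlap mulr_suml.
  by apply: eq_bigr => i _; rewrite mul1r.
have cst (X : R) : n.+1%:R * X = \sum_(i < n.+1) X.
  by rewrite sumr_const card_ord mulr_natl.
rewrite !cst -sumrB (le_trans (ler_norm_sum _ _ _))//; apply: ler_sum => i _.
by rewrite mul1r; exact: h.
Qed.

Lemma model_entropy_step : `|model_entropy P c s n.+1 - model_entropy P c s n - s ^+
  2 / 4 * abs_moment n 2| <=
  1920 * exp6 B * (s ^+ 3 * K ^+ 6) * abs_moment n 3.
Proof.
have dSa k := dm_Lbr (F := Sa k) (bd_ovaX mc cK n k).
have Lc (a x : R) g : L g * (a * x) = a * (L g * x) by rewrite mulrCA.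
have d2 (a : R) k : dm (@l1norm R #|upper_pairs n|) (fun g => L g * (a * gibbs P c s g (Sa k))).
  by have := dmZ a (dSa k); congr (dm _ _); apply/funext => g; rewrite Lc.
have i2 (a : R) k : \int[gam _]_g (L g * (a * gibbs P c s g (Sa k))) = a * abs_moment n k.
  rewrite -[abs_moment n k]/(av mu (@sg n) (Sa k)) -int_Lbr -(intZ gg); last exact: dSa.
  by apply: eq_int => g; rewrite Lc.
rewrite -!i2; apply: (entropy_site mc cK ord0); [exact: d2|exact: d2|].
move=> g nu nuE; exact: (row_entropy mc cK cint0 cint1 s0 sn nuE).
Qed.

Lemma momM k : signal_moment P c k ^+ 2 <= K ^+ (2 * k).
Proof.
rewrite mulnC exprM -real_normK ?num_real//; apply: lerXn2r; rewrite ?nnegrE ?exprn_ge0//.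
have bc := bd_c mc cK.
rewrite (le_trans (int_norm (gauge0 P) (dmX k bc)))// -[leRHS](int_cst P).
apply: (int_le (gauge0 P)); [by apply: dm_norm; exact: dmX|exact: dm_cst|].
by move=> x; rewrite normrX; apply: lerXn2r; rewrite ?nnegrE.
Qed.

Lemma mom1 : signal_moment P c 1 = 0. Proof. exact: cint0. Qed.
Lemma mom2 : signal_moment P c 2 = 1. Proof. exact: cint1. Qed.

Lemma ovm0 : overlap_moment n 0 = 1.
Proof. exact: (av_cst mu (@ms n) (@sK n)). Qed.

Lemma ovam_ge0 p : 0 <= abs_moment n p.
Proof.
have := @av_le _ _ _ mu _ _ _ (@ms n) (@sK n) (fun _ _ => 0) (Sa p) (dm_cst _ _)
  (bd_ovaX mc cK n p) (fun x y => exprn_ge0 p (normr_ge0 _)).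
by rewrite (av_cst mu (@ms n) (@sK n)).
Qed.

Lemma ovm_abs p : `|overlap_moment n p| <= abs_moment n p.
Proof.
have h (e : R) : `|e| <= 1 -> e * overlap_moment n p <= abs_moment n p.
  move=> e1; have := av_sum mu (@ms n) (@sK n) [:: tt] (fun=> e) (w := fun=> Sp p)
    (fun=> bd_ovX mc cK n p).
  rewrite big_seq1 => <-; apply: (av_le mu (@ms n) (@sK n)).
  - by apply: dm_sum => _; apply: dmZ; exact: (bd_ovX mc cK n p).
  - exact: (bd_ovaX mc cK n p).
  - move=> x y; rewrite big_seq1 -normrX (le_trans (ler_norm _))// normrM.
    by rewrite ler_piMl.
have := h 1; have := h (-1); rewrite normrN normr1 lexx mulN1r mul1r.
by move=> /(_ isT) h1 /(_ isT) h2; rewrite ler_norml h2 andbT lerNl.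
Qed.

(* Q^k is a positive definite kernel. *)
Lemma wav_pos k : forall f g, bd f ->
  0 <= pair_weight mu (@sg n) (fun x y => f x * f y * overlap c x y ^+ k) g.
Proof.
elim: k => [|k IH] f g bf.
  have -> : (fun x y : n.-tuple T => f x * f y * overlap c x y ^+ 0) = (fun x y => f x * f y).
    by apply/funext => x; apply/funext => y; rewrite mulr1.
  rewrite (wav_mul mu (@ms n) (@sK n) g bf bf) -expr2; exact: sqr_ge0.
have bfc (j : 'I_n) : bd (fun x : n.-tuple T => f x * c (tnth x j)).
  by apply: dmM => //; exact: (bd_comp (measurable_tnth j) (bd_c mc cK)).
have -> : (fun x y : n.-tuple T => f x * f y * overlap c x y ^+ k.+1) =
  (fun x y => \sum_(j < n) 1 *
    (f x * c (tnth x j) * (f y * c (tnth y j)) * overlap c x y ^+ k)).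
  apply/funext => x; apply/funext => y; rewrite exprS mulrA {1}/overlap mulr_sumr mulr_suml.
  by apply: eq_bigr => j _; ring.
have bW (j : 'I_n) : bd (fun p : n.-tuple T * n.-tuple T =>
    f p.1 * c (tnth p.1 j) * (f p.2 * c (tnth p.2 j)) * overlap c p.1 p.2 ^+ k).
  apply: dmM; last exact: (bd_ovX mc cK n k).
  by apply: dmM; [exact: (bd_comp measurable_fst (bfc j))|
      exact: (bd_comp measurable_snd (bfc j))].
rewrite (wav_sum mu (@ms n) (@sK n) (index_enum 'I_n) (fun=> 1)
  (w := fun j x y => f x * c (tnth x j) * (f y * c (tnth y j)) * overlap c x y ^+ k) g bW).
by apply: sumr_ge0 => j _; rewrite mul1r; exact: (IH (fun x => f x * c (tnth x j))).
Qed.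

Lemma ovm_ge0 k : 0 <= overlap_moment n k.
Proof.
apply: int_ge0 => g; rewrite divr_ge0//; last exact/ltW/(lik_gt0 mu (@ms n) (@sK n)).
have E : (fun x y : n.-tuple T => 1 * 1 * overlap c x y ^+ k) = Sp k.
  by apply/funext => x; apply/funext => y; rewrite !mul1r.
have b1 : bd (fun _ : n.-tuple T => 1 : R) by exact: dm_cst.
by have := wav_pos k g b1; rewrite E.
Qed.

End cavity_recursion.

Lemma le_1Dsqr (R : realType) (x : R) : x ^+ 1 <= 1 + x ^+ 2.
Proof. by have := sqr_ge0 (2 * x - 1); lra. Qed.

Section average_linear.
Context d (Z : measurableType d) (R : realType) (pi : probability Z R).
Variables (m : nat) (a : 'I_m -> Z -> R) (A : R).
Hypotheses (ma : forall k, measurable_fun setT (a k)) (aA : forall k z, `|a k z| <= A).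

Lemma avZ (x : R) w : bd (fun p => w p.1 p.2) ->
  av pi a (fun y z => x * w y z) = x * av pi a w.
Proof.
move=> bw; have := av_sum pi ma aA [:: tt] (fun=> x) (w := fun=> w) (fun=> bw).
by rewrite big_seq1 => <-; apply: eq_av => y z; rewrite big_seq1.
Qed.

Lemma avD w1 w2 : bd (fun p => w1 p.1 p.2) -> bd (fun p => w2 p.1 p.2) ->
  av pi a (fun y z => w1 y z + w2 y z) = av pi a w1 + av pi a w2.
Proof.
move=> b1 b2; have gg := gauge_l1norm R m.
have b12 : bd (fun p : Z * Z => w1 p.1 p.2 + w2 p.1 p.2) by exact: dmD.
rewrite {2 3}/av -(intD gg); last 2 first.
- exact: (dm_wavlik pi ma aA b1).
- exact: (dm_wavlik pi ma aA b2).
apply: eq_int => g; rewrite -mulrDl; congr (_ / _).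
rewrite (wav_prod pi ma aA (w := fun y z => w1 y z + w2 y z) g b12).
rewrite (wav_prod pi ma aA g b1) (wav_prod pi ma aA g b2) -(intD (gauge0 _)).
- by apply: eq_int => p; rewrite mulrDl.
- exact: (bd_wamp pi ma aA b1).
- exact: (bd_wamp pi ma aA b2).
Qed.

End average_linear.

(** * Recursions for the moments of the overlap *)

Section overlap_moments.
Context d (T : measurableType d) (R : realType) (P : probability T R).
Variables (c : T -> R) (K : R).
Hypotheses (mc : measurable_fun setT c) (cK : forall x, `|c x| <= K).
Hypotheses (cint0 : \int[P]_x c x = 0) (cint1 : \int[P]_x c x ^+ 2 = 1).
Variables (s l : R).
Hypotheses (s0 : 0 <= s).

Local Notation sg := (signal c s).
Local Notation m_ n p := (overlap_moment P c s n p).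
Local Notation a_ n p := (abs_moment P c s n p).

Let ms k j := @measurable_signal _ T R c mc s k j.
Let sK k j x := @signal_le _ T R c K cK s k j x.
Let K0 : 0 <= K. Proof. exact: le_trans (cK point). Qed.
Let l0 n : s * n%:R <= l -> 0 <= l. Proof. by apply: le_trans; rewrite mulr_ge0. Qed.

Definition deviation_mass n (e : R) := av (iid P n) (@sg n)
  (fun x y => \1_[set t : R | e < t] (s * overlap c x y)).

Lemma bd_pdev n e : bd (fun p : n.-tuple T * n.-tuple T =>
  \1_[set t : R | e < t] (s * overlap c p.1 p.2) : R).
Proof.
have mo : measurable_fun setT (fun p : n.-tuple T * n.-tuple T => s * overlap c p.1 p.2).
  by apply: measurable_funM => //; case: (bd_ov mc cK n).
apply: (bdI (B := 1)).
  apply: (measurableT_comp _ mo); apply: measurable_indic.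
  have -> : [set t : R | e < t] = `]e, +oo[%classic.
    by apply/seteqP; split => t /=; rewrite in_itv/= andbT.
  exact: measurable_itv.
by move=> p; rewrite indicE; case: (_ \in _); rewrite ?normr1 ?normr0.
Qed.

Lemma ovam_even n p : ~~ odd p -> a_ n p = m_ n p.
Proof. by move=> pe; apply: eq_av => x y; rewrite -normrX ger0_norm// exprn_even_ge0. Qed.

Lemma ovam_mono n p (be : R) k (ga : R) j :
  (forall S : R, `|S| ^+ p <= be * `|S| ^+ k + ga * `|S| ^+ j) ->
  a_ n p <= be * a_ n k + ga * a_ n j.
Proof.
move=> h; have bk := bd_ovaX mc cK n k; have bj := bd_ovaX mc cK n j.
apply: (@le_trans _ _ (av (iid P n) (@sg n)
    (fun x y => be * `|overlap c x y| ^+ k + ga * `|overlap c x y| ^+ j))).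
  apply: (av_le (iid P n) (@ms n) (@sK n)).
  - exact: (bd_ovaX mc cK n p).
  - by apply: dmD; exact: dmZ.
  - by move=> x y; exact: h.
rewrite le_eqVlt; apply/orP; left; apply/eqP; etransitivity.
  exact: (avD (iid P n) (@ms n) (@sK n) (w1 := fun x y => be * `|overlap c x y| ^+ k)
    (w2 := fun x y => ga * `|overlap c x y| ^+ j) (dmZ be bk) (dmZ ga bj)).
by congr (_ + _); [exact: (avZ (iid P n) (@ms n) (@sK n) be bk)|
  exact: (avZ (iid P n) (@ms n) (@sK n) ga bj)].
Qed.

Lemma ovam0 n : a_ n 0 = 1.
Proof. exact: (av_cst (iid P n) (@ms n) (@sK n)). Qed.

Lemma ovam3_le n : s * n%:R <= l -> s * a_ n 3 <= l * K ^+ 2 * a_ n 2.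
Proof.
move=> sn; have b2 := bd_ovaX mc cK n 2; have b3 := bd_ovaX mc cK n 3.
have E3 : s * a_ n 3 = av (iid P n) (@sg n) (fun x y => s * `|overlap c x y| ^+ 3).
  exact/esym/(avZ (iid P n) (@ms n) (@sK n) s b3).
have E2 : l * K ^+ 2 * a_ n 2 =
    av (iid P n) (@sg n) (fun x y => l * K ^+ 2 * `|overlap c x y| ^+ 2).
  exact/esym/(avZ (iid P n) (@ms n) (@sK n) (l * K ^+ 2) b2).
rewrite E3 E2; apply: (av_le (iid P n) (@ms n) (@sK n)); [exact: dmZ|exact: dmZ|].
move=> x y; rewrite exprS mulrA; apply: ler_wpM2r; first exact: exprn_ge0.
rewrite (@le_trans _ _ (s * (n%:R * K ^+ 2)))//.
  by rewrite ler_wpM2l// overlap_le.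
by rewrite mulrA ler_wpM2r// exprn_even_ge0.
Qed.

(** |Q|^5 is -Q^5 plus twice the fifth power of the positive part, and E<Q^5> >= 0. The positive
    part is at most e Q^4 / s where s Q <= e; elsewhere the crude bound |Q| <= n K^2 is used. *)
Lemma ovam5_le n e : 0 < e ->
  s ^+ 2 * a_ n 5 <= 2 * e * (s * a_ n 4) +
    2 * s ^+ 2 * (n%:R * K ^+ 2) ^+ 5 * deviation_mass n e.
Proof.
move=> e0; have b5 := bd_ovX mc cK n 5; have b4 := bd_ovaX mc cK n 4.
have ba5 := bd_ovaX mc cK n 5; have bp := bd_pdev n e.
have p5 := ovm_ge0 P mc cK s n 5.
set D := 2 * s ^+ 2 * (n%:R * K ^+ 2) ^+ 5.
have D0 : 0 <= D by rewrite !mulr_ge0 ?sqr_ge0// exprn_ge0// mulr_ge0// sqr_ge0.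
apply: (@le_trans _ _ (- s ^+ 2 * m_ n 5 + (2 * e * s * a_ n 4 + D * deviation_mass n e)));
  last first.
  have : 0 <= s ^+ 2 * m_ n 5 by rewrite mulr_ge0// sqr_ge0.
  lra.
have bD4 : bd (fun p : n.-tuple T * n.-tuple T =>
    2 * e * s * `|overlap c p.1 p.2| ^+ 4) by exact: dmZ.
have bDp : bd (fun p : n.-tuple T * n.-tuple T =>
    D * \1_[set t : R | e < t] (s * overlap c p.1 p.2)) by exact: dmZ.
have bD5 : bd (fun p : n.-tuple T * n.-tuple T =>
    - s ^+ 2 * overlap c p.1 p.2 ^+ 5) by exact: dmZ.
have E5 : s ^+ 2 * a_ n 5 = av (iid P n) (@sg n) (fun x y => s ^+ 2 * `|overlap c x y| ^+ 5).
  exact/esym/(avZ (iid P n) (@ms n) (@sK n) (s ^+ 2) ba5).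
have Er : - s ^+ 2 * m_ n 5 + (2 * e * s * a_ n 4 + D * deviation_mass n e) =
  av (iid P n) (@sg n) (fun x y => - s ^+ 2 * overlap c x y ^+ 5 +
    (2 * e * s * `|overlap c x y| ^+ 4 + D * \1_[set t : R | e < t] (s * overlap c x y))).
  symmetry; etransitivity.
    exact: (avD (iid P n) (@ms n) (@sK n) (w1 := fun x y => - s ^+ 2 * overlap c x y ^+ 5)
      (w2 := fun x y => 2 * e * s * `|overlap c x y| ^+ 4 +
        D * \1_[set t : R | e < t] (s * overlap c x y)) bD5 (dmD bD4 bDp)).
  congr (_ + _); first exact: (avZ (iid P n) (@ms n) (@sK n) (- s ^+ 2) b5).
  etransitivity.
    exact: (avD (iid P n) (@ms n) (@sK n) (w1 := fun x y => 2 * e * s * `|overlap c x y| ^+ 4)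
      (w2 := fun x y => D * \1_[set t : R | e < t] (s * overlap c x y)) bD4 bDp).
  congr (_ + _); first exact: (avZ (iid P n) (@ms n) (@sK n) (2 * e * s) b4).
  exact: (avZ (iid P n) (@ms n) (@sK n) D
    (w := fun x y => \1_[set t : R | e < t] (s * overlap c x y)) bp).
rewrite E5 Er; clear E5 Er p5.
apply: (av_le (iid P n) (@ms n) (@sK n)).
- exact: dmZ.
- by apply: dmD => //; exact: dmD.
move=> x y; set S := overlap c x y.
have i0 : 0 <= \1_[set t : R | e < t] (s * S) :> R by rewrite indicE.
have S4 : 0 <= 2 * e * s * `|S| ^+ 4.
  by rewrite mulr_ge0 ?exprn_ge0// mulr_ge0// mulr_ge0// ltW.
have Di : 0 <= D * \1_[set t : R | e < t] (s * S) by exact: mulr_ge0.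
have [S0|S0] := leP S 0.
  have -> : - s ^+ 2 * S ^+ 5 = s ^+ 2 * `|S| ^+ 5 by rewrite ler0_norm//; ring.
  by rewrite lerDl addr_ge0.
have S5 : `|S| ^+ 5 = S ^+ 5 by rewrite gtr0_norm.
rewrite S5; have [se|se] := leP (s * S) e.
  have : 0 <= (e - s * S) * (s * S ^+ 4).
    by rewrite mulr_ge0 ?subr_ge0// mulr_ge0// exprn_even_ge0.
  move: S4 Di; rewrite gtr0_norm//; set X := D * _; lra.
have -> : \1_[set t : R | e < t] (s * S) = 1 :> R.
  by rewrite indicE mem_set.
rewrite mulr1 /D.
have h : S ^+ 5 <= (n%:R * K ^+ 2) ^+ 5.
  rewrite lerXn2r ?nnegrE ?mulr_ge0 ?sqr_ge0 ?(ltW S0)//.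
  by rewrite (le_trans (ler_norm _))// overlap_le.
have := ler_wpM2l (sqr_ge0 s) h; move: S4; lra.
Qed.

Definition cerr : R := 12 * posterior_err (l * K ^+ 4) + expR (l * K ^+ 4).

Lemma cerr_ge0 : 0 <= cerr.
Proof. by rewrite /cerr /posterior_err addr_ge0 ?expR_ge0// !(mulr_ge0, addr_ge0) ?expR_ge0. Qed.

Lemma overlap2_step n : s * n%:R <= l ->
  `|m_ n.+1 2 - n.+1%:R * (1 + s * m_ n 2)| <=
  n.+1%:R * (s * K ^+ 6 * a_ n 1 +
    cerr * (K ^+ 2 * (1 + K ^+ 2) * (s ^+ 2 * K ^+ 4)) * (a_ n 3 + a_ n 2)).
Proof.
move=> sn.
(* The term v^2 has mean 1, v S has mean 0, and s v^2 S^2 gives s <Q^2>; only s v^3 S goes to the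
   error. *)
pose r : seq (R * (nat * nat)) :=
  [:: (1, (2%N, 0%N)); (1, (1%N, 1%N)); (s, (3%N, 1%N)); (s, (2%N, 2%N))].
have M0 : 0 <= K ^+ 2 * (1 + K ^+ 2) by rewrite mulr_ge0 ?addr_ge0 ?sqr_ge0.
have hr v S : v * (v + S) ^+ 1 * (1 + s * v * S) =
    \sum_(e <- r) e.1 * (v ^+ e.2.1 * S ^+ e.2.2).
  by rewrite /r !big_cons big_nil /=; ring.
have hM v S : `|v| <= K ^+ 2 ->
    `|v * (v + S) ^+ 1| <= K ^+ 2 * (1 + K ^+ 2) * (`|S| ^+ 1 + 1).
  move=> vK; rewrite !expr1 normrM -mulrA; apply: ler_pM => //.
  rewrite (le_trans (ler_normD _ _))//.
  have : 0 <= K ^+ 2 * `|S| by rewrite mulr_ge0// sqr_ge0.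
  lra.
have h := overlap_step mc cK cint0 s0 sn M0 hr hM.
rewrite -/cerr in h.
have f0 := ovm0 P mc cK s n; have f1 := ovm_abs P mc cK s n 1.
have m1 := mom1 cint0; have m2 := mom2 cint1; have m3 := momM P mc cK 3.
have a1 := ovam_ge0 P mc cK s n 1.
have k0 : 0 <= n.+1%:R :> R by [].
move: h f0 f1 m1 m2 m3 a1.
move: (overlap_moment P c s n.+1 2) (overlap_moment P c s n) (abs_moment P c s n) (signal_moment
  P c) => X f a m.
rewrite /r !big_cons big_nil /= => h f0 f1 m1 m2 m3 a1.
rewrite f0 m1 m2 in h; move: h.
set E := cerr * _ * _ => h.
have e : `|n.+1%:R * (s * (m 3%N ^+ 2 * f 1%N))| <= n.+1%:R * (s * K ^+ 6 * a 1%N).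
  rewrite normrM ger0_norm// ler_wpM2l// normrM (ger0_norm s0) -mulrA ler_wpM2l//.
  by rewrite normrM (ger0_norm (sqr_ge0 _)); apply: ler_pM; rewrite ?sqr_ge0.
rewrite [leRHS]mulrDr; apply: (@le_trans _ _ (n.+1%:R * E + n.+1%:R * (s * K ^+ 6 * a 1%N)));
  last by rewrite addrC.
apply: (le_trans _ (lerD h e)); apply: (le_trans _ (ler_normD _ _)).
rewrite le_eqVlt; apply/orP; left; apply/eqP; congr `|_|; ring.
Qed.

(** Only s <Q^4> must keep its exact coefficient, which makes the recursion contract. The fifth
    moment stays apart because it calls for the bound on large overlaps; everything else is absorbed
    in 1 + <Q^2>. *)
Lemma overlap4_step n : s <= 1 -> s * n%:R <= l -> m_ n.+1 4 <= n.+1%:R *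
  (s * m_ n 4 + (3 + 7 * K ^+ 6 + 4 * K ^+ 8 + K ^+ 10 + 3 * l * K ^+ 8 +
     4 * cerr * (K ^+ 2 * (1 + K ^+ 6) * K ^+ 4)) * (1 + m_ n 2) +
   4 * cerr * (K ^+ 2 * (1 + K ^+ 6) * K ^+ 4) * (s ^+ 2 * a_ n 5)).
Proof.
move=> s1 sn.
pose r : seq (R * (nat * nat)) := [:: (1, (4%N, 0%N)); (3, (3%N, 1%N));
  (3, (2%N, 2%N)); (1, (1%N, 3%N)); (s, (5%N, 1%N)); (3 * s, (4%N, 2%N));
  (3 * s, (3%N, 3%N)); (s, (2%N, 4%N))].
have M0 : 0 <= 4 * (K ^+ 2 * (1 + K ^+ 6)).
  by rewrite !mulr_ge0 ?addr_ge0 ?sqr_ge0 ?exprn_ge0.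
have hr v S : v * (v + S) ^+ 3 * (1 + s * v * S) =
    \sum_(e <- r) e.1 * (v ^+ e.2.1 * S ^+ e.2.2).
  by rewrite /r !big_cons big_nil /=; ring.
have hM v S : `|v| <= K ^+ 2 ->
    `|v * (v + S) ^+ 3| <= 4 * (K ^+ 2 * (1 + K ^+ 6)) * (`|S| ^+ 3 + 1).
  move=> vK; rewrite normrM.
  have -> : 4 * (K ^+ 2 * (1 + K ^+ 6)) * (`|S| ^+ 3 + 1) =
    K ^+ 2 * (4 * (1 + K ^+ 6) * (`|S| ^+ 3 + 1)) by ring.
  apply: ler_pM => //; rewrite normrX.
  apply: (@le_trans _ _ ((K ^+ 2 + `|S|) ^+ 3)).
    apply: lerXn2r; rewrite ?nnegrE ?addr_ge0 ?sqr_ge0//.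
    by rewrite (le_trans (ler_normD _ _))// lerD2r.
  have : 0 <= 3 * (K ^+ 2 + `|S|) * (K ^+ 2 - `|S|) ^+ 2.
    by rewrite mulr_ge0 ?sqr_ge0// mulr_ge0// addr_ge0 ?sqr_ge0.
  have : 0 <= K ^+ 6 * `|S| ^+ 3 by rewrite mulr_ge0// exprn_ge0.
  lra.
have h := overlap_step mc cK cint0 s0 sn M0 hr hM.
rewrite -/cerr in h.
have f0 := ovm0 P mc cK s n; have f1 := ovm_abs P mc cK s n 1.
have f3 := ovm_abs P mc cK s n 3.
have m1 := mom1 cint0; have m2 := mom2 cint1; have m3 := momM P mc cK 3.
have m4 := momM P mc cK 4; have m5 := momM P mc cK 5.
have f2 := ovam_even n (p := 2) isT.
have a1 := ovam_ge0 P mc cK s n 1; have a2 := ovam_ge0 P mc cK s n 2.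
have a3 := ovam3_le sn; have a5 := ovam_ge0 P mc cK s n 5.
have a30 := ovam_ge0 P mc cK s n 3.
have a12 : abs_moment P c s n 1 <= 1 * abs_moment P c s n 0 + 1 * abs_moment P c s n 2.
  by apply: ovam_mono => S; rewrite !mul1r expr0; exact: le_1Dsqr.
have a0 := ovam0 n.
have k0 : 0 <= n.+1%:R :> R by [].
have ce0 := cerr_ge0; have l00 := l0 sn.
move: h f0 f1 f2 f3 m1 m2 m3 m4 m5 a0 a1 a2 a3 a5 a12 a30.
move: (overlap_moment P c s n.+1 4) (overlap_moment P c s n) (abs_moment P c s n) (signal_moment
  P c) cerr ce0 => X f a m ce ce0.
rewrite /r !big_cons big_nil /= => h f0 f1 f2 f3 m1 m2 m3 m4 m5 a0 a1 a2 a3 a5 a12 a30.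
rewrite f0 m1 m2 -f2 in h; rewrite a0 in a12; rewrite -f2.
clear hr hM r f0 f2 a0 m1 m2.
have {h} h : X <= n.+1%:R *
   (1 * (m 4 ^+ 2 * 1) + (3 * (m 3 ^+ 2 * f 1%N) + (3 * (1 ^+ 2 * a 2%N) +
     (1 * (0 ^+ 2 * f 3%N) + (s * (m 5 ^+ 2 * f 1%N) + (3 * s * (m 4 ^+ 2 * a 2%N) +
     (3 * s * (m 3 ^+ 2 * f 3%N) + (s * (1 ^+ 2 * f 4%N) + 0))))))) +
     ce * (4 * (K ^+ 2 * (1 + K ^+ 6)) * (s ^+ 2 * K ^+ 4)) * (a 5%N + a 2%N)).
  by rewrite mulrDr -lerBlDl (le_trans (ler_norm _)).
apply: (le_trans h); apply: ler_wpM2l => //.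
have A2 : 0 <= 1 + a 2%N by lra.
move: a12; rewrite !mul1r; set S := 1 + a 2%N in A2 * => a12.
have aS : a 2%N <= S by rewrite /S; lra.
have pK k : 0 <= K ^+ k by exact: exprn_ge0.
have ab (x : R) k : x ^+ 2 <= K ^+ k -> x ^+ 2 * f 1%N <= K ^+ k * S.
  move=> xK; apply: (@le_trans _ _ (x ^+ 2 * S)); last by rewrite ler_wpM2r.
  rewrite ler_wpM2l ?sqr_ge0// (le_trans (ler_norm _))// (le_trans f1)//.
have t4 : m 4 ^+ 2 <= K ^+ 8 * S.
  by rewrite (le_trans m4)// ler_peMr// /S; lra.
have t31 := ab _ _ m3; have t51 := ab _ _ m5.
have t51' : s * (m 5 ^+ 2 * f 1%N) <= K ^+ 10 * S.
  apply: (@le_trans _ _ (s * (K ^+ 10 * S))); first by rewrite ler_wpM2l.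
  by rewrite ler_piMl// mulr_ge0.
have t42 : s * (m 4 ^+ 2 * a 2%N) <= K ^+ 8 * S.
  apply: (@le_trans _ _ (1 * (K ^+ 8 * S))); last by rewrite mul1r.
  by apply: ler_pM => //; [rewrite mulr_ge0 ?sqr_ge0|apply: ler_pM; rewrite ?sqr_ge0].
have t33 : s * (m 3 ^+ 2 * f 3%N) <= l * K ^+ 8 * S.
  apply: (@le_trans _ _ (K ^+ 6 * (s * a 3%N))).
    rewrite mulrCA; apply: (@le_trans _ _ (m 3 ^+ 2 * (s * a 3%N))).
      by rewrite ler_wpM2l ?sqr_ge0// ler_wpM2l// (le_trans (ler_norm _)).
    by rewrite ler_wpM2r// mulr_ge0.
  apply: (@le_trans _ _ (K ^+ 6 * (l * K ^+ 2 * a 2%N))); first by rewrite ler_wpM2l.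
  have -> : l * K ^+ 8 * S = K ^+ 6 * (l * K ^+ 2 * S) by ring.
  by rewrite ler_wpM2l// ler_wpM2l// mulr_ge0.
have s2 : s ^+ 2 <= 1 by rewrite expr_le1.
have c4 : 0 <= 4 * ce * (K ^+ 2 * (1 + K ^+ 6) * K ^+ 4).
  by rewrite !mulr_ge0// addr_ge0.
have te : ce * (4 * (K ^+ 2 * (1 + K ^+ 6)) * (s ^+ 2 * K ^+ 4)) * (a 5%N + a 2%N) <=
    4 * ce * (K ^+ 2 * (1 + K ^+ 6) * K ^+ 4) * S +
    4 * ce * (K ^+ 2 * (1 + K ^+ 6) * K ^+ 4) * (s ^+ 2 * a 5%N).
  rewrite -mulrDr [leLHS](_ : _ = 4 * ce * (K ^+ 2 * (1 + K ^+ 6) * K ^+ 4) *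
    (s ^+ 2 * a 2%N + s ^+ 2 * a 5%N)); last by ring.
  apply: ler_wpM2l => //; rewrite lerD2r.
  by rewrite (le_trans _ aS)// ler_piMl.
move: te; set C4 := 4 * ce * _ in c4 *; set TE := ce * _ * _ => te.
have x6S : 0 <= K ^+ 6 * S by rewrite mulr_ge0.
have x8S : 0 <= K ^+ 8 * S by rewrite mulr_ge0.
clear - t4 t31 t51' t42 t33 te aS A2 x6S x8S.
move: t4 t31 t51' t42 t33 te aS A2 x6S x8S; rewrite expr1n expr0n /=.
move: (m 4 ^+ 2) (m 3 ^+ 2) (m 5 ^+ 2) (f 1%N) (f 3%N) (f 4) (a 5%N) (a 2%N).
move: (K ^+ 6) (K ^+ 8) (K ^+ 10) S C4 TE => k6 k8 k10 S C4 TE *.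
lra.
Qed.

End overlap_moments.

(** * Limit of the relative entropy *)

Lemma iter_le (R : realType) (rho D : R) (u : nat -> R) N : 0 <= rho -> rho < 1 ->
  0 <= D -> u 0%N <= 0 -> (forall n, (n < N)%N -> u n.+1 <= rho * u n + D) ->
  forall n, (n <= N)%N -> u n <= D / (1 - rho).
Proof.
move=> r0 r1 D0 u0 h; have rr : 0 < 1 - rho by lra.
elim=> [_|n IH nN]; first by rewrite (le_trans u0)// divr_ge0// ltW.
apply: (le_trans (h _ nN)); apply: (@le_trans _ _ (rho * (D / (1 - rho)) + D)).
  by rewrite lerD2r ler_wpM2l// IH// ltnW.
by rewrite le_eqVlt; apply/orP; left; apply/eqP; field; rewrite gt_eqF.
Qed.

Lemma telescope_le (R : realType) (D : R) (u : nat -> R) N : u 0%N = 0 ->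
  (forall n, (n < N)%N -> `|u n.+1 - u n| <= D) ->
  forall n, (n <= N)%N -> `|u n| <= n%:R * D.
Proof.
move=> u0 h; elim=> [_|n IH nN]; first by rewrite u0 normr0 mul0r.
have -> : u n.+1 = (u n.+1 - u n) + u n by rewrite subrK.
rewrite (le_trans (ler_normD _ _))// -natr1 mulrDl mul1r addrC lerD ?h//.
by rewrite IH// ltnW.
Qed.

Lemma amgm_scaled (R : realType) (t x : R) : 0 < t -> x <= t * x ^+ 2 + (4 * t)^-1.
Proof.
move=> t0; have t4 : 0 < 4 * t by rewrite mulr_gt0.
rewrite -subr_ge0.
have -> : t * x ^+ 2 + (4 * t)^-1 - x = (2 * t * x - 1) ^+ 2 / (4 * t).
  by field; rewrite gt_eqF.
by rewrite divr_ge0 ?sqr_ge0// ltW.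
Qed.

(** -ln (1 - x) - x is the primitive of x / (1 - x) vanishing at 0. With y = s / (1 - x) the error
    of the Riemann sum is exactly -ln (1 - y) - y. *)
Lemma entropy_primitive_step (R : realType) (l s x : R) : 0 <= s -> 0 <= x ->
  x + s <= l -> l < 1 -> s <= (1 - l) / 2 ->
  `|(- ln (1 - (x + s)) - (x + s)) - (- ln (1 - x) - x) - s * (x / (1 - x))|
    <= 2 * (s / (1 - l)) ^+ 2.
Proof.
move=> s0 x0 xsl l1 sl; have x1 : 0 < 1 - x by lra.
set y := s / (1 - x).
have y0 : 0 <= y by rewrite divr_ge0// ltW.
have yl : y <= s / (1 - l) by rewrite ler_wpM2l// lef_pV2 ?posrE; lra.
have y2 : y <= 2^-1.
  rewrite (le_trans yl)// ler_pdivrMr; lra.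
have /andP[h1 h2] := ln1B_bound y0 y2.
have E : 1 - (x + s) = (1 - x) * (1 - y) by rewrite /y; field; rewrite gt_eqF.
rewrite E lnM ?posrE//; last by lra.
have -> : - (ln (1 - x) + ln (1 - y)) - (x + s) - (- ln (1 - x) - x) - s * (x / (1 - x)) =
  - ln (1 - y) - y by rewrite /y; field; rewrite gt_eqF.
rewrite ger0_norm// (le_trans h2)// ler_wpM2l//.
by apply: lerXn2r; rewrite ?nnegrE// (le_trans y0).
Qed.

Section overlap_limit.
Context d (T : measurableType d) (R : realType) (P : probability T R).
Variables (c : T -> R) (K : R).
Hypotheses (mc : measurable_fun setT c) (cK : forall x, `|c x| <= K).
Hypotheses (cint0 : \int[P]_x c x = 0) (cint1 : \int[P]_x c x ^+ 2 = 1).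
Variable l : R.
Hypotheses (l0 : 0 <= l) (l1 : l < 1).
(** The order 1 / N^2 is dictated by [overlap4_bound]: this mass is multiplied by (n + 1) s^2 n^5,
    of order N^4, in a recursion whose other terms are O(N^2). *)
Hypothesis tail : forall e, 0 < e -> exists2 Cp, 0 <= Cp &
  forall N n, (0 < N)%N -> (n <= N)%N ->
    deviation_mass P c (l / N%:R) n e <= Cp / N%:R ^+ 2.

Let K0 : 0 <= K. Proof. exact: le_trans (cK point). Qed.

Local Notation sN N := (l / N%:R).

Let Ngt0 N : (0 < N)%N -> 0 < N%:R :> R. Proof. by rewrite ltr0n. Qed.
Let Nge1 N : (0 < N)%N -> 1 <= N%:R :> R. Proof. by rewrite ler1n. Qed.
Let sN0 N : 0 <= sN N. Proof. by rewrite divr_ge0. Qed.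

Let sNn N n : (0 < N)%N -> (n <= N)%N -> sN N * n%:R <= l.
Proof.
move=> N0 nN; rewrite mulrAC ler_pdivrMr ?Ngt0//.
by rewrite ler_wpM2l// ler_nat.
Qed.

Let sN1 N : (0 < N)%N -> sN N <= 1.
Proof. by move=> N0; have := sNn N0 N0; rewrite mulr1 => /le_trans; apply; exact: ltW. Qed.

Lemma av_n0 s w k : (forall x y, w x y = k) -> av (iid P 0) (@signal _ _ _ c s 0) w = k.
Proof.
move=> h; have -> : w = (fun _ _ => k) by apply/funext => x; apply/funext => y.
exact: (av_cst (iid P 0) (@measurable_signal _ _ _ c mc s 0) (@signal_le _ _ _ c K cK s 0)).
Qed.

Lemma ovm_n0 s p : overlap_moment P c s 0 p.+1 = 0.
Proof. by apply: av_n0 => x y; rewrite /overlap big_ord0 expr0n. Qed.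

Lemma entr_n0 s : model_entropy P c s 0 = 0.
Proof.
rewrite /model_entropy -[RHS](int_cst (iid (std_normal R) #|upper_pairs 0|)).
apply: eq_int => g; suff -> : lik (iid P 0) (@signal _ _ _ c s 0) g = 1.
  by rewrite ln1 mulr0.
rewrite /lik -[RHS](int_cst (iid P 0)); apply: eq_int => x.
rewrite /amp /gexp big1 ?expR0// => k _.
by case: (enum_val k).1.
Qed.

(** A contraction of factor (1 + l) / 2. The second moment is fed back through <Q^2> <= (th / N)
    <Q^4> + N / (4 th). *)
Lemma overlap4_bound : exists2 C, 0 <= C & forall N n, (0 < N)%N -> (n <= N)%N ->
  overlap_moment P c (sN N) n 4 <= C * N%:R ^+ 2.
Proof.
have ce0 := cerr_ge0 K l; have l0' := l0; have l1' := l1; have K0' := K0.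
pose C3 := 4 * cerr K l * (K ^+ 2 * (1 + K ^+ 6) * K ^+ 4).
pose C2 := 3 + 7 * K ^+ 6 + 4 * K ^+ 8 + K ^+ 10 + 3 * l * K ^+ 8 + C3.
have C30 : 0 <= C3 by rewrite !mulr_ge0// ?addr_ge0 ?exprn_ge0.
have C20 : 0 <= C2.
  have := exprn_ge0 6 K0; have := exprn_ge0 8 K0; have := exprn_ge0 10 K0.
  have := mulr_ge0 l0 (exprn_ge0 8 K0).
  rewrite /C2; move: C30; move: (C3) => z *; lra.
(* e0 and th are such that the fifth and the second moment each add at most (1 - l) / 4 to the
   coefficient l of the fourth. *)
pose e0 := (1 - l) / (8 * (C3 + 1)).
pose th := (1 - l) / (4 * (C2 + 1)).
have e00 : 0 < e0 by rewrite divr_gt0; lra.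
have th0 : 0 < th by rewrite divr_gt0; lra.
have q1 : C3 * (2 * e0) <= (1 - l) / 4.
  have -> : C3 * (2 * e0) = (1 - l) / 4 * (C3 / (C3 + 1)).
    by rewrite /e0; field; rewrite gt_eqF//; lra.
  rewrite ler_piMr//; first by lra.
  by rewrite ler_pdivrMr; lra.
have q2 : C2 * th <= (1 - l) / 4.
  have -> : C2 * th = (1 - l) / 4 * (C2 / (C2 + 1)).
    by rewrite /th; field; rewrite gt_eqF//; lra.
  rewrite ler_piMr//; first by lra.
  by rewrite ler_pdivrMr; lra.
clearbody e0 th.
have [Cp Cp0 hp] := tail e00.
pose D := C2 + C2 / (4 * th) + 2 * C3 * l ^+ 2 * K ^+ 10 * Cp.
have D1 : 0 <= C2 / (4 * th).
  by apply: divr_ge0 => //; apply: mulr_ge0 => //; exact: ltW.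
have D2 : 0 <= 2 * C3 * l ^+ 2 * K ^+ 10 * Cp.
  apply: mulr_ge0 => //; apply: mulr_ge0; last exact: exprn_ge0.
  by apply: mulr_ge0; [apply: mulr_ge0|exact: sqr_ge0].
have D0 : 0 <= D := addr_ge0 (addr_ge0 C20 D1) D2.
exists (D / (1 - (1 + l) / 2)); first by rewrite divr_ge0; lra.
move=> N n N0 nN; have Np := Ngt0 N0; have N1 := Nge1 N0.
rewrite mulrAC; move: n nN.
apply: (iter_le (u := fun n => overlap_moment P c (sN N) n 4)); [lra|lra| |by rewrite ovm_n0|].
  by rewrite mulr_ge0// sqr_ge0.
move=> n nN; have nN' := ltnW nN.
have st := overlap4_step mc cK cint0 cint1 (sN0 N) (sN1 N0) (sNn N0 nN').
have a5 := ovam5_le P mc cK (sN0 N) n e00.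
have p := hp N n N0 nN'.
have a2 : abs_moment P c (sN N) n 2 <=
    (th / N%:R) * abs_moment P c (sN N) n 4 + (4 * (th / N%:R))^-1 * abs_moment P c (sN N) n 0.
  apply: (ovam_mono P mc cK) => S; rewrite expr0 mulr1 (exprM _ 2 2).
  by apply: amgm_scaled; rewrite divr_gt0.
have a4 := ovm_ge0 P mc cK (sN N) n 4.
have ov0 := ovam0 P mc cK (sN N) n.
have p0 : 0 <= deviation_mass P c (sN N) n e0.
  apply: int_ge0 => g; rewrite divr_ge0//.
    apply: int_ge0 => x; apply: int_ge0 => y.
    by rewrite mulr_ge0// ?mulr_ge0 ?expR_ge0// indicE.
  by apply: int_ge0 => x; exact: expR_ge0.
rewrite -/C3 -/C2 in st; move: st a5 p a2 a4 ov0 p0.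
rewrite (ovam_even P c (sN N) n (p := 2))// (ovam_even P c (sN N) n (p := 4))//.
have ns : n.+1%:R * sN N <= l by rewrite mulrC; exact: sNn.
have n1N : n.+1%:R <= N%:R :> R by rewrite ler_nat.
have nNr : n%:R <= N%:R :> R by rewrite ler_nat.
have sE : sN N * N%:R = l by rewrite mulfVK// gt_eqF.
move: (sN0 N) ns sE; move: (sN N) => s s0 ns sE.
move: (overlap_moment P c s n.+1 4) (overlap_moment P c s n 4) (overlap_moment P c s n 2)
  (abs_moment P c s n 5)
  (abs_moment P c s n 0) (deviation_mass P c s n e0) => X f4 f2 a5 a0 p st h5 hp' h2 f40 a00 p0.
rewrite a00 mulr1 in h2.
have k0 : 0 <= n.+1%:R :> R by [].
have t1 : n.+1%:R * (s * f4) <= l * f4 by rewrite mulrA ler_wpM2r.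
have t2 : n.+1%:R * C2 <= C2 * N%:R ^+ 2.
  rewrite mulrC ler_wpM2l// (le_trans n1N)// expr2 ler_peMl// ltW.
have t3 : n.+1%:R * (C2 * f2) <= C2 * th * f4 + C2 / (4 * th) * N%:R ^+ 2.
  apply: (@le_trans _ _ (N%:R * (C2 * (th / N%:R * f4 + (4 * (th / N%:R))^-1)))).
    apply: (@le_trans _ _ (n.+1%:R * (C2 * (th / N%:R * f4 + (4 * (th / N%:R))^-1)))).
      by rewrite ler_wpM2l// ler_wpM2l.
    have tN : 0 < th / N%:R by rewrite divr_gt0.
    apply: ler_wpM2r => //; apply: mulr_ge0 => //; apply: addr_ge0.
      by apply: mulr_ge0 => //; exact: ltW.
    by rewrite invr_ge0; apply: mulr_ge0 => //; exact: ltW.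
  rewrite le_eqVlt; apply/orP; left; apply/eqP; field.
  by rewrite !gt_eqF.
have t5 : n.+1%:R * (s ^+ 2 * a5) <= 2 * e0 * l * f4 +
    2 * l ^+ 2 * K ^+ 10 * Cp * N%:R ^+ 2.
  apply: (@le_trans _ _ (n.+1%:R * (2 * e0 * (s * f4) + 2 * s ^+ 2 * (n%:R * K ^+ 2) ^+ 5 * p))).
    by rewrite ler_wpM2l.
  rewrite mulrDr lerD//.
    have -> : n.+1%:R * (2 * e0 * (s * f4)) = 2 * e0 * (n.+1%:R * (s * f4)) by ring.
    by rewrite -[leRHS]mulrA ler_wpM2l// mulr_ge0// ltW.
  apply: (@le_trans _ _ (N%:R * (2 * s ^+ 2 * (N%:R * K ^+ 2) ^+ 5 * (Cp / N%:R ^+ 2)))).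
    have q0 : 0 <= (n%:R * K ^+ 2) ^+ 5 by rewrite exprn_ge0// mulr_ge0// sqr_ge0.
    have s20 : 0 <= 2 * s ^+ 2 by rewrite mulr_ge0// sqr_ge0.
    apply: ler_pM => //; first by rewrite mulr_ge0// mulr_ge0.
    apply: ler_pM => //; first by rewrite mulr_ge0.
    rewrite ler_wpM2l//; apply: lerXn2r; rewrite ?nnegrE ?mulr_ge0 ?sqr_ge0//.
    by rewrite ler_wpM2r// sqr_ge0.
  rewrite -sE le_eqVlt; apply/orP; left; apply/eqP; field.
  by rewrite gt_eqF.
have t6 := ler_wpM2l C30 t5.
have q3 : C3 * (2 * e0) * l <= (1 - l) / 4.
  apply: (@le_trans _ _ ((1 - l) / 4 * l)); first by rewrite ler_wpM2r.
  by rewrite ler_piMr ?(ltW l1)// divr_ge0// subr_ge0 ltW.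
have q4 : (l + C3 * (2 * e0) * l + C2 * th) * f4 <= (1 + l) / 2 * f4.
  by rewrite ler_wpM2r//; lra.
apply: (le_trans st).
have -> : n.+1%:R * (s * f4 + C2 * (1 + f2) + C3 * (s ^+ 2 * a5)) =
  n.+1%:R * (s * f4) + n.+1%:R * C2 + n.+1%:R * (C2 * f2) + C3 * (n.+1%:R * (s ^+ 2 * a5)).
  by ring.
have -> : D * N%:R ^+ 2 = C2 * N%:R ^+ 2 + C2 / (4 * th) * N%:R ^+ 2 +
   C3 * (2 * l ^+ 2 * K ^+ 10 * Cp * N%:R ^+ 2) by rewrite /D; ring.
move: t1 t2 t3 t6 q4; clear.
move: (n.+1%:R * (s * f4)) (n.+1%:R * C2) (n.+1%:R * (C2 * f2)) (n.+1%:R * (s ^+ 2 * a5))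
  (C2 / (4 * th) * N%:R ^+ 2) => *; lra.
Qed.

Let rN N : (0 < N)%N -> exists2 r : R, r = Num.sqrt N%:R & [/\ 1 <= r, 0 < r & N%:R = r ^+ 2].
Proof.
move=> N0; exists (Num.sqrt N%:R) => //; have N1 := Nge1 N0; split.
- by rewrite -[leLHS]sqrtr1 ler_sqrt// ltr0n.
- by rewrite sqrtr_gt0 Ngt0.
- by rewrite sqr_sqrtr.
Qed.

(** Interpolation between 1 and the fourth moment at the scale |Q| ~ sqrt N. *)
Lemma overlap_bounds : exists2 C, 0 <= C & forall N n, (0 < N)%N -> (n <= N)%N ->
  [/\ abs_moment P c (sN N) n 1 <= C * Num.sqrt N%:R, overlap_moment P c (sN N) n 2 <= C * N%:R &
    abs_moment P c (sN N) n 3 <= C * (N%:R * Num.sqrt N%:R)].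
Proof.
have [C C0 h] := overlap4_bound; exists (2 * C + 1); first by lra.
move=> N n N0 nN; have := h N n N0 nN; have [r <- [r1 r0 NE]] := rN N0.
have Np := Ngt0 N0; have ri : 0 < r^-1 by rewrite invr_gt0.
have Ni : 0 < N%:R^-1 :> R by rewrite invr_gt0.
have a2 : abs_moment P c (sN N) n 2 <=
    N%:R^-1 * abs_moment P c (sN N) n 4 + (4 * N%:R^-1)^-1 * abs_moment P c (sN N) n 0.
  apply: (ovam_mono P mc cK) => S; rewrite expr0 mulr1 (exprM _ 2 2).
  exact: amgm_scaled.
have a1 : abs_moment P c (sN N) n 1 <=
    r^-1 * abs_moment P c (sN N) n 2 + (4 * r^-1)^-1 * abs_moment P c (sN N) n 0.
  apply: (ovam_mono P mc cK) => S; rewrite expr0 mulr1 expr1.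
  exact: amgm_scaled.
have a3 : abs_moment P c (sN N) n 3 <=
    r^-1 * abs_moment P c (sN N) n 4 + (4 * r^-1)^-1 * abs_moment P c (sN N) n 2.
  apply: (ovam_mono P mc cK) => S.
  have := ler_wpM2l (exprn_ge0 2 (normr_ge0 S)) (amgm_scaled `|S| ri).
  clear a1 a2; move: `|S| => x; lra.
move: a1 a2 a3; rewrite (ovam0 P mc cK (sN N) n).
rewrite (ovam_even P c (sN N) n (p := 2))// (ovam_even P c (sN N) n (p := 4))//.
move: (sN N) => s; rewrite NE.
move: (abs_moment P c s n 1) (overlap_moment P c s n 2) (abs_moment P c s n 3) (overlap_moment P
  c s n 4) => a1 a2 a3 a4.
have -> : (4 * (r ^+ 2)^-1)^-1 = r ^+ 2 / 4 by field; rewrite gt_eqF.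
have -> : (4 * r^-1)^-1 = r / 4 by field; rewrite gt_eqF.
move=> h1 h2 h3 h4.
have k1 : (r ^+ 2)^-1 * a4 <= C * r ^+ 2.
  rewrite mulrC ler_pdivrMr ?exprn_gt0// (le_trans h4)//.
  by rewrite -mulrA.
have k2 : a2 <= (C + 1 / 4) * r ^+ 2 by lra.
have k3 : r^-1 * a2 <= (C + 1 / 4) * r.
  by rewrite mulrC ler_pdivrMr// -mulrA -expr2.
have k4 : r^-1 * a4 <= C * (r ^+ 2 * r).
  rewrite mulrC ler_pdivrMr// (le_trans h4)// le_eqVlt; apply/orP; left; apply/eqP; ring.
have k5 : r / 4 * a2 <= r / 4 * ((C + 1 / 4) * r ^+ 2).
  by rewrite ler_wpM2l// divr_ge0// ltW.
have Cr : 0 <= C * r by rewrite mulr_ge0// ltW.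
have Cr2 : 0 <= C * r ^+ 2 by rewrite mulr_ge0// sqr_ge0.
have Cr3 : 0 <= C * (r ^+ 2 * r) by rewrite mulr_ge0// mulr_ge0 ?sqr_ge0// ltW.
have r2 : 0 <= r ^+ 2 by exact: sqr_ge0.
have r3 : 0 <= r ^+ 2 * r by rewrite mulr_ge0// ltW.
split; lra.
Qed.

(** Deviations contract by a factor l at each step, so the errors of all steps together keep the
    order 1 / sqrt N of a single one. *)
Lemma overlap2_limit : exists2 C, 0 <= C & forall N n, (0 < N)%N -> (n <= N)%N ->
  `|sN N * overlap_moment P c (sN N) n 2 - sN N * n%:R / (1 - sN N * n%:R)| <= C / Num.sqrt N%:R.
Proof.
have [C C0 h] := overlap_bounds.
have ce0 := cerr_ge0 K l; have l0' := l0; have l1' := l1.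
pose Ce := cerr K l * (K ^+ 2 * (1 + K ^+ 2) * K ^+ 4).
have Ce0 : 0 <= Ce.
  by rewrite mulr_ge0// mulr_ge0 ?exprn_ge0// mulr_ge0 ?addr_ge0 ?exprn_ge0.
pose D := K ^+ 6 * C + 2 * (Ce * C) + ((1 - l) ^+ 2)^-1.
have D0 : 0 <= D.
  apply: addr_ge0; last by rewrite invr_ge0 sqr_ge0.
  by apply: addr_ge0; apply: mulr_ge0 => //; [exact: exprn_ge0|exact: mulr_ge0].
exists (D / (1 - l)); first by rewrite divr_ge0//; lra.
move=> N n N0 nN; have [r <- [r1 r0 NE]] := rN N0; have Np := Ngt0 N0.
rewrite [leRHS]mulrAC; move: n nN.
apply: (iter_le (u := fun n => `|sN N * overlap_moment P c (sN N) n 2 -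
    sN N * n%:R / (1 - sN N * n%:R)|)) => //.
- by rewrite divr_ge0// ltW.
- by rewrite ovm_n0 !mulr0 mul0r subrr normr0.
move=> n nN; have nN' := ltnW nN.
have [b1 b2 b3] := h N n N0 nN'.
have st := overlap2_step mc cK cint0 cint1 (sN0 N) (sNn N0 nN').
have ns := sNn N0 nN.
have sE : sN N * N%:R = l by rewrite mulfVK// gt_eqF.
move: b1 b2 b3 st (sN0 N) ns sE (ovam_ge0 P mc cK (sN N) n 1)
  (ovam_ge0 P mc cK (sN N) n 2) (ovam_ge0 P mc cK (sN N) n 3).
have -> : Num.sqrt N%:R = r by rewrite NE sqrtr_sqr gtr0_norm.
rewrite (ovam_even P c (sN N) n (p := 2))//.
move: (sN N) => s; rewrite NE.
move: (abs_moment P c s n 1) (overlap_moment P c s n 2) (abs_moment P c s n 3) (overlap_moment P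
  c s n.+1 2) => a1 a2 a3 X.
move=> b1 b2 b3 st s0 ns sE a10 a20 a30.
have sr : s <= (r ^+ 2)^-1.
  by rewrite -[leRHS]mul1r ler_pdivlMr ?exprn_gt0// sE ltW.
have ri : 0 < r^-1 by rewrite invr_gt0.
have ir2 : (r ^+ 2)^-1 <= r^-1.
  by rewrite lef_pV2 ?posrE ?exprn_gt0// expr2 ler_peMl// ltW.
have e1 : s * a1 <= C / r.
  apply: (@le_trans _ _ ((r ^+ 2)^-1 * (C * r))); first exact: ler_pM.
  by rewrite le_eqVlt; apply/orP; left; apply/eqP; field; rewrite gt_eqF.
have s2r : s ^+ 2 <= (r ^+ 2)^-1 ^+ 2.
  by apply: lerXn2r; rewrite ?nnegrE// invr_ge0 exprn_ge0// ltW.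
have e3 : s ^+ 2 * a3 <= C / r.
  apply: (@le_trans _ _ ((r ^+ 2)^-1 ^+ 2 * (C * (r ^+ 2 * r)))).
    by apply: ler_pM; rewrite ?sqr_ge0.
  by rewrite le_eqVlt; apply/orP; left; apply/eqP; field; rewrite gt_eqF.
have e2 : s ^+ 2 * a2 <= C / r.
  apply: (@le_trans _ _ ((r ^+ 2)^-1 ^+ 2 * (C * r ^+ 2))).
    by apply: ler_pM; rewrite ?sqr_ge0.
  apply: (@le_trans _ _ (C * (r ^+ 2)^-1)); last by rewrite ler_wpM2l.
  by rewrite le_eqVlt; apply/orP; left; apply/eqP; field; rewrite gt_eqF.
have n0 : 0 <= n%:R :> R by [].
have nS : n.+1%:R = n%:R + 1 :> R by rewrite natr1.
rewrite nS in st ns *; move: (n%:R) n0 st ns => k k0 st ns.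
have x0 : 0 <= s * k by rewrite mulr_ge0.
have xs : s * (k + 1) = s * k + s by rewrite mulrDr mulr1.
have x1 : 0 < 1 - s * k by lra.
have x1' : 0 < 1 - s * (k + 1) by lra.
(* x / (1 - x) at x = s n satisfies the recursion of s <Q^2> up to the last term, which is O(s). *)
have -> : s * X - s * (k + 1) / (1 - s * (k + 1)) =
  s * (X - (k + 1) * (1 + s * a2)) +
  s * (k + 1) * (s * a2 - s * k / (1 - s * k)) -
  s * (k + 1) * s / ((1 - s * k) * (1 - s * (k + 1))).
  by field; rewrite !gt_eqF.
apply: (le_trans (ler_normB _ _)).
have F1 : `|s * (k + 1) * (s * a2 - s * k / (1 - s * k))| <=
    l * `|s * a2 - s * k / (1 - s * k)|.
  by rewrite normrM ger0_norm ?ler_wpM2r// mulr_ge0// addr_ge0.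
have F2 : `|s * (X - (k + 1) * (1 + s * a2))| <= (K ^+ 6 * C + 2 * (Ce * C)) / r.
  rewrite normrM (ger0_norm s0).
  apply: (le_trans (ler_wpM2l s0 st)); rewrite (mulrA s).
  apply: (@le_trans _ _ (1 * (s * K ^+ 6 * a1 +
     cerr K l * (K ^+ 2 * (1 + K ^+ 2) * (s ^+ 2 * K ^+ 4)) * (a3 + a2)))).
    apply: ler_wpM2r; last by lra.
    apply: addr_ge0; first by apply: mulr_ge0 => //; apply: mulr_ge0 => //; exact: exprn_ge0.
    apply: mulr_ge0; last exact: addr_ge0.
    apply: mulr_ge0 => //; apply: mulr_ge0.
      by apply: mulr_ge0; [exact: sqr_ge0|apply: addr_ge0 => //; exact: sqr_ge0].
    by apply: mulr_ge0; exact: exprn_ge0.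
  have -> : 1 * (s * K ^+ 6 * a1 +
     cerr K l * (K ^+ 2 * (1 + K ^+ 2) * (s ^+ 2 * K ^+ 4)) * (a3 + a2)) =
     K ^+ 6 * (s * a1) + Ce * (s ^+ 2 * a3 + s ^+ 2 * a2) by rewrite /Ce; ring.
  have := ler_wpM2l (exprn_ge0 6 K0) e1.
  have := ler_wpM2l Ce0 (lerD e3 e2); lra.
have F3 : `|s * (k + 1) * s / ((1 - s * k) * (1 - s * (k + 1)))| <= ((1 - l) ^+ 2)^-1 / r.
  have p0 : 0 <= s * (k + 1) * s by rewrite !mulr_ge0// addr_ge0.
  rewrite ger0_norm; last by rewrite divr_ge0// mulr_ge0// ltW.
  rewrite mulrC; apply: ler_pM => //.
  - by rewrite invr_ge0 mulr_ge0// ltW.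
  - have l10 : 0 < 1 - l by lra.
    rewrite lef_pV2 ?posrE ?mulr_gt0 ?exprn_gt0//.
    by rewrite expr2; apply: ler_pM; lra.
  - apply: (@le_trans _ _ (1 * s)); first by rewrite ler_wpM2r//; lra.
    by rewrite mul1r (le_trans sr).
rewrite /D; move: F1 F2 F3; rewrite [(_ + ((1 - l) ^+ 2)^-1) / r]mulrDl.
set q := ((1 - l) ^+ 2)^-1 / r; set q' := (_ + 2 * _) / r => F1 F2 F3.
have := ler_normD (s * (X - (k + 1) * (1 + s * a2)))
  (s * (k + 1) * (s * a2 - s * k / (1 - s * k))).
lra.
Qed.

End overlap_limit.

(** r is the square root of N, x1 the remainder of the entropy step, x2 that of the primitive and x3
    = s n / (1 - s n). The error is O(N^(-3/2)) per site, hence O(N^(-1/2)) after N sites. *)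
Lemma limit_step_bound (R : realType) (r s l C C' Cc a2 a3 x1 x2 x3 : R) :
  1 <= r -> 0 <= s -> s * r ^+ 2 = l -> l <= 1 -> 0 <= C -> 0 <= C' -> 0 <= Cc ->
  `|s * a2 - x3| <= C' / r -> a3 <= C * (r ^+ 2 * r) -> 0 <= a3 ->
  `|x1| <= Cc * (s ^+ 3 * a3) -> `|x2| <= 2 * (s / (1 - l)) ^+ 2 -> l < 1 ->
  `|x1 + s / 4 * (s * a2 - x3) - 4^-1 * x2| <=
    (Cc * C + C' + 2 * ((1 - l) ^+ 2)^-1) / (r ^+ 2 * r).
Proof.
move=> r1 s0 sE l1 C0 C'0 Cc0 b2 b3 a30 st La' l1'.
have r0 : 0 < r by lra.
have sr : s <= (r ^+ 2)^-1 by rewrite -[leRHS]mul1r ler_pdivlMr ?exprn_gt0// sE.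
have ri : 0 < r^-1 by rewrite invr_gt0.
have r2i : 0 <= (r ^+ 2)^-1 by rewrite invr_ge0 sqr_ge0.
have e1 : `|x1| <= Cc * C / (r ^+ 2 * r).
  apply: (le_trans st); rewrite -mulrA; apply: ler_wpM2l => //.
  apply: (@le_trans _ _ ((r ^+ 2)^-1 ^+ 3 * (C * (r ^+ 2 * r)))).
    by apply: ler_pM; rewrite ?exprn_ge0//; apply: lerXn2r; rewrite ?nnegrE.
  by rewrite le_eqVlt; apply/orP; left; apply/eqP; field; rewrite gt_eqF.
have e2 : `|s / 4 * (s * a2 - x3)| <= C' / (r ^+ 2 * r).
  rewrite normrM ger0_norm ?divr_ge0//.
  apply: (@le_trans _ _ ((r ^+ 2)^-1 * (C' / r))).
    apply: ler_pM => //; first by rewrite divr_ge0.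
    by rewrite (le_trans _ sr)// ler_pdivrMr//; lra.
  by rewrite le_eqVlt; apply/orP; left; apply/eqP; field; rewrite gt_eqF.
have e3 : `|4^-1 * x2| <= 2 * ((1 - l) ^+ 2)^-1 / (r ^+ 2 * r).
  rewrite normrM ger0_norm//; apply: (@le_trans _ _ `|x2|).
    by rewrite ler_piMl//; lra.
  apply: (le_trans La'); rewrite -[leRHS]mulrA ler_wpM2l// expr_div_n mulrC.
  rewrite ler_wpM2l ?invr_ge0 ?sqr_ge0//.
  apply: (@le_trans _ _ ((r ^+ 2)^-1 ^+ 2)).
    by apply: lerXn2r; rewrite ?nnegrE.
  rewrite exprVn -exprM lef_pV2 ?posrE ?exprn_gt0// ?mulr_gt0 ?exprn_gt0//.
  by rewrite -exprSr (exprSr r 3) ler_peMr// exprn_ge0// ltW.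
have := ler_normB (x1 + s / 4 * (s * a2 - x3)) (4^-1 * x2).
have := ler_normD x1 (s / 4 * (s * a2 - x3)).
have -> : (Cc * C + C' + 2 * ((1 - l) ^+ 2)^-1) / (r ^+ 2 * r) = Cc * C / (r ^+ 2 * r) +
  C' / (r ^+ 2 * r) + 2 * ((1 - l) ^+ 2)^-1 / (r ^+ 2 * r) by rewrite !mulrDl.
move: e1 e2 e3; clear.
move: (Cc * C / _) (C' / _) (2 * _ / _) => u1 u2 u3 *; lra.
Qed.

(** * Summation of the entropy increments *)

Section entropy_limit.
Context d (T : measurableType d) (R : realType) (P : probability T R).
Variables (c : T -> R) (K : R).
Hypotheses (mc : measurable_fun setT c) (cK : forall x, `|c x| <= K).
Hypotheses (cint0 : \int[P]_x c x = 0) (cint1 : \int[P]_x c x ^+ 2 = 1).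
Variable l : R.
Hypotheses (l0 : 0 <= l) (l1 : l < 1).
Hypothesis tail : forall e, 0 < e -> exists2 Cp, 0 <= Cp &
  forall N n, (0 < N)%N -> (n <= N)%N ->
    deviation_mass P c (l / N%:R) n e <= Cp / N%:R ^+ 2.

Let K0 : 0 <= K. Proof. exact: le_trans (cK point). Qed.

Local Notation sN N := (l / N%:R).

Let Ngt0 N : (0 < N)%N -> 0 < N%:R :> R. Proof. by rewrite ltr0n. Qed.
Let Nge1 N : (0 < N)%N -> 1 <= N%:R :> R. Proof. by rewrite ler1n. Qed.
Let sN0 N : 0 <= sN N. Proof. by rewrite divr_ge0. Qed.

Let sNn N n : (0 < N)%N -> (n <= N)%N -> sN N * n%:R <= l.
Proof.
move=> N0 nN; rewrite mulrAC ler_pdivrMr ?Ngt0//.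
by rewrite ler_wpM2l// ler_nat.
Qed.

Let sN1 N : (0 < N)%N -> sN N <= 1.
Proof. by move=> N0; have := sNn N0 N0; rewrite mulr1 => /le_trans; apply; exact: ltW. Qed.

Let rN N : (0 < N)%N -> exists2 r : R, r = Num.sqrt N%:R & [/\ 1 <= r, 0 < r & N%:R = r ^+ 2].
Proof.
move=> N0; exists (Num.sqrt N%:R) => //; have N1 := Nge1 N0; split.
- by rewrite -[leLHS]sqrtr1 ler_sqrt// ltr0n.
- by rewrite sqrtr_gt0 Ngt0.
- by rewrite sqr_sqrtr.
Qed.

Lemma model_entropy_limit : exists C N0, 0 <= C /\ forall N, (N0 <= N)%N ->
  `|model_entropy P c (sN N) N - 4^-1 * (- ln (1 - l) - l)| <= C / Num.sqrt N%:R.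
Proof.
have [C C0 hC] := overlap_bounds mc cK cint0 cint1 l0 l1 tail;
  have [C' C'0 hC'] := overlap2_limit mc cK cint0 cint1 l0 l1 tail.
have l0' := l0; have l1' := l1.
pose Cc := 1920 * exp6 (l * K ^+ 4) * K ^+ 6.
have Cc0 : 0 <= Cc.
  apply: mulr_ge0; last exact: exprn_ge0.
  by apply: mulr_ge0; [exact: ler0n|exact: expR_ge0].
pose D := Cc * C + C' + 2 * ((1 - l) ^+ 2)^-1.
have i2 : 0 <= 2 * ((1 - l) ^+ 2)^-1 by rewrite mulr_ge0// invr_ge0 sqr_ge0.
(* From this rank on s <= (1 - l) / 2, as [entropy_primitive_step] requires, and N is positive. *)
exists D, (Num.bound (2 / (1 - l))).+1; split.
  by rewrite !addr_ge0// mulr_ge0.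
move=> N N0N; have N0 : (0 < N)%N by exact: leq_trans N0N.
have [r <- [r1 r0 NE]] := rN N0; have Np := Ngt0 N0.
have lN : 2 / (1 - l) <= N%:R.
  rewrite (@le_trans _ _ (Num.bound (2 / (1 - l)))%:R)//; last by rewrite ler_nat ltnW.
  by apply/ltW/archi_boundP; rewrite divr_ge0//; lra.
have sl : sN N <= (1 - l) / 2.
  rewrite ler_pdivrMr// (@le_trans _ _ ((1 - l) / 2 * (2 / (1 - l))))//.
    by rewrite mulrA divfK// mulfV ?gt_eqF//; lra.
  by rewrite ler_wpM2l//; lra.
pose La x : R := - ln (1 - x) - x.
pose u n := model_entropy P c (sN N) n - 4^-1 * La (sN N * n%:R).
have sE : sN N * N%:R = l by rewrite mulfVK// gt_eqF.
have -> : model_entropy P c (sN N) N - 4^-1 * (- ln (1 - l) - l) = u N by rewrite /u sE.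
have -> : D / r = N%:R * (D / (N%:R * r)) by field; rewrite !gt_eqF.
apply: (telescope_le (N := N)) => //.
  by rewrite /u (entr_n0 P c) mulr0 /La !subr0 ln1 oppr0 mulr0 subrr.
move=> n nN; have nN' := ltnW nN.
have [_ _ b3] := hC N n N0 nN'.
have b2 := hC' N n N0 nN'.
have st := model_entropy_step mc cK cint0 cint1 (sN0 N) (sNn N0 nN').
have ns := sNn N0 nN.
rewrite -natr1 mulrDr mulr1 in ns.
have n0 : 0 <= sN N * n%:R by rewrite mulr_ge0.
have La' := entropy_primitive_step (sN0 N) n0 ns l1 sl.
have uE : u n.+1 - u n = (model_entropy P c (sN N) n.+1 - model_entropy P c (sN N) n -
    sN N ^+ 2 / 4 * overlap_moment P c (sN N) n 2) +
  sN N / 4 * (sN N * overlap_moment P c (sN N) n 2 - sN N * n%:R / (1 - sN N * n%:R)) -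
  4^-1 * (La (sN N * n%:R + sN N) - La (sN N * n%:R) -
    sN N * (sN N * n%:R / (1 - sN N * n%:R))).
  have nS : sN N * n.+1%:R = sN N * n%:R + sN N by rewrite -natr1 mulrDr mulr1.
  rewrite /u nS.
  have alg (A B C2 D1 D2 s' y : R) : A - 4^-1 * D1 - (B - 4^-1 * D2) =
    A - B - s' ^+ 2 / 4 * C2 + s' / 4 * (s' * C2 - y) - 4^-1 * (D1 - D2 - s' * y).
    by field.
  exact: alg.
rewrite uE; clear uE; have a2E := ovam_even P c (sN N) n (p := 2) isT.
have rE : Num.sqrt N%:R = r by rewrite NE sqrtr_sqr gtr0_norm.
rewrite rE in b2 b3; rewrite a2E in st.
move: b2 b3 st La' (sN0 N) sE (ovam_ge0 P mc cK (sN N) n 3).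
move: (sN N) => s; rewrite NE => b2 b3 st La' s0 sE a30.
apply: (limit_step_bound r1 s0 sE (ltW l1') C0 C'0 Cc0 b2 b3 a30 _ La' l1').
apply: (le_trans st); rewrite /Cc; move: (abs_moment _ _ _ _ _) (exp6 _) => x z.
by rewrite le_eqVlt; apply/orP; left; apply/eqP; ring.
Qed.

End entropy_limit.

(** * Large overlaps *)

Section planted.
Context d (Z : measurableType d) (R : realType) (pi : probability Z R).
Variables (m : nat) (a : 'I_m -> Z -> R) (A : R).
Hypotheses (ma : forall k, measurable_fun setT (a k)) (aA : forall k z, `|a k z| <= A).
Variable th : R.
Hypotheses (th0 : 0 < th) (th1 : th < 1).

Local Notation gam := (iid (std_normal R) m).
Local Notation L := (lik pi a).
Let gg : gauge gam (@l1norm R m) := gauge_l1norm R m.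

Lemma pmom_le f1 f2 : bd f1 -> bd f2 -> (forall z, 0 <= f1 z) ->
  (forall z, f1 z <= f2 z) -> frac_moment pi th a f1 <= frac_moment pi th a f2.
Proof.
move=> b1 b2 f0 f12; have f20 z : 0 <= f2 z by rewrite (le_trans (f0 z)).
apply: (int_le gg).
- exact: (dm_pmom1 pi th0 th1 ma aA b1 f0).
- exact: (dm_pmom1 pi th0 th1 ma aA b2 f20).
move=> g; apply: (ge0_ler_powR (ltW th0)); rewrite ?nnegrE//.
- by apply: int_ge0 => z; rewrite mulr_ge0// expR_ge0.
- by apply: int_ge0 => z; rewrite mulr_ge0// expR_ge0.
- apply: (int_le (gauge0 pi)).
  + exact: (bd_ampf pi g ma aA b1).
  + exact: (bd_ampf pi g ma aA b2).
  + by move=> z; rewrite ler_wpM2l// expR_ge0.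
Qed.

Lemma pmom_scale (k : R) f : 0 <= k -> bd f -> (forall z, 0 <= f z) ->
  frac_moment pi th a (fun z => k * f z) = k `^ th * frac_moment pi th a f.
Proof.
move=> k0 bf f0; rewrite -(intZ gg); last exact: (dm_pmom1 pi th0 th1 ma aA bf f0).
apply: eq_int => g; rewrite -powRM//; last first.
  by apply: int_ge0 => z; rewrite mulr_ge0// expR_ge0.
congr (_ `^ _); rewrite -(intZ (gauge0 pi)); last exact: (bd_ampf pi g ma aA bf).
by apply: eq_int => z; rewrite mulrCA.
Qed.

Lemma amp_shiftt x g y : amp a (shiftt (a^~ x) g) y = amp a g y * expR (ker a y x).
Proof.
rewrite /amp -expRD; congr expR; rewrite /gexp /ker -big_split; apply: eq_bigr => k _.
by rewrite tnth_mktuple /=; ring.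
Qed.

Section weight.
Variable w : Z -> Z -> R.
Hypotheses (bw : bd (fun p => w p.1 p.2)) (w0 : forall x y, 0 <= w x y).

(** The part of the likelihood ratio due to the replicas y that w selects relative to a planted
    spike x. *)
Definition tilted_lik (g : m.-tuple R) x := \int[pi]_y (w x y * amp a g y).

Let bwx x : bd (w x). Proof. exact: (bd_comp (pair1_measurable x) bw). Qed.

Lemma inner_ge0 g x : 0 <= tilted_lik g x.
Proof. by apply: int_ge0 => y; rewrite mulr_ge0// expR_ge0. Qed.

Lemma dm_inner : dm (prodG (@l1norm R m) (fun _ : Z => 0)) (fun p => tilted_lik p.1 p.2).
Proof.
have mp : measurable_fun setT (fun q : (m.-tuple R * Z) * Z => (q.1.1, q.2)).
  apply: measurable_fun_pair => //; exact: (measurableT_comp measurable_fst measurable_fst).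
have mq : measurable_fun setT (fun q : (m.-tuple R * Z) * Z => (q.1.2, q.2)).
  apply: measurable_fun_pair => //; exact: (measurableT_comp measurable_snd measurable_fst).
have dF : dm (prodG (prodG (@l1norm R m) (fun _ : Z => 0)) (fun _ : Z => 0))
    (fun q => w q.1.2 q.2 * amp a q.1.1 q.2).
  apply: dmM; first by apply: bd_dm; exact: (bd_comp mq bw).
  apply: (dm_comp (B := 1) (phi := fun q : (m.-tuple R * Z) * Z =>
    (q.1.1, q.2)) _ _ (dm_amp pi ma aA)) => //.
  by move=> [[g x] y]; rewrite /prodG /= mul1r !addr0 lerDr.
exact: (dm_int2 (gauge_prod gg (gauge0 pi)) (gauge0 pi) dF).
Qed.

Lemma dm_amp_inner : dm (prodG (@l1norm R m) (fun _ : Z => 0))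
  (fun p => amp a p.1 p.2 * tilted_lik p.1 p.2 `^ th).
Proof.
apply: dmM; first exact: (dm_amp pi ma aA).
apply: dm_powR; [exact: ltW|exact: ltW| |exact: dm_inner].
by move=> p; exact: inner_ge0.
Qed.

(** The amplitude of x is a Cameron-Martin density: it plants the signal of x in the noise, which
    multiplies the amplitude of y by exp (ker y x). *)
Lemma int_amp_inner x : \int[gam]_g (amp a g x * tilted_lik g x `^ th) =
  frac_moment pi th a (fun y => w x y * expR (ker a y x)).
Proof.
have dI : dm (@l1norm R m) (fun g => tilted_lik g x `^ th).
  apply: dm_powR; [exact: ltW|exact: ltW| |exact: (dm_sec2 gg (gauge0 pi) x dm_inner)].
  by move=> g; exact: inner_ge0.
transitivity (\int[gam]_g (tilted_lik g x `^ th * expR (gexp (a^~ x) g))).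
  by apply: eq_int => g; rewrite mulrC.
rewrite -(int_shift (a^~ x) dI); apply: eq_int => g; congr (_ `^ _); apply: eq_int => y.
by rewrite amp_shiftt; ring.
Qed.

Hypothesis w1 : forall x y, w x y <= 1.

Lemma inner_le g x : tilted_lik g x <= L g.
Proof.
have ba := bd_amp pi ma aA g; apply: (int_le (gauge0 pi)).
- by apply: dmM; [exact: bwx|exact: ba].
- exact: ba.
- by move=> y; rewrite ler_piMl// expR_ge0.
Qed.

(* Used with M the part of the likelihood ratio [l] due to a set of overlaps. *)
Lemma ratio_le (tau M l : R) : 0 < tau -> 0 <= M -> M <= l -> 0 < l ->
  M / l <= tau / l + tau `^ (- th) * M `^ th.
Proof.
move=> t0 M0 Ml l0; have [lt|tl] := leP l tau.
  rewrite (@le_trans _ _ (tau / l))//; last by rewrite lerDl mulr_ge0 ?powR_ge0.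
  by rewrite ler_pM2r ?invr_gt0// (le_trans Ml).
rewrite (@le_trans _ _ (tau `^ (- th) * M `^ th))//; last by rewrite lerDr divr_ge0// ltW.
have Ml1 : M / l <= 1 by rewrite ler_pdivrMr// mul1r.
have Ml0 : 0 <= M / l by rewrite divr_ge0// ltW.
apply: (@le_trans _ _ ((M / l) `^ th)).
  have [->|n0] := eqVneq (M / l) 0; first exact: powR_ge0.
  rewrite -[leLHS]powRr1//; apply: ger_powR; last exact: ltW.
  by rewrite lt_neqAle eq_sym n0 Ml0 Ml1.
rewrite powRM ?invr_ge0 ?(ltW l0)// mulrC; apply: ler_wpM2r; first exact: powR_ge0.
rewrite powRN -powR_inv1 ?(ltW l0)// -powRrM mulN1r powRN.
rewrite lef_pV2 ?posrE ?powR_gt0//.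
by apply: (ge0_ler_powR (ltW th0)); rewrite ?nnegrE ltW.
Qed.

(** [ratio_le] is applied for each planted x. The term tau / L contributes exactly tau, since the
    amplitude averaged over x is L. *)
Lemma av_le_pmom tau : 0 < tau ->
  av pi a w <= tau + tau `^ (- th) *
    \int[pi]_x frac_moment pi th a (fun y => w x y * expR (ker a y x)).
Proof.
move=> t0; have dI := dm_amp_inner; have L0 g := lik_gt0 pi ma aA g.
have dL := dm_lik pi ma aA; have dinv := dm_invlik pi ma aA.
have dI2 := dm_int2 gg (gauge0 pi) dI.
have dr : dm (@l1norm R m) (fun g => tau + tau `^ (- th) *
    \int[pi]_x (amp a g x * tilted_lik g x `^ th)).
  by apply: dmD; [exact: dm_cst|exact: dmZ].
have -> : \int[pi]_x frac_moment pi th a (fun y => w x y * expR (ker a y x)) =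
    \int[gam]_g \int[pi]_x (amp a g x * tilted_lik g x `^ th).
  rewrite (fubini_swap gg (gauge0 pi) dI); apply: eq_int => x.
  by rewrite -int_amp_inner.
have -> : tau + tau `^ (- th) * \int[gam]_g \int[pi]_x (amp a g x * tilted_lik g x `^ th) =
    \int[gam]_g (tau + tau `^ (- th) * \int[pi]_x (amp a g x * tilted_lik g x `^ th)).
  rewrite (intD gg); [|exact: dm_cst|exact: dmZ].
  by rewrite int_cst (intZ gg).
apply: (int_le gg); [exact: (dm_wavlik pi ma aA bw)|exact: dr|].
move=> g.
have ba := bd_amp pi ma aA g.
have bin : bd (tilted_lik g) := dm_sec1 gg (gauge0 pi) g dm_inner.
have bai : bd (fun x => amp a g x * tilted_lik g x `^ th) := dm_sec1 gg (gauge0 pi) g dI.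
have b1 : bd (fun x => amp a g x * (tilted_lik g x / L g)).
  by apply: dmM => //; apply: dmM => //; exact: dm_cst.
have -> : pair_weight pi a w g / L g = \int[pi]_x (amp a g x * (tilted_lik g x / L g)).
  rewrite /pair_weight -(intZr (gauge0 pi)); last first.
    exact: (dm_int2 (gauge0 pi) (gauge0 pi) (bd_dm _ (bd_wamp pi ma aA bw g))).
  apply: eq_int => x; rewrite mulrA; congr (_ / _).
  have bwa : bd (fun y => w x y * amp a g y) by apply: dmM; [exact: bwx|exact: ba].
  rewrite -(intZ (gauge0 pi))//.
  by apply: eq_int => y; ring.
have e0 : tau = \int[pi]_x (amp a g x * (tau / L g)).
  by rewrite (intZr (gauge0 pi))// -/(lik pi a g) mulrCA mulfV ?mulr1// gt_eqF.
rewrite [X in _ <= X + _]e0 -(intZ (gauge0 pi))// -(intD (gauge0 pi)); last 2 first.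
- by apply: dmM => //; exact: dm_cst.
- exact: dmZ.
apply: (int_le (gauge0 pi)) => //.
  by apply: dmD; [apply: dmM => //; exact: dm_cst|exact: dmZ].
move=> x; rewrite [X in _ <= _ + X]mulrCA -mulrDr ler_wpM2l ?expR_ge0//.
by apply: ratio_le => //; [exact: inner_ge0|exact: inner_le].
Qed.

End weight.
End planted.

(** * Comparison channels: constant and scalar signals *)

Section constant_signal.
Context d (Z : measurableType d) (R : realType) (pi : probability Z R).
Variables (m : nat) (a : 'I_m -> Z -> R) (A v : R).
Hypotheses (ma : forall k, measurable_fun setT (a k)) (aA : forall k z, `|a k z| <= A).
Hypothesis v0 : 0 <= v.
Variable th : R.
Hypotheses (th0 : 0 < th) (th1 : th < 1).

(* An additional observation with constant signal adds v to the covariance. *)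
Definition cons_sig (k : 'I_m.+1) (z : Z) : R :=
  if unlift ord0 k is Some j then a j z else Num.sqrt v.

Lemma measurable_cons_sig k : measurable_fun setT (cons_sig k).
Proof. by rewrite /cons_sig; case: (unlift ord0 k) => // j; exact: ma. Qed.

Lemma cons_sig_le k z : `|cons_sig k z| <= `|A| + Num.sqrt v.
Proof.
rewrite /cons_sig; case: (unlift ord0 k) => [j|].
  by rewrite (le_trans (aA j z))// (le_trans (ler_norm A))// lerDl sqrtr_ge0.
by rewrite ger0_norm ?sqrtr_ge0// lerDr.
Qed.

Lemma ker_cons_sig x y : ker cons_sig x y = v + ker a x y.
Proof.
rewrite /ker big_ord_recl; congr (_ + _).
  by rewrite /cons_sig unlift_none -expr2 sqr_sqrtr.
by apply: eq_bigr => j _; rewrite /cons_sig liftK.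
Qed.

Lemma amp_cons_sig (z : R) (g : m.-tuple R) x : amp cons_sig [tuple of z :: g] x =
  expR (Num.sqrt v * z - v / 2) * amp a g x.
Proof.
rewrite /amp gexp_cons expRD /cons_sig unlift_none sqr_sqrtr//; congr (_ * expR _).
by apply: eq_bigr => j _; rewrite /= liftK.
Qed.

(** A constant signal factors out of the prior. Its fractional moment is exp (th^2 v / 2 - th v /
    2), of which the nonnegative th^2 v / 2 is dropped. *)
Lemma pmom_cons_sig f : bd f -> (forall z, 0 <= f z) ->
  expR (- (th * v / 2)) * frac_moment pi th a f <= frac_moment pi th cons_sig f.
Proof.
move=> bf f0; have gm := gauge_gam R.
have dF := dm_pmom1 pi th0 th1 measurable_cons_sig cons_sig_le bf f0.
rewrite {2}/frac_moment (int_iidS gm dF).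
have E z : \int[iid (std_normal R) m]_g
    ((\int[pi]_x (amp cons_sig [tuple of z :: g] x * f x)) `^ th) =
    expR (th * Num.sqrt v * z - (th * Num.sqrt v) ^+ 2 / 2) *
    (expR ((th * Num.sqrt v) ^+ 2 / 2 - th * v / 2) * frac_moment pi th a f).
  rewrite mulrA -expRD -(intZ (gauge_l1norm R m)); last exact: (dm_pmom1 pi th0 th1 ma aA bf f0).
  apply: eq_int => g.
  have -> : \int[pi]_x (amp cons_sig [tuple of z :: g] x * f x) =
      expR (Num.sqrt v * z - v / 2) * \int[pi]_x (amp a g x * f x).
    rewrite -(intZ (gauge0 pi)); last exact: (bd_ampf pi g ma aA bf).
    by apply: eq_int => x; rewrite amp_cons_sig mulrA.
  rewrite powRM ?expR_ge0//; last by apply: int_ge0 => x; rewrite mulr_ge0// expR_ge0.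
  by rewrite -expRM; congr (expR _ * _); ring.
have -> : \int[std_normal R]_z \int[iid (std_normal R) m]_g
    ((\int[pi]_x (amp cons_sig [tuple of z :: g] x * f x)) `^ th) =
  \int[std_normal R]_z (expR (th * Num.sqrt v * z - (th * Num.sqrt v) ^+ 2 / 2) *
    (expR ((th * Num.sqrt v) ^+ 2 / 2 - th * v / 2) * frac_moment pi th a f)).
  by apply: eq_int => z; exact: E.
have de : dm (@absg R) (fun z => expR (th * Num.sqrt v * z - (th * Num.sqrt v) ^+ 2 / 2)).
  by apply: dm_exp; apply: linB; [apply: linZ; exact: lin_absg|exact: lin_cst].
rewrite (intZr gm)//.
have := int_gam_shift (th * Num.sqrt v) (dm_cst (@absg R) 1); rewrite int_cst.
have -> : \int[std_normal R]_x (1 * expR (th * Num.sqrt v * x - (th * Num.sqrt v) ^+ 2 / 2)) =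
  \int[std_normal R]_x (expR (th * Num.sqrt v * x - (th * Num.sqrt v) ^+ 2 / 2)).
  by apply: eq_int => x; rewrite mul1r.
move=> <-; rewrite mul1r; apply: ler_wpM2r; first exact: pmom_ge0.
by rewrite ler_expR lerDr divr_ge0// sqr_ge0.
Qed.

End constant_signal.

Lemma expR_le_quad (R : realType) (u : R) : u <= 0 -> expR u <= 1 + u + u ^+ 2.
Proof.
move=> u0; have h := expR_ge1Dx (- u); have e0 := expR_gt0 u.
have h1 : expR u * (1 - u) <= 1.
  by rewrite -[leRHS](expRxMexpNx_1 u) ler_wpM2l// ltW.
have p1 : 0 < 1 - u by lra.
rewrite -(ler_pM2r p1) (le_trans h1)//.
have : 0 <= - u ^+ 3 by rewrite -[- _]mulN1r -[-1]/(-1) (_ : -1 * u ^+ 3 = (- u) ^+ 3);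
  [rewrite exprn_ge0//; lra|ring].
lra.
Qed.

(** At t = ln L it bounds L^(1 + th) by L + th L ln L + th^2 (L^4 + 4). For t >= 0 use t <= e^t; for
    t < 0 use e^t t^2 <= 4. *)
Lemma exp_entropy_bound (R : realType) (th t : R) : 0 < th -> th < 1 ->
  expR t * expR (th * t) <=
  expR t + th * (expR t * t) + th ^+ 2 * (expR t ^+ 4 + 4).
Proof.
move=> th0 th1; have e0 := expR_gt0 t.
have [t0|t0] := leP 0 t.
  have te : t <= expR t by have := expR_ge1Dx t; lra.
  have tht : 0 <= th * t by rewrite mulr_ge0// ltW.
  have := expR_taylor2 (th * t); rewrite (ger0_norm tht) => /(le_trans (ler_norm _)) h1.
  have h2 : expR (th * t) <= expR t by rewrite ler_expR; nra.
  have h3 : (th * t) ^+ 2 * expR (th * t) <= th ^+ 2 * (expR t ^+ 2 * expR t).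
    rewrite exprMn -mulrA ler_wpM2l ?sqr_ge0//; apply: ler_pM; rewrite ?sqr_ge0 ?expR_ge0//.
    by apply: lerXn2r; rewrite ?nnegrE ?expR_ge0.
  have h4 : expR (th * t) <= 1 + th * t + th ^+ 2 * (expR t ^+ 2 * expR t) by lra.
  have := ler_wpM2l (ltW e0) h4; have := sqr_ge0 th; lra.
have h1 : expR (th * t) <= 1 + th * t + (th * t) ^+ 2.
  by apply: expR_le_quad; nra.
have h2 : expR t * t ^+ 2 <= 4.
  have g1 := expR_ge1Dx (- t / 2).
  have g2 : (- t / 2) ^+ 2 <= expR (- t / 2) ^+ 2.
    by apply: lerXn2r; rewrite ?nnegrE; [lra|exact: expR_ge0|lra].
  have g3 : expR (- t / 2) ^+ 2 * expR t = 1.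
    by rewrite expr2 -!expRD -[RHS]expR0; congr expR; field.
  have := ler_wpM2r (ltW e0) g2; rewrite g3; lra.
have := ler_wpM2l (ltW e0) h1.
have := ler_wpM2l (sqr_ge0 th) h2.
have : 0 <= th ^+ 2 * expR t ^+ 4 by rewrite mulr_ge0 ?sqr_ge0// exprn_ge0// ltW.
lra.
Qed.

Lemma powR_prod (R : realType) (I : finType) (f : I -> R) th : (forall i, 0 <= f i) ->
  (\prod_i f i) `^ th = \prod_i f i `^ th.
Proof.
move=> f0; suff : 0 <= \prod_i f i /\ (\prod_i f i) `^ th = \prod_i f i `^ th by case.
apply: (big_ind2 (fun x y => 0 <= x /\ x `^ th = y)) => //.
- by rewrite powR1.
- by move=> x1 x2 y1 y2 [? <-] [? <-]; rewrite mulr_ge0// powRM.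
Qed.

Section apriori.
Context d (T : measurableType d) (R : realType) (P : probability T R).
Variables (c : T -> R) (K : R).
Hypotheses (mc : measurable_fun setT c) (cK : forall x, `|c x| <= K).
Hypotheses (cint0 : \int[P]_x c x = 0).
Variable th : R.
Hypotheses (th0 : 0 < th) (th1 : th < 1).

Local Notation gam m := (iid (std_normal R) m).
Let K0 : 0 <= K. Proof. exact: le_trans (cK point). Qed.

Variables (r B : R).
Hypotheses (r0 : 0 <= r) (rB : r * K ^+ 2 <= B).

Definition scalar_signal (k : 'I_1) (x : T) : R := Num.sqrt r * c x.

Lemma mscalar_signal k : measurable_fun setT (scalar_signal k).
Proof. exact: measurable_funM. Qed.

Lemma scalar_signal_le k x : `|scalar_signal k x| <= Num.sqrt r * K.
Proof. by rewrite normrM (ger0_norm (sqrtr_ge0 r)) ler_wpM2l ?sqrtr_ge0. Qed.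

Lemma ker_sc1 x y : ker scalar_signal x y = r * (c x * c y).
Proof.
by rewrite /ker big_ord1 /scalar_signal -[in RHS](sqr_sqrtr r0); ring.
Qed.

Lemma ker_sc1_le x y : `|ker scalar_signal x y| <= B.
Proof.
rewrite ker_sc1 (le_trans _ rB)// normrM (ger0_norm r0) ler_wpM2l//.
exact: cc_le.
Qed.

(** Equal to [psi P r], by [psi_scalar]. *)
Definition scalar_entropy := \int[gam 1]_g (lik P scalar_signal g * ln (lik P scalar_signal g)).

Lemma lik_powR_le : \int[gam 1]_g (lik P scalar_signal g * lik P scalar_signal g `^ th) <=
  1 + th * scalar_entropy + th ^+ 2 * (4 + expR (6 * B)).
Proof.
have gg := gauge_l1norm R 1; have dL := dm_lik P mscalar_signal scalar_signal_le.
have L0 g := lik_gt0 P mscalar_signal scalar_signal_le g;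
  have dll := dm_liklnlik P mscalar_signal scalar_signal_le.
have dX : dm (@l1norm R 1) (fun g => lik P scalar_signal g ^+ 4) by exact: dmX.
have dp : dm (@l1norm R 1) (fun g => lik P scalar_signal g `^ th).
  by apply: dm_powR; [exact: ltW|exact: ltW|move=> g; exact: ltW|exact: dL].
apply: (@le_trans _ _ (\int[gam 1]_g (lik P scalar_signal g +
   th * (lik P scalar_signal g * ln (lik P scalar_signal g)) + th ^+
     2 * (lik P scalar_signal g ^+ 4 + 4)))).
  apply: (int_le gg); first exact: dmM.
    apply: dmD; first by apply: dmD => //; exact: dmZ.
    by apply: dmZ; apply: dmD => //; exact: dm_cst.
  move=> g; have := exp_entropy_bound (ln (lik P scalar_signal g)) th0 th1.
  have -> : expR (th * ln (lik P scalar_signal g)) = lik P scalar_signal g `^ th.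
    by rewrite mulrC expRM lnK// posrE.
  by rewrite lnK// posrE.
rewrite (intD gg); last 2 first.
- by apply: dmD => //; exact: dmZ.
- by apply: dmZ; apply: dmD => //; exact: dm_cst.
rewrite (intD gg)//; last exact: dmZ.
rewrite (int_lik1 P mscalar_signal scalar_signal_le) (intZ gg)// lerD2l (intZ gg); last first.
  by apply: dmD => //; exact: dm_cst.
rewrite ler_wpM2l ?sqr_ge0// (intD gg)//; last exact: dm_cst.
rewrite int_cst addrC lerD2l (int_lik4 P mscalar_signal scalar_signal_le) -[leRHS](int_cst (iid P
  4)).
apply: (int_le (gauge0 _)).
- by apply: bd_exp; exact: (bd_s4 mscalar_signal scalar_signal_le).
- exact: dm_cst.
- move=> t; rewrite ler_expR (le_trans (ler_norm _))// (le_trans (s4_sabs scalar_signal t))//.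
  exact: (sabs1_le ker_sc1_le).
Qed.

(** The fractional moment of one scalar channel planted at y; the factor 1 is the weight w of
    [int_amp_inner]. *)
Definition site_moment y := frac_moment P th scalar_signal (fun x => 1 * expR (ker scalar_signal
  x y)).

Let b1 : bd (fun _ : T * T => 1 : R). Proof. exact: dm_cst. Qed.

Lemma inner1 g x : tilted_lik P scalar_signal (fun _ _ => 1) g x = lik P scalar_signal g.
Proof. by apply: eq_int => y; rewrite mul1r. Qed.

Lemma int_site_moment : \int[P]_y site_moment y <=
  1 + th * scalar_entropy + th ^+ 2 * (4 + expR (6 * B)).
Proof.
have dI := dm_amp_inner P mscalar_signal scalar_signal_le th0 th1 (w :=
  fun _ _ => 1) b1 (fun _ _ => ler01).
have gg := gauge_l1norm R 1.
apply: le_trans lik_powR_le; rewrite le_eqVlt; apply/orP; left; apply/eqP.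
transitivity (\int[P]_y \int[gam 1]_g (amp scalar_signal g y * tilted_lik P scalar_signal (fun _
  _ => 1) g y `^ th)).
  apply: eq_int => y; symmetry.
  exact: (int_amp_inner P mscalar_signal scalar_signal_le th0 th1 (w :=
    fun _ _ => 1) b1 (fun _ _ => ler01)).
have /= <- := fubini_swap gg (gauge0 P) dI.
apply: eq_int => g; rewrite -(intZr (gauge0 P)); last exact: (bd_amp P mscalar_signal
  scalar_signal_le).
by apply: eq_int => y; rewrite inner1.
Qed.

Section sites.
Variable n : nat.
Local Notation mu := (iid P n).

Definition product_signal (i : 'I_n) (x : n.-tuple T) : R := Num.sqrt r * c (tnth x i).

Lemma mbsig i : measurable_fun setT (product_signal i).
Proof. by apply: measurable_funM => //; exact: measurable_entry. Qed.

Lemma bsig_le i x : `|product_signal i x| <= Num.sqrt r * K.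
Proof. by rewrite normrM (ger0_norm (sqrtr_ge0 r)) ler_wpM2l ?sqrtr_ge0. Qed.

Lemma ker_bsig x y : ker product_signal x y = r * overlap c x y.
Proof.
rewrite /ker /overlap mulr_sumr; apply: eq_bigr => i _.
by rewrite /product_signal -[in RHS](sqr_sqrtr r0); ring.
Qed.

(** Noise, prior and weight are all products over the sites, so the fractional moment factors. *)
Lemma pmom_bsig x : frac_moment mu th product_signal (fun y => expR (r * overlap c y x)) =
  \prod_(i < n) site_moment (tnth x i).
Proof.
have gm := gauge_gam R; have gg := gauge_l1norm R 1.
pose X (u : T) (g : 1.-tuple R) := \int[P]_y (amp scalar_signal g y * (1 * expR (ker
  scalar_signal y u))).
have bX u : bd (fun y => 1 * expR (ker scalar_signal y u)).
  apply: dmZ; apply: bd_exp; exact: (bd_comp (pair2_measurable u) (bd_ker mscalar_signal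
    scalar_signal_le)).
have X0 u g : 0 <= X u g by apply: int_ge0 => y; rewrite mul1r mulr_ge0// expR_ge0.
have dX u : dm (@l1norm R 1) (fun g => X u g `^ th).
  apply: (dm_pmom1 P th0 th1 mscalar_signal scalar_signal_le (bX u)) => z; rewrite mul1r;
    exact: expR_ge0.
have E1 u : site_moment u = \int[std_normal R]_z (X u [tuple z] `^ th).
  rewrite /site_moment /frac_moment (int_iidS gm (dX u)); apply: eq_int => z.
  rewrite -[RHS](int_cst (gam 0)); apply: eq_int => t.
  by congr (X u _ `^ th); apply/val_inj; rewrite /= (tuple0 t).
have dX1 u : dm (@absg R) (fun z => X u [tuple z] `^ th).
  have h := dm_iid_int gm (dX u); move: h; congr (dm _ _); apply/funext => z.
  rewrite -[RHS](int_cst (gam 0)); apply: eq_int => t.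
  by congr (X u _ `^ th); apply/val_inj; rewrite /= (tuple0 t).
transitivity (\prod_(i < n) \int[std_normal R]_z (X (tnth x i) [tuple z] `^ th)); last first.
  by apply: eq_bigr => i _; rewrite E1.
rewrite -(int_iid_prod gm) //; apply: eq_int => g.
rewrite -powR_prod//; congr (_ `^ _).
transitivity (\int[mu]_y \prod_(i < n) (fun u => amp scalar_signal [tuple tnth g i] u *
   (1 * expR (ker scalar_signal u (tnth x i)))) (tnth y i)).
  apply: eq_int => y; rewrite /amp /gexp /overlap mulr_sumr -expRD -big_split expR_sum.
  apply: eq_bigr => i _; rewrite /= big_ord1 mul1r -expRD ker_sc1 /product_signal /scalar_signal.
  by congr (expR (_ + _)); rewrite (tnth_nth 0).
have bb i : bd (fun u => amp scalar_signal [tuple tnth g i] u * (1 * expR (ker scalar_signal u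
  (tnth x i)))).
  by apply: dmM; [exact: (bd_amp P mscalar_signal scalar_signal_le)|exact: bX].
exact: (int_iid_prod (gauge0 P) bb).
Qed.

Lemma bd_site_moment : bd site_moment.
Proof.
have gg := gauge_l1norm R 1.
have dI := dm_amp_inner P mscalar_signal scalar_signal_le th0 th1 (w :=
  fun _ _ => 1) b1 (fun _ _ => ler01).
have := dm_int1 gg (gauge0 P) dI; congr (dm _ _); apply/funext => y.
exact: (int_amp_inner P mscalar_signal scalar_signal_le th0 th1 (w :=
  fun _ _ => 1) b1 (fun _ _ => ler01)).
Qed.

Lemma int_pmom_bsig : \int[mu]_x frac_moment mu th product_signal (fun y => expR (r * overlap c y
  x)) =
  (\int[P]_y site_moment y) ^+ n.
Proof.
transitivity (\int[mu]_x \prod_(i < n) site_moment (tnth x i)).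
  by apply: eq_int => x; rewrite pmom_bsig.
rewrite (int_iid_prod (gauge0 P) (fun _ => bd_site_moment)).
by rewrite prodr_const card_ord.
Qed.

End sites.
End apriori.

Lemma sum_upper_pairs (R : realType) n (f : 'I_n -> R) :
  2 * (\sum_(k < #|upper_pairs n|) f (enum_val k).1 * f (enum_val k).2) =
  (\sum_(i < n) f i) ^+ 2 - \sum_(i < n) f i ^+ 2.
Proof.
elim: n f => [|n IH] f.
  rewrite !big_ord0 big1 ?mulr0 ?expr0n ?subr0// => k _.
  by case: (enum_val k).1.
rewrite (reindex (join_pair (ord0 : 'I_n.+1)))/=; last first.
  by exists (split_pair ord0) => t _; [exact: join_pairK|exact: split_pairK].
rewrite big_sumType /= mulrDr.
under eq_bigr do rewrite enum_val_join /=.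
rewrite (IH (fun j => f (lift ord0 j))).
under eq_bigr do rewrite enum_val_join /=.
rewrite -mulr_sumr !(big_ord_recl n); ring.
Qed.

(** * Posterior mass of a window of overlaps *)

Section window.
Context d (T : measurableType d) (R : realType) (P : probability T R).
Variables (c : T -> R) (K : R).
Hypotheses (mc : measurable_fun setT c) (cK : forall x, `|c x| <= K).
Hypotheses (cint0 : \int[P]_x c x = 0).
Variables (s l l0 : R).
Hypotheses (s0 : 0 < s) (lge0 : 0 <= l) (l00 : 0 < l0).
Variable n : nat.
Hypothesis sn : s * n%:R <= l.

Local Notation sg := (signal c s).
Local Notation mu := (iid P n).
Let ms k j := @measurable_signal _ T R c mc s k j.
Let sK k j x := @signal_le _ T R c K cK s k j x.
Let K0 : 0 <= K. Proof. exact: le_trans (cK point). Qed.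

Lemma ker_sig (x y : n.-tuple T) : ker (@sg n) x y =
  s / 2 * (overlap c x y ^+ 2 - \sum_(i < n) (c (tnth x i) * c (tnth y i)) ^+ 2).
Proof.
rewrite -(sum_upper_pairs (fun i => c (tnth x i) * c (tnth y i))) mulrA divfK//.
rewrite mulr_sumr /ker; apply: eq_bigr => k _; rewrite /signal.
by rewrite -[in RHS](sqr_sqrtr (ltW s0)); ring.
Qed.

Lemma sum_sqr_bounds (x y : n.-tuple T) :
  0 <= \sum_(i < n) (c (tnth x i) * c (tnth y i)) ^+ 2 <= n%:R * K ^+ 4.
Proof.
apply/andP; split; first by apply: sumr_ge0 => i _; exact: sqr_ge0.
rewrite mulr_natl -[in leRHS](card_ord n) -sumr_const; apply: ler_sum => i _.
rewrite -real_normK ?num_real// (exprM _ 2 2); apply: lerXn2r; rewrite ?nnegrE ?sqr_ge0//.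
exact: cc_le.
Qed.

Variables (th r B de : R).
Hypotheses (th0 : 0 < th) (th1 : th < 1) (r0 : 0 <= r) (rB : r * K ^+ 2 <= B).
Hypothesis de0 : 0 <= de.
Hypothesis Hpsi : scalar_entropy P c r <= r ^+ 2 / (4 * l0).

(** r^2 / (2 s) completes the square s Q^2 / 2 - r Q, and the second term makes up for the diagonal
    missing from a sum over pairs i < j. *)
Let v := r ^+ 2 / (2 * s) + s * n%:R * K ^+ 4 / 2.
Let v0 : 0 <= v.
Proof.
by rewrite addr_ge0// divr_ge0 ?sqr_ge0// ?mulr_ge0// ?ltW// exprn_ge0.
Qed.

(** On the window the quadratic s Q^2 / 2 exceeds its tangent at Q = r / s by at most de^2 / (2
    s). *)
Lemma ker_sig_window x y : `|s * overlap c x y - r| <= de ->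
  ker (@sg n) x y <= r * overlap c x y + (de ^+ 2 - r ^+ 2) / (2 * s).
Proof.
move=> h; rewrite ker_sig; have /andP[S0 _] := sum_sqr_bounds x y.
have h2 : (s * overlap c x y - r) ^+ 2 <= de ^+ 2.
  by rewrite -real_normK ?num_real//; apply: lerXn2r; rewrite ?nnegrE.
move: h2 S0; move: (overlap c x y) (\sum_(i < n) _) => o S h2 S0.
have s2 : 0 < 2 * s by rewrite mulr_gt0.
rewrite -(ler_pM2r s2) [leRHS]mulrDl divfK ?gt_eqF//.
have : 0 <= s ^+ 2 * S by rewrite mulr_ge0// sqr_ge0.
lra.
Qed.

Lemma ker_compare x y : r * overlap c x y <= v + ker (@sg n) x y.
Proof.
rewrite ker_sig; have /andP[_ S1] := sum_sqr_bounds x y; rewrite /v.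
move: S1; move: (overlap c x y) (\sum_(i < n) _) => o S S1.
have : 0 <= (s * o - r) ^+ 2 / (2 * s) by rewrite divr_ge0 ?sqr_ge0// mulr_ge0// ltW.
have -> : (s * o - r) ^+ 2 / (2 * s) = s / 2 * o ^+ 2 - r * o + r ^+ 2 / (2 * s).
  by field; rewrite gt_eqF.
have := ler_wpM2l (ltW s0) S1; lra.
Qed.

(** Adding the constant signal makes the covariance of the model dominate that of the scalar
    channels, by [ker_compare]; Kahane's inequality then bounds its moment from above, at the price
    exp (th v / 2). *)
Lemma pmom_sig_le x : frac_moment mu th (@sg n) (fun y => expR (r * overlap c y x)) <=
  expR (th * v / 2) * frac_moment mu th (@product_signal _ _ _ c r n) (fun y => expR (r * overlap
    c y x)).
Proof.
have bF : bd (fun y => expR (r * overlap c y x)).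
  apply: bd_exp; apply: dmZ; exact: (bd_comp (pair2_measurable x) (bd_ov mc cK n)).
have F0 y : 0 <= expR (r * overlap c y x) by exact: expR_ge0.
have h1 := pmom_cons_sig mu (@ms n) (@sK n) v0 th0 th1 bF F0.
have mcs := measurable_cons_sig v (@ms n).
have csl := cons_sig_le v (@sK n).
have mbs := @mbsig _ T R c mc r n.
have bsl := @bsig_le _ T R c K cK r n.
have [B1 B10 hB1] := bdP (bd_ker mcs csl).
have [B2 B20 hB2] := bdP (bd_ker mbs bsl).
have aB y z : `|ker (cons_sig (@sg n) v) y z| <= B1 + B2.
  by rewrite (le_trans (hB1 (y, z)))// lerDl.
have bB y z : `|ker (@product_signal _ _ _ c r n) y z| <= B1 + B2.
  by rewrite (le_trans (hB2 (y, z)))// lerDr.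
have kab y z : ker (@product_signal _ _ _ c r n) y z <= ker (cons_sig (@sg n) v) y z.
  by rewrite (ker_cons_sig _ v0) (ker_bsig _ r0); exact: ker_compare.
have h2 := kahane mu th0 th1 mcs csl mbs bsl aB bB kab bF F0.
have := ler_wpM2l (expR_ge0 (th * v / 2)) (le_trans h1 h2).
by rewrite mulrA -expRD subrr expR0 mul1r.
Qed.

Let I : set R := `[r - de, r + de]%classic.

Lemma bd_window : bd (fun p : n.-tuple T * n.-tuple T => \1_I (s * overlap c p.1 p.2) : R).
Proof.
have mo : measurable_fun setT (fun p : n.-tuple T * n.-tuple T => s * overlap c p.1 p.2).
  by apply: measurable_funM => //; case: (bd_ov mc cK n).
apply: (bdI (B := 1)).
  apply: (measurableT_comp _ mo); apply: measurable_indic; exact: measurable_itv.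
by move=> p; rewrite indicE; case: (_ \in _); rewrite ?normr1 ?normr0.
Qed.

Lemma planted_window x : frac_moment mu th (@sg n)
    (fun y => \1_I (s * overlap c x y) * expR (ker (@sg n) y x)) <=
  expR (th * ((de ^+ 2 - r ^+ 2) / (2 * s))) * (expR (th * v / 2) *
    frac_moment mu th (@product_signal _ _ _ c r n) (fun y => expR (r * overlap c y x))).
Proof.
have bF : bd (fun y => expR (r * overlap c y x)).
  apply: bd_exp; apply: dmZ; exact: (bd_comp (pair2_measurable x) (bd_ov mc cK n)).
have F0 y : 0 <= expR (r * overlap c y x) by exact: expR_ge0.
set k0 := expR ((de ^+ 2 - r ^+ 2) / (2 * s)).
have ovC y : overlap c y x = overlap c x y by apply: eq_bigr => i _; rewrite mulrC.
apply: (@le_trans _ _ (frac_moment mu th (@sg n) (fun y => k0 * expR (r * overlap c y x)))).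
  apply: (pmom_le mu (@ms n) (@sK n) th0 th1).
  - apply: dmM; first exact: (bd_comp (pair1_measurable x) bd_window).
    apply: bd_exp; exact: (bd_comp (pair2_measurable x) (bd_ker (@ms n) (@sK n))).
  - exact: dmZ.
  - by move=> y; rewrite mulr_ge0 ?expR_ge0// indicE.
  - move=> y; rewrite indicE; case: (boolP (_ \in _)) => [|_]; last first.
      by rewrite mul0r mulr_ge0// expR_ge0.
    rewrite inE /I /= in_itv /= => yI.
    rewrite mul1r /k0 -expRD ler_expR addrC; apply: ker_sig_window.
    by rewrite ovC ler_distl.
rewrite (pmom_scale mu (@ms n) (@sK n) th0 th1 (expR_ge0 _) bF F0).
rewrite /k0 -expRM (mulrC _ th) ler_wpM2l ?expR_ge0//; exact: pmom_sig_le.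
Qed.

(** In units of th / s, the tangent contributes -r^2 / 2, the constant signal r^2 / 4 and the at
    most l / s sites l r^2 / (4 l0): a negative total when l < l0, up to the terms in de and th. *)
Lemma int_planted_window : \int[mu]_x frac_moment mu th (@sg n)
    (fun y => \1_I (s * overlap c x y) * expR (ker (@sg n) y x)) <=
  expR (th * ((de ^+ 2 / 2 - r ^+ 2 / 4 + l * (r ^+ 2 / (4 * l0)) +
    l * (th * (4 + expR (6 * B)))) / s + l * K ^+ 4 / 4)).
Proof.
set Ce := 4 + expR (6 * B).
have Ce0 : 0 <= Ce by rewrite addr_ge0// expR_ge0.
have bR : bd (fun x => frac_moment mu th (@product_signal _ _ _ c r n) (fun y => expR (r *
  overlap c y x))).
  have := dm_prod (index_enum 'I_n) predT (fun i : 'I_n =>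
    bd_tnth i (bd_site_moment P mc cK th0 th1 r)).
  by congr (dm _ _); apply/funext => x; rewrite (pmom_bsig P mc cK th0 th1 r0).
have bL : bd (fun x => frac_moment mu th (@sg n)
    (fun y => \1_I (s * overlap c x y) * expR (ker (@sg n) y x))).
  have w0 (x y : n.-tuple T) : 0 <= \1_I (s * overlap c x y) :> R by rewrite indicE.
  have dI := dm_amp_inner mu (@ms n) (@sK n) th0 th1
    (w := fun x y => \1_I (s * overlap c x y)) bd_window w0.
  have := dm_int1 (gauge_l1norm R _) (gauge0 mu) dI; congr (dm _ _); apply/funext => x.
  exact: (int_amp_inner mu (@ms n) (@sK n) th0 th1
    (w := fun x y => \1_I (s * overlap c x y)) bd_window w0).
apply: (@le_trans _ _ (expR (th * ((de ^+ 2 - r ^+ 2) / (2 * s))) * (expR (th * v / 2) *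
    \int[mu]_x frac_moment mu th (@product_signal _ _ _ c r n) (fun y => expR (r * overlap c y
      x))))).
  rewrite -!(intZ (gauge0 mu))//; last exact: dmZ.
  apply: (int_le (gauge0 mu)); [exact: bL|by apply: dmZ; exact: dmZ|].
  exact: planted_window.
rewrite (int_pmom_bsig P mc cK th0 th1 r0).
have sm := int_site_moment P mc cK th0 th1 r0 rB.
have sm0 : 0 <= \int[P]_y site_moment P c th r y.
  by apply: int_ge0 => y; exact: pmom_ge0.
have E : \int[P]_y site_moment P c th r y <= expR (th * (r ^+ 2 / (4 * l0)) + th ^+ 2 * Ce).
  apply: (le_trans sm); apply: le_trans (expR_ge1Dx _).
  by rewrite addrA lerD2r lerD2l ler_wpM2l// ltW.
have En : (\int[P]_y site_moment P c th r y) ^+ n <=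
    expR (l / s * (th * (r ^+ 2 / (4 * l0)) + th ^+ 2 * Ce)).
  apply: (@le_trans _ _ (expR (th * (r ^+ 2 / (4 * l0)) + th ^+ 2 * Ce) ^+ n)).
    by apply: lerXn2r; rewrite ?nnegrE ?expR_ge0.
  rewrite -expRM_natl ler_expR; apply: ler_wpM2r.
    rewrite addr_ge0// mulr_ge0 ?sqr_ge0 ?(ltW th0)//.
    by rewrite divr_ge0 ?sqr_ge0// mulr_ge0// ltW.
  by rewrite ler_pdivlMr// mulrC.
move: En; move: (_ ^+ n) => X hX.
apply: (@le_trans _ _ (expR (th * ((de ^+ 2 - r ^+ 2) / (2 * s))) * (expR (th * v / 2) *
    expR (l / s * (th * (r ^+ 2 / (4 * l0)) + th ^+ 2 * Ce))))).
  by rewrite ler_wpM2l ?expR_ge0// ler_wpM2l// expR_ge0.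
rewrite -!expRD ler_expR /v.
have K4 : 0 <= K ^+ 4 by exact: exprn_ge0.
have t1 := ler_wpM2r K4 sn; have t2 := ler_wpM2l (ltW th0) t1.
rewrite -subr_ge0.
rewrite [X in 0 <= X](_ : _ = (th * (l * K ^+ 4) - th * (s * n%:R * K ^+ 4)) / 4).
  by rewrite divr_ge0// subr_ge0.
by field; rewrite !gt_eqF.
Qed.

Lemma window_le tau : 0 < tau ->
  av mu (@sg n) (fun x y => \1_I (s * overlap c x y)) <=
  tau + tau `^ (- th) * expR (th * ((de ^+ 2 / 2 - r ^+ 2 / 4 + l * (r ^+ 2 / (4 * l0)) +
    l * (th * (4 + expR (6 * B)))) / s + l * K ^+ 4 / 4)).
Proof.
move=> t0; apply: le_trans (av_le_pmom mu (@ms n) (@sK n) th0 th1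
  (w := fun x y => \1_I (s * overlap c x y)) bd_window _ _ t0) _.
- by move=> x y; rewrite indicE.
- by move=> x y; rewrite indicE; case: (_ \in _).
by rewrite lerD2l ler_wpM2l ?powR_ge0// int_planted_window.
Qed.

End window.

Lemma grid_cover (R : realType) (e de Q : R) J : 0 < de -> e < Q -> Q <= e + J%:R * de ->
  exists j : 'I_J, `|Q - (e + j%:R * de)| <= de.
Proof.
move=> de0 eQ; elim: J => [|J IH] QJ; first by rewrite mul0r addr0 leNgt eQ in QJ.
have [QJ'|QJ'] := leP Q (e + J%:R * de).
  by have [j hj] := IH QJ'; exists (widen_ord (leqnSn J) j).
exists ord_max; rewrite ger0_norm /=; last by lra.
by move: QJ; rewrite -natr1; lra.
Qed.

Lemma expRN_le (R : realType) (x : R) : 0 < x -> expR (- x) <= 4 / x ^+ 2.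
Proof.
move=> x0; have g1 := expR_ge1Dx (x / 2).
have g2 : (x / 2) ^+ 2 <= expR (x / 2) ^+ 2.
  by apply: lerXn2r; rewrite ?nnegrE; [lra|exact: expR_ge0|lra].
have g3 : expR (x / 2) ^+ 2 * expR (- x) = 1.
  by rewrite expr2 -!expRD -[RHS]expR0; congr expR; field.
rewrite ler_pdivlMr ?exprn_gt0//.
have := ler_wpM2r (expR_ge0 (- x)) g2; rewrite g3; lra.
Qed.

Section tail.
Context d (T : measurableType d) (R : realType) (P : probability T R).
Variables (c : T -> R) (K : R).
Hypotheses (mc : measurable_fun setT c) (cK : forall x, `|c x| <= K).
Hypotheses (cint0 : \int[P]_x c x = 0).
Variables (l l0 : R).
Hypotheses (lge0 : 0 <= l) (ll0 : l < l0).
Hypothesis Hpsi : forall r, 0 <= r -> scalar_entropy P c r <= r ^+ 2 / (4 * l0).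
Let K0 : 0 <= K. Proof. exact: le_trans (cK point). Qed.

Lemma deviation_mass_tail e : 0 < e -> exists2 Cp, 0 <= Cp &
  forall N n, (0 < N)%N -> (n <= N)%N ->
    deviation_mass P c (l / N%:R) n e <= Cp / N%:R ^+ 2.
Proof.
move=> e0; have lge0' := lge0; have ll0' := ll0.
(* The window estimates divide by s. For l = 0 the scaled overlap vanishes and never exceeds e. *)
have [lE|ln0] := eqVneq l 0.
  exists 0 => // N n N0 nN; rewrite lE !mul0r /deviation_mass.
  rewrite (_ : (fun _ _ => _) = (fun _ _ => 0)).
    by rewrite (av_cst (iid P n) (@measurable_signal _ _ _ c mc 0 n) (@signal_le _ _ _ c K cK 0 n)).
  apply/funext => x; apply/funext => y; rewrite mul0r indicE memNset//=.
  by apply/negP; rewrite -leNgt ltW.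
have lp : 0 < l by rewrite lt_neqAle eq_sym ln0.
have l00 : 0 < l0 by exact: lt_trans ll0'.
have q0 : 0 < 1 - l / l0 by rewrite subr_gt0 ltr_pdivrMr// mul1r.
(* A quarter of the gap (1 - l / l0) r^2 / 4 at r = e. The width of the window and the th^2 term
   cost one be each, so an exponent of at most -2 be is left. The order of choice is be, [de], J, B,
   th. *)
pose be := (1 - l / l0) * e ^+ 2 / 16.
have be0 : 0 < be by rewrite divr_gt0// mulr_gt0// exprn_gt0.
pose de := Num.sqrt (2 * be).
have de0 : 0 < de by rewrite sqrtr_gt0 mulr_gt0.
have deE : de ^+ 2 / 2 = be.
  by rewrite sqr_sqrtr; [field|rewrite mulr_ge0// ltW].
(* As s Q <= l K^2, the number of windows depends neither on N nor on n. *)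
pose J := Num.bound (l * K ^+ 2 / de).
have JE : l * K ^+ 2 <= J%:R * de.
  rewrite -ler_pdivrMr//; apply/ltW/archi_boundP.
  by rewrite divr_ge0 ?mulr_ge0 ?sqr_ge0// ltW.
pose B := (e + J%:R * de) * K ^+ 2.
pose Ce := 4 + expR (6 * B).
have Ce0 : 0 < Ce by rewrite addr_gt0// expR_gt0.
have lCe : 0 < l * Ce by rewrite mulr_gt0.
have den0 : 0 < 2 * be + l * Ce by rewrite addr_gt0// mulr_gt0.
(* Small enough for l th Ce <= be, and below 1. *)
pose th := be / (2 * be + l * Ce).
have th0 : 0 < th by rewrite divr_gt0.
have th1 : th < 1 by rewrite ltr_pdivrMr//; lra.
have thCe : l * (th * Ce) <= be.
  have -> : l * (th * Ce) = be * (l * Ce / (2 * be + l * Ce)).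
    by rewrite /th; field; rewrite gt_eqF.
  by rewrite ler_piMr ?(ltW be0)// ler_pdivrMr//; lra.
have beE : be = (1 - l / l0) * e ^+ 2 / 16 by [].
clearbody th; clearbody de; clearbody be.
pose ka := th * be / l.
have ka0 : 0 < ka by rewrite divr_gt0// mulr_gt0.
pose D := (1 + expR (l * K ^+ 4 / 4)) * (4 / ka ^+ 2).
have D0 : 0 <= D by rewrite mulr_ge0 ?addr_ge0 ?expR_ge0// divr_ge0// sqr_ge0.
exists (J%:R * D); first by rewrite mulr_ge0.
move=> N n N0 nN; have Np : 0 < N%:R :> R by rewrite ltr0n.
set s := l / N%:R; have s0 : 0 < s by rewrite divr_gt0.
have sn : s * n%:R <= l.
  by rewrite mulrAC ler_pdivrMr// ler_wpM2l// ler_nat.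
pose I (j : 'I_J) : set R := `[e + j%:R * de - de, e + j%:R * de + de]%classic.
have bI (j : 'I_J) : bd (fun p : n.-tuple T * n.-tuple T => \1_(I j) (s * overlap c p.1 p.2) : R).
  exact: (bd_window mc cK s n (e + j%:R * de) de).
have win (j : 'I_J) : av (iid P n) (@signal _ _ _ c s n)
    (fun x y => \1_(I j) (s * overlap c x y)) <= D / N%:R ^+ 2.
  have jd : j%:R * de <= J%:R * de by rewrite ler_wpM2r ?ltW// ltr_nat.
  have jd0 : 0 <= j%:R * de by rewrite mulr_ge0// ltW.
  set r := e + j%:R * de; have r0 : 0 <= r by rewrite addr_ge0// ltW.
  have er : e <= r by rewrite lerDl.
  have rB : r * K ^+ 2 <= B by rewrite ler_wpM2r ?sqr_ge0// lerD2l.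
  (* With tau = exp (-be / s) the factor tau^(-th) uses up one of the two remaining be, and both
     terms are at most of order exp (-th be / s). *)
  have w := window_le mc cK s0 l00 sn th0 th1 r0 rB (ltW de0) (Hpsi r0)
    (expR_gt0 (- (be / s))).
  apply: (le_trans w); rewrite deE -/Ce.
  have kN : th * be / s = ka * N%:R by rewrite /ka /s; field; rewrite !gt_eqF.
  have e1 : expR (- (be / s)) <= expR (- (ka * N%:R)).
    rewrite ler_expR -kN lerN2 -mulrA ler_piMl ?(ltW th1)//.
    by rewrite divr_ge0// ltW.
  have r2 : 4 * be <= r ^+ 2 / 4 - l * (r ^+ 2 / (4 * l0)).
    have -> : r ^+ 2 / 4 - l * (r ^+ 2 / (4 * l0)) = (1 - l / l0) * r ^+ 2 / 4.
      by field; rewrite gt_eqF.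
    rewrite beE (_ : 4 * _ = (1 - l / l0) * e ^+ 2 / 4); last by field; rewrite gt_eqF.
    rewrite ler_pM2r// ler_pM2l//; apply: lerXn2r; rewrite ?nnegrE//; exact: ltW.
  have e2 : expR (- (be / s)) `^ (- th) * expR (th * ((be - r ^+ 2 / 4 +
      l * (r ^+ 2 / (4 * l0)) + l * (th * Ce)) / s + l * K ^+ 4 / 4)) <=
    expR (- (ka * N%:R)) * expR (l * K ^+ 4 / 4).
    rewrite -expRM -!expRD ler_expR -kN.
    have b2 : be - r ^+ 2 / 4 + l * (r ^+ 2 / (4 * l0)) + l * (th * Ce) <= - (2 * be) by lra.
    have b3 : (be - r ^+ 2 / 4 + l * (r ^+ 2 / (4 * l0)) + l * (th * Ce)) / s <=
       - (2 * be) / s by rewrite ler_pM2r// invr_gt0.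
    have b4 : th * (l * K ^+ 4 / 4) <= l * K ^+ 4 / 4.
      by rewrite ler_piMl ?(ltW th1)// divr_ge0// mulr_ge0// exprn_ge0.
    have := ler_wpM2l (ltW th0) b3; rewrite mulrDr; lra.
  have e3 := expRN_le (mulr_gt0 ka0 Np).
  apply: (@le_trans _ _ (expR (- (ka * N%:R)) * (1 + expR (l * K ^+ 4 / 4)))); first by lra.
  apply: (@le_trans _ _ (4 / (ka * N%:R) ^+ 2 * (1 + expR (l * K ^+ 4 / 4)))).
    by rewrite ler_wpM2r// addr_ge0// expR_ge0.
  rewrite le_eqVlt; apply/orP; left; apply/eqP; rewrite /D; field.
  by rewrite !gt_eqF.
have ms := @measurable_signal _ _ _ c mc s n; have sK := @signal_le _ _ _ c K cK s n.
apply: (@le_trans _ _ (av (iid P n) (@signal _ _ _ c s n)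
    (fun x y => \sum_(j < J) 1 * \1_(I j) (s * overlap c x y)))).
  apply: (av_le (iid P n) ms sK).
  - exact: (bd_pdev mc cK).
  - by apply: dm_sum => j; apply: dmZ; exact: bI.
  move=> x y; rewrite indicE; case: (boolP (_ \in _)) => [|_]; last first.
    by apply: sumr_ge0 => j _; rewrite mul1r indicE.
  rewrite inE /= => eQ.
  have [j hj] : exists j : 'I_J, `|s * overlap c x y - (e + j%:R * de)| <= de.
    apply: grid_cover => //; rewrite (le_trans _ (_ : l * K ^+ 2 <= _))//; last by lra.
    apply: (@le_trans _ _ (s * (n%:R * K ^+ 2))).
      by rewrite ler_wpM2l ?(ltW s0)// (le_trans (ler_norm _))// overlap_le.
    by rewrite mulrA ler_wpM2r ?sqr_ge0.
  rewrite (bigD1 j)//= indicE mem_set ?mul1r ?lerDl; last first.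
    by rewrite /I /= in_itv /= -ler_distl.
  by apply: sumr_ge0 => k _; rewrite mul1r indicE.
rewrite (av_sum (iid P n) ms sK (index_enum 'I_J) (fun=> 1)
  (w := fun j x y => \1_(I j) (s * overlap c x y)) bI).
apply: (@le_trans _ _ (\sum_(j < J) D / N%:R ^+ 2)).
  by apply: ler_sum => j _; rewrite mul1r.
by rewrite sumr_const card_ord -[leLHS]mulr_natl mulrA lexx.
Qed.

End tail.

(** * The spiked model *)

Section almost_sure.
Context d (T : measurableType d) (R : realType) (mu : probability T R).
Variable A : set T.
Hypotheses (mA : measurable A) (A1 : mu A = 1%E).

Lemma almost_surely (Q : T -> Prop) : (forall x, A x -> Q x) -> {ae mu, forall x, Q x}.
Proof.
move=> AQ; exists (~` A); split; first exact: measurableC.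
  by rewrite probability_setC// A1 subee.
by move=> x /= nQ Ax; apply: nQ; exact: AQ.
Qed.

Lemma eq_int_as (f g : T -> R) : measurable_fun setT f -> measurable_fun setT g ->
  (forall x, A x -> f x = g x) -> \int[mu]_x f x = \int[mu]_x g x.
Proof.
move=> mf mg fg; congr fine; apply: ae_eq_integral => //.
- exact/measurable_EFinP.
- exact/measurable_EFinP.
- by apply: almost_surely => x Ax _ /=; rewrite fg.
Qed.

Lemma measure_int_indic (B : set T) : measurable B -> mu B = (\int[mu]_x \1_B x)%:E.
Proof.
move=> mB; rewrite int_EFin; last first.
  apply: (dm_integrable (gauge0 mu)); apply: (dm_bounded _ (B := 1)).
    exact: measurable_indic.
  by move=> x; rewrite indicE; case: (_ \in _); rewrite ?normr1 ?normr0.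
by rewrite integral_indic// setIT.
Qed.

Lemma eq_measure_as (B C : set T) : measurable B -> measurable C ->
  (forall x, A x -> B x <-> C x) -> mu B = mu C.
Proof.
move=> mB mC BC; rewrite !measure_int_indic//; congr EFin.
apply: eq_int_as; [exact: measurable_indic|exact: measurable_indic|].
by move=> x /BC BCx; rewrite !indicE; congr (_%:R); congr nat_of_bool;
  apply/idP/idP; rewrite !inE => /BCx.
Qed.

End almost_sure.

Section channel_law.
Context d (Z : measurableType d) (R : realType) (pi : probability Z R) (m : nat).
Variables (a : 'I_m -> Z -> R) (A : R).
Hypotheses (ma : forall k, measurable_fun setT (a k)) (aA : forall k x, `|a k x| <= A).
Local Notation gam := (iid (std_normal R) m).

Definition emit (p : Z * m.-tuple R) : m.-tuple R := shiftt (a^~ p.1) p.2.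

Lemma measurable_emit : measurable_fun setT emit.
Proof.
apply/measurable_fun_tnthP => k.
rewrite (_ : _ \o _ = fun p => tnth p.2 k + a k p.1); last first.
  by apply/funext => p /=; rewrite tnth_mktuple.
apply: measurable_funD.
  exact: (measurableT_comp (measurable_tnth _) measurable_snd).
exact: (measurableT_comp (ma k) measurable_fst).
Qed.

Lemma dm_emit F : dm (@l1norm R m) F ->
  dm (prodG (fun _ : Z => 0) (@l1norm R m)) (fun p => F (emit p)).
Proof.
move=> dF; apply: (dm_comp (B := 1 + m%:R * `|A|) measurable_emit _ dF).
move=> p; rewrite /prodG add0r !(ger0_norm (l1norm_ge0 _)).
apply: (@le_trans _ _ (l1norm p.2 + m%:R * `|A|)).
  rewrite -[m in m%:R](card_ord m) mulr_natl -sumr_const.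
  rewrite /l1norm /iidG -big_split/=; apply: ler_sum => k _.
  rewrite tnth_mktuple (le_trans (ler_normD _ _))// lerD2l.
  by rewrite (le_trans (aA k p.1))// ler_norm.
have : 0 <= m%:R * `|A| by rewrite mulr_ge0.
have := l1norm_ge0 p.2; move: (_ * _) (l1norm _) => u v; nra.
Qed.

(** [lik] is the density of the output of the channel with respect to pure noise. *)
Lemma int_emit F : dm (@l1norm R m) F ->
  \int[(pi \x gam)%E]_p F (emit p) = \int[gam]_g (F g * lik pi a g).
Proof.
move=> dF; have gg := gauge_l1norm R m.
rewrite (fubini1 (gauge0 pi) gg (dm_emit dF)).
transitivity (\int[pi]_x \int[gam]_g (F g * amp a g x)).
  by apply: eq_int => x; rewrite -(int_shift (a^~ x) dF).
have dFa : dm (prodG (@l1norm R m) (fun _ : Z => 0)) (fun p => F p.1 * amp a p.1 p.2).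
  by apply: dmM; [exact: (dm_fst gg (gauge0 pi) dF)|exact: (dm_amp pi ma aA)].
rewrite -(fubini_swap gg (gauge0 pi) dFa); apply: eq_int => g.
rewrite -[RHS](intZ (gauge0 pi) _ (bd_amp pi ma aA g)); exact: eq_int.
Qed.

End channel_law.

Lemma int_gam1 (R : realType) (F : R -> R) : dm (@absg R) F ->
  \int[iid (std_normal R) 1]_g F (tnth g ord0) = \int[std_normal R]_z F z.
Proof.
move=> dF; have gm := gauge_gam R.
rewrite (int_iidS gm (dm_tnth gm ord0 dF)); apply: eq_int => z.
by rewrite -[RHS](int_cst (iid (std_normal R) 0)); apply: eq_int.
Qed.

(** * Identification of [psi] with a relative entropy *)

Section clamp.
Context (R : realType) (P : probability R R).
Variables (c : R -> R) (K : R).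
Hypotheses (mc : measurable_fun setT c) (cK : forall x, `|c x| <= K).
Hypotheses (PK : P [set x | `|x| <= K] = 1%E) (cE : forall x, `|x| <= K -> c x = x).
Local Notation std := (std_normal R).

Lemma measurable_norm_le : measurable [set x : R | `|x| <= K].
Proof.
rewrite -[X in measurable X]setTI; apply: (@measurable_fun_le _ _ R setT) => //.
Qed.

Lemma eq_int_clamp (f g : R -> R) : measurable_fun setT f -> measurable_fun setT g ->
  (forall x, `|x| <= K -> f x = g x) -> \int[P]_x f x = \int[P]_x g x.
Proof. exact: (eq_int_as measurable_norm_le PK). Qed.

Definition loglik1 r (p : R * R) : R :=
  ln (\int[P]_y expR (Num.sqrt r * p.2 * c y + r * c y * p.1 - r / 2 * c y ^+ 2)).

Lemma measurable_loglik1 r : measurable_fun setT (loglik1 r).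
Proof.
pose f (p : (R * R) * R) := expR (Num.sqrt r * p.1.2 * c p.2 + r * c p.2 * p.1.1 -
  r / 2 * c p.2 ^+ 2).
have mf : measurable_fun setT (EFin \o f).
  have m1 : measurable_fun setT (fun p : (R * R) * R => p.1.1).
    exact: (measurableT_comp measurable_fst measurable_fst).
  have m2 : measurable_fun setT (fun p : (R * R) * R => p.1.2).
    exact: (measurableT_comp measurable_snd measurable_fst).
  have m3 : measurable_fun setT (fun p : (R * R) * R => c p.2).
    exact: (measurableT_comp mc measurable_snd).
  apply/measurable_EFinP; apply: measurableT_comp => //; apply: measurable_funB.
    by apply: measurable_funD; apply: measurable_funM => //; exact: measurable_funM.
  by apply: measurable_funM => //; exact: measurable_funX.
have f0 p : (0 <= (EFin \o f) p)%E by rewrite lee_fin expR_ge0.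
apply: measurableT_comp => //; apply: measurableT_comp => //.
exact: (measurable_fun_fubini_tonelli_F (m2 := P) _ mf f0).
Qed.

Lemma psi_loglik1 r : psi P r = \int[(P \x std)%E]_p loglik1 r p.
Proof.
apply: eq_int => -[x z]; rewrite /loglik1 /=; congr ln; apply: eq_int_clamp.
- apply: measurableT_comp => //; apply: measurable_funB.
    by apply: measurable_funD; apply: measurable_funM => //; exact: measurable_funM.
  by apply: measurable_funM => //; exact: measurable_funX.
- apply: measurableT_comp => //; apply: measurable_funB.
    by apply: measurable_funD; apply: measurable_funM => //; exact: measurable_funM.
  by apply: measurable_funM => //; exact: measurable_funX.
by move=> y /cE ->.
Qed.

Lemma loglik1E r x g : 0 <= r ->
  loglik1 r (c x, tnth g ord0) = ln (lik P (scalar_signal c r) (emit (scalar_signal c r) (x, g))).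
Proof.
move=> r0; congr ln; apply: eq_int => y.
rewrite /emit /= amp_shiftt (ker_sc1 c r0) /amp /gexp big_ord1 /scalar_signal -expRD; congr expR.
by rewrite -[in r * c y](sqr_sqrtr r0) -[in r / 2](sqr_sqrtr r0) -[in r * (c y * _)](sqr_sqrtr
  r0); field.
Qed.

(** sqrt r x + z is the output of the scalar channel, and the integral inside [psi] is its
    likelihood ratio there; the expectation of ln L under the law of the output is E L ln L. *)
Lemma psi_scalar r : 0 <= r -> psi P r = scalar_entropy P c r.
Proof.
move=> r0; rewrite psi_loglik1.
have ms := @mscalar_signal _ _ _ c mc r; have sK := @scalar_signal_le _ _ _ c K cK r.
have gm := gauge_gam R; have gg := gauge_l1norm R 1.
have dl := dm_lin (lin_lnlik P ms sK).
have dT : dm (fun=> 0) (fun _ : R => 0 : R) by exact: dm_cst.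
have dE := dm_emit ms sK dl.
have mE : measurable_fun setT (fun p : R * 1.-tuple R =>
   ln (lik P (scalar_signal c r) (emit (scalar_signal c r) p))) by case: dE.
transitivity (\int[(P \x std)%E]_p loglik1 r (c p.1, p.2)).
  apply: (@eq_int_as _ _ _ _ ([set x : R | `|x| <= K] `*` setT)).
  - exact: measurableX measurable_norm_le measurableT.
  - set A := mkset _; transitivity (P A * std setT)%E.
      by apply: product_measure1E => //; exact: measurable_norm_le.
    by rewrite PK probability_setT mule1.
  - exact: measurable_loglik1.
  - apply: (measurableT_comp (measurable_loglik1 r)); apply: measurable_fun_pair => //.
    exact: (measurableT_comp mc measurable_fst).
  - by move=> [x z] /= [/cE -> _].
have E1 x z : loglik1 r (c x, z) = ln (lik P (scalar_signal c r) (emit (scalar_signal c r) (x,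
  [tuple z]))).
  by rewrite -loglik1E.
have dE1 : dm (prodG (fun _ : R => 0) (@absg R)) (fun p => loglik1 r (c p.1, p.2)).
  rewrite (_ : (fun _ => _) = fun p => ln (lik P (scalar_signal c r)
    (emit (scalar_signal c r) (p.1, [tuple p.2])))); last by apply/funext => p; exact: E1.
  apply: (dm_comp (B := 1) (phi := fun p => (p.1, [tuple p.2])) _ _ dE).
    apply: measurable_fun_pair => //; apply/measurable_fun_tnthP => i.
    by rewrite (_ : _ \o _ = snd)//; apply/funext => p; rewrite /= ord1.
  move=> p; rewrite mul1r /prodG !add0r /l1norm /iidG big_ord1.
  by rewrite (_ : tnth _ _ = p.2)// lerDr.
rewrite (fubini1 (gauge0 P) gm dE1).
transitivity (\int[(P \x iid std 1)%E]_p ln (lik P (scalar_signal c r) (emit (scalar_signal c r)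
  p))).
  rewrite (fubini1 (gauge0 P) gg dE); apply: eq_int => x.
  rewrite -(int_gam1 (dm_sec1 (gauge0 P) gm x dE1)); apply: eq_int => g.
  exact: loglik1E.
rewrite (int_emit P ms sK dl); apply: eq_int => g; exact: mulrC.
Qed.

End clamp.

(** * Relative entropy computed from a density *)

Section relative_entropy.
Context d (T : measurableType d) (R : realType) (nu mu : probability T R).
Variable f : T -> R.
Hypotheses (mf : measurable_fun setT f) (f0 : forall x, 0 < f x).
Hypothesis nuE : forall A, measurable A -> (nu A = \int[mu]_(x in A) (f x)%:E)%E.

Lemma density_dominates : charge_of_finite_measure nu `<< mu.
Proof.
apply/null_content_dominatesP => A mA A0.
have -> : charge_of_finite_measure nu A = nu A by [].
by rewrite nuE// null_set_integral//; apply: measurable_funTS; exact/measurable_EFinP.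
Qed.

Lemma Radon_Nikodym_density :
  ae_eq mu setT (Radon_Nikodym (charge_of_finite_measure nu) mu) (EFin \o f).
Proof.
apply: integral_ae_eq => //.
- exact: Radon_Nikodym_integrable density_dominates.
- exact/measurable_EFinP.
- move=> A _ mA; rewrite -(Radon_Nikodym_integral density_dominates mA).
  by rewrite -nuE.
Qed.

Lemma measurable_lne_fin (g : T -> \bar R) : (forall x, g x \is a fin_num) ->
  measurable_fun setT g -> measurable_fun setT (fun x => lne (g x)).
Proof.
move=> gfin mg; rewrite (_ : (fun _ => _) =
    fun x => if 0 < fine (g x) then (ln (fine (g x)))%:E else -oo%E); last first.
  apply/funext => x; have := gfin x; case: (g x) => [r|//|//] _ /=.
  by rewrite ltNge; case: (r <= 0).
have mgf : measurable_fun setT (fun x => fine (g x)) by exact: measurableT_comp.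
apply: measurable_fun_ifT => //; first exact: measurable_fun_ltr.
by apply/measurable_EFinP; exact: measurableT_comp.
Qed.

(** The Radon-Nikodym derivative equals f almost everywhere for mu, hence for the dominated nu; the
    integral of ln f is then brought back to mu. *)
Lemma KL_density : mu.-integrable setT (EFin \o (fun x => f x * ln (f x))) ->
  KL nu mu = (\int[mu]_x (f x * ln (f x)))%:E.
Proof.
move=> fi; have dom := density_dominates.
have mln : measurable_fun setT (fun x => ln (f x)) by exact: measurableT_comp.
have f0' x : 0 <= f x by exact: ltW.
transitivity (\int[nu]_x (ln (f x))%:E)%E; first apply: ae_eq_integral => //.
- apply: measurable_lne_fin; last first.
    by have /integrableP[] := Radon_Nikodym_integrable dom.
  by move=> x; exact: Radon_Nikodym_fin_num.
- exact/measurable_EFinP.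
- have := null_dominates_ae_eq (nu := nu) measurableT dom Radon_Nikodym_density.
  by apply: filterS => x /= + _ => ->//; rewrite lne_EFin.
rewrite -int_EFin.
  congr EFin; rewrite (int_density mf f0' nuE mln); apply: eq_int => x; exact: mulrC.
apply/integrableP; split; first exact/measurable_EFinP.
rewrite (ge0_integral_density mf f0' nuE)//; last first.
  by apply: measurableT_comp => //; exact/measurable_EFinP.
have /integrableP[_] := fi; congr (_ < _)%E; apply: eq_integral => x _ /=.
by rewrite -EFinM normrM (ger0_norm (f0' x)) mulrC.
Qed.

End relative_entropy.

(** * Consequences of l < lambda_c *)

Section threshold.
Context (R : realType) (P : probability R R).
Variables (c : R -> R) (K : R).
Hypotheses (mc : measurable_fun setT c) (cK : forall x, `|c x| <= K).
Hypotheses (cint0 : \int[P]_x c x = 0) (cint1 : \int[P]_x c x ^+ 2 = 1).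

Let K0 : 0 <= K. Proof. exact: le_trans (cK 0). Qed.

Lemma scalar_entropy0 : scalar_entropy P c 0 = 0.
Proof.
rewrite -[RHS](int_cst (iid (std_normal R) 1)); apply: eq_int => g.
rewrite (_ : lik _ _ _ = 1) ?ln1 ?mulr0//.
rewrite -[RHS](int_cst P); apply: eq_int => x.
by rewrite /amp /gexp big_ord1 /scalar_signal sqrtr0 mul0r mulr0 expr0n/= mul0r subrr expR0.
Qed.

Lemma qsq_sc1 r : 0 <= r -> qsq P (scalar_signal c r) = r ^+ 2.
Proof.
move=> r0; have ms := @mscalar_signal _ _ _ c mc r; have sK := @scalar_signal_le _ _ _ c K cK r.
have bc : bd c by exact: (bdI mc cK).
have bf : bd (fun p : R * R => ker (scalar_signal c r) p.1 p.2 ^+ 2).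
  by apply: dmX; exact: (bd_ker ms sK).
rewrite /qsq /ker_at (int_pair_marg P (f := fun x y => ker (scalar_signal c r) x y ^+ 2) (n :=
  4) (i := o0) (j := o1) isT bf).
transitivity (\int[P]_x (r ^+ 2 * c x ^+ 2)); last first.
  by rewrite (intZ (gauge0 P)) ?cint1 ?mulr1//; exact: dmX.
apply: eq_int => x; rewrite -[RHS]mulr1 -cint1 -(intZ (gauge0 P)); last exact: dmX.
by apply: eq_int => y; rewrite ker_sc1//; ring.
Qed.

Lemma scalar_entropy_expansion r : 0 <= r -> r <= 1 ->
  r ^+ 2 / 4 - 320 * exp6 (K ^+ 2) * (6 * K ^+ 6) * r ^+ 3 <= scalar_entropy P c r.
Proof.
move=> r0 r1; have ms := @mscalar_signal _ _ _ c mc r; have sK := @scalar_signal_le _ _ _ c K cK r.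
have kB : forall x y, `|ker (scalar_signal c r) x y| <= K ^+ 2.
  by apply: (ker_sc1_le cK r0); rewrite ler_piMl ?sqr_ge0.
have kr : forall x y, `|ker (scalar_signal c r) x y| <= r * K ^+ 2 by exact: (ker_sc1_le cK r0).
have a0 k : \int[P]_x scalar_signal c r k x = 0.
  by rewrite (intZ (gauge0 P)) ?cint0 ?mulr0//; exact: (bdI mc cK).
have := entropy_expansion (pi := P) ms sK kB a0.
rewrite -/(scalar_entropy P c r) qsq_sc1// => h.
have s3 : \int[iid P 4]_t sabs (scalar_signal c r) 3 t <= 6 * K ^+ 6 * r ^+ 3.
  rewrite -[leRHS](int_cst (iid P 4)); apply: (int_le (gauge0 _)).
  - exact: (bd_sabs ms sK).
  - exact: dm_cst.
  move=> t; rewrite /sabs.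
  have q3 i j : `|ker_at (scalar_signal c r) i j t| ^+ 3 <= (r * K ^+ 2) ^+ 3.
    by apply: lerXn2r; rewrite ?nnegrE ?mulr_ge0 ?sqr_ge0//; exact: kr.
  have := q3 o0 o1; have := q3 o0 o2; have := q3 o1 o2.
  have := q3 o0 o3; have := q3 o1 o3; have := q3 o2 o3.
  rewrite (_ : (r * K ^+ 2) ^+ 3 = K ^+ 6 * r ^+ 3); last by ring.
  rewrite -mulrA; move: (K ^+ 6 * _) (`|_| ^+ 3) (`|_| ^+ 3) (`|_| ^+ 3) (`|_| ^+ 3) (`|_| ^+
    3) (`|_| ^+ 3).
  by clear; move=> u x1 x2 x3 x4 x5 x6; lra.
have c0 : 0 <= 320 * exp6 (K ^+ 2) := mulr_ge0 (ler0n _ _) (exp6_ge0 _).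
have := le_trans h (ler_wpM2l c0 s3); rewrite ler_norml lerBrDl => /andP[+ _].
by rewrite -[X in _ -> _ - X <= _](mulrA _ (6 * K ^+ 6)).
Qed.

(** Near r = 0 the scalar entropy is at least r^2 / 4 - O(r^3), which exceeds r^2 / (4 l0) if l0 >
    1. *)
Lemma critical_le1 l0 : 0 < l0 ->
  (forall r, 0 <= r -> scalar_entropy P c r <= r ^+ 2 / (4 * l0)) -> l0 <= 1.
Proof.
move=> l00 H; rewrite leNgt; apply/negP => l01.
set C := 320 * exp6 (K ^+ 2) * (6 * K ^+ 6).
have C0 : 0 <= C.
  exact: mulr_ge0 (mulr_ge0 (ler0n _ _) (exp6_ge0 _)) (mulr_ge0 (ler0n _ _) (exprn_ge0 _ K0)).
pose de := 1 / 4 - (4 * l0)^-1.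
have de0 : 0 < de.
  rewrite /de mul1r subr_gt0 ltf_pV2 ?posrE ?mulr_gt0//; lra.
have D0 : 0 < C + 1 + de by lra.
(* Chosen so that r <= 1 and C r < de: the cubic error stays below the gap between 1 / 4 and 1 / (4
   l0). *)
pose r := de / (C + 1 + de).
have r0 : 0 < r by rewrite divr_gt0.
have r1 : r <= 1 by rewrite ler_pdivrMr// mul1r; lra.
have := scalar_entropy_expansion (ltW r0) r1; rewrite -/C => /le_trans /(_ (H r (ltW r0))).
apply/negP; rewrite -ltNge.
have Cr : C * r < de.
  rewrite /r mulrA ltr_pdivrMr//.
  by rewrite -subr_gt0 (_ : _ - _ = de * (1 + de)); [rewrite mulr_gt0//; lra|ring].
have : 0 < r ^+ 2 * (de - C * r) by rewrite mulr_gt0 ?exprn_gt0// subr_gt0.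
rewrite (_ : r ^+ 2 / (4 * l0) = r ^+ 2 * (1 / 4 - de)); last by rewrite /de; ring.
by move=> h; rewrite -subr_gt0 (_ : _ - _ = r ^+ 2 * (de - C * r))//; field.
Qed.

Variables (PK : P [set x | `|x| <= K] = 1%E) (cE : forall x, `|x| <= K -> c x = x).

Lemma subcritical (l : R) : (l%:E < lambda_c P)%E -> exists l0, [/\ l < l0, 0 < l0 &
  forall r, 0 <= r -> scalar_entropy P c r <= r ^+ 2 / (4 * l0)].
Proof.
move=> /ereal_sup_gt[_ [l0 [l00 _ q0] <-]]; rewrite lte_fin => ll0.
exists l0; split=> // r r0.
have : RS_maximizers P l0 0.
  move: q0; rewrite /q_star; case: xgetP => [q -> Hq q0|_ E]; first by rewrite -q0.
  by exfalso; move: E; lra.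
(* 0 maximizes the potential at l0. Comparison with the overlap q = r / l0, for which l0 q = r and
   l0 q^2 / 4 = r^2 / (4 l0), gives the bound at every r. *)
move=> [_ /(_ (r / l0))]; rewrite divr_ge0 ?(ltW l00)// => /(_ isT).
have -> : RS_potential P l0 0 = 0.
  rewrite /RS_potential expr0n/= mulr0 mul0r subr0 (psi_scalar mc cK PK cE)//.
  exact: scalar_entropy0.
rewrite /RS_potential (_ : l0 * (r / l0) = r); last by field; rewrite gt_eqF.
rewrite (psi_scalar mc cK PK cE)// subr_le0.
move=> /le_trans; apply; rewrite le_eqVlt; apply/orP; left; apply/eqP; field.
by rewrite gt_eqF.
Qed.

End threshold.

Section spiked_density.
Context (R : realType) (P : probability R R).
Variables (c : R -> R) (K : R).
Hypotheses (mc : measurable_fun setT c) (cK : forall x, `|c x| <= K).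
Hypotheses (PK : P [set x | `|x| <= K] = 1%E) (cE : forall x, `|x| <= K -> c x = x).
Variable N : nat.
Local Notation gam := (iid (std_normal R) #|upper_pairs N|).
Local Notation L l := (lik (iid P N) (@signal _ R R c (l / N%:R) N)).

Lemma iid_norm_le : iid P N [set x | forall i, `|tnth x i| <= K] = 1%E.
Proof.
rewrite (iidE P (A := fun=> [set x | `|x| <= K])) => [|i]; last exact: measurable_norm_le.
by rewrite big1.
Qed.

Lemma measurable_iid_norm_le : measurable [set x : N.-tuple R | forall i, `|tnth x i| <= K].
Proof.
rewrite (_ : mkset _ = \bigcap_(i in [set: 'I_N]) ((@tnth _ R ^~ i) @^-1` [set x | `|x| <= K])).
  apply: fin_bigcap_measurable => // i _; rewrite -[X in measurable X]setTI.
  by apply: measurable_tnth => //; exact: measurable_norm_le.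
by apply/seteqP; split => x /= h i; [move=> _; exact: h|exact: (h i)].
Qed.

(** Almost surely no coordinate of the spike is clamped, so the observations are the output of a
    channel with bounded signal, whose density is known. *)
Lemma spiked_lawE l A : measurable A ->
  spiked_law P l N A = (\int[gam]_(g in A) (L l g)%:E)%E.
Proof.
move=> mA; set s := l / N%:R.
have ms := @measurable_signal _ _ _ c mc s N; have sK := @signal_le _ _ _ c K cK s N.
have me := measurable_emit ms; have gg := gauge_l1norm R #|upper_pairs N|.
have mpre d1 d2 (T1 : measurableType d1) (T2 : measurableType d2) (h : T1 -> T2) B :
    measurable_fun setT h -> measurable B -> measurable (h @^-1` B).
  by move=> mh mB; rewrite -[X in measurable X]setTI; exact: mh.
transitivity ((iid P N \x gam)%E (emit (@signal _ R R c s N) @^-1` A)).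
  suff : (iid P N \x gam)%E (@observation R l N @^-1` A) =
      (iid P N \x gam)%E (emit (@signal _ R R c s N) @^-1` A) by [].
  apply: (@eq_measure_as _ _ R (iid P N \x gam)%E
    ([set x : N.-tuple R | forall i, `|tnth x i| <= K] `*` setT)).
  - exact: measurableX measurable_iid_norm_le measurableT.
  - set B := mkset _; transitivity (iid P N B * gam setT)%E.
      by apply: product_measure1E => //; exact: measurable_iid_norm_le.
    by rewrite iid_norm_le probability_setT mule1.
  - by apply: mpre => //; exact: measurable_observation.
  - exact: mpre.
  - move=> [x g] [/= xK _]; rewrite (_ : observation l (x, g) = emit (@signal _ R R c s N) (x,
    g))//.
    apply: eq_from_tnth => k; rewrite !tnth_mktuple /signal /= !cE// addrC.
    by rewrite -mulrA.
have dA : dm (@l1norm R #|upper_pairs N|) (\1_A : _ -> R).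
  apply: (dm_bounded _ (B := 1)); first exact: measurable_indic.
  by move=> g; rewrite indicE; case: (_ \in _); rewrite ?normr1 ?normr0.
rewrite measure_int_indic; last exact: mpre.
rewrite (int_emit (iid P N) ms sK dA) int_EFin; last first.
  by apply: (dm_integrable gg); apply: dmM => //; exact: (dm_lik (iid P N) ms sK).
rewrite [RHS]integral_mkcond; apply: eq_integral => g _.
by rewrite patchE indicE; case: ifP; rewrite ?mul1r ?mul0r.
Qed.

Lemma spiked_law0E A : measurable A -> spiked_law P 0 N A = gam A.
Proof.
move=> mA; rewrite spiked_lawE// -[RHS]mul1e -integral_cst//.
apply: eq_integral => g _; congr EFin.
rewrite -[RHS](int_cst (iid P N)); apply: eq_int => x; rewrite /amp /gexp big1 ?expR0// => k _.
by rewrite /signal mul0r sqrtr0 mul0r mulr0 expr0n/= mul0r subrr.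
Qed.

Lemma KL_spiked l :
  KL (spiked_law P l N) (spiked_law P 0 N) = (model_entropy P c (l / N%:R) N)%:E.
Proof.
have gg := gauge_l1norm R #|upper_pairs N|; set s := l / N%:R.
have ms := @measurable_signal _ _ _ c mc s N; have sK := @signal_le _ _ _ c K cK s N.
have E0 (h : _ -> \bar R) A : (\int[spiked_law P 0 N]_(g in A) h g = \int[gam]_(g in A) h g)%E.
  by apply: eq_measure_integral => B mB _; exact: spiked_law0E.
have mL : measurable_fun setT (L l) by case: (dm_lik (iid P N) ms sK).
have L0 g : 0 < L l g by exact: (lik_gt0 (iid P N) ms sK).
rewrite (KL_density mL L0).
- by rewrite /model_entropy /Rintegral E0.
- by move=> A mA; rewrite E0 spiked_lawE.
have /integrableP[mf fi] := dm_integrable gg (dm_liklnlik (iid P N) ms sK).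
by apply/integrableP; split; rewrite ?E0.
Qed.

End spiked_density.

Section clamp_function.
Variables (R : realType) (K : R).
Hypothesis K0 : 0 <= K.

(** Makes the signal bounded everywhere, not just almost surely, and is the identity on a set of
    full measure. *)
Definition clamp (x : R) : R := Num.max (- K) (Num.min K x).

Lemma clamp_le x : `|clamp x| <= K.
Proof.
rewrite ler_norml /clamp le_max lexx /= ge_max lerNl ge_min lexx andbT.
by rewrite (le_trans _ K0)// oppr_le0.
Qed.

Lemma clamp_id x : `|x| <= K -> clamp x = x.
Proof. by rewrite ler_norml => /andP[x1 x2]; rewrite /clamp min_r// max_r. Qed.

Lemma measurable_clamp : measurable_fun setT clamp.
Proof. by apply: measurable_maxr => //; exact: measurable_minr. Qed.

End clamp_function.

Theorem corollary3 (R : realType) (P : probability R R)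
  (bounded_support : exists K : R, P [set x | `|x| <= K] = 1%E)
  (zero_mean : ('E_P[idfun] = 0)%E)
  (unit_variance : ('V_P[idfun] = 1)%E)
  (l : R) (l_ge0 : 0 <= l) (l_lt : (l%:E < lambda_c P)%E) :
  (\forall N \near \oo, KL (spiked_law P l N) (spiked_law P 0 N) \is a fin_num)
  /\ (fun N => fine (KL (spiked_law P l N) (spiked_law P 0 N)))
     = cst (4^-1 * (- ln (1 - l) - l)) +O_\oo (fun N => (Num.sqrt N%:R)^-1 : R).
Proof.
have [K PK] := bounded_support.
have K0 : 0 <= K.
  rewrite leNgt; apply/negP => K0; move: PK.
  rewrite (_ : [set x | _] = set0) ?measure0; first by move=> /eqP; rewrite eq_sym onee_eq0.
  by rewrite -subset0 => x /=; rewrite leNgt (lt_le_trans K0).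
pose c := clamp K.
have mc : measurable_fun setT c := measurable_clamp K.
have cK : forall x, `|c x| <= K := clamp_le K0.
have cE : forall x, `|x| <= K -> c x = x := @clamp_id _ K.
have bi n : P.-integrable setT (EFin \o (fun x => c x ^+ n)).
  by apply: (dm_integrable (gauge0 P)); apply: dmX; exact: (bdI mc cK).
have E n : (\int[P]_x (x ^+ n)%:E = (\int[P]_x c x ^+ n)%:E)%E.
  rewrite int_EFin; last exact: bi.
  apply: ae_eq_integral => //; [exact/measurable_EFinP|exact/measurable_EFinP/measurable_funX|].
  by apply: (almost_surely (@measurable_norm_le R K) PK) => x /= /cE ->.
have c1 : \int[P]_x c x = 0.
  have := E 1; move: zero_mean; rewrite unlock => ->.
  by move=> [].
have cvar : \int[P]_x c x ^+ 2 = 1.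
  have := E 2; move: unit_variance; rewrite /variance unlock zero_mean /= unlock.
  rewrite (_ : (\int[P]_w _)%E = (\int[P]_x (x ^+ 2)%:E)%E); first by move=> -> [].
  by apply: eq_integral => x _; rewrite -[(_ * _) x]/((x - 0) * (x - 0)) subr0 expr2.
have [l0 [ll0 l00 H]] := subcritical mc cK PK cE l_lt.
(* The limit involves ln (1 - l), and the recursions contract only for l < 1. *)
have l1 : l < 1 by apply: (lt_le_trans ll0); exact: (critical_le1 mc cK c1 cvar l00 H).
have [C [N0 [C0 HC]]] := model_entropy_limit mc cK c1 cvar l_ge0 l1
  (fun e e0 => deviation_mass_tail mc cK l_ge0 ll0 H e0).
have KLE N : KL (spiked_law P l N) (spiked_law P 0 N) = (model_entropy P c (l / N%:R) N)%:E.
  exact: (KL_spiked mc cK PK cE).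
split; first by near=> N; rewrite KLE.
apply/eqaddOP; near=> k; near=> N.
rewrite -[(_ - _) N]/(fine _ - _) KLE [`|(Num.sqrt _)^-1|]ger0_norm ?invr_ge0 ?sqrtr_ge0//.
apply: (@le_trans _ _ (C / Num.sqrt N%:R)).
  by apply: HC; near: N; exact: nbhs_infty_ge.
by rewrite ler_wpM2r ?invr_ge0 ?sqrtr_ge0//; near: k; exact: nbhs_pinfty_ge (num_real _).
Unshelve. all: by end_near. Qed.
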